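(* Let $k\ge1$, $\mathbf d\in(\mathbb Z_{\ge0})^k$, $d=|\mathbf d|$. The set $\mathcal B_I=\{T_{Y_b}\}$ ($b$ running over all lower crossingless matches) acting on $\mathcal T_c(\mathbf d)\cong V_{\mathbf d_1}\otimes\cdots\otimes V_{\mathbf d_k}$ spans the space of intertwiners $\bigoplus_\mu\operatorname{Hom}_{\mathbf U_q}(V_{\mathbf d_1}\otimes\cdots\otimes V_{\mathbf d_k},V_\mu)$, where for $b$ with $r$ arcs and $\mu=d-2r$ unmatched vertices $T_{Y_b}$ is regarded as a map $\mathcal T_c(\mathbf d)\to\mathcal M^r(d)\cong V_\mu$. In particular, if $0\le\mathbf w_i\le\mathbf d_i$ for all $i$ and $b\le M(\mathbf d,\mathbf w)$, then $$T_{Y_b}(g^{\mathbf d}_{\mathbf w})=\omega\,\mathbf 1_{\mathfrak M^{|\mathbf l^b|}(|\mathbf w|,d)},\qquad \omega=\sum_{\mathbf a}\Big(\kappa^{\mathbf m^b,\mathbf w-\mathbf l^b}_{\mathbf a}\,k_{\mathbf a+\mathbf l^b,\mathbf l^b,\mathbf l^b+\mathbf m^b}\prod_{i=1}^{k-1}c_{\mathbf a^i_1,\mathbf a^i_2}\Big),$$ where the sum is over $\mathbf a$ with $0\le\mathbf a_i\le\mathbf m^b_i$ and $$\mathbf a^i_1=\big((\mathbf l^b)^{(i,k)},\ \mathbf a^{(i,k)},\ (\mathbf m^b-\mathbf a)^{(i,k)},\ (\mathbf d-\mathbf m^b-2\mathbf l^b)^{(i,k)}\big),\quad \mathbf a^i_2=\big(\mathbf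 l^b_i,\ \mathbf a_i,\ \mathbf m^b_i-\mathbf a_i,\ \mathbf d_i-\mathbf m^b_i-\mathbf l^b_i\big).$$ Otherwise (if $b\not\le M(\mathbf d,\mathbf w)$), $T_{Y_b}(g^{\mathbf d}_{\mathbf w})=0$.
   Context: **Notation.** $|\mathbf a|=\sum_i\mathbf a_i$, $\mathbf a^{(j,l)}=\sum_{i=j}^l\mathbf a_i$, and $k_{\mathbf w,\mathbf r,\mathbf n}=q^{\sum_{i<j}(\mathbf r_i\mathbf w_j+\mathbf w_i\mathbf n_j-\mathbf w_i\mathbf w_j)}$. For $\mathbf e,\mathbf a\in(\mathbb Z_{\ge0})^s$ with $\mathbf a_i\le\mathbf e_i$ and $e=|\mathbf e|$, $c_{\mathbf e,\mathbf a}=\sum_{\mathbf b}q^{2\sum_{1\le j<i\le e}\mathbf b_i(1-\mathbf b_j)}$, the sum over $\mathbf b\in\{0,1\}^e$ such that, dividing the positions $1,\dots,e$ into consecutive blocks of lengths $\mathbf e_1,\dots,\mathbf e_s$, the sum of the entries of $\mathbf b$ in the $j$-th block is $\mathbf a_j$ for every $j$. **Counting convention.** $\mathbb F$ is a finite field whose cardinality is written $q^2$; vector spaces are finite-dimensional over $\mathbb F$. Functions take values in $\mathbb C(q)$, $q$ an indeterminate, and spans are $\mathbb C(q)$-spans. $\mathbf 1_Y$ is the indicator function of $Y$. Numbers of points are viewed in $\mathbb C(q)$: the sets counted are given by the same linear-algebra conditions over every finite field and have $P_Y(|\mathbb F|)$ points for a polynomial $P_Y$, and $\chi_q(Y):=P_Y(q^2)$.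 Sums of function values over points are understood accordingly; for a map $p$, $p_!(f)(x)=\sum_{y\in p^{-1}(x)}f(y)$, so $p_!(\mathbf 1_Y)(x)=\chi_q(p^{-1}(x)\cap Y)$. **Quantum group.** $\mathbf U_q=U_q(\mathfrak{sl}_2)$ is the $\mathbb C(q)$-algebra generated by $E,F,K^{\pm1}$ with $KK^{-1}=K^{-1}K=1$, $KE=q^2EK$, $KF=q^{-2}FK$, $EF-FE=(K-K^{-1})/(q-q^{-1})$, with coproduct $\Delta K^{\pm1}=K^{\pm1}\otimes K^{\pm1}$, $\Delta E=E\otimes1+K\otimes E$, $\Delta F=F\otimes K^{-1}+1\otimes F$; tensor products are modules via iterated $\Delta$. $[n]=(q^n-q^{-n})/(q-q^{-1})$, $[n]!=[1]\cdots[n]$. $V_n$ has basis $v_n,v_{n-2},\dots,v_{-n}$ with $K^{\pm1}v_m=q^{\pm m}v_m$, $Ev_m=[\frac{n+m}2+1]v_{m+2}$, $Fv_m=[\frac{n-m}2+1]v_{m-2}$. Put $\otimes\,{}^{\mathbf e}v_{\mathbf u}=v_{\mathbf e_1-2\mathbf u_1}\otimes\cdots\otimes v_{\mathbf e_k-2\mathbf u_k}\in V_{\mathbf e_1}\otimes\cdots\otimes V_{\mathbf e_k}$. **Canonical basis.** Let $\sigma$ be the $\mathbb C$-linear map on any $V_n$ with $\sigma(f(q)v_m)=f(q^{-1})v_m$. Let $\Theta=\sum_{n\ge0}(-1)^nq^{-n(n-1)/2}\frac{(q-q^{-1})^n}{[n]!}F^n\otimes E^n$. Define $\Psi^{(1)}=\sigma$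 and $\Psi^{(k)}(x\otimes y)=\Theta(\Psi^{(k-1)}(x)\otimes\sigma(y))$ for $x\in V_{\mathbf e_1}\otimes\cdots\otimes V_{\mathbf e_{k-1}}$, $y\in V_{\mathbf e_k}$. Lusztig's canonical basis element $\diamondsuit\,{}^{\mathbf e}v_{\mathbf u}$ is the unique element of $V_{\mathbf e_1}\otimes\cdots\otimes V_{\mathbf e_k}$ fixed by $\Psi^{(k)}$ with $\diamondsuit\,{}^{\mathbf e}v_{\mathbf u}-\otimes\,{}^{\mathbf e}v_{\mathbf u}\in\bigoplus_{\mathbf a}q^{-1}\mathbb Z[q^{-1}](\otimes\,{}^{\mathbf e}v_{\mathbf a})$. The coefficients $\kappa^{\mathbf e,\mathbf u}_{\mathbf a}$ are defined by $\diamondsuit\,{}^{\mathbf e}v_{\mathbf u}=\sum_{\mathbf a}\kappa^{\mathbf e,\mathbf u}_{\mathbf a}(\otimes\,{}^{\mathbf e}v_{\mathbf a})$. **Varieties.** Let $D$ be a $d$-dimensional space. $\mathfrak M(d)=\{(W,t):W\subset D,\ t\in\mathrm{End}\,D,\ \operatorname{im}t\subset W\subset\ker t\}$; $\mathfrak M^r(w,d)$ is the subset with $\dim W=w$, $\operatorname{rank}t=r$; $\mathcal M^r(d)=\bigoplus_w\mathbb C(q)\mathbf 1_{\mathfrak M^r(w,d)}$. $\mathfrak T(\mathbf d)$ is the set of triples $(\mathbf D,W,t)$ with $(W,t)\in\mathfrak M(d)$ and $\mathbf D=(0=\mathbf D_0\subset\cdots\subset\mathbf D_k=D)$ a flag with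 $\dim\mathbf D_i/\mathbf D_{i-1}=\mathbf d_i$ and $t(\mathbf D_i)\subset\mathbf D_{i-1}$. For a subspace $X\subset D$, $\alpha(X,\mathbf D)_i=\dim(X\cap\mathbf D_i)/(X\cap\mathbf D_{i-1})$. Set $A_{\mathbf w,\mathbf r,\mathbf n}=\{(\mathbf D,W,t)\in\mathfrak T(\mathbf d):\alpha(W,\mathbf D)=\mathbf w,\ \alpha(\operatorname{im}t,\mathbf D)=\mathbf r,\ \alpha(\ker t,\mathbf D)=\mathbf n\}$, $f_{\mathbf w,\mathbf r,\mathbf n}=k_{\mathbf w,\mathbf r,\mathbf n}\mathbf 1_{A_{\mathbf w,\mathbf r,\mathbf n}}$, $\mathcal T(\mathbf d)=\operatorname{Span}\{f_{\mathbf w,\mathbf r,\mathbf n}\}$, $\mathcal T_0(\mathbf d)=\operatorname{Span}\{f_{\mathbf w,\mathbf 0,\mathbf d}\}_{\mathbf w}$. On $\mathcal T(\mathbf d)$, $\mathbf U_q$ acts by $(Ef)(\mathbf D,W,t)=q^{-(\dim\ker t-\dim W-1)}\sum_{W\subset U\subset\ker t,\ \dim U=\dim W+1}f(\mathbf D,U,t)$, $(Ff)(\mathbf D,W,t)=q^{-(\dim W-\operatorname{rank}t-1)}\sum_{\operatorname{im}t\subset U\subset W,\ \dim U=\dim W-1}f(\mathbf D,U,t)$, $(K^{\pm1}f)(\mathbf D,W,t)=q^{\pm(d-2\dim W)}f(\mathbf D,W,t)$, and on functions on $\mathfrak M(d)$ by the same formulas with $\mathbf D$ omitted; then $\mathcal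 M^r(d)\cong V_{d-2r}$ via $\mathbf 1_{\mathfrak M^r(w,d)}\mapsto v_{d-2w}$. For $(\mathbf r,\mathbf n)$ occurring in a non-empty $A_{\mathbf w,\mathbf r,\mathbf n}$, $\eta_{\mathbf r,\mathbf n}:\operatorname{Span}\{f_{\mathbf w,\mathbf r,\mathbf n}\}_{\mathbf w}\to V_{\mathbf n_1-\mathbf r_1}\otimes\cdots\otimes V_{\mathbf n_k-\mathbf r_k}$ is the linear isomorphism $f_{\mathbf w,\mathbf r,\mathbf n}\mapsto\otimes\,{}^{\mathbf n-\mathbf r}v_{\mathbf w-\mathbf r}$. **Lower crossingless matches.** Place $k$ boxes from left to right, box $i$ having $\mathbf d_i$ vertices. A lower crossingless match is a set of pairwise non-crossing arcs drawn above the line, each joining two vertices of different boxes, each vertex on at most one arc, and no unmatched vertex lying under an arc. $S_1\le S_2$ means the set of arcs of $S_1$ is a subset of that of $S_2$. $M(\mathbf d,\mathbf w)$ is the match obtained by marking the rightmost $\mathbf w_i$ vertices of box $i$ down and the others up, and then, going from right to left, joining each down vertex to the first unmatched up vertex to its right, if any. For a match $S$, $\mathbf r^S_i$ is the number of left endpoints of arcs in box $i$ and $\mathbf n^S_i$ is $\mathbf d_i$ minus the number of right endpoints of arcs in box $i$. For a match $b$, $\mathbf l^b_i$ is the number of left endpoints of arcs in box $i$, $\mathbf m^b_i$ the number of unmatched vertices in box $i$. **Intertwiners $\gamma$ and extension.** Let $\iota_n:V_n\to V_1^{\otimes n}$ and $\pi_n:V_1^{\otimes n}\to V_n$ be the $\mathbf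 U_q$-maps with $v_n\mapsto v_1^{\otimes n}$, resp. $v_1^{\otimes n}\mapsto v_n$; let $\varepsilon:V_1\otimes V_1\to\mathbb C(q)$ be the $\mathbf U_q$-map with $\varepsilon(v_{-1}\otimes v_1)=1$, $\varepsilon(v_1\otimes v_{-1})=-q^{-1}$, $\varepsilon(v_{\pm1}\otimes v_{\pm1})=0$. For a lower crossingless match $S$, $\gamma_{\mathbf r^S,\mathbf n^S}:V_{\mathbf d_1}\otimes\cdots\otimes V_{\mathbf d_k}\to V_{\mathbf n^S_1-\mathbf r^S_1}\otimes\cdots\otimes V_{\mathbf n^S_k-\mathbf r^S_k}$ is: apply $\iota_{\mathbf d_1}\otimes\cdots\otimes\iota_{\mathbf d_k}$ (tensor factors of $V_1^{\otimes d}$ correspond to vertices), contract the pairs of factors joined by arcs of $S$ with $\varepsilon$ (innermost first), and apply $\pi_{\mathbf n^S_1-\mathbf r^S_1}\otimes\cdots\otimes\pi_{\mathbf n^S_k-\mathbf r^S_k}$ to the remaining factors. ($S\mapsto(\mathbf r^S,\mathbf n^S)$ is injective.) Put $\gamma_{\mathbf r,\mathbf n}=0$ for all other $(\mathbf r,\mathbf n)$. For $f\in\mathcal T_0(\mathbf d)$, $f^e=\epsilon(f)=\sum_{\mathbf r,\mathbf n}\eta_{\mathbf r,\mathbf n}^{-1}\gamma_{\mathbf r,\mathbf n}\eta_{\mathbf 0,\mathbf d}(f)$, $\mathcal T_c(\mathbf d)=\epsilon(\mathcal T_0(\mathbf d))$ (isomorphic to $V_{\mathbf d_1}\otimes\cdots\otimes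 V_{\mathbf d_k}$), and $g^{\mathbf d}_{\mathbf w}=\big(\eta_{\mathbf 0,\mathbf d}^{-1}(\diamondsuit\,{}^{\mathbf d}v_{\mathbf w})\big)^e$. **The maps $T_Y$.** For a lower crossingless match $b$, $Y_b=\{(\mathbf D,W,t)\in\mathfrak T(\mathbf d):\alpha(\ker t,\mathbf D)=\mathbf n^b\}$. With $p:\mathfrak T(\mathbf d)\to\mathfrak M(d)$, $p(\mathbf D,W,t)=(W,t)$, set $T_Y(f)=p_!(\mathbf 1_Yf)$ for $f\in\mathcal T(\mathbf d)$. *)

(* Defs.v *)
From HB Require Import structures.
From mathcomp Require Import all_boot all_order all_algebra.
From mathcomp Require Import boolp classical_sets fsbigop reals complex.

Set Implicit Arguments.
Unset Strict Implicit.
Unset Printing Implicit Defensive.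

Import GRing.Theory Num.Theory.
Local Open Scope ring_scope.

Section FinVector.
Import VectorInternalTheory.
HB.instance Definition _ (F : finFieldType) (V : vectType F) :=
  [Countable of {vspace V} by <:].
HB.instance Definition _ (F : finFieldType) (V : vectType F) :=
  [Finite of {vspace V} by <:].
HB.instance Definition _ (F : finFieldType) (U V : vectType F) :=
  [Countable of 'Hom(U, V) by <:].
HB.instance Definition _ (F : finFieldType) (U V : vectType F) :=
  [Finite of 'Hom(U, V) by <:].
End FinVector.

Definition Cq (R : realType) := {fraction {poly R[i]}}.
HB.instance Definition _ (R : realType) := GRing.Field.on (Cq R).

Section Scalars.
Variable R : realType.
Implicit Types (n : nat) (x : Cq R).

Definition cst (c : R[i]) : Cq R := FracField.tofrac c%:P.
Definition q : Cq R := FracField.tofrac 'X.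

(* The substitution f(q) |-> f(q^-1), computed on a fraction representing f. *)
Definition bar x : Cq R :=
  (map_poly cst (\n_(repr x))).[q^-1] / (map_poly cst (\d_(repr x))).[q^-1].

Definition qint n : Cq R := (q ^+ n - q ^- n) / (q - q^-1).
Definition qfact n : Cq R := \prod_(1 <= i < n.+1) qint i.

(* c_{e,a}: b : {0,1}^{|e|} is a tuple of booleans, reshaped into blocks of *)
(* lengths e_1, e_2, ... *)
Definition cnum (e a : seq nat) : Cq R :=
  \sum_(b : (sumn e).-tuple bool | [seq count id s | s <- reshape e b] == a)
    q ^+ (2 * \sum_(i < sumn e) \sum_(j < sumn e | (j < i)%N)
                (tnth b i * (1 - tnth b j)))%N.

End Scalars.

Arguments q {R}.

(* Multi-indices u with 0 <= u_i <= e_i; u indexes the vector *)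
(* v_{e_1 - 2 u_1} (x) ... (x) v_{e_k - 2 u_k}. *)
Definition idx k (e : 'I_k -> nat) : finType :=
  {dffun forall i : 'I_k, 'I_(e i).+1}.

Section Tensors.
Variable R : realType.
Local Notation K := (Cq R).

(* V_{e_1} (x) ... (x) V_{e_k}, in coordinates. *)
Definition tens k (e : 'I_k -> nat) : vectType K := {ffun idx e -> K^o}.

Definition Vn (n : nat) := tens (fun _ : 'I_1 => n).
Definition V1pow (n : nat) := tens (fun _ : 'I_n => 1%N).

Definition tbas k (e u : 'I_k -> nat) : tens e :=
  [ffun a : idx e => [forall i, a i == u i :> nat]%:R].

(* Matrices of the generators on V_n: entry (a, b) is the coefficient of *)
(* v_{n-2a} in the image of v_{n-2b}. *)
Definition Emx n : 'M[K]_n.+1 :=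
  \matrix_(a, b) if a.+1 == b then qint R (n - b).+1 else 0.
Definition Fmx n : 'M[K]_n.+1 :=
  \matrix_(a, b) if a == b.+1 :> nat then qint R b.+1 else 0.
Definition Kmx n : 'M[K]_n.+1 :=
  \matrix_(a, b) if a == b then q ^+ n * q ^- (2 * b) else 0.
Definition Kimx n : 'M[K]_n.+1 :=
  \matrix_(a, b) if a == b then q ^- n * q ^+ (2 * b) else 0.

Section Action.
Variables (k : nat) (e : 'I_k -> nat).
Implicit Type z : tens e.

Definition tensop (M : forall i, 'M[K]_((e i).+1)) z : tens e :=
  [ffun u : idx e => \sum_(u' : idx e) (\prod_i M i (u i) (u' i)) * z u'].

(* Iterated coproducts: Delta E = sum_i K^(i-1) (x) E (x) 1^(k-i) and *)
(* Delta F = sum_i 1^(i-1) (x) F (x) (K^-1)^(k-i). *)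
Definition actE z : tens e :=
  \sum_(i < k) tensop (fun j => if (j < i)%N then Kmx (e j)
                          else if j == i then Emx (e j) else 1%:M) z.

(* The action of F on the first m tensor factors. *)
Definition actF_first (m : nat) z : tens e :=
  \sum_(i < k | (i < m)%N)
    tensop (fun j => if (j < i)%N then 1%:M else if j == i then Fmx (e j)
                     else if (j < m)%N then Kimx (e j) else 1%:M) z.
Definition actF z := actF_first k z.
Definition actK z := tensop (fun j => Kmx (e j)) z.
Definition actKi z := tensop (fun j => Kimx (e j)) z.

Definition actE_at (m : 'I_k) z : tens e :=
  tensop (fun j => if j == m then Emx (e j) else 1%:M) z.

(* Theta acting on (V_{e_1} (x) ... (x) V_{e_(m-1)}) (x) V_{e_m} (and as the *)
(* identity on the other factors); E^n = 0 on V_{e_m} for n > e_m. *)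
Definition Theta (m : 'I_k) z : tens e :=
  \sum_(n < (e m).+1)
    ((-1) ^+ n * q ^- 'C(n, 2) * (q - q^-1) ^+ n / qfact R n) *:
      iter n (actF_first m) (iter n (actE_at m) z).

Definition sigma z : tens e := [ffun u => bar (z u)].

(* The recursion Psi^(k)(x (x) y) = Theta (Psi^(k-1) x (x) sigma y) unfolds to *)
(* Theta_k o ... o Theta_2 o Theta_1 o sigma, where Theta_1 = id since *)
(* actF_first is 0 on the empty product. *)
Definition Psi z : tens e :=
  foldl (fun z' m => Theta m z') (sigma z) (enum 'I_k).

Definition in_qinvZ (x : K) : Prop :=
  exists p : {poly int}, x = q^-1 * (map_poly intr p).[q^-1].

Definition is_canonical (u : 'I_k -> nat) z : Prop :=
  Psi z = z /\ forall a : idx e, in_qinvZ (z a - tbas e u a).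

End Action.

Definition uq_hom k (e : 'I_k -> nat) l (f : 'I_l -> nat)
    (phi : tens e -> tens f) : Prop :=
  [/\ forall z, phi (actE z) = actE (phi z),
      forall z, phi (actF z) = actF (phi z),
      forall z, phi (actK z) = actK (phi z) &
      forall z, phi (actKi z) = actKi (phi z)].

Definition is_iota n (phi : 'Hom(Vn n, V1pow n)) : Prop :=
  uq_hom phi /\ phi (tbas _ (fun=> 0%N)) = tbas _ (fun=> 0%N).

Definition is_pi n (phi : 'Hom(V1pow n, Vn n)) : Prop :=
  uq_hom phi /\ phi (tbas _ (fun=> 0%N)) = tbas _ (fun=> 0%N).

(* epsilon : V_1 (x) V_1 -> C(q); true stands for v_{-1}, false for v_1. *)
Definition eps (x y : bool) : K :=
  match x, y with
  | true, false => 1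
  | false, true => - q^-1
  | _, _ => 0
  end.

End Tensors.

Section Matches.
Variables (k : nat) (d : 'I_k -> nat).

Definition tot : nat := \sum_i d i.

(* The vertices are 0, ..., |d| - 1 from left to right; box i starts at off i. *)
Definition off (i : 'I_k) : nat := \sum_(j < k | (j < i)%N) d j.
Definition inbox (i : 'I_k) (x : nat) : bool := (off i <= x < off i + d i)%N.

(* An arc is a pair (left endpoint, right endpoint). *)
Definition arcs := {set 'I_tot * 'I_tot}.
Implicit Type S : arcs.

Definition touches (x : nat) (a : 'I_tot * 'I_tot) : bool :=
  (a.1 == x :> nat) || (a.2 == x :> nat).
Definition matched S (x : nat) : bool := [exists a in S, touches x a].

Definition lcmatch S : bool :=
  [&& [forall a in S, (a.1 < a.2)%N],
      [forall a in S, ~~ [exists i, inbox i a.1 && inbox i a.2]],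
      [forall a in S, forall b in S,
         [exists x : 'I_tot, touches x a && touches x b] ==> (a == b)],
      [forall a in S, forall b in S, ~~ ((a.1 < b.1) && (b.1 < a.2 < b.2))%N] &
      [forall a in S, forall x : 'I_tot, (a.1 < x < a.2)%N ==> matched S x]].

Definition lcmatches : seq arcs := [seq S <- enum {: arcs} | lcmatch S].

Definition lefts S (i : 'I_k) : nat := #|[set a in S | inbox i a.1]%SET|.
Definition rights S (i : 'I_k) : nat := #|[set a in S | inbox i a.2]%SET|.

(* r^S = l^S and n^S, m^S. *)
Definition rS S := lefts S.
Definition nS S (i : 'I_k) : nat := d i - rights S i.
Definition mS S (i : 'I_k) : nat :=
  #|[set x : 'I_tot | inbox i x && ~~ matched S x]%SET|.

Definition down (w : 'I_k -> nat) (x : nat) : bool :=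
  [exists i, inbox i x && (off i + (d i - w i) <= x)%N].

(* The vertices are processed from right to left. *)
Definition Mmatch (w : 'I_k -> nat) : arcs :=
  foldr (fun (x : 'I_tot) S =>
      if down w x then
        if [seq y : 'I_tot <- enum 'I_tot | [&& (x < y)%N, ~~ down w y & ~~ matched S y]]
          is y :: _ then ((x, y) |: S)%SET else S
      else S)
    finset.set0 (enum 'I_tot).

End Matches.

Section Gamma.
Variables (R : realType) (k : nat) (d : 'I_k -> nat).
Variables (iota_ : forall n, 'Hom(Vn R n, V1pow R n))
          (pi_ : forall n, 'Hom(V1pow R n, Vn R n)).

(* The index in V_1^(x)n of the basis vector given by a word of length n. *)
Definition word n (s : seq bool) : idx (fun _ : 'I_n => 1%N) :=
  [ffun j : 'I_n => inord (nth false s j)].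

(* The letters of b in box i, and those at the unmatched vertices of box i. *)
Definition letters (b : seq bool) (i : 'I_k) : seq bool :=
  [seq nth false b x | x <- iota (off d i) (d i)].
Definition uletters (S : arcs d) (b : seq bool) (i : 'I_k) : seq bool :=
  [seq nth false b x | x <- iota (off d i) (d i) & ~~ matched S x].

(* Since epsilon is scalar valued, contracting all pairs joined by arcs sends *)
(* the basis vector b of V_1^(x)|d| to the product of the epsilons times the *)
(* basis vector given by the unmatched letters. *)
Definition gamma (S : arcs d) (z : tens R d) :
    tens R (fun i => nS S i - rS S i)%N :=
  [ffun a : idx (fun i => nS S i - rS S i)%N =>
   \sum_(u : idx d) z u * (\sum_(b : (tot d).-tuple bool)
     (\prod_i (iota_ (d i) (tbas R _ (fun=> u i)) : V1pow R _)
                (word (d i) (letters b i)))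
   * (\prod_(x in S) eps R (tnth b x.1) (tnth b x.2))
   * (\prod_i (pi_ (nS S i - rS S i)
                (tbas R _ (fun j => word (nS S i - rS S i) (uletters S b i) j))
                : Vn R _)
             [ffun=> a i]))].

End Gamma.

Section Varieties.
Variables (k : nat) (d : 'I_k -> nat) (F : finFieldType).
Local Notation D := 'rV[F]_(tot d).

Definition Mcond (x : {vspace D} * 'End(D)) : bool :=
  (limg x.2 <= x.1)%VS && (x.1 <= lker x.2)%VS.
Definition Mvar : finType := {x : {vspace D} * 'End(D) | Mcond x}.

Definition flo (fl : {ffun 'I_k.+1 -> {vspace D}}) (i : 'I_k) : {vspace D} :=
  fl (widen_ord (leqnSn k) i).
Definition fhi (fl : {ffun 'I_k.+1 -> {vspace D}}) (i : 'I_k) : {vspace D} :=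
  fl (lift ord0 i).

Definition Tcond
    (y : {ffun 'I_k.+1 -> {vspace D}} * ({vspace D} * 'End(D))) : bool :=
  [&& Mcond y.2, y.1 ord0 == 0%VS, y.1 ord_max == fullv &
      [forall i : 'I_k,
         [&& (flo y.1 i <= fhi y.1 i)%VS,
             (\dim (fhi y.1 i) - \dim (flo y.1 i))%N == d i &
             (y.2.2 @: fhi y.1 i <= flo y.1 i)%VS]]].
Definition Tvar : finType :=
  {y : {ffun 'I_k.+1 -> {vspace D}} * ({vspace D} * 'End(D)) | Tcond y}.

Definition Wdim (x : Mvar) : nat := \dim (val x).1.
Definition trank (x : Mvar) : nat := \dim (limg (val x).2).
Definition Mstratum (r w : nat) (x : Mvar) : bool :=
  (Wdim x == w) && (trank x == r).

Definition flag (y : Tvar) := (val y).1.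
Definition Wof (y : Tvar) := (val y).2.1.
Definition tof (y : Tvar) := (val y).2.2.

Lemma Tcond_Mcond (y : Tvar) : Mcond (val y).2.
Proof. by case: y => y /= /and4P[]. Qed.

Definition Tproj (y : Tvar) : Mvar := exist _ (val y).2 (Tcond_Mcond y).

Definition alpha (X : {vspace D}) (fl : {ffun 'I_k.+1 -> {vspace D}})
    (i : 'I_k) : nat :=
  \dim (X :&: fhi fl i) - \dim (X :&: flo fl i).

Definition Aset (w r n : 'I_k -> nat) (y : Tvar) : bool :=
  [forall i, [&& alpha (Wof y) (flag y) i == w i,
                 alpha (limg (tof y)) (flag y) i == r i &
                 alpha (lker (tof y)) (flag y) i == n i]].

Definition Yset (b : arcs d) (y : Tvar) : bool :=
  [forall i, alpha (lker (tof y)) (flag y) i == nS b i].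

End Varieties.

Section Functions.
Variables (R : realType) (k : nat) (d : 'I_k -> nat).
Local Notation K := (Cq R).

(* As point counts are polynomials in the cardinality of the field, a function *)
(* on M(d) or T(d) is a family of functions, one over every finite field. *)
Definition funM := forall F : finFieldType, Mvar d F -> K.
Definition funT := forall F : finFieldType, Tvar d F -> K.

(* chi_q of a set Y whose possible numbers of points over F satisfy N F: *)
(* P_Y(q^2), where P_Y(|F|) is the number of points over every F. *)
Definition chi_q (N : finFieldType -> nat -> Prop) : K :=
  FracField.tofrac
    (xget 0 [set P : {poly R[i]} |
       forall (F : finFieldType) (n : nat), N F n -> n%:R = P.[#|F|%:R]]%classic
     \Po 'X^2).

(* p_!(f)(x) is the sum of c * chi_q {y in p^-1(x) | f(y) = c} over the values *)
(* c of f.  The linear-algebra type of x = (W, t) is (dim W, rank t), so the *)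
(* fibre of x is counted over all fields at the points x' of the same type. *)
Definition pushforward (f : funT) : funM := fun F x =>
  \sum_(c \in [set: K]) c *
    chi_q (fun F' n => exists x' : Mvar d F',
      [/\ Wdim x' = Wdim x, trank x' = trank x &
          n = #|[set y : Tvar d F' | (Tproj y == x') && (f F' y == c)]%SET|]).

Definition TY (Y : forall F : finFieldType, Tvar d F -> bool) (f : funT) : funM :=
  pushforward (fun F y => (Y F y)%:R * f F y).

Definition kfac (w r n : 'I_k -> nat) : K :=
  q ^ (\sum_(i < k) \sum_(j < k | (i < j)%N)
         ((r i * w j)%N%:Z + (w i * n j)%N%:Z - (w i * w j)%N%:Z)).

Definition fwrn (w r n : 'I_k -> nat) : funT := fun F y =>
  kfac w r n * (Aset w r n y)%:R.

Definition eta_inv (r n : 'I_k -> nat) (z : tens R (fun i => n i - r i)%N) : funT :=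
  fun F y => \sum_(a : idx (fun i => n i - r i)%N)
               z a * fwrn (fun i => a i + r i)%N r n y.

(* The map epsilon o eta_{0,d}^-1, i.e. the identification of *)
(* V_{d_1} (x) ... (x) V_{d_k} with T_c(d). *)
Definition Tc_iso (iota_ : forall n, 'Hom(Vn R n, V1pow R n))
    (pi_ : forall n, 'Hom(V1pow R n, Vn R n)) (z : tens R d) : funT :=
  fun F y => \sum_(S : arcs d | lcmatch S) eta_inv (gamma iota_ pi_ S z) y.

Definition indM (r w : nat) : funM := fun F x => (Mstratum r w x)%:R.

(* The identification of V_{d-2r} with M^r(d), v_{d-2w} |-> 1_{M^r(w,d)}: for *)
(* mu = d - 2r, the vector v_{mu-2u} is v_{d-2(u+r)}. *)
Definition M_iso (r mu : nat) (z : Vn R mu) : funM := fun F x =>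
  \sum_(u < mu.+1) z [ffun=> u] * indM r (u + r) x.

(* The sum of v_j over j >= i. *)
Definition tailsum (v : 'I_k -> nat) (i : 'I_k) : nat :=
  \sum_(j < k | (i <= j)%N) v j.

(* d_j - m_j - 2 l_j may be negative for a single j, so the subtraction is *)
(* performed on the sums, where it is not truncated. *)
Definition omega (b : arcs d) (kappa : tens R (mS b)) : K :=
  let l := lefts b in let m := mS b in
  \sum_(a : idx m)
    kappa a * kfac (fun i => a i + l i)%N l (fun i => l i + m i)%N *
    \prod_(i < k | (i.+1 < k)%N)
      cnum R [:: tailsum l i;
                 tailsum (fun j => a j) i;
                 tailsum (fun j => m j - a j)%N i;
                 (tailsum d i - tailsum m i - 2 * tailsum l i)%N]
             [:: l i; a i : nat; (m i - a i)%N; (d i - m i - l i)%N].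

End Functions.

(* Submission.v *)
(* Contracting an arc that joins boxes i < j, with only empty boxes between, is
   the map (El z)(a) = z(a + d_i) - q^-(a_i + e_j - a_j) z(a + d_j), which
   commutes with U_q and with Psi; every gamma_{r,n} is a composite of such
   maps.  Hence gamma sends a canonical basis element to a Psi-fixed vector
   that is congruent modulo q^-1 to a basis vector or to 0, i.e. to a canonical
   basis element or to 0.
   A point of Y_b lies in a single A_{w,r,n} with (r,n) = (r^b,n^b), and the
   fibres of A_{w,r,n} over M(d) are iterated Schubert cells, counted by
   products of Gaussian binomials.  With the factor k_{w,r,n} these products are
   q^(sum_{i<j} (m_i - a_i) a_j) times q-multinomials up to a constant, which is
   the U_q-map from a tensor product to its largest summand.
   An intertwiner to V_mu is determined by the coefficient of v_mu, a functional
   on one weight space that kills the image of F.  The matches M(d,u) with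
   l = u give functionals whose matrix is the identity modulo q^-1, and F is
   injective below the middle weight, so a dimension count shows they span. *)
Require Import Defs.
From HB Require Import structures.
From mathcomp Require Import all_boot all_order all_algebra.
From mathcomp Require Import boolp classical_sets fsbigop reals complex.
From mathcomp Require Import ring lra zify.

Set Implicit Arguments.
Unset Strict Implicit.
Unset Printing Implicit Defensive.

Import GRing.Theory Num.Theory.
Local Open Scope ring_scope.

(** * The bar involution and Z[q^-1] *)

(** Gamma is one sum over words, whereas commutation with Psi is accessible only arc by arc. In each
    box of a match the right endpoints come first and the left endpoints last, so the inversions
    involving matched vertices depend on the unmatched letters only through their number of downs,
    and the rest of the sum collapses by pi o iota = id. Adding arcs by increasing right end keeps
    every stage a match, and each new arc is the map [El]. The delicate point is that [El] need not
    commute with E on the two ends of the arc, which Theta uses. It commutes with F, and the vectors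
    with u_j = 0 generate the first j factors under F, so those suffice; on them [El] is a shift of
    u_i. F on symmetric words, EF - FE and the multinomial map all rest on one telescoping sum,
    [qz_telescope]. The dimension count uses no multiplicity formula: an index violating a ballot
    condition is lowered at its last box of maximal excess, which injects the bad indices into the
    next higher weight. *)

Section BarInvolution.

Section Bar.
Variable R : realType.
Local Notation K := (Cq R).
Local Notation tofrac := (@FracField.tofrac {poly R[i]}).
Local Notation q := (@q R).

Lemma frac_repr (x : K) : x * tofrac \d_(repr x) = tofrac \n_(repr x).
Proof.
rewrite -{1}[x]reprK; set r := repr x.
rewrite /FracField.tofrac; unlock.
rewrite /GRing.mul /= -FracField.pi_mul.
apply/eqmodP; rewrite /= /FracField.equivf /FracField.mulf.
by rewrite !numden_Ratio ?oner_neq0 ?mulf_neq0 ?denom_ratioP ?oner_neq0 // mulr1 mulrC mulr1.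
Qed.

Lemma tofrac_inj : injective tofrac.
Proof. by move=> x y /eqP; rewrite tofrac_eq => /eqP. Qed.

Fact cst_zmod_morphism : zmod_morphism (@cst R).
Proof. by move=> x y; rewrite /cst polyCB rmorphB. Qed.
Fact cst_monoid_morphism : monoid_morphism (@cst R).
Proof. by split=> [|x y]; rewrite /cst ?polyC1 ?rmorph1 // polyCM rmorphM. Qed.
HB.instance Definition _ :=
  GRing.isZmodMorphism.Build R[i] K (@cst R) cst_zmod_morphism.
HB.instance Definition _ :=
  GRing.isMonoidMorphism.Build R[i] K (@cst R) cst_monoid_morphism.

Lemma q_neq0 : q != 0.
Proof. by rewrite /q /Defs.q tofrac_eq0 polyX_eq0. Qed.

Lemma tofracE (p : {poly R[i]}) : tofrac p = (map_poly (@cst R) p).[q].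
Proof.
rewrite -[p in LHS]coefK poly_def rmorph_sum horner_coef size_map_poly.
apply: eq_bigr => i _; rewrite coef_map -mul_polyC rmorphM.
by rewrite [X in _ * X]rmorphXn.
Qed.

Definition qinv_eval (p : {poly R[i]}) : K := (map_poly (@cst R) p).[q^-1].

Fact qinv_eval_zmod_morphism : zmod_morphism qinv_eval.
Proof. by move=> x y; rewrite /qinv_eval rmorphB hornerD hornerN. Qed.
Fact qinv_eval_monoid_morphism : monoid_morphism qinv_eval.
Proof. by split=> [|x y]; rewrite /qinv_eval ?rmorph1 ?hornerC // rmorphM hornerM. Qed.
HB.instance Definition _ :=
  GRing.isZmodMorphism.Build {poly R[i]} K qinv_eval qinv_eval_zmod_morphism.
HB.instance Definition _ :=
  GRing.isMonoidMorphism.Build {poly R[i]} K qinv_eval qinv_eval_monoid_morphism.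

(** Clearing denominators in p(q^-1) reverses the coefficients. This brings the substitution back to
    polynomials in q, where [tofrac] is injective. *)
Lemma qinv_eval_rev (p : {poly R[i]}) :
  qinv_eval p * q ^+ (size p).-1 =
  tofrac (\poly_(i < size p) p`_((size p).-1 - i)).
Proof.
rewrite /qinv_eval horner_coef size_map_poly poly_def rmorph_sum mulr_suml.
rewrite (reindex_inj rev_ord_inj) /=; apply: eq_bigr => i _.
have le : (i <= (size p).-1)%N by rewrite -ltnS prednK // (leq_ltn_trans _ (ltn_ord i)).
have -> : (size p - i.+1 = (size p).-1 - i)%N by move: (nat_of_ord i) le => m; lia.
rewrite coef_map -mul_polyC rmorphM -mulrA; congr (_ * _).
rewrite [RHS]rmorphXn exprVn.
by rewrite -[X in q ^+ X](subnK le) exprD mulrA mulVf ?expf_neq0 ?q_neq0 // mul1r.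
Qed.

Lemma qinv_eval_eq0 (p : {poly R[i]}) : (qinv_eval p == 0) = (p == 0).
Proof.
apply/eqP/eqP => [p0|->]; last exact: rmorph0.
apply/eqP; rewrite -lead_coef_eq0; apply/negPn/negP => nz.
have := qinv_eval_rev p; rewrite p0 mul0r => /esym/eqP; rewrite tofrac_eq0.
move=> /eqP/(congr1 (fun r : {poly _} => r`_0)).
rewrite coef_poly coef0 subn0 lt0n size_poly_eq0 -lead_coef_eq0 nz => e.
by rewrite /lead_coef e eqxx in nz.
Qed.

(** The definition of [bar] uses one representing fraction. Cross multiplication survives the
    substitution, so any other fraction gives the same value, and the ring properties follow by
    choosing convenient fractions. *)
Lemma bar_frac (x : K) (a b : {poly R[i]}) :
  b != 0 -> x * tofrac b = tofrac a -> bar x = qinv_eval a / qinv_eval b.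
Proof.
move=> b0 xb; rewrite /bar -/(qinv_eval _) -/(qinv_eval \d_(repr x)).
have d0 := denom_ratioP (repr x).
apply/eqP; rewrite eqr_div ?qinv_eval_eq0 // -!rmorphM; apply/eqP; congr qinv_eval.
by apply: tofrac_inj; rewrite !rmorphM /= -frac_repr -xb mulrAC.
Qed.

Lemma bar_zmod_morphism : zmod_morphism (@bar R).
Proof.
move=> x y; have [dx dy] := (denom_ratioP (repr x), denom_ratioP (repr y)).
rewrite (@bar_frac (x - y) (\n_(repr x) * \d_(repr y) - \n_(repr y) * \d_(repr x))
  (\d_(repr x) * \d_(repr y))) ?mulf_neq0 //; last first.
  by rewrite rmorphB !rmorphM /= -!frac_repr mulrBl !mulrA; congr (_ - _); rewrite mulrAC.
rewrite rmorphB !rmorphM.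
by rewrite -mulNr -addf_div ?qinv_eval_eq0 // mulNr.
Qed.

Lemma bar_monoid_morphism : monoid_morphism (@bar R).
Proof.
split=> [|x y].
  by rewrite (@bar_frac 1 1 1) ?oner_neq0 ?rmorph1 ?divr1 ?mulr1.
have [dx dy] := (denom_ratioP (repr x), denom_ratioP (repr y)).
rewrite (@bar_frac (x * y) (\n_(repr x) * \n_(repr y))
  (\d_(repr x) * \d_(repr y))) ?mulf_neq0 //; last first.
  by rewrite !rmorphM /= -!frac_repr mulrACA.
by rewrite !rmorphM invfM mulrACA.
Qed.

HB.instance Definition _ :=
  GRing.isZmodMorphism.Build K K (@bar R) bar_zmod_morphism.
HB.instance Definition _ :=
  GRing.isMonoidMorphism.Build K K (@bar R) bar_monoid_morphism.

Lemma bar_q : bar q = q^-1.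
Proof.
rewrite (@bar_frac q 'X 1) ?oner_neq0 ?rmorph1 ?mulr1 ?divr1 //.
by rewrite /qinv_eval map_polyX hornerX.
Qed.

(** The embedding of Z[q^-1], the variable standing for q^-1. *)
Definition evZ (p : {poly int}) : K := (map_poly intr p).[q^-1].

Fact evZ_zmod_morphism : zmod_morphism evZ.
Proof. by move=> x y; rewrite /evZ rmorphB hornerD hornerN. Qed.
Fact evZ_monoid_morphism : monoid_morphism evZ.
Proof. by split=> [|x y]; rewrite /evZ ?rmorph1 ?hornerC // rmorphM hornerM. Qed.
HB.instance Definition _ :=
  GRing.isZmodMorphism.Build {poly int} K evZ evZ_zmod_morphism.
HB.instance Definition _ :=
  GRing.isMonoidMorphism.Build {poly int} K evZ evZ_monoid_morphism.

Lemma evZE p : evZ p = qinv_eval (map_poly intr p).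
Proof.
rewrite /evZ /qinv_eval -map_poly_comp; congr (_.[_]).
by apply: eq_map_poly => i /=; rewrite rmorph_int.
Qed.

Lemma evZX : evZ 'X = q^-1.
Proof. by rewrite /evZ map_polyX hornerX. Qed.

Lemma evZ_eq0 p : (evZ p == 0) = (p == 0).
Proof. by rewrite evZE qinv_eval_eq0 -!size_poly_eq0 (size_map_inj_poly (@intr_inj _)). Qed.

Lemma bar_evZ p : bar (evZ p) = (map_poly intr p).[q].
Proof.
rewrite /evZ !horner_coef rmorph_sum; apply: eq_bigr => i _.
by rewrite rmorphM rmorphXn fmorphV /= bar_q invrK !coef_map /= rmorph_int.
Qed.

Lemma qinvZP x : in_qinvZ x <-> exists p, x = evZ ('X * p).
Proof.
by split=> -[p ->]; exists p; rewrite rmorphM /= evZX.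
Qed.

Lemma qinvZ0 : in_qinvZ (0 : K).
Proof. by apply/qinvZP; exists 0; rewrite mulr0 rmorph0. Qed.

Lemma qinvZB (x y : K) : in_qinvZ x -> in_qinvZ y -> in_qinvZ (x - y).
Proof.
move=> /qinvZP[a ->] /qinvZP[b ->]; apply/qinvZP; exists (a - b).
by rewrite mulrBr rmorphB.
Qed.

Lemma qinvZM (x y : K) : in_qinvZ x -> (exists p, y = evZ p) -> in_qinvZ (x * y).
Proof.
move=> /qinvZP[a ->] [b ->]; apply/qinvZP; exists (a * b).
by rewrite mulrA [RHS]rmorphM.
Qed.

Lemma qinvZ_exp n : (0 < n)%N -> in_qinvZ (q ^- n).
Proof.
case: n => // n _; apply/qinvZP; exists 'X^n.
by rewrite -exprS rmorphXn /= evZX exprVn.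
Qed.

(* A fixed point would satisfy [q p(q) = q^-1 p(q^-1)]. *)
Lemma qinvZ_bar_eq0 (x : K) : in_qinvZ x -> bar x = x -> x = 0.
Proof.
move=> /qinvZP[p ->] /eqP; apply: contra_eq; rewrite evZ_eq0 mulf_eq0 polyX_eq0 /= => p0.
set r := 'X * p; have sr : (1 < size r)%N by rewrite /r mulrC size_mulX // ltnS lt0n size_poly_eq0.
apply/eqP; rewrite bar_evZ evZE.
set s : {poly R[i]} := map_poly intr r => /eqP e; move: (congr1 ( *%R^~ (q ^+ (size s).-1)) e) => /= {e}.
have -> : (map_poly intr r).[q] = tofrac s.
  rewrite tofracE -map_poly_comp; congr (_.[_]).
  by apply: eq_map_poly => i /=; rewrite rmorph_int.
have ss : size s = size r.
  by apply: (size_map_inj_poly (@intr_inj _)).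
rewrite qinv_eval_rev -[q ^+ _](rmorphXn tofrac) -(rmorphM tofrac) => /tofrac_inj/(congr1 (fun p : {poly _} => size p)).
have s0 : s != 0 by rewrite -size_poly_eq0 ss -lt0n (ltn_trans _ sr).
(* With n = size r, the left side now has size 2n - 1 and the reversed polynomial size at most n,
   while n > 1 because of the factor ['X]. *)
rewrite (size_Mmonic s0 (monicXn _ _)) ss size_polyXn => e.
have := size_poly (size r) (fun i => s`_((size r).-1 - i)).
by rewrite -e => {e}; move: (size r) sr => m; lia.
Qed.

End Bar.

End BarInvolution.

(** * Quantum integers and coordinates of tensors *)

Section Coordinates.

Section QuantumIntegers.
Variables (K : fieldType) (q : K).
Hypothesis q0 : q != 0.
Hypothesis qnr : forall n, (0 < n)%N -> q ^+ n != q ^- n.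

Definition qz (n : int) : K := (q ^ n - q ^ (- n)) / (q - q^-1).
Definition qn (n : nat) : K := (q ^+ n - q ^- n) / (q - q^-1).
Definition qf (n : nat) : K := \prod_(1 <= i < n.+1) qn i.

Lemma qmV_neq0 : q - q^-1 != 0.
Proof. by rewrite subr_eq0; apply: (@qnr 1). Qed.

Lemma qq1_neq0 : q * q - 1 != 0.
Proof.
have -> : q * q - 1 = q * (q - q^-1) by rewrite mulrBr mulfV.
by rewrite mulf_neq0 ?qmV_neq0.
Qed.

Lemma qnE (n : nat) : qn n = qz n.
Proof. by rewrite /qn /qz exprnN. Qed.

Lemma qn0 : qn 0 = 0.
Proof. by rewrite /qn !expr0 invr1 subrr mul0r. Qed.

Lemma qz0 : qz 0 = 0.
Proof. by rewrite -(qnE 0) qn0. Qed.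

Lemma qn_neq0 n : (0 < n)%N -> qn n != 0.
Proof. by move=> n0; rewrite mulf_neq0 ?invr_eq0 ?qmV_neq0 // subr_eq0 qnr. Qed.

Lemma qf_neq0 n : qf n != 0.
Proof. by rewrite /qf prodf_seq_neq0; apply/allP => i; rewrite mem_index_iota => /andP[i0 _]; rewrite qn_neq0. Qed.

Lemma qfS n : qf n.+1 = qf n * qn n.+1.
Proof. by rewrite /qf big_nat_recr. Qed.

Lemma qzD (a b : int) : qz (a + b) = q ^ b * qz a + q ^ (- a) * qz b.
Proof.
rewrite /qz opprD !expfzDr // !mulrA -mulrDl; congr (_ / _).
rewrite !mulrBr (mulrC (q ^ b)) (mulrC (q ^ b)) [_ * q ^ b in X in _ = X]mulrC; ring.
Qed.

Lemma qzN a : qz (- a) = - qz a.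
Proof. by rewrite /qz opprK -mulNr opprB. Qed.

(** For c = 1 this is the scalar form of EF - FE = (K - K^-1)/(q - q^-1). *)
Lemma qz_comm (a b c : int) : qz a * qz (b + c) - qz b * qz (a + c) = qz c * qz (a - b).
Proof.
have nz := qmV_neq0; rewrite /qz !opprD !opprK !expfzDr // -!exprz_inv !exprz_inv.
rewrite -!invr_expz; set A := q ^ a; set B := q ^ b; set C := q ^ c.
have hA : A != 0 by rewrite expfz_neq0.
have hB : B != 0 by rewrite expfz_neq0.
have hC : C != 0 by rewrite expfz_neq0.
by field; rewrite hA hB hC qq1_neq0 q0.
Qed.

End QuantumIntegers.

Section MultiIndex.
Variable k : nat.
Implicit Types (e u : 'I_k -> nat) (s t : 'I_k).

Definition up u s : 'I_k -> nat := fun t => (u t + (t == s))%N.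
Definition dn u s : 'I_k -> nat := fun t => (u t - (t == s))%N.
Definition inr e u := [forall t, u t <= e t]%N.

Lemma upE u s : up u s s = (u s).+1. Proof. by rewrite /up eqxx addn1. Qed.
Lemma dnE u s : dn u s s = (u s).-1. Proof. by rewrite /dn eqxx subn1. Qed.
Lemma upN u s t : t != s -> up u s t = u t.
Proof. by move=> /negPf e; rewrite /up e addn0. Qed.
Lemma dnN u s t : t != s -> dn u s t = u t.
Proof. by move=> /negPf e; rewrite /dn e subn0. Qed.
Lemma upK u s : dn (up u s) s = u.
Proof. by apply: funext => t; rewrite /dn /up addnK. Qed.
Lemma dnK u s : (0 < u s)%N -> up (dn u s) s = u.
Proof.
by move=> us; apply: funext => t; rewrite /dn /up; case: eqP => [->|_]; lia.
Qed.
Lemma upC u s t : up (up u s) t = up (up u t) s.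
Proof. by apply: funext => x; rewrite /up addnAC. Qed.
Lemma dnC u s t : dn (dn u s) t = dn (dn u t) s.
Proof. by apply: funext => x; rewrite /dn subnAC. Qed.
Lemma up_dn u s t : t != s -> up (dn u s) t = dn (up u t) s.
Proof.
move=> ts; apply: funext => x; rewrite /up /dn.
by case: (eqVneq x t) => [->|_]; rewrite ?(negPf ts) ?subn0 ?addn0.
Qed.

Lemma inrP e u : reflect (forall t, (u t <= e t)%N) (inr e u).
Proof. exact: forallP. Qed.
Lemma inr_up e u s : inr e (up u s) -> inr e u.
Proof. by move=> /inrP h; apply/inrP => t; apply: leq_trans (h t); apply: leq_addr. Qed.

Variable K : fieldType.

Definition gtens e := {ffun idx e -> K^o}.
HB.instance Definition _ e := Vector.on (gtens e).

Definition mki e u : idx e := [ffun t => inord (u t)].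
(** Coordinates at arbitrary functions, with value 0 out of range: indices can be shifted without
    carrying range proofs, and tensors of different shapes can be compared. *)
Definition cf e u (z : gtens e) : K := if inr e u then z (mki e u) else 0.
Definition mk e (g : ('I_k -> nat) -> K) : gtens e := [ffun a : idx e => g (fun t => a t)].

Lemma inr_idx e (a : idx e) : inr e (fun t => a t).
Proof. by apply/inrP => t; rewrite -ltnS. Qed.

Lemma mki_idx e (a : idx e) : mki e (fun t => a t) = a.
Proof. by apply/ffunP => t; rewrite ffunE; apply: val_inj; rewrite /= inordK. Qed.

Lemma idx_mki e u : inr e u -> (fun t => mki e u t : nat) = u.
Proof. by move=> /inrP h; apply: funext => t; rewrite ffunE inordK // ltnS. Qed.

Lemma cf_idx e (z : gtens e) (a : idx e) : cf (fun t => a t) z = z a.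
Proof. by rewrite /cf inr_idx mki_idx. Qed.

Lemma cf_mk e u g : cf u (mk e g) = if inr e u then g u else 0.
Proof. by rewrite /cf; case: ifP => // h; rewrite ffunE idx_mki. Qed.

Lemma cf_out e u (z : gtens e) : ~~ inr e u -> cf u z = 0.
Proof. by rewrite /cf => /negPf->. Qed.

Lemma cf_out1 e u s (z : gtens e) : (e s < u s)%N -> cf u z = 0.
Proof. by move=> h; rewrite cf_out //; apply/negP => /inrP/(_ s); rewrite leqNgt h. Qed.

Lemma gext e (z z' : gtens e) : (forall u, inr e u -> cf u z = cf u z') -> z = z'.
Proof. by move=> h; apply/ffunP => a; rewrite -!cf_idx h // inr_idx. Qed.

Fact cf_linear e u : linear (@cf e u : gtens e -> K^o).
Proof.
move=> c x y; rewrite /cf; case: ifP => _; last by rewrite scaler0 addr0.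
by rewrite !ffunE.
Qed.
HB.instance Definition _ e u :=
  GRing.isLinear.Build K (gtens e) K^o *:%R (@cf e u) (@cf_linear e u).

Lemma cfD e u (x y : gtens e) : cf u (x + y) = cf u x + cf u y.
Proof. exact: (linearD (@cf e u)). Qed.
Lemma cfB e u (x y : gtens e) : cf u (x - y) = cf u x - cf u y.
Proof. exact: (linearB (@cf e u)). Qed.
Lemma cfZ e u c (x : gtens e) : cf u (c *: x) = c * cf u x.
Proof. exact: (linearZ_LR (@cf e u)). Qed.
Lemma cf0 e u : cf u (0 : gtens e) = 0.
Proof. exact: (linear0 (@cf e u)). Qed.
Lemma cf_sum e u I (r : seq I) P (x : I -> gtens e) :
  cf u (\sum_(i <- r | P i) x i) = \sum_(i <- r | P i) cf u (x i).
Proof. exact: (linear_sum (@cf e u)). Qed.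

End MultiIndex.

End Coordinates.

(** * Generators in coordinates *)

Section QuantumOperators.

Section Operators.
Variables (K : fieldType) (q : K).
Hypothesis q0 : q != 0.
Hypothesis qnr : forall n, (0 < n)%N -> q ^+ n != q ^- n.
Variables (k : nat) (e : 'I_k -> nat).
Implicit Types (u : 'I_k -> nat) (s t : 'I_k) (z : gtens K e).
Local Notation qn := (qn q).
Local Notation qz := (qz q).

(** The exponent of q by which K acts on factor t. Below, [wF] and [wE] collect the K^-1 to the
    right and the K to the left of the active factor in the iterated coproducts. *)
Definition hw u t : int := (e t)%:Z - (u t)%:Z *+ 2.
Definition wF u s m : int := \sum_(t < k | (s < t < m)%N) hw u t.
Definition wE u s : int := \sum_(t < k | (t < s)%N) hw u t.

Definition gE s z : gtens K e := mk e (fun u => qn (e s - u s) * cf (up u s) z).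
Definition gf s z : gtens K e :=
  mk e (fun u => qn (u s) * cf (dn u s) z).
Definition gk s z : gtens K e := mk e (fun u => q ^ (hw u s) * cf u z).
Definition gki s z : gtens K e := mk e (fun u => q ^ (- hw u s) * cf u z).
Definition gF m z : gtens K e :=
  \sum_(s < k | (s < m)%N) mk e (fun u => q ^ (- wF u s m) * cf u (gf s z)).
Definition gEt z : gtens K e :=
  \sum_s mk e (fun u => q ^ (wE u s) * cf u (gE s z)).
Definition gKt z : gtens K e := mk e (fun u => q ^ (\sum_t hw u t) * cf u z).
Definition gKit z : gtens K e := mk e (fun u => q ^ (- \sum_t hw u t) * cf u z).

Lemma inr_dn u s : inr e u -> inr e (dn u s).
Proof. by move=> /inrP h; apply/inrP => t; apply: leq_trans (h t); apply: leq_subr. Qed.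

Lemma cf_gE u s z : cf u (gE s z) = qn (e s - u s) * cf (up u s) z.
Proof.
rewrite cf_mk; case: ifP => // /negbT h; rewrite cf_out ?mulr0 //.
by apply: contra h; apply: inr_up.
Qed.

Lemma cf_gf u s z : cf u (gf s z) = (u s <= e s)%:R * (qn (u s) * cf (dn u s) z).
Proof.
rewrite cf_mk; case: ifP => [/inrP ->|/negbT h]; first by rewrite mul1r.
case: leqP => [us|_]; last by rewrite mul0r.
rewrite cf_out ?mulr0 //; apply: contra h => /inrP h; apply/inrP => t.
by case: (eqVneq t s) => [->//|ts]; rewrite -(dnN u ts).
Qed.

Lemma cf_gk u s z : cf u (gk s z) = q ^ (hw u s) * cf u z.
Proof. by rewrite cf_mk; case: ifP => // /negbT h; rewrite cf_out ?mulr0. Qed.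
Lemma cf_gki u s z : cf u (gki s z) = q ^ (- hw u s) * cf u z.
Proof. by rewrite cf_mk; case: ifP => // /negbT h; rewrite cf_out ?mulr0. Qed.
Lemma cf_gKt u z : cf u (gKt z) = q ^ (\sum_t hw u t) * cf u z.
Proof. by rewrite cf_mk; case: ifP => // /negbT h; rewrite cf_out ?mulr0. Qed.
Lemma cf_gKit u z : cf u (gKit z) = q ^ (- \sum_t hw u t) * cf u z.
Proof. by rewrite cf_mk; case: ifP => // /negbT h; rewrite cf_out ?mulr0. Qed.

Lemma cf_gF u m z :
  cf u (gF m z) = \sum_(s < k | (s < m)%N) q ^ (- wF u s m) * cf u (gf s z).
Proof.
rewrite cf_sum; apply: eq_bigr => s _; rewrite cf_mk.
by case: ifP => // /negbT h; rewrite cf_out ?mulr0.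
Qed.

Lemma cf_gEt u z : cf u (gEt z) = \sum_s q ^ (wE u s) * cf u (gE s z).
Proof.
rewrite cf_sum; apply: eq_bigr => s _; rewrite cf_mk.
by case: ifP => // /negbT h; rewrite cf_out ?mulr0.
Qed.

Lemma gE_linear s : linear (gE s).
Proof. by move=> c x y; apply: gext => u _; rewrite !(cfD, cfZ, cf_gE); ring. Qed.
Lemma gf_linear s : linear (gf s).
Proof. by move=> c x y; apply: gext => u _; rewrite !(cfD, cfZ, cf_gf); ring. Qed.
Lemma gk_linear s : linear (gk s).
Proof. by move=> c x y; apply: gext => u _; rewrite !(cfD, cfZ, cf_gk); ring. Qed.
Lemma gki_linear s : linear (gki s).
Proof. by move=> c x y; apply: gext => u _; rewrite !(cfD, cfZ, cf_gki); ring. Qed.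
Lemma gKt_linear : linear gKt.
Proof. by move=> c x y; apply: gext => u _; rewrite !(cfD, cfZ, cf_gKt); ring. Qed.
Lemma gF_linear m : linear (gF m).
Proof.
move=> c x y; apply: gext => u _; rewrite !(cfD, cfZ, cf_gF) mulr_sumr -big_split.
by apply: eq_bigr => s _; rewrite !(cfD, cfZ, cf_gf) /=; ring.
Qed.
Lemma gEt_linear : linear gEt.
Proof.
move=> c x y; apply: gext => u _; rewrite !(cfD, cfZ, cf_gEt) mulr_sumr -big_split.
by apply: eq_bigr => s _; rewrite !(cfD, cfZ, cf_gE) /=; ring.
Qed.
HB.instance Definition _ s := GRing.isLinear.Build K (gtens K e) (gtens K e) _ (gE s) (gE_linear s).
HB.instance Definition _ s := GRing.isLinear.Build K (gtens K e) (gtens K e) _ (gf s) (gf_linear s).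
HB.instance Definition _ s := GRing.isLinear.Build K (gtens K e) (gtens K e) _ (gk s) (gk_linear s).
HB.instance Definition _ s := GRing.isLinear.Build K (gtens K e) (gtens K e) _ (gki s) (gki_linear s).
HB.instance Definition _ := GRing.isLinear.Build K (gtens K e) (gtens K e) _ gKt gKt_linear.
HB.instance Definition _ m := GRing.isLinear.Build K (gtens K e) (gtens K e) _ (gF m) (gF_linear m).
HB.instance Definition _ := GRing.isLinear.Build K (gtens K e) (gtens K e) _ gEt gEt_linear.

Lemma hw_up u s t : hw (up u s) t = hw u t - (t == s)%:Z *+ 2.
Proof. by rewrite /hw /up PoszD; ring. Qed.

Lemma sum_hw_up (P : pred 'I_k) u s :
  \sum_(t | P t) hw (up u s) t = \sum_(t | P t) hw u t - (P s)%:Z *+ 2.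
Proof.
rewrite (eq_bigr _ (fun t _ => hw_up u s t)) big_split /= sumrN; congr (_ - _).
rewrite sumrMnl; congr (_ *+ _); case: (boolP (P s)) => Ps.
  by rewrite (bigD1 s) //= eqxx big1 ?addr0 // => t /andP[_ /negPf->].
by rewrite big1 // => t Pt; case: eqP Ps => // <-; rewrite Pt.
Qed.

Lemma sum_hw_dn (P : pred 'I_k) u s : (0 < u s)%N ->
  \sum_(t | P t) hw (dn u s) t = \sum_(t | P t) hw u t + (P s)%:Z *+ 2.
Proof. by move=> us; rewrite -[in RHS](dnK us) sum_hw_up subrK. Qed.

Lemma gE_gf s t z : t != s -> gE s (gf t z) = gf t (gE s z).
Proof.
move=> ts; apply: gext => u _; rewrite !(cf_gE, cf_gf) (upN _ ts) (@dnN _ _ _ s) 1?eq_sym //.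
by rewrite -up_dn 1?eq_sym //; ring.
Qed.

Lemma gE_gF m s z : (m <= s)%N -> gE s (gF m z) = gF m (gE s z).
Proof.
move=> ms; apply: gext => u _; rewrite cf_gE !cf_gF mulr_sumr; apply: eq_bigr => t tm.
have ts : t != s by apply: contraTneq (leq_trans tm ms) => ->; rewrite ltnn.
rewrite -gE_gf // cf_gE /wF sum_hw_up [(s < m)%N]ltnNge ms andbF subr0; ring.
Qed.

Lemma gk_gF m s z : (m <= s)%N -> gk s (gF m z) = gF m (gk s z).
Proof.
move=> ms; apply: gext => u _; rewrite cf_gk !cf_gF mulr_sumr; apply: eq_bigr => t tm.
have ts : s != t by apply: contraTneq (leq_trans tm ms) => ->; rewrite ltnn.
by rewrite !cf_gf cf_gk /hw dnN //; ring.
Qed.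

Lemma gki_gF m s z : (m <= s)%N -> gki s (gF m z) = gF m (gki s z).
Proof.
move=> ms; apply: gext => u _; rewrite cf_gki !cf_gF mulr_sumr; apply: eq_bigr => t tm.
have ts : s != t by apply: contraTneq (leq_trans tm ms) => ->; rewrite ltnn.
by rewrite !cf_gf cf_gki /hw dnN //; ring.
Qed.

Lemma gf_gF m s z : (m <= s)%N -> gf s (gF m z) = gF m (gf s z).
Proof.
move=> ms; apply: gext => u _; rewrite cf_gf !cf_gF.
have [us|us] := posnP (u s); last first.
  rewrite !mulr_sumr; apply: eq_bigr => t tm.
  have ts : t != s by apply: contraTneq (leq_trans tm ms) => ->; rewrite ltnn.
  rewrite !cf_gf !dnN // 1?eq_sym // dnC /wF sum_hw_dn // [(s < m)%N]ltnNge ms andbF addr0.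
  by ring.
rewrite us qn0 mul0r mulr0 big1 // => t tm.
have ts : t != s by apply: contraTneq (leq_trans tm ms) => ->; rewrite ltnn.
by rewrite !cf_gf !dnN 1?eq_sym // us qn0 mul0r !mulr0.
Qed.

(** The coproduct F (x) K^-1 + 1 (x) F with factor s split off; inductions over the number of
    factors rest on it. *)
Lemma gFS s z : gF s.+1 z = gF s (gki s z) + gf s z.
Proof.
apply: gext => u _; rewrite cfD !cf_gF (bigD1 s) //= addrC; congr (_ + _).
  apply: eq_big => [t|t /andP[ts tns]]; first by rewrite ltnS [RHS]ltn_neqAle andbC.
  have {tns}ts : (t < s)%N by rewrite ltn_neqAle -ltnS ts andbT.
  have nst : s != t by apply: contraTneq ts => ->; rewrite ltnn.
  rewrite !cf_gf cf_gki /wF (bigD1 s) ?ts ?ltnSn //= opprD expfzDr // /hw dnN //.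
  rewrite (eq_bigl (fun i : 'I_k => t < i < s)%N); last first.
    move=> i; rewrite ltnS; case: ltngtP => //= ti; rewrite -[i != s]/(~~ (val i == val s)).
    by rewrite [RHS]ltn_neqAle andbC.
  by ring.
rewrite /wF big_pred0 ?oppr0 ?expr0z ?mul1r // => t; lia.
Qed.

Lemma gk_gE s z : gk s (gE s z) = q ^+ 2 *: gE s (gk s z).
Proof.
apply: gext => u _; rewrite cfZ cf_gk !cf_gE cf_gk hw_up eqxx.
rewrite expfzDr // -[q ^ - (_ *+ 2)]/(q ^- 2); field; exact: q0.
Qed.

Lemma gki_gE s z : gki s (gE s z) = q ^- 2 *: gE s (gki s z).
Proof.
apply: gext => u _; rewrite cfZ cf_gki !cf_gE cf_gki hw_up eqxx (opprB (hw u s)) expfzDr //.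
rewrite -[q ^ (true%:Z *+ 2)]/(q ^+ 2); field; exact: q0.
Qed.

Lemma gE_gf_comm s z :
  gE s (gf s z) - gf s (gE s z) = (q - q^-1)^-1 *: (gk s z - gki s z).
Proof.
apply: gext => u /inrP/(_ s) us; rewrite cfZ !cfB cf_gk cf_gki !(cf_gE, cf_gf).
rewrite upK upE dnE us mul1r.
(* The cut-off of [gf] above the top index is harmless: there the quantum integer in front is 0. *)
have -> : qn (e s - u s) * ((u s < e s)%N%:R * (qn (u s).+1 * cf u z)) =
   qn (e s - u s) * qn (u s).+1 * cf u z.
  case: ltnP => us'; first by rewrite /= mul1r mulrA.
  by rewrite (eqP (_ : (e s - u s == 0)%N)) ?subn_eq0 // qn0 !mul0r.
have -> : qn (u s) * (qn (e s - (u s).-1) * cf (up (dn u s) s) z) =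
    qn (u s) * qn (e s - u s).+1 * cf u z.
  have [->|us0] := posnP (u s); first by rewrite qn0 !mul0r.
  by rewrite dnK // mulrA; congr (_ * qn _ * _); lia.
have e1 (n : nat) : n%:Z + 1 = n.+1 by lia.
have := qz_comm q0 qnr (e s - u s)%N (u s) 1.
have -> : (e s - u s)%N%:Z - (u s)%:Z = hw u s by rewrite /hw; lia.
rewrite !e1 -!qnE (qnE q 1) /qz expr1z exprN1 divff ?(qmV_neq0 qnr) // mul1r => E.
by rewrite -mulrBl E -mulrBl mulrAC mulrC mulrA.
Qed.

End Operators.

End QuantumOperators.

(** * The quasi-R-matrix and Psi *)

Section QuasiRMatrix.

Section QuasiR.
Variables (K : fieldType) (q : K).
Hypothesis q0 : q != 0.
Hypothesis qnr : forall n, (0 < n)%N -> q ^+ n != q ^- n.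
Local Notation qn := (qn q).

Definition cth n : K := (-1) ^+ n * q ^- 'C(n, 2) * (q - q^-1) ^+ n / qf q n.

(** The recursion by which consecutive terms of Theta cancel in [thp_diff]. *)
Lemma cthS n : cth n.+1 * qn n.+1 = - cth n * (q - q^-1) * q ^- n.
Proof.
rewrite /cth qfS binS bin1 !exprS addnC exprD.
have nz := qf_neq0 qnr n; have nz' := qn_neq0 qnr (ltn0Sn n).
have nq : q ^+ n != 0 by rewrite expf_neq0.
have nq' : q ^+ 'C(n, 2) != 0 by rewrite expf_neq0.
by field; rewrite q0 nz nz' nq nq'.
Qed.

Section Iter.
Variables (V : lmodType K) (E : {linear V -> V}).
Lemma iter_linD n x y : iter n E (x + y) = iter n E x + iter n E y.
Proof. by elim: n => //= n ->; rewrite linearD. Qed.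
Lemma iter_linZ n c x : iter n E (c *: x) = c *: iter n E x.
Proof. by elim: n => //= n ->; rewrite linearZ. Qed.
Lemma iter_linN n x : iter n E (- x) = - iter n E x.
Proof. by rewrite -scaleN1r iter_linZ scaleN1r. Qed.
Lemma iter_lin0 n : iter n E 0 = 0.
Proof. by elim: n => //= n ->; rewrite linear0. Qed.

End Iter.

Section CommuteIter.
Variables (V W : Type) (E : V -> V) (E' : W -> W) (f : V -> W).
Lemma iter_comm n x : (forall x, f (E x) = E' (f x)) -> f (iter n E x) = iter n E' (f x).
Proof. by move=> h; elim: n => //= n <-; rewrite h. Qed.
End CommuteIter.

Section Abstract.
(** [A] plays F on the factors already treated; [E], [f], [k], [ki] play the generators on the next
    factor. *)
Variables (V : lmodType K) (A E f k ki : {linear V -> V}).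
Hypothesis kE : forall x, k (E x) = q ^+ 2 *: E (k x).
Hypothesis kiE : forall x, ki (E x) = q ^- 2 *: E (ki x).
Hypothesis Ef : forall x, E (f x) = f (E x) + (q - q^-1)^-1 *: (k x - ki x).

Lemma k_iterE n x : k (iter n E x) = q ^+ (2 * n) *: iter n E (k x).
Proof.
elim: n => [|n IHn] /=; first by rewrite scale1r.
by rewrite kE IHn linearZ scalerA -exprD; congr (_ ^+ _ *: _); lia.
Qed.

Lemma ki_iterE n x : ki (iter n E x) = q ^- (2 * n) *: iter n E (ki x).
Proof.
elim: n => [|n IHn] /=; first by rewrite invr1 scale1r.
by rewrite kiE IHn linearZ scalerA -invfM -exprD; congr (_ ^- _ *: _); lia.
Qed.

(** Up to the factor [n+1]/(q - q^-1) this is the commutator of E^(n+1) with F. *)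
Definition DE n x := iter n E (q ^+ n *: k x - q ^- n *: ki x).

Lemma iterE_f n x :
  iter n.+1 E (f x) = f (iter n.+1 E x) + (qn n.+1 / (q - q^-1)) *: DE n x.
Proof.
have nz := qmV_neq0 qnr.
elim: n => [|n IHn].
  by rewrite /DE /= Ef /Submission.qn expr1 divff // mul1r invr1 !scale1r.
rewrite [LHS]iterS IHn linearD Ef -iterS -addrA; congr (_ + _).
rewrite k_iterE ki_iterE linearZ /= /DE /= !(iter_linD, iter_linN, iter_linZ) !(linearB, linearZ) /=.
rewrite !(scalerDr, scalerN, scalerA) addrACA -opprD -!scalerDl.
have nq : q ^+ n != 0 by rewrite expf_neq0.
have -> : q ^+ (2 * n.+1) = q * q * q ^+ n * q ^+ n.
  by rewrite -mulrA -exprD -expr2 -exprD; congr (_ ^+ _); lia.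
by congr (_ *: _ - _ *: _); rewrite /Submission.qn !exprS; field; rewrite q0 nq qq1_neq0.
Qed.

Hypothesis AE : forall x, E (A x) = A (E x).
Hypothesis Af : forall x, f (A x) = A (f x).
Hypothesis Aki : forall x, ki (A x) = A (ki x).

Definition thp N x := \sum_(n < N) cth n *: iter n A (iter n E x).

Lemma thpS N x : thp N.+1 x = thp N x + cth N *: iter N A (iter N E x).
Proof. by rewrite /thp big_ord_recr. Qed.

(** Theta intertwines F (x) K + 1 (x) F, the bar conjugate of the coproduct, with F (x) K^-1 + 1 (x)
    F. For the truncated sum the terms cancel in pairs by [cthS], and only the last one leaves a
    remainder. *)
Lemma thp_diff N x :
  thp N.+1 (A (k x) + f x) =
  A (ki (thp N.+1 x)) + f (thp N.+1 x) + (cth N * q ^- N) *: iter N.+1 A (DE N x).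
Proof.
have iA n y : iter n E (A y) = A (iter n E y) by apply/esym/iter_comm => ?; rewrite AE.
have iki n y : ki (iter n A y) = iter n A (ki y) by exact: iter_comm.
have iff n y : f (iter n A y) = iter n A (f y) by exact: iter_comm.
elim: N => [|N IHN].
  rewrite !thpS /thp !big_ord0 !add0r /= expr0 invr1 mulr1 !linearZ /= -!scalerDr.
  congr (_ *: _); rewrite /DE /= expr0 invr1 !scale1r linearB addrAC; congr (_ + _).
  by rewrite addrC subrK.
rewrite thpS IHN [thp N.+2 x]thpS (linearD ki) (linearD A) (linearD f).
rewrite [iter N.+1 E (_ + _)]iter_linD iterE_f iA.
set P := iter N.+1 A; set X := iter N.+1 E (k x); set Z := iter N.+1 E x.
have Pt y : iter N.+2 A y = A (P y) by rewrite iterS.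
have PA y : P (A y) = A (P y) by rewrite /P -iterSr iterS.
rewrite Pt !(linearZ_LR f, linearZ_LR ki, linearZ_LR A) /= iki iff -/P.
rewrite [DE N.+1 x]/DE iter_linD iter_linN !iter_linZ -/X -/Z.
rewrite ki_iterE; set Y := iter N.+1 E (ki x).
have PD x1 x2 : P (x1 + x2) = P x1 + P x2 by exact: iter_linD.
have PZ c x1 : P (c *: x1) = c *: P x1 by exact: iter_linZ.
have PN x1 : P (- x1) = - P x1 by exact: iter_linN.
rewrite !(PD, PN, PZ, PA) linearB !(linearZ_LR A) /= !(scalerDr, scalerN, scalerA).
move: (A (P X)) (A (P Y)) (P (DE N x)) (P (f Z)) (A _) (f _) => x1 x2 x3 x4 x5 x6.
have -> : cth N.+1 * (qn N.+1 / (q - q^-1)) = - (cth N / q ^+ N).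
  by rewrite mulrA cthS !mulNr mulrAC mulfK ?qmV_neq0.
have -> : cth N.+1 / q ^+ N.+1 / q ^+ N.+1 = cth N.+1 / q ^+ (2 * N.+1).
  by rewrite -mulrA -invfM -exprD; congr (_ / _ ^+ _); lia.
rewrite divfK ?expf_neq0 // scaleNr !addrA.
move: (_ *: x1) (_ *: x2) (_ *: x3) (_ *: x4) => y1 y2 y3 y4.
rewrite (addrAC _ y3 y1) (addrAC _ y3 y4) addrK.
by rewrite (addrAC _ y2 x6) (addrAC _ y2 y4) (addrAC _ y2 y1) addrK (addrAC _ y1).
Qed.

Lemma thp_comm N x : (forall x, iter N.+1 E x = 0) ->
  thp N.+1 (A (k x) + f x) = A (ki (thp N.+1 x)) + f (thp N.+1 x).
Proof.
(* As E^(N+1) = 0, the commutator formula leaves a non-zero multiple of [DE N x] equal to 0, which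
   removes the remainder. *)
move=> EN; rewrite thp_diff; have := iterE_f N x.
rewrite !EN linear0 add0r => /esym/eqP; rewrite scaler_eq0 mulf_eq0 invr_eq0.
rewrite (negPf (qmV_neq0 qnr)) (negPf (qn_neq0 qnr _)) //= => /eqP ->.
by rewrite iter_lin0 linear0 scaler0 addr0.
Qed.
End Abstract.
End QuasiR.

Section Psi.
Variables (K : fieldType) (q : K).
Hypothesis q0 : q != 0.
Hypothesis qnr : forall n, (0 < n)%N -> q ^+ n != q ^- n.
Variable bar : {rmorphism K -> K}.
Hypothesis barq : bar q = q^-1.
Variables (k : nat) (e : 'I_k -> nat).
Implicit Types (u : 'I_k -> nat) (s t : 'I_k) (z : gtens K e).
Local Notation qn := (qn q).
Local Notation gE := (gE q).
Local Notation gf := (gf q).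
Local Notation gk := (gk q).
Local Notation gki := (gki q).
Local Notation gF := (gF q).

Definition gsigma z : gtens K e := [ffun a => bar (z a)].
Definition gTheta s z : gtens K e :=
  \sum_(n < (e s).+1) cth q n *: iter n (gF s) (iter n (gE s) z).
(** Recursion on the number m of treated factors, so that commutation can be proved for all prefixes
    by induction; [insub] turns m' < k into an index. *)
Fixpoint gPsi m z : gtens K e :=
  if m is m'.+1 then
    if insub m' is Some s then gTheta s (gPsi m' z) else gPsi m' z
  else gsigma z.

Lemma cf_gsigma u z : cf u (gsigma z) = bar (cf u z).
Proof. by rewrite /cf; case: ifP; rewrite ?ffunE ?rmorph0. Qed.

Lemma gPsiS s z : gPsi s.+1 z = gTheta s (gPsi s z).
Proof. by rewrite /= valK. Qed.

Lemma gTheta_linear s : linear (gTheta s).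
Proof.
move=> c x y; rewrite scaler_sumr -big_split; apply: eq_bigr => n _ /=.
by rewrite !(iter_linD, iter_linZ) scalerDr !scalerA (mulrC c).
Qed.
HB.instance Definition _ s :=
  GRing.isLinear.Build K (gtens K e) (gtens K e) _ (gTheta s) (gTheta_linear s).

Lemma gPsiD m x y : gPsi m (x + y) = gPsi m x + gPsi m y.
Proof.
elim: m => [|m IH] /=; first by apply: gext => u _; rewrite !(cf_gsigma, cfD) rmorphD.
by case: insub => [s|//]; rewrite IH linearD.
Qed.

Lemma gPsiZ m c x : gPsi m (c *: x) = bar c *: gPsi m x.
Proof.
elim: m => [|m IH] /=; first by apply: gext => u _; rewrite !(cf_gsigma, cfZ) rmorphM.
by case: insub => [s|//]; rewrite IH linearZ.
Qed.

Lemma gPsiB m x y : gPsi m (x - y) = gPsi m x - gPsi m y.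
Proof. by rewrite -scaleN1r gPsiD gPsiZ rmorphN1 scaleN1r. Qed.

Lemma bar_qn n : bar (qn n) = qn n.
Proof.
rewrite /Submission.qn fmorph_div !rmorphB !fmorphV !rmorphXn /= barq !exprVn !invrK.
by rewrite -[X in _ / X]opprB -[X in X / _]opprB invrN mulrNN.
Qed.

Lemma bar_qz (n : int) : bar (q ^ n) = q ^ (- n).
Proof. by rewrite rmorphXz ?unitfE // barq exprz_inv. Qed.

Lemma gTheta_comm (op : {linear gtens K e -> gtens K e}) s z :
  (forall z, op (gE s z) = gE s (op z)) -> (forall z, op (gF s z) = gF s (op z)) ->
  op (gTheta s z) = gTheta s (op z).
Proof.
move=> hE hF; rewrite linear_sum; apply: eq_bigr => n _.
by rewrite linearZ /= (iter_comm _ _ hF) (iter_comm _ _ hE).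
Qed.

Section Commute.
Variables (op op' : {linear gtens K e -> gtens K e}).
Lemma gPsi_comm m z :
  (forall z, gsigma (op z) = op' (gsigma z)) ->
  (forall s z, (s < m)%N -> op' (gE s z) = gE s (op' z)) ->
  (forall s z, (s < m)%N -> op' (gF s z) = gF s (op' z)) ->
  gPsi m (op z) = op' (gPsi m z).
Proof.
move=> hs hE hF; elim: m hE hF => [|m IH] hE hF /=; first exact: hs.
have {}IH : gPsi m (op z) = op' (gPsi m z).
  by apply: IH => s y sm; [apply: hE|apply: hF]; apply: ltnW.
case: insubP => [s _ es|//]; rewrite IH -(@gTheta_comm op') // => y.
  by apply: hE; rewrite es.
by apply: hF; rewrite es.
Qed.
End Commute.

Lemma gPsi_gf m s z : (m <= s)%N -> gPsi m (gf s z) = gf s (gPsi m z).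
Proof.
move=> ms; apply: gPsi_comm => [y|t y tm|t y tm].
- by apply: gext => u _; rewrite !(cf_gsigma, cf_gf) rmorphM rmorph_nat rmorphM bar_qn.
- by rewrite gE_gf //; apply: contraTneq (leq_trans tm ms) => ->; rewrite ltnn.
- by apply: gf_gF => //; apply: leq_trans ms; apply: ltnW.
Qed.

Lemma gE_gk s t z : s != t -> gE s (gk t z) = gk t (gE s z).
Proof. by move=> st; apply: gext => u _; rewrite !(cf_gE, cf_gk) /hw upN 1?eq_sym //; ring. Qed.

Lemma gPsi_gki m s z : (m <= s)%N -> gPsi m (gki s z) = gk s (gPsi m z).
Proof.
move=> ms; apply: gPsi_comm => [y|t y tm|t y tm].
- by apply: gext => u _; rewrite !(cf_gsigma, cf_gk, cf_gki) !rmorphM /= bar_qz opprK.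
- by rewrite gE_gk //; apply: contraTneq (leq_trans tm ms) => ->; rewrite ltnn.
- by apply: gk_gF => //; apply: leq_trans ms; apply: ltnW.
Qed.

Lemma iter_gE s n z u : (e s < u s + n)%N -> cf u (iter n (gE s) z) = 0.
Proof.
elim: n u => [|n IH] u h /=; first by rewrite (cf_out1 (s := s)) // -[u s]addn0.
by rewrite cf_gE IH ?mulr0 // upE addSnnS.
Qed.

(** Induction by [gFS]: the bar map turns K^-1 on the last factor into K, and Theta turns it back by
    [thp_comm]. *)
Lemma gPsi_gF m z : (m <= k)%N -> gPsi m (gF m z) = gF m (gPsi m z).
Proof.
elim: m z => [|m IH] z mk.
  have g0 y : gF 0 y = 0 by rewrite /Submission.gF big_pred0.
  by rewrite !g0 -[0 in LHS](scale0r z) gPsiZ rmorph0 scale0r.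
pose s := Ordinal mk.
have ES y : gPsi m.+1 y = gTheta s (gPsi m y) by exact: (gPsiS s).
rewrite !ES -[m.+1]/(s.+1) !gFS // gPsiD IH ?(ltnW mk) // gPsi_gki // gPsi_gf //.
apply: (@thp_comm _ q q0 qnr _ (gF s) (gE s) (gf s) (gk s) (gki s)) => y.
- exact: gk_gE.
- exact: gki_gE.
- by rewrite -[LHS](subrK (gf s (gE s y))) addrC gE_gf_comm.
- exact: gE_gF.
- exact: gf_gF.
- exact: gki_gF.
- by apply: gext => u _; rewrite iter_gE ?cf0 // addnS ltnS leq_addl.
Qed.

(* The change of basis underlying [gPsi] is unitriangular for this degree. *)
Definition deg u : nat := \sum_(s < k) s * u s.

Lemma deg_up u s : deg (up u s) = (deg u + s)%N.
Proof.
rewrite /deg (bigD1 s) //= [in RHS](bigD1 s) //= upE mulnS.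
by rewrite (eq_bigr (fun t : 'I_k => t * u t)%N) => [|t ts]; [lia|rewrite upN].
Qed.

(** Vanishing in all degrees from D - N on, written without subtraction. E on factor s lowers the
    degree by s and F on an earlier factor t raises it by t < s, so each pair loses at least one
    degree. *)
Definition van N D z := forall u, (D <= deg u + N)%N -> cf u z = 0.

Lemma van_gE s N D z : van N D z -> van (N + s) D (gE s z).
Proof. by move=> h u hu; rewrite cf_gE h ?mulr0 // deg_up -addnA (addnC s). Qed.

Lemma van_gF s N D z : van (N + s) D z -> van N.+1 D (gF s z).
Proof.
move=> h u hu; rewrite cf_gF big1 // => t ts; rewrite cf_gf.
have [->|ut] := posnP (u t); first by rewrite qn0 mul0r !mulr0.
rewrite h ?mulr0 //; move: (deg_up (dn u t) t); rewrite dnK // => e1.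
by move: hu; rewrite e1; move: ts; clear; lia.
Qed.

Lemma van_FE s n D z : van 0 D z -> van n D (iter n (gF s) (iter n (gE s) z)).
Proof.
move=> h; have {}h : van (n * s) D (iter n (gE s) z).
  elim: n => [|n IH] //=; rewrite mulSn addnC; exact: van_gE.
suff H j y : (j <= n)%N -> van (n * s) D y -> van (j + (n - j) * s) D (iter j (gF s) y).
  by move: (H n _ (leqnn n) h); rewrite subnn mul0n addn0.
elim: j => [|j IH] jn hy; first by rewrite subn0.
rewrite iterS addSn; apply: van_gF.
have {IH} := IH (ltnW jn) hy; congr (van _ _ _).
by rewrite -addnA -mulSnr; congr (_ + _ * _)%N; lia.
Qed.

(** By [van_FE] all terms of Theta except the identity lower the degree, so in the top degree Psi is
    just [bar]. *)
Lemma gPsi_van m D z : van 0 D.+1 z ->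
  van 0 D.+1 (gPsi m z) /\ forall u, deg u = D -> cf u (gPsi m z) = bar (cf u z).
Proof.
move=> h; elim: m => [|m [IH1 IH2]] /=.
  by split=> [u hu|u _]; rewrite cf_gsigma // h // rmorph0.
case: insubP => [s _ es|_]; last by split.
have key u : (D <= deg u)%N -> cf u (gTheta s (gPsi m z)) = cf u (gPsi m z).
  move=> hu; rewrite cf_sum big_ord_recl /= big1 ?addr0 => [|i _].
    by rewrite cfZ /cth expr0 bin0n expr0 /qf big_geq // !invr1 !mulr1 mul1r.
  have vf := @van_FE s (lift ord0 i) D.+1 _ IH1.
  by rewrite cfZ (vf u) ?mulr0 //= -addn1; apply: leq_add.
split=> [u hu|u hu]; last by rewrite key ?hu ?IH2.
by rewrite key ?IH1 //; move: hu; rewrite addn0; apply: ltnW.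
Qed.

(** Descending induction on the degree: once the higher degrees vanish, the coordinates of the
    current one are fixed by [bar] and lie in I. With I the ideal q^-1 Z[q^-1] this gives uniqueness
    of canonical basis elements. *)
Lemma gPsi_fixed_eq0 m (I : K -> Prop) z : (forall x, I x -> bar x = x -> x = 0) ->
  gPsi m z = z -> (forall u, inr e u -> I (cf u z)) -> z = 0.
Proof.
move=> hI fz Iz; apply: gext => u ur; rewrite cf0.
suff H n : van 0 ((deg e).+1 - n) z by apply: (H (deg e).+1); rewrite subnn.
elim: n => [|n IH] v.
  rewrite subn0 addn0 ltnNge => h; apply: cf_out; apply: contra h => /inrP h.
  by apply: leq_sum => t _; rewrite leq_mul.
have [hn|hn] := leqP (deg e).+1 n.
  by move=> _; apply: IH; rewrite (eqP (_ : _ - n == 0)%N) // subn_eq0.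
have en : ((deg e).+1 - n = ((deg e).+1 - n.+1).+1)%N by lia.
rewrite addn0 leq_eqVlt => /orP[/eqP dv|dv]; last by apply: IH; rewrite addn0 en.
move: IH; rewrite en => /(gPsi_van m)[_ /(_ v (esym dv))]; rewrite fz => /esym bv.
case: (boolP (inr e v)) => [/Iz/hI->//|]; exact: cf_out.
Qed.

Definition lev u : nat := \sum_s u s.
(** The projection to a weight space. It commutes with [gPsi], so a fixed vector can be examined one
    weight at a time. *)
Definition pr n z : gtens K e := mk e (fun u => if lev u == n then cf u z else 0).

Lemma cf_pr u n z : cf u (pr n z) = if lev u == n then cf u z else 0.
Proof. by rewrite cf_mk; case: ifP => // /negbT h; rewrite cf_out ?if_same. Qed.

Lemma lev_up u s : lev (up u s) = (lev u).+1.
Proof.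
rewrite /lev (bigD1 s) //= [in RHS](bigD1 s) //= upE addSn.
by rewrite (eq_bigr u) // => t ts; rewrite upN.
Qed.

Lemma pr_gE n s z : pr n (gE s z) = gE s (pr n.+1 z).
Proof.
by apply: gext => u _; rewrite !(cf_pr, cf_gE) lev_up eqSS; case: ifP; rewrite ?mulr0.
Qed.

Lemma pr_gF n m z : pr n.+1 (gF m z) = gF m (pr n z).
Proof.
apply: gext => u _; rewrite !(cf_pr, cf_gF).
have lu t : (0 < u t)%N -> (lev u == n.+1) = (lev (dn u t) == n).
  by move=> ut; rewrite -[in LHS](dnK ut) lev_up eqSS.
case: ifP => lun; last symmetry; [apply: eq_bigr => t tm|apply: big1 => t tm];
  rewrite !cf_gf cf_pr; (have [->|ut] := posnP (u t); first by rewrite qn0 !mul0r ?mulr0);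
  by rewrite -lu // lun ?mulr0.
Qed.

Lemma pr_gPsi m n z : pr n (gPsi m z) = gPsi m (pr n z).
Proof.
elim: m => [|m IH] /=.
  by apply: gext => u _; rewrite !(cf_pr, cf_gsigma); case: ifP; rewrite ?rmorph0.
case: insubP => [s _ es|//]; rewrite -IH; move: (gPsi m z) => y.
have prD x y' : pr n (x + y') = pr n x + pr n y'.
  by apply: gext => u _; rewrite !(cf_pr, cfD); case: ifP; rewrite ?addr0.
have prZ c x : pr n (c *: x) = c *: pr n x.
  by apply: gext => u _; rewrite !(cf_pr, cfZ); case: ifP; rewrite ?mulr0.
have pr0 : pr n 0 = 0 by apply: gext => u _; rewrite !(cf_pr, cf0) if_same.
rewrite /gTheta (big_morph _ prD pr0); apply: eq_bigr => i _; rewrite prZ; congr (_ *: _).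
have prE j x n' : pr n' (iter j (gE s) x) = iter j (gE s) (pr (n' + j)%N x).
  elim: j n' => [|j IHj] n'; first by rewrite addn0.
  by rewrite !iterS pr_gE IHj addSnnS.
have prF j x n' : pr (n' + j)%N (iter j (gF s) x) = iter j (gF s) (pr n' x).
  by elim: j => [|j IHj]; rewrite ?addn0 // addnS !iterS pr_gF IHj.
have [ni|ni] := leqP i n.
  by rewrite -{1}(subnK ni) prF prE subnK.
(* For i > n both sides vanish: F^i has no component in level n, and E^i kills level n. *)
have prF0 j x n' : (n' < j)%N -> pr n' (iter j (gF s) x) = 0.
  elim: j n' => // j IHj n'; rewrite ltnS iterS.
  case: n' => [|n'] nj; last by rewrite pr_gF IHj // linear0.
  apply: gext => u _; rewrite cf_pr cf0; case: eqP => // lu0.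
  rewrite cf_gF big1 // => t _; rewrite cf_gf (_ : u t = 0%N) ?qn0 ?mul0r ?mulr0 //.
  by apply/eqP; rewrite -leqn0 -lu0 /lev (bigD1 t) //= leq_addr.
have prE0 j x n' : (n' < j)%N -> iter j (gE s) (pr n' x) = 0.
  elim: j n' x => // j IHj [|n'] x; rewrite ltnS iterSr => nj.
    rewrite (_ : gE s _ = 0) ?iter_lin0 //; apply: gext => u _.
    by rewrite cf_gE cf_pr lev_up cf0 mulr0.
  by rewrite -pr_gE IHj.
by rewrite prF0 // prE0 // iter_lin0.
Qed.

End Psi.

End QuasiRMatrix.

(** * Contraction of one arc *)

Section ArcContraction.

Section Arc.
Variables (K : fieldType) (q : K).
Hypothesis q0 : q != 0.
Hypothesis qnr : forall n, (0 < n)%N -> q ^+ n != q ^- n.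
Variables (k : nat) (e e' : 'I_k -> nat) (i j : 'I_k).
Hypothesis ij : (i < j)%N.
Hypothesis ei : e i = (e' i).+1.
Hypothesis ej : e j = (e' j).+1.
Hypothesis et : forall t, t != i -> t != j -> e t = e' t.
Hypothesis mid : forall t : 'I_k, (i < t < j)%N -> e t = 0%N.
Implicit Types (a u : 'I_k -> nat) (s t : 'I_k) (z : gtens K e).
Local Notation qn := (qn q).

(** The weight of an up ending box i joined to a down starting box j: q^-1 from [eps], and q^-1 for
    each inversion with the [a i] downs before and the [e' j - a j] ups after. The other orientation
    creates no inversion and has weight 1. *)
Definition carc a : K := q ^ (- ((a i)%:Z + (e' j)%:Z + 1 - (a j)%:Z)).

(* Contraction with [eps] of the last vertex of box [i] with the first one of box [j]. *)
Definition El z : gtens K e' :=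
  mk e' (fun a => cf (up a i) z - carc a * cf (up a j) z).

Let nij : i != j.
Proof. by rewrite neq_ltn ij. Qed.

Lemma inr_arc a s : (s == i) || (s == j) ->
  (a i <= e' i)%N -> (a j <= e' j)%N -> inr e (up a s) -> inr e' a.
Proof.
move=> hs ai aj /inrP h; apply/inrP => t.
have [->//|ti] := eqVneq t i; have [->//|tj] := eqVneq t j.
rewrite -et //; apply: leq_trans (h t); exact: leq_addr.
Qed.

Lemma cf_El a z : (a i <= e' i)%N -> (a j <= e' j)%N ->
  cf a (El z) = cf (up a i) z - carc a * cf (up a j) z.
Proof.
move=> ai aj; rewrite cf_mk; case: ifP => // /negbT h.
by rewrite !cf_out ?mulr0 ?subr0 //; apply: contra h; apply: inr_arc;
  rewrite ?eqxx ?orbT.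
Qed.

Lemma El_linear : linear El.
Proof.
move=> c x y; apply: gext => u /inrP h.
by rewrite !(cfD, cfZ) !cf_El // !(cfD, cfZ); ring.
Qed.
HB.instance Definition _ :=
  GRing.isLinear.Build K (gtens K e) (gtens K e') _ El El_linear.

Lemma hw_arc a t : hw e a t = hw e' a t + (t == i)%:Z + (t == j)%:Z.
Proof.
rewrite /hw; case: (eqVneq t i) => [->|ti]; first by rewrite ei (negPf nij); lia.
case: (eqVneq t j) => [->|tj]; first by rewrite ej; lia.
by rewrite et //; lia.
Qed.

Lemma sum_hw_arc (P : pred 'I_k) a :
  \sum_(t | P t) hw e a t = \sum_(t | P t) hw e' a t + (P i)%:Z + (P j)%:Z.
Proof.
rewrite (eq_bigr _ (fun t _ => hw_arc a t)) !big_split /=.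
have H x : \sum_(t | P t) (t == x)%:Z = (P x)%:Z.
  case: (boolP (P x)) => Px.
    by rewrite (bigD1 x) //= eqxx big1 ?addr0 // => t /andP[_ /negPf->].
  by rewrite big1 // => t Pt; case: eqP Px => // <-; rewrite Pt.
by rewrite !H.
Qed.

Lemma sum_hw_arci (P : pred 'I_k) a :
  \sum_(t | P t) hw e (up a i) t = \sum_(t | P t) hw e' a t - (P i)%:Z + (P j)%:Z.
Proof. by rewrite sum_hw_up sum_hw_arc; ring. Qed.

Lemma sum_hw_arcj (P : pred 'I_k) a :
  \sum_(t | P t) hw e (up a j) t = \sum_(t | P t) hw e' a t + (P i)%:Z - (P j)%:Z.
Proof. by rewrite sum_hw_up sum_hw_arc; ring. Qed.

Lemma carc_upi a : carc (up a i) = carc a * q^-1.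
Proof.
rewrite /carc upE upN 1?eq_sym // -[q^-1]exprN1 -expfzDr //; congr (_ ^ _); lia.
Qed.

Lemma carc_upj a : carc (up a j) = carc a * q.
Proof. by rewrite /carc upE upN // -{3}[q]expr1z -expfzDr //; congr (_ ^ _); lia. Qed.

Lemma carc_up a s : s != i -> s != j -> carc (up a s) = carc a.
Proof. by move=> si sj; rewrite /carc !upN // eq_sym. Qed.

Lemma carcE a : (a j <= e' j)%N -> carc a = q ^- (a i + (e' j - a j)).+1.
Proof.
move=> h; rewrite /carc exprnN; congr (q ^ (- _)); lia.
Qed.

Lemma mid' a t : inr e' a -> (i < t < j)%N -> a t = 0%N /\ hw e' a t = 0.
Proof.
move=> /inrP/(_ t) h tm; have e0 : e' t = 0%N.
  by rewrite -et ?mid //; apply: contraTneq tm => ->; rewrite ltnn ?andbF.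
by move: h; rewrite e0 leqn0 => /eqP a0; rewrite /hw e0 a0.
Qed.

Lemma big_ij (F : 'I_k -> K) (P : pred 'I_k) : P i -> P j ->
  \sum_(s | P s) F s = F i + F j + \sum_(s | P s && (s != i) && (s != j)) F s.
Proof.
move=> Pi Pj; rewrite (bigD1 i) //= (bigD1 j) ?Pj 1?eq_sym //= addrA.
by [].
Qed.

Lemma El_gEt z : El (gEt q z) = gEt q (El z).
Proof.
apply: gext => a ar; have /inrP h := ar.
rewrite cf_El // !cf_gEt mulr_sumr -sumrB !(@big_ij _ xpredT) //=; congr (_ + _); last first.
  apply: eq_bigr => s /andP[si sj]; rewrite !cf_gE.
  have [sm|sm] := boolP (i < s < j)%N.
    have e0 := mid sm; have e0' : e' s = 0%N by rewrite -et.
    by rewrite e0 e0' !sub0n !qn0 !mul0r !mulr0 subrr.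
  (* Boxes between i and j are copies of V_0, so any other s sees both ends of the arc or neither;
     the weights +1 and -1 of the two ends then cancel. *)
  have Pij : (i < s)%N = (j < s)%N.
    have vi : val s != val i by []; have vj : val s != val j by [].
    by move: vi vj sm ij => /=; clear; lia.
  rewrite /wE sum_hw_arci sum_hw_arcj -Pij subrK addrK !upN // et //.
  have [as'|as'] := eqVneq (a s) (e' s); first by rewrite as' subnn qn0 !mul0r !mulr0 subrr.
  rewrite cf_El; [|by rewrite upN 1?eq_sym ..].
  by rewrite carc_up // ![up (up a s) _]upC; ring.
rewrite !cf_gE.
(* The boxes strictly between have weight 0, so only box i separates the two exponents. *)
have wij : wE e' a j = wE e' a i + hw e' a i.
  rewrite /wE [LHS](bigID (fun t : 'I_k => t < i)%N) /=; congr (_ + _).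
    by apply: eq_bigl => t; apply/andP/idP => [[]//|h1]; split=> //; apply: ltn_trans ij.
  rewrite (bigD1 i) /= ?ij ?ltnn // big1 ?addr0 // => t /andP[/andP[tj ti] tni].
  by have [] := @mid' a t ar _; rewrite // tj andbT ltn_neqAle eq_sym tni leqNgt ti.
have Ei : qn (e' i - a i) * cf (up a i) (El z) = qn (e' i - a i) *
   (cf (up (up a i) i) z - carc a * q^-1 * cf (up (up a i) j) z).
  have [as'|as'] := eqVneq (a i) (e' i); first by rewrite as' subnn qn0 !mul0r.
  rewrite cf_El ?carc_upi //; last by rewrite upN // eq_sym.
  by rewrite upE ltn_neqAle as' h.
have Ej : qn (e' j - a j) * cf (up a j) (El z) = qn (e' j - a j) *
   (cf (up (up a j) i) z - carc a * q * cf (up (up a j) j) z).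
  have [as'|as'] := eqVneq (a j) (e' j); first by rewrite as' subnn qn0 !mul0r.
  rewrite cf_El ?carc_upj //; first by rewrite upN.
  by rewrite upE ltn_neqAle as' h.
rewrite Ei Ej !upE !(upN _ nij) !(@upN _ _ _ j) 1?eq_sym // [up (up a j) i]upC ei ej !subSS wij.
rewrite /wE !sum_hw_arci !sum_hw_arcj !ltnn ij [(j < i)%N]ltnNge (ltnW ij) /=.
rewrite -!/(wE e' a _) wij carcE //.
move: (wE e' a i) => W.
have [x ex] : exists x, e' i = (x + a i)%N by exists (e' i - a i)%N; rewrite subnK.
have [y ey] : exists y, e' j = (y + a j)%N by exists (e' j - a j)%N; rewrite subnK.
rewrite !subSn ?h // ex ey !addnK /hw ex PoszD /Submission.qn.
rewrite !(expfzDr, exprSr, exprD, mulr2n, opprD) // !exprnN -!exprnP.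
rewrite -!invr_expz -!exprnP !expr0 !expr1.
have := (expf_neq0 x q0, expf_neq0 y q0, expf_neq0 (a i) q0).
move: (q ^+ x) (q ^+ y) (q ^+ a i) (q ^ W) => X Y A B [[X0 Y0] A0].
by field; rewrite q0 X0 Y0 A0 qq1_neq0.
Qed.

Lemma El_gF m z : (j < m)%N -> El (gF q m z) = gF q m (El z).
Proof.
move=> jm; have im := ltn_trans ij jm; apply: gext => a ar; have /inrP h := ar.
rewrite cf_El // !cf_gF mulr_sumr -sumrB !(@big_ij _ (fun s : 'I_k => s < m)%N) //=.
congr (_ + _); last first.
  apply: eq_bigr => s /andP[/andP[sm' si] sj]; rewrite !cf_gf.
  have [sm|sm] := boolP (i < s < j)%N.
    have [as0 _] := mid' ar sm.
    by rewrite !upN // as0 !qn0 !mul0r !mulr0 subrr.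
  have Pij : (s < i < m)%N = (s < j < m)%N.
    have vi : val s != val i by []; have vj : val s != val j by [].
    by move: vi vj sm ij im jm => /=; clear; lia.
  rewrite /wF sum_hw_arci sum_hw_arcj -Pij subrK addrK !upN // et //.
  have [as'|as'] := posnP (a s); first by rewrite as' qn0 !mul0r !mulr0 subrr.
  rewrite cf_El; [|by rewrite dnN 1?eq_sym ..].
  have -> : carc a = carc (dn a s) by rewrite -[in LHS](dnK as') carc_up.
  by rewrite -!up_dn 1?eq_sym //; ring.
rewrite !cf_gf.
have wij : wF e' a i m = wF e' a j m + hw e' a j.
  rewrite /wF [LHS](bigID (fun t : 'I_k => j < t)%N) /=; congr (_ + _).
    apply: eq_bigl => t; apply/andP/andP => [[/andP[]]//|[h1 h2]].
    by rewrite h1 h2 (ltn_trans ij).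
  rewrite (bigD1 j) /= ?ij ?jm ?ltnn // big1 ?addr0 // => t /andP[/andP[/andP[ti tm] tj] tnj].
  by have [] := @mid' a t ar _; rewrite // ti ltn_neqAle tnj leqNgt tj.
have Ei : qn (a i) * cf (dn a i) (El z) = qn (a i) *
   (cf a z - carc a * q * cf (up (dn a i) j) z).
  have [as'|as'] := posnP (a i); first by rewrite as' qn0 !mul0r.
  rewrite cf_El; last 2 first.
  - by rewrite dnE; apply: leq_trans (h i); apply: leq_pred.
  - by rewrite dnN // eq_sym.
  have -> : carc a = carc (dn a i) * q^-1 by rewrite -carc_upi dnK.
  by rewrite divfK // dnK.
have Ej : qn (a j) * cf (dn a j) (El z) = qn (a j) *
   (cf (up (dn a j) i) z - carc a * q^-1 * cf a z).
  have [as'|as'] := posnP (a j); first by rewrite as' qn0 !mul0r.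
  rewrite cf_El; last 2 first.
  - by rewrite dnN.
  - by rewrite dnE; apply: leq_trans (h j); apply: leq_pred.
  have -> : carc a = carc (dn a j) * q by rewrite -carc_upj dnK.
  by rewrite mulfK // dnK.
rewrite !h !mul1r Ei Ej !upE !(upN _ nij) !(@upN _ _ _ j) 1?eq_sym // ei ej !ltnS !h.
rewrite !upK !(leq_trans (h _) (leqnSn _)) !mul1r -!up_dn // 1?eq_sym //.
rewrite /wF !sum_hw_arci !sum_hw_arcj !ltnn ij im jm [(j < i)%N]ltnNge (ltnW ij) /=.
rewrite -!/(wF e' a _ m) wij carcE //.
move: (wF e' a j m) => W.
have [y ey] : exists y, e' j = (y + a j)%N by exists (e' j - a j)%N; rewrite subnK.
rewrite ey !addnK /hw ey PoszD /Submission.qn.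
rewrite !(expfzDr, exprSr, exprD, mulr2n, opprD, opprK, opprB) // !exprnN -!exprnP.
rewrite -!invr_expz -!exprnP !expr0 !expr1.
have := (expf_neq0 (a j) q0, expf_neq0 y q0, expf_neq0 (a i) q0).
have : q ^ W != 0 by rewrite expfz_neq0.
move: (q ^+ a j) (q ^+ y) (q ^+ a i) (q ^ W) => X Y A B B0 [[X0 Y0] A0].
by field; rewrite q0 X0 Y0 A0 B0 qq1_neq0.
Qed.

Lemma El_gKt z : El (gKt q z) = gKt q (El z).
Proof.
apply: gext => a /inrP h; rewrite cf_El // !cf_gKt cf_El //.
by rewrite sum_hw_arci sum_hw_arcj /= subrK addrK; ring.
Qed.

Lemma El_gKit z : El (gKit q z) = gKit q (El z).
Proof.
apply: gext => a /inrP h; rewrite cf_El // !cf_gKit cf_El //.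
by rewrite sum_hw_arci sum_hw_arcj /= subrK addrK; ring.
Qed.

Lemma El_gE s z : s != i -> s != j -> El (gE q s z) = gE q s (El z).
Proof.
move=> si sj; apply: gext => a /inrP h; rewrite cf_El // !cf_gE !upN // et //.
have [as'|as'] := eqVneq (a s) (e' s); first by rewrite as' subnn qn0 !mul0r !mulr0 subrr.
rewrite cf_El; [|by rewrite upN 1?eq_sym ..].
by rewrite carc_up // ![up (up a s) _]upC; ring.
Qed.

Variable bar : {rmorphism K -> K}.
Hypothesis barq : bar q = q^-1.

(* On vectors with [u_j = 0] the contraction is the shift in box [i], which commutes
   with [E_i]; such vectors generate the first [j] factors under [F]. *)
Definition El0 z : gtens K e' := mk e' (fun a => if a j == 0%N then cf (up a i) z else 0).

Lemma cf_El0 a z : (a i <= e' i)%N ->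
  cf a (El0 z) = if a j == 0%N then cf (up a i) z else 0.
Proof.
move=> ai; rewrite cf_mk; case: ifP => // /negbT h; case: eqP => // aj.
rewrite cf_out //; apply: contra h; apply: inr_arc; rewrite ?eqxx // aj //.
Qed.

Lemma El0_linear : linear El0.
Proof.
move=> c x y; apply: gext => u /inrP h.
by rewrite !(cfD, cfZ) !cf_El0 // !(cfD, cfZ); case: ifP => _; rewrite ?mulr0 ?addr0.
Qed.
HB.instance Definition _ :=
  GRing.isLinear.Build K (gtens K e) (gtens K e') _ El0 El0_linear.

Definition jzero (f : 'I_k -> nat) (z : gtens K f) := forall u, (0 < u j)%N -> cf u z = 0.

Lemma El_jzero z : jzero z -> El z = El0 z.
Proof.
move=> h; apply: gext => a /inrP ar; rewrite cf_El // cf_El0 // (h (up a j)) ?upE //.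
rewrite mulr0 subr0; case: posnP => // aj; rewrite h //.
by rewrite upN // eq_sym.
Qed.

Lemma jzero_El0 z : jzero (El0 z).
Proof.
move=> u uj; rewrite cf_mk; case: ifP => // _; by rewrite eqn0Ngt uj.
Qed.

Lemma jzero_gE (f : 'I_k -> nat) s (z : gtens K f) : s != j -> jzero z -> jzero (gE q s z).
Proof. by move=> sj h u uj; rewrite cf_gE h ?mulr0 // upN // eq_sym. Qed.

Lemma jzero_gF (f : 'I_k -> nat) m (z : gtens K f) : (m <= j)%N -> jzero z -> jzero (gF q m z).
Proof.
move=> mj h u uj; rewrite cf_gF big1 // => t tm; rewrite cf_gf h ?mulr0 // dnN //.
by apply: contraTneq (leq_trans tm mj) => <-; rewrite ltnn.
Qed.

Lemma jzero_gPsi (f : 'I_k -> nat) m (z : gtens K f) :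
  (m <= j)%N -> jzero z -> jzero (gPsi q bar m z).
Proof.
elim: m => [_ h u uj|m IH mj h] /=; first by rewrite cf_gsigma h // rmorph0.
have {}IH := IH (ltnW mj) h; case: insubP => [s _ es|//] u uj.
have sj : s != j by apply: contraTneq mj => <-; rewrite es ltnn.
rewrite cf_sum big1 // => n _; rewrite cfZ.
have h1 : jzero (iter n (gE q s) (gPsi q bar m z)).
  by elim: (n : nat) => //= l; apply: jzero_gE.
have h2 : jzero (iter n (gF q s) (iter n (gE q s) (gPsi q bar m z))).
  suff H l : jzero (iter l (gF q s) (iter n (gE q s) (gPsi q bar m z))) by exact: H.
  by elim: l => //= l; apply: jzero_gF; rewrite es ltnW.
by rewrite h2 ?mulr0.
Qed.

Lemma gTheta1 (f : 'I_k -> nat) s (z : gtens K f) : gE q s z = 0 -> gTheta q s z = z.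
Proof.
move=> h; rewrite /gTheta big_ord_recl big1 ?addr0 => [|n _].
  by rewrite /= /cth expr0 bin0n expr0 /qf big_geq // !invr1 !mulr1 scale1r.
by rewrite lift0 [iter n.+1 (gE q s) z]iterSr h !iter_lin0 scaler0.
Qed.

Lemma gTheta_size0 (f : 'I_k -> nat) s (z : gtens K f) : f s = 0%N -> gTheta q s z = z.
Proof.
move=> h; apply: gTheta1; apply: gext => u _.
by rewrite cf_gE h sub0n qn0 mul0r cf0.
Qed.

Lemma gTheta_jzero (f : 'I_k -> nat) (z : gtens K f) : jzero z -> gTheta q j z = z.
Proof.
move=> h; apply: gTheta1; apply: gext => u _.
by rewrite cf_gE h ?mulr0 ?cf0 // upE.
Qed.

Lemma El0_gE s z : s != j -> El0 (gE q s z) = gE q s (El0 z).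
Proof.
move=> sj; apply: gext => a /inrP h; rewrite cf_El0 // !cf_gE.
have [as'|as'] := eqVneq (a s) (e' s).
  rewrite as' subnn qn0 mul0r; case: ifP => // _.
  have [si|si] := eqVneq s i; last by rewrite upN // et // as' subnn qn0 mul0r.
  by rewrite si upE ei subSS -si as' subnn qn0 mul0r.
rewrite cf_El0; last first.
  have [si|si] := eqVneq s i; last by rewrite upN // eq_sym.
  by rewrite -si upE ltn_neqAle as' h.
rewrite (@upN _ a s j) 1?eq_sym // upC; case: ifP; rewrite ?mulr0 // => _.
have [si|si] := eqVneq s i; last by rewrite upN // et.
by rewrite si upE ei subSS.
Qed.

Lemma El0_gF m z : (m <= i)%N -> El0 (gF q m z) = gF q m (El0 z).
Proof.
move=> mi; apply: gext => a /inrP h; rewrite cf_El0 // !cf_gF.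
have -> : (if a j == 0%N then \sum_(s < k | (s < m)%N) q ^ (- wF e (up a i) s m) * cf (up a i) (gf q s z)
   else 0) = \sum_(s < k | (s < m)%N) (if a j == 0%N then q ^ (- wF e (up a i) s m) * cf (up a i) (gf q s z) else 0).
  by case: ifP => // _; rewrite big1.
apply: eq_bigr => s sm; rewrite !cf_gf.
have si : s != i by apply: contraTneq (leq_trans sm mi) => ->; rewrite ltnn.
have sj : s != j by apply: contraTneq (leq_trans sm mi) => ->; rewrite -leqNgt ltnW.
rewrite /wF sum_hw_arci !upN // et //.
have [as'|as'] := posnP (a s); first by rewrite as' qn0 !mul0r !mulr0 if_same.
rewrite cf_El0; last by rewrite dnN // eq_sym.
rewrite dnN 1?eq_sym // -up_dn 1?eq_sym //.
rewrite [(i < m)%N]ltnNge [(j < m)%N]ltnNge mi (leq_trans mi (ltnW ij)) !andbF subr0 addr0.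
by case: ifP => // _; rewrite !mulr0.
Qed.

Lemma El0_gPsi m z : (m <= j)%N -> El0 (gPsi q bar m z) = gPsi q bar m (El0 z).
Proof.
elim: m => [_|m IH mj] /=.
  apply: gext => a /inrP h; rewrite cf_El0 // !cf_gsigma cf_El0 //.
  by case: ifP => // _; rewrite rmorph0.
case: insubP => [s _ es|_]; last exact/IH/ltnW.
rewrite -IH ?(ltnW mj) //; move: (gPsi q bar m z) => y.
have sj : s != j by apply: contraTneq mj => <-; rewrite es ltnn.
case: (leqP s i) => si; last first.
  have es0 : e s = 0%N by apply: mid; rewrite si es.
  rewrite !gTheta_size0 // -et //; by apply: contraTneq si => ->; rewrite ltnn.
have := iter_comm; rewrite /gTheta linear_sum => H.
have -> : e' s = if s == i then (e s).-1 else e s.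
  by case: eqP => [->|/eqP h]; rewrite ?ei // et.
rewrite (eq_bigr (fun n : 'I_(e s).+1 => cth q n *: iter n (gF q s) (iter n (gE q s) (El0 y)))); last first.
  move=> n _; rewrite linearZ /= (iter_comm _ _ (fun x => El0_gF x si)).
  by rewrite (iter_comm _ _ (fun x => El0_gE x sj)).
case: eqP => // -> {sj si es s}; rewrite ei big_ord_recr.
(* Factor i is shorter after the contraction, so Theta has one term fewer there; the extra one
   carries E^(e' i + 1), which is 0 on the shorter factor. *)
have -> : iter (@ord_max (e' i).+1) (gE q i) (El0 y) = 0.
  by apply: gext => u _; rewrite iter_gE ?cf0 // addnS ltnS leq_addl.
by rewrite iter_lin0 scaler0; exact: addr0.
Qed.

Lemma El_gPsi_jzero z : jzero z -> El (gPsi q bar j.+1 z) = gPsi q bar j.+1 (El z).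
Proof.
move=> h; rewrite !gPsiS (El_jzero h) -El0_gPsi //.
have h1 : jzero (gPsi q bar j z) by apply: jzero_gPsi.
by rewrite !gTheta_jzero ?El_jzero //; apply: jzero_El0.
Qed.

(** Induction on the largest value of u j. The part with u j = p + 1 is F y, up to terms with
    smaller u j, for a vector y living in u j = p; the division by [p+1] in y undoes the coefficient
    of F. *)
Lemma El_gPsi_j z : El (gPsi q bar j.+1 z) = gPsi q bar j.+1 (El z).
Proof.
have jk : (j.+1 <= k)%N by [].
suff H p x : (forall u, (p < u j)%N -> cf u x = 0) ->
   El (gPsi q bar j.+1 x) = gPsi q bar j.+1 (El x).
  by apply: (H (e j)) => u uj; exact: (cf_out1 _ uj).
elim: p x => [|p IH] x hx; first exact: El_gPsi_jzero.
pose y : gtens K e := mk e (fun u => if u j == p then cf (up u j) x / qn p.+1 else 0).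
have cy u : u j != p -> cf u y = 0 by rewrite cf_mk => /negPf ->; rewrite if_same.
have y1 : El (gPsi q bar j.+1 y) = gPsi q bar j.+1 (El y).
  by apply: IH => u pu; rewrite cy // neq_ltn pu orbT.
have y2 : El (gPsi q bar j.+1 (gF q j.+1 y)) = gPsi q bar j.+1 (El (gF q j.+1 y)).
  by rewrite gPsi_gF // El_gF // y1 -gPsi_gF // El_gF.
have y3 : El (gPsi q bar j.+1 (x - gF q j.+1 y)) = gPsi q bar j.+1 (El (x - gF q j.+1 y)).
  apply: IH => u pu; case: (boolP (inr e u)) => [ur|]; last exact: cf_out.
  have uj0 : (0 < u j)%N by apply: leq_ltn_trans pu.
  rewrite cfB gFS // cfD cf_gF big1 ?add0r => [|t tj]; last first.
    rewrite cf_gf cf_gki cy ?mulr0 // dnN ?neq_ltn ?pu ?orbT //.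
    by rewrite tj orbT.
  have /inrP/(_ j) uj := ur; rewrite cf_gf uj mul1r.
  have [up1|up1] := eqVneq (u j) p.+1; last first.
    rewrite hx; last by rewrite ltn_neqAle eq_sym up1.
    rewrite cy ?mulr0 ?subr0 // dnE; apply: contraNneq up1 => <-.
    by rewrite prednK.
  rewrite cf_mk inr_dn // dnE up1 eqxx dnK //.
  by rewrite mulrC divfK ?subrr // qn_neq0.
have ED x1 x2 : El (x1 + x2) = El x1 + El x2 by exact: linearD.
by rewrite -[x](subrK (gF q j.+1 y)) gPsiD !ED gPsiD y2 y3 ED.
Qed.

Lemma El_gPsi m z : (j < m)%N -> El (gPsi q bar m z) = gPsi q bar m (El z).
Proof.
elim: m => // m IH; rewrite ltnS leq_eqVlt => /orP[/eqP <-|jm]; first exact: El_gPsi_j.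
rewrite /=; case: insubP => [s _ es|_]; last exact: IH.
rewrite -IH //; move: (gPsi q bar m z) => y.
have sj : s != j by apply: contraTneq jm => <-; rewrite es ltnn.
have si : s != i by apply: contraTneq (ltn_trans ij jm) => <-; rewrite es ltnn.
rewrite /gTheta linear_sum -et //; apply: eq_bigr => n _; rewrite linearZ /=.
have js : (j < s)%N by rewrite es.
rewrite (iter_comm _ _ (fun x => El_gF x js)) (iter_comm _ _ (fun x => El_gE x si sj)) //.
Qed.

End Arc.

End ArcContraction.

(** * Generators and Psi of the tensor product *)

Section DefinitionsInCoordinates.

Section Bridge.
Variable R : realType.
Local Notation K := (Cq R).
Local Notation q := (@q R).

Lemma q_regular n : (0 < n)%N -> q ^+ n != q ^- n.
Proof.
move=> n0; apply/negP => /eqP/(congr1 ( *%R^~ (q ^+ n))).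
rewrite mulVf ?expf_neq0 ?q_neq0 // -exprD /Defs.q -rmorphXn -(rmorph1 (@FracField.tofrac _)).
move=> /tofrac_inj/(congr1 (fun p : {poly _} => size p)).
by rewrite size_polyXn size_poly1; case: n n0.
Qed.

Let q0 := q_neq0 R.
Let qnr := q_regular.

Definition barM : {rmorphism K -> K} := @bar R.

Variables (k : nat) (e : 'I_k -> nat).
Implicit Types (z : tens R e) (u : 'I_k -> nat) (s t : 'I_k).

Lemma cf_tensop (M : forall i, 'M[K]_((e i).+1)) z u (c : idx e) : inr e u ->
  (forall i b, b != c i -> M i (mki e u i) b = 0) ->
  cf u (tensop M z : gtens K e) = (\prod_i M i (mki e u i) (c i)) * z c.
Proof.
move=> ur h; rewrite /cf ur ffunE (bigD1 c) //= [X in _ + X]big1 ?addr0 // => u' u'c.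
suff [i hi] : exists i, u' i != c i by rewrite (bigD1 i) //= h // !mul0r.
by apply/existsP; rewrite -negb_forall; apply: contra u'c => /forallP h'; apply/eqP/ffunP => i; apply/eqP/h'.
Qed.

Lemma mkiE u i : inr e u -> mki e u i = u i :> nat.
Proof. by move=> /inrP h; rewrite ffunE inordK // ltnS. Qed.

Lemma prod_q (P : pred 'I_k) (h : 'I_k -> int) :
  \prod_(t | P t) q ^ (h t) = q ^ (\sum_(t | P t) h t).
Proof. by rewrite (big_morph (fun x : int => q ^ x) (fun x y => expfzDr x y q0) (expr0z q)). Qed.

Lemma Kmx_diag u i : inr e u -> Kmx R (e i) (mki e u i) (mki e u i) = q ^ (hw e u i).
Proof.
move=> ur; rewrite mxE eqxx mkiE // /hw expfzDr // mul2n -addnn.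
by rewrite mulr2n -PoszD exprnN.
Qed.

Lemma Kimx_diag u i : inr e u -> Kimx R (e i) (mki e u i) (mki e u i) = q ^ (- hw e u i).
Proof.
move=> ur; rewrite mxE eqxx mkiE // /hw opprB expfzDr // mul2n -addnn.
by rewrite mulr2n -PoszD exprnN mulrC.
Qed.

Section OneSite.
Variables (s : 'I_k) (D : forall i, 'M[K]_((e i).+1)) (X : 'M[K]_((e s).+1)).
Hypothesis Ddiag : forall i a b, a != b -> D i a b = 0.

(** Each summand of an iterated coproduct is diagonal outside one factor s, and its row in that
    factor has at most one non-zero entry, so a single coordinate of z contributes. *)
Lemma cf_onesite (M : forall i, 'M[K]_((e i).+1)) z u v (x : K) :
  inr e u ->
  (forall i, i != s -> M i = D i) ->
  (forall t, t != s -> v t = u t) ->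
  (forall b, M s (mki e u s) b = if b == v s :> nat then x else 0) ->
  cf u (tensop M z : gtens K e) =
    (\prod_(i | i != s) D i (mki e u i) (mki e u i)) * x * cf v (z : gtens K e).
Proof.
move=> ur hD huv hs.
have [vs|vs] := leqP (v s) (e s).
  have vr : inr e v.
    apply/inrP => t; have [->//|ts] := eqVneq t s; rewrite huv //; exact/inrP.
  have mv i : i != s -> mki e v i = mki e u i.
    by move=> si; apply: val_inj; rewrite /= !mkiE // huv.
  rewrite (@cf_tensop M z u (mki e v)) // => [|i b].
    rewrite /cf vr (bigD1 s) //= hs mkiE // eqxx [x * _]mulrC; congr (_ * _ * _).
    by apply: eq_bigr => i si; rewrite hD // mv.
  move: b; have [->|si] := eqVneq i s => b.
    by rewrite hs => bs; case: eqP => // e1; case/eqP: bs; apply: val_inj; rewrite /= e1 mkiE.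
  by move=> bi; rewrite hD //; apply: Ddiag; rewrite -mv // eq_sym.
rewrite [cf v _](cf_out1 _ vs) mulr0 /cf ur ffunE big1 // => u' _.
rewrite (bigD1 s) //= hs; case: eqP => [e1|_]; last by rewrite !mul0r.
by move: (ltn_ord (u' s)); rewrite e1 ltnS leqNgt vs.
Qed.
End OneSite.

Lemma Kmx_off n (a b : 'I_n.+1) : a != b -> Kmx R n a b = 0.
Proof. by rewrite mxE => /negPf->. Qed.
Lemma Kimx_off n (a b : 'I_n.+1) : a != b -> Kimx R n a b = 0.
Proof. by rewrite mxE => /negPf->. Qed.
Lemma one_off n (a b : 'I_n.+1) : a != b -> (1%:M : 'M[K]_n.+1) a b = 0.
Proof. by rewrite mxE => /negPf->. Qed.

Lemma qintE n : qint R n = qn q n. Proof. by []. Qed.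

Lemma congr_if (b1 b2 : bool) (x y c : K) : b1 = b2 -> (b2 -> x = y) ->
  (if b1 then x else c) = (if b2 then y else c).
Proof. by move=> ->; case: b2 => // ->. Qed.

Lemma Emx_row u s b : inr e u ->
  Emx R (e s) (mki e u s) b = if b == up u s s :> nat then qn q (e s - u s) else 0.
Proof.
move=> ur; rewrite mxE (mkiE _ ur) upE; apply: congr_if; first exact: eq_sym.
move=> /eqP eb; rewrite qintE; apply: congr1; move: (ltn_ord b); rewrite eb; lia.
Qed.

Lemma Fmx_row u s b : inr e u ->
  Fmx R (e s) (mki e u s) b = if b == (u s).-1 :> nat then qn q (u s) else 0.
Proof.
move=> ur; rewrite mxE (mkiE _ ur).
have [->|us] := posnP (u s); first by rewrite qn0 if_same.
apply: congr_if => [|/eqP ->]; last by rewrite prednK // qintE.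
by rewrite -{1}(prednK us) eqSS eq_sym.
Qed.

Lemma actE_atE s z : actE_at s z = gE q s z.
Proof.
apply: gext => u ur; rewrite cf_gE.
rewrite (@cf_onesite s (fun i => 1%:M) (fun i a b => @one_off (e i) a b) _ _ _ (up u s)
  (qn q (e s - u s))) //.
- rewrite big1 ?mul1r // => i _; by rewrite mxE eqxx.
- by move=> i /negPf->.
- by move=> t ts; rewrite upN.
- by move=> b; rewrite eqxx Emx_row.
Qed.

Lemma prod_if3 (A B : 'I_k -> K) (P : pred 'I_k) s : ~~ P s ->
  (forall i, i != s -> P i -> B i = A i) -> (forall i, i != s -> ~~ P i -> B i = 1) ->
  \prod_(i | i != s) B i = \prod_(i | P i) A i.
Proof.
move=> Ps hA h1; rewrite (bigID P) /= [X in _ * X]big1 ?mulr1 => [|i /andP[]]; last exact: h1.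
apply: eq_big => [i|i /andP[]]; last exact: hA.
by rewrite andb_idl // => Pi; apply: contraNneq Ps => <-.
Qed.

Lemma actE_E z : actE z = gEt q z.
Proof.
apply: gext => u ur; rewrite cf_gEt /actE cf_sum; apply: eq_bigr => s _.
pose D i : 'M[K]_((e i).+1) := if (i < s)%N then Kmx R (e i) else 1%:M.
have Dd i a b : a != b -> D i a b = 0.
  by rewrite /D; case: ifP => _; [apply: Kmx_off|apply: one_off].
rewrite (@cf_onesite s D Dd _ _ u (up u s) (qn q (e s - u s))) //.
- rewrite (@prod_if3 (fun t => q ^ (hw e u t)) _ (fun t : 'I_k => t < s)%N) ?ltnn //.
  + by rewrite prod_q cf_gE /wE [RHS]mulrA.
  + by move=> i _ h; rewrite /D h Kmx_diag.
  + by move=> i _ /negPf h; rewrite /D h mxE eqxx.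
- by move=> i /negPf h; rewrite /D h.
- by move=> t ts; rewrite upN.
- by move=> b; rewrite ltnn eqxx Emx_row.
Qed.

Lemma actF_firstE m z : actF_first m z = gF q m z.
Proof.
apply: gext => u ur; rewrite cf_gF /actF_first cf_sum; apply: eq_bigr => s sm.
pose D i : 'M[K]_((e i).+1) := if (s < i < m)%N then Kimx R (e i) else 1%:M.
have Dd i a b : a != b -> D i a b = 0.
  by rewrite /D; case: ifP => _; [apply: Kimx_off|apply: one_off].
rewrite (@cf_onesite s D Dd _ _ u (dn u s) (qn q (u s))) //.
- rewrite (@prod_if3 (fun t => q ^ (- hw e u t)) _ (fun t : 'I_k => s < t < m)%N) ?ltnn //.
  + by rewrite prod_q sumrN cf_gf; have /inrP/(_ s)-> := ur; rewrite mul1r /wF [RHS]mulrA.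
  + by move=> i _ h; rewrite /D h Kimx_diag.
  + by move=> i _ /negPf h; rewrite /D h mxE eqxx.
- move=> i /negPf h; rewrite /D h; case: ltngtP => //.
  by move=> e1; rewrite (val_inj e1) eqxx in h.
- by move=> t ts; rewrite dnN.
- by move=> b; rewrite ltnn eqxx dnE Fmx_row.
Qed.

Lemma actKE z : actK z = gKt q z.
Proof.
apply: gext => u ur; rewrite cf_gKt (@cf_tensop _ z u (mki e u)) // => [|i b bi].
  rewrite -prod_q /cf ur; congr (_ * _).
  by apply: eq_bigr => i _; rewrite Kmx_diag.
by apply: Kmx_off; rewrite eq_sym.
Qed.

Lemma actKiE z : actKi z = gKit q z.
Proof.
apply: gext => u ur; rewrite cf_gKit (@cf_tensop _ z u (mki e u)) // => [|i b bi].
  rewrite -sumrN -prod_q /cf ur; congr (_ * _).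
  by apply: eq_bigr => i _; rewrite Kimx_diag.
by apply: Kimx_off; rewrite eq_sym.
Qed.

Lemma ThetaE s z : Theta s z = gTheta q s z.
Proof.
apply: eq_bigr => n _; congr (_ *: _).
by rewrite (eq_iter (actF_firstE s)) (eq_iter (@actE_atE s)).
Qed.

Lemma PsiE z : Psi z = gPsi q barM k z.
Proof.
have H m : (m <= k)%N ->
  foldl (fun z' s => Theta s z') (sigma z) (take m (enum 'I_k)) = gPsi q barM m z.
  elim: m => [|m IH] mk; first by rewrite take0.
  have sk : (m < size (enum 'I_k))%N by rewrite size_enum_ord.
  rewrite (take_nth (Ordinal mk) sk) foldl_rcons IH ?(ltnW mk) //.
  rewrite (_ : nth _ _ _ = Ordinal mk); last by apply: val_inj; rewrite /= nth_enum_ord.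
  by rewrite ThetaE -gPsiS.
by rewrite -H // take_oversize // size_enum_ord.
Qed.

End Bridge.

End DefinitionsInCoordinates.

(** * Boxes and crossingless matches *)

Section BoxGeometry.

Local Open Scope nat_scope.

Lemma sum_ring_nat (I : Type) (r : seq I) (P : pred I) (F : I -> nat) :
  (\sum_(i <- r | P i) F i)%R = \sum_(i <- r | P i) F i.
Proof. by []. Qed.

Section Boxes.
Variables (k : nat) (d : 'I_k -> nat).
Local Notation tot := (tot d).
Local Notation off := (off d).
Local Notation inbox := (inbox d).
Implicit Types (i j t : 'I_k).

Lemma sum_subset (P Q : pred 'I_k) (F : 'I_k -> nat) : (forall t, P t -> Q t) ->
  (\sum_(t | P t) F t <= \sum_(t | Q t) F t)%N.
Proof.
move=> PQ; rewrite big_mkcond [X in (_ <= X)%N]big_mkcond; apply: leq_sum => t _.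
by case: (boolP (P t)) => // /PQ ->.
Qed.

Lemma off_S i : (off i + d i)%N = \sum_(t < k | (t <= i)%N) d t.
Proof.
rewrite (bigD1 i) //= addnC /Defs.off sum_ring_nat; congr addn; apply: eq_bigl => t.
by rewrite ltn_neqAle andbC -(inj_eq val_inj).
Qed.

Lemma off_lt i j : (i < j)%N -> (off i + d i <= off j)%N.
Proof. by move=> ij; rewrite off_S /Defs.off sum_ring_nat; apply: sum_subset => t ti; apply: leq_ltn_trans ij. Qed.

Lemma off_tot i : (off i + d i <= tot)%N.
Proof. by rewrite off_S /Defs.tot sum_ring_nat; apply: sum_subset. Qed.

Lemma inbox_lt i j x y : inbox i x -> inbox j y -> (i < j)%N -> (x < y)%N.
Proof.
move=> /andP[_ xi] /andP[yj _] /off_lt h; apply: leq_trans xi _; exact: leq_trans yj.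
Qed.

Lemma inbox_inj i j x : inbox i x -> inbox j x -> i = j.
Proof.
move=> xi xj; apply: val_inj; case: (ltngtP i j) => // h.
  by move: (inbox_lt xi xj h); rewrite ltnn.
by move: (inbox_lt xj xi h); rewrite ltnn.
Qed.

Lemma inbox_mid i x y z : inbox i x -> inbox i y -> (x <= z <= y)%N -> inbox i z.
Proof.
move=> /andP[h1 _] /andP[_ h2] /andP[h3 h4]; rewrite /inbox (leq_trans h1 h3).
exact: leq_ltn_trans h2.
Qed.

Lemma inbox_le i j x y : inbox i x -> inbox j y -> (x <= y)%N -> (i <= j)%N.
Proof. by move=> xi yj xy; rewrite leqNgt; apply/negP => /(inbox_lt yj xi); rewrite ltnNge xy. Qed.

Lemma box_ex (x : nat) : (x < tot)%N -> exists i, inbox i x.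
Proof.
suff H m : (m <= k)%N -> (x < \sum_(t < k | (t < m)%N) d t)%N -> exists i, inbox i x.
  move=> xt; apply: (H k) => //; rewrite (eq_bigl xpredT) // => t; exact: ltn_ord.
elim: m => [|m IH] mk; first by rewrite big_pred0.
case: (ltnP x (\sum_(t < k | (t < m)%N) d t)) => [h _|h]; first exact: IH (ltnW mk) h.
move=> xm; exists (Ordinal mk); rewrite /inbox off_S; apply/andP; split; first exact: h.
by apply: leq_trans xm _; apply: sum_subset => t; rewrite ltnS.
Qed.

Lemma card_itv n (a b : nat) : (b <= n)%N -> #|[set y : 'I_n | a <= y < b]%N| = (b - a)%N.
Proof.
move=> bn; rewrite cardE -(size_map val) -(size_iota a (b - a)).
apply: perm_size; apply: uniq_perm; rewrite ?iota_uniq ?(map_inj_uniq val_inj) ?enum_uniq // => y.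
rewrite mem_iota; apply/mapP/andP => [[z]|[ay yb]].
  by rewrite mem_enum inE => /andP[h1 h2] ->; split=> //=; rewrite subnKC // ltnW // (leq_ltn_trans h1).
have yn : (y < n)%N by move: ay yb bn; clear; lia.
by exists (Ordinal yn) => //; rewrite mem_enum inE /=; move: ay yb; clear; lia.
Qed.

Lemma card_box i : #|[set x : 'I_tot | inbox i x]| = d i.
Proof. by rewrite /inbox card_itv ?off_tot // addKn. Qed.

Lemma card_boxes (P : pred 'I_k) (D : pred nat) :
  #|[set x : 'I_tot | [exists i, inbox i x && P i] && D x]| =
  \sum_(i | P i) #|[set x : 'I_tot | inbox i x && D x]|.
Proof.
rewrite -sum1_card.
have H (x : 'I_tot) : (x \in [set x : 'I_tot | [exists i, inbox i x && P i] && D x] : nat) =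
   \sum_(i | P i) (x \in [set x : 'I_tot | inbox i x && D x] : nat).
  rewrite inE; have [i xi] := box_ex (ltn_ord x).
  have E j : inbox j x -> j = i by move=> xj; apply: inbox_inj xj xi.
  case: existsP => [[j /andP[/E -> Pi]]|h].
    rewrite (bigD1 i) //= inE xi /= big1 ?addn0 // => t /andP[_ ti].
    by rewrite inE; case: (boolP (inbox t x)) => // /E e1; rewrite e1 eqxx in ti.
  rewrite big1 // => t Pt; rewrite inE; case: (boolP (inbox t x)) => // xt.
  by case: h; exists t; rewrite xt.
rewrite big_mkcond /= (eq_bigr _ (fun x _ => H x)) exchange_big; apply: eq_bigr => i _.
by rewrite -sum1_card [RHS]big_mkcond.
Qed.

End Boxes.

Section Match.
Variables (k : nat) (d : 'I_k -> nat).
Local Notation tot := (tot d).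
Local Notation off := (off d).
Local Notation inbox := (inbox d).
Implicit Types (i j t : 'I_k) (S : arcs d) (a b : 'I_tot * 'I_tot).

Definition isL S (x : nat) := [exists a in S, a.1 == x :> nat].
Definition isR S (x : nat) := [exists a in S, a.2 == x :> nat].

Lemma isLP S x : reflect (exists2 a, a \in S & a.1 = x :> nat) (isL S x).
Proof.
apply: (iffP existsP) => [[a /andP[aS /eqP ax]]|[a aS ax]]; exists a => //.
by rewrite aS ax eqxx.
Qed.
Lemma isRP S x : reflect (exists2 a, a \in S & a.2 = x :> nat) (isR S x).
Proof.
apply: (iffP existsP) => [[a /andP[aS /eqP ax]]|[a aS ax]]; exists a => //.
by rewrite aS ax eqxx.
Qed.

Lemma matchedE S x : matched S x = isL S x || isR S x.
Proof.
apply/existsP/orP => [[a /andP[aS /orP[]]] ax|[]/existsP[a /andP[aS ax]]].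
- by left; apply/existsP; exists a; rewrite aS.
- by right; apply/existsP; exists a; rewrite aS.
- by exists a; rewrite aS /touches ax.
- by exists a; rewrite aS /touches ax orbT.
Qed.

Record lcm_spec S : Prop := LcmSpec {
  lcm_lt : forall a, a \in S -> (a.1 < a.2)%N;
  lcm_box : forall a i, a \in S -> inbox i a.1 -> inbox i a.2 -> False;
  lcm_uniq : forall a b (x : 'I_tot), a \in S -> b \in S -> touches x a -> touches x b -> a = b;
  lcm_cross : forall a b, a \in S -> b \in S -> (a.1 < b.1 < a.2)%N -> (b.2 <= a.2)%N;
  lcm_under : forall a (x : 'I_tot), a \in S -> (a.1 < x < a.2)%N -> matched S x }.

Lemma lcmP S : reflect (lcm_spec S) (lcmatch S).
Proof.
apply: (iffP and5P) => [[h1 h2 h3 h4 h5]|[h1 h2 h3 h4 h5]].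
  split.
  - by move=> a aS; move/forallP/(_ a)/implyP: h1; apply.
  - move=> a i aS i1 i2; move/forallP/(_ a)/implyP: h2 => /(_ aS)/existsP[]; exists i.
    by rewrite i1.
  - move=> a b x aS bS xa xb; apply/eqP; move/forallP/(_ a)/implyP: h3 => /(_ aS).
    move/forallP/(_ b)/implyP => /(_ bS)/implyP; apply; apply/existsP; exists x.
    by rewrite xa.
  - move=> a b aS bS /andP[ab ba]; rewrite leqNgt; apply/negP => h.
    move/forallP/(_ a)/implyP: h4 => /(_ aS)/forallP/(_ b)/implyP/(_ bS).
    by rewrite ab ba h.
  - move=> a x aS ax; move/forallP/(_ a)/implyP: h5 => /(_ aS)/forallP/(_ x)/implyP.
    exact.
split.
- by apply/forallP => a; apply/implyP => /h1.
- apply/forallP => a; apply/implyP => aS; apply/existsP => -[i /andP[]]; exact: h2.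
- apply/forallP => a; apply/implyP => aS; apply/forallP => b; apply/implyP => bS.
  by apply/implyP => /existsP[x /andP[xa xb]]; apply/eqP; apply: h3 xa xb.
- apply/forallP => a; apply/implyP => aS; apply/forallP => b; apply/implyP => bS.
  by apply/negP => /and3P[h6 h7 h8]; move: (h4 a b aS bS); rewrite h6 h7 leqNgt h8 => /(_ isT).
- apply/forallP => a; apply/implyP => aS; apply/forallP => x; apply/implyP; exact: h5.
Qed.

Section Spec.
Variable S : arcs d.
Hypothesis HS : lcm_spec S.

Lemma uniq_L a b : a \in S -> b \in S -> a.1 = b.1 -> a = b.
Proof.
by move=> aS bS e; apply: (lcm_uniq HS (x := a.1)) => //; rewrite /touches ?e eqxx.
Qed.
Lemma uniq_R a b : a \in S -> b \in S -> a.2 = b.2 -> a = b.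
Proof.
by move=> aS bS e; apply: (lcm_uniq HS (x := a.2)) => //; rewrite /touches ?e eqxx orbT.
Qed.
Lemma not_LR a b : a \in S -> b \in S -> a.1 = b.2 -> False.
Proof.
move=> aS bS e; have ab : a = b.
  by apply: (lcm_uniq HS (x := a.1)) => //; rewrite /touches ?e eqxx ?orbT.
by have := lcm_lt HS aS; rewrite e ab ltnn.
Qed.

Lemma not_LRx x : isL S x -> isR S x -> False.
Proof. by move=> /isLP[a aS ax] /isRP[b bS bx]; apply: (not_LR aS bS); apply: val_inj; rewrite /= ax. Qed.

(** The arc ending at y starts in an earlier box, so x lies under it and is matched. Were x a left
    endpoint, non-crossing would force its arc to end in the same box. *)
Lemma R_down i x y : inbox i x -> inbox i y -> (x < y)%N -> isR S y -> isR S x.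
Proof.
move=> xi yi xy /isRP[a aS ay].
have a1 : (a.1 < x)%N.
  rewrite ltnNge; apply/negP => h; apply: (lcm_box HS aS _ (i := i)); last by rewrite ay.
  by apply: inbox_mid xi yi _; rewrite h -ay ltnW // (lcm_lt HS).
have xt : (x < tot)%N by apply: ltn_trans xy _; rewrite -ay.
have := lcm_under HS aS (x := Ordinal xt); rewrite /= a1 ay xy matchedE => /(_ isT)/orP[|//].
case/isLP => b bS bx; have := lcm_cross HS aS bS; rewrite bx a1 ay xy => /(_ isT).
rewrite leq_eqVlt => /orP[/eqP e|b2].
  have ab : b = a by apply: uniq_R => //; apply: val_inj; rewrite /= e ay.
  by move: a1; rewrite -ab bx ltnn.
case: (lcm_box HS bS (i := i)); first by rewrite bx.
apply: inbox_mid xi yi _; apply/andP; split; last exact: ltnW.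
by rewrite -bx ltnW // (lcm_lt HS).
Qed.

(** Mirror image of [R_down]. Together: a box reads right endpoints, then unmatched vertices, then
    left endpoints. *)
Lemma L_up i x y : inbox i x -> inbox i y -> (x < y)%N -> isL S x -> isL S y.
Proof.
move=> xi yi xy /isLP[a aS ax].
have a2 : (y < a.2)%N.
  rewrite ltnNge; apply/negP => h; apply: (lcm_box HS aS (i := i)); first by rewrite ax.
  by apply: inbox_mid xi yi _; rewrite h -ax ltnW // (lcm_lt HS).
have yt : (y < tot)%N by apply: ltn_trans a2 _.
have := lcm_under HS aS (x := Ordinal yt); rewrite /= ax a2 xy matchedE => /(_ isT)/orP[//|].
case/isRP => b bS bx; case: (ltngtP b.1 x) => [b1|b1|b1].
- have := lcm_cross HS bS aS; rewrite ax b1 bx xy => /(_ isT).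
  by rewrite leqNgt a2.
- case: (lcm_box HS bS (i := i)); last by rewrite bx.
  by apply: inbox_mid xi yi _; rewrite (ltnW b1) -bx ltnW // (lcm_lt HS).
- have ab : b = a by apply: uniq_L => //; apply: val_inj; rewrite /= b1 ax.
  by move: a2; rewrite -ab bx ltnn.
Qed.

Lemma leftsE i : lefts S i = #|[set x : 'I_tot | inbox i x && isL S x]|.
Proof.
rewrite /lefts -(card_in_imset (f := fst)) => [|a b]; last first.
  by rewrite !inE => /andP[aS _] /andP[bS _]; apply: uniq_L.
apply: eq_card => x; rewrite inE; apply/imsetP/andP => [[a]|[xi /isLP[a aS ax]]].
  by rewrite inE => /andP[aS ai] ->; split=> //; apply/isLP; exists a.
by exists a; [rewrite inE aS ax|apply: val_inj].
Qed.

Lemma rightsE i : rights S i = #|[set x : 'I_tot | inbox i x && isR S x]|.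
Proof.
rewrite /rights -(card_in_imset (f := snd)) => [|a b]; last first.
  by rewrite !inE => /andP[aS _] /andP[bS _]; apply: uniq_R.
apply: eq_card => x; rewrite inE; apply/imsetP/andP => [[a]|[xi /isRP[a aS ax]]].
  by rewrite inE => /andP[aS ai] ->; split=> //; apply/isRP; exists a.
by exists a; [rewrite inE aS ax|apply: val_inj].
Qed.

Lemma box_count i : d i = (lefts S i + rights S i + mS S i)%N.
Proof.
rewrite -[LHS](card_box d i) -sum1_card leftsE rightsE /mS -!sum1_card.
rewrite (bigID (fun x : 'I_tot => matched S x)) /=; congr addn; last first.
  by apply: eq_bigl => x; rewrite !inE.
rewrite (bigID (fun x : 'I_tot => isL S x)) /=; congr addn; apply: eq_bigl => x;
  rewrite !inE matchedE; case: (inbox i x) => //=.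
  by rewrite andb_idl // => ->.
case: (boolP (isR S x)) => [h|_]; last by rewrite orbF andbN.
by rewrite orbT; apply/negP => /not_LRx; apply.
Qed.

Lemma nrE i : (nS S i - rS S i)%N = mS S i.
Proof. by rewrite /nS /rS {1}(box_count i); lia. Qed.

Lemma sum_lefts : (\sum_i lefts S i)%N = #|S|.
Proof.
rewrite (eq_bigr _ (fun i _ => leftsE i)) -(@card_boxes k d xpredT (isL S)).
rewrite -(card_in_imset (f := fst) (D := S)) => [|a b aS bS]; last exact: uniq_L.
apply: eq_card => x; rewrite inE; apply/andP/imsetP => [[_ /isLP[a aS ax]]|[a aS ->]].
  by exists a => //; apply: val_inj.
split; last by apply/isLP; exists a.
by have [i xi] := box_ex (ltn_ord a.1); apply/existsP; exists i; rewrite xi.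
Qed.

Lemma sum_rights : (\sum_i rights S i)%N = #|S|.
Proof.
rewrite (eq_bigr _ (fun i _ => rightsE i)) -(@card_boxes k d xpredT (isR S)).
rewrite -(card_in_imset (f := snd) (D := S)) => [|a b aS bS]; last exact: uniq_R.
apply: eq_card => x; rewrite inE; apply/andP/imsetP => [[_ /isRP[a aS ax]]|[a aS ->]].
  by exists a => //; apply: val_inj.
split; last by apply/isRP; exists a.
by have [i xi] := box_ex (ltn_ord a.2); apply/existsP; exists i; rewrite xi.
Qed.

End Spec.
End Match.

Local Close Scope nat_scope.

End BoxGeometry.

(** * The match obtained from a marking of the vertices *)

Section MarkedMatches.

Local Open Scope nat_scope.

Section FilterHead.
Lemma filter_ord_head n (P : pred 'I_n) :
  match [seq y <- enum 'I_n | P y] with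
  | [::] => forall z, ~~ P z
  | y :: _ => P y /\ forall z, P z -> (y <= z)%N
  end.
Proof.
have : sorted (fun x y : 'I_n => (x < y)%N) [seq y <- enum 'I_n | P y].
  apply: sorted_filter => [x y z|]; first exact: ltn_trans.
  by rewrite -(@sorted_map _ _ val ltn) val_enum_ord iota_ltn_sorted.
have : forall z, P z -> z \in [seq y <- enum 'I_n | P y] by move=> z; rewrite mem_filter mem_enum => ->.
have : all P [seq y <- enum 'I_n | P y] by apply: filter_all.
case: [seq y <- enum 'I_n | P y] => [_ h _ z|y s /=/andP[Py _] h hp].
  by apply/negP => /h.
split=> // z /h; rewrite inE => /orP[/eqP->//|zs].
have tr : transitive (fun x y : 'I_n => (x < y)%N) by move=> ? ? ?; apply: ltn_trans.
by have /allP/(_ z zs)/ltnW := order_path_min tr hp.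
Qed.

Lemma filter_ord_eq n (P : pred 'I_n) y : P y -> (forall z : 'I_n, (z < y)%N -> ~~ P z) ->
  exists s, [seq y <- enum 'I_n | P y] = y :: s.
Proof.
move=> Py h; have := filter_ord_head P; case: [seq y <- enum 'I_n | P y] => [|z s [Pz hz]].
  by move=> /(_ y); rewrite Py.
exists s; congr cons; apply: val_inj; apply/eqP; rewrite eqn_leq hz //= leqNgt.
by apply/negP => /h; rewrite Pz.
Qed.
End FilterHead.

Section Mmatch.
Variables (k : nat) (d w : 'I_k -> nat).
Local Notation tot := (tot d).
Local Notation inbox := (inbox d).
Local Notation D := (Defs.down d w).
Implicit Types (i j t : 'I_k) (S : arcs d) (a b : 'I_tot * 'I_tot) (x y z : 'I_tot).

Lemma downE i x : inbox i x -> D x = (Defs.off d i + (d i - w i) <= x).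
Proof.
move=> xi; apply/existsP/idP => [[j /andP[xj h]]|h]; last by exists i; rewrite xi.
by rewrite (inbox_inj xi xj).
Qed.

Definition Mstep (x : 'I_tot) S : arcs d :=
  if D x then
    if [seq y : 'I_tot <- enum 'I_tot | [&& (x < y)%N, ~~ D y & ~~ matched S y]]
      is y :: _ then ((x, y) |: S)%SET else S
  else S.

Definition Mfrom (n : nat) : arcs d := foldr Mstep finset.set0 (drop n (enum 'I_tot)).

Lemma Mfrom0 : Mfrom 0 = Mmatch d w. Proof. by rewrite /Mfrom drop0. Qed.
Lemma Mfrom_tot n : tot <= n -> Mfrom n = finset.set0.
Proof. by move=> h; rewrite /Mfrom drop_oversize ?size_enum_ord. Qed.
Lemma MfromS x : Mfrom x = Mstep x (Mfrom x.+1).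
Proof.
rewrite /Mfrom (drop_nth x) ?size_enum_ord //=; congr Mstep.
by apply: val_inj; rewrite /= nth_enum_ord.
Qed.

(** Induction in the processing order, from the right end of the line. *)
Lemma down_ind (P : nat -> Prop) : (forall n, tot <= n -> P n) ->
  (forall x, P x.+1 -> P x) -> forall n, P n.
Proof.
move=> h0 hS n; have [|nt] := leqP tot n; first exact: h0.
have [m em] : exists m, n + m = tot by exists (tot - n); rewrite subnKC // ltnW.
elim: m n nt em => [|m IH] n nt em; first by move: nt; rewrite -em addn0 ltnn.
apply: (hS (Ordinal nt)); have [h|h] := leqP tot n.+1; first exact: h0.
by apply: IH => //; rewrite addSnnS.
Qed.

(** The last two fields carry the geometry: an up under an arc is matched inside it, and a down left
    unmatched sees on its right only ups matched to downs beyond it. They give non-crossing and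
    leave no unmatched vertex under an arc. *)
Record Minv (n : nat) S : Prop := MInv {
  inv_arc : forall a, a \in S -> [/\ n <= a.1, D a.1, ~~ D a.2 & a.1 < a.2];
  inv_L : forall a b, a \in S -> b \in S -> a.1 = b.1 -> a = b;
  inv_R : forall a b, a \in S -> b \in S -> a.2 = b.2 -> a = b;
  inv_up : forall a z, a \in S -> a.1 < z < a.2 -> ~~ D z ->
    exists2 b, b \in S & b.2 = z /\ a.1 < b.1;
  inv_down : forall z, n <= z -> D z -> isL S z \/
    forall y, z < y -> ~~ D y -> exists2 b, b \in S & b.2 = y /\ z < b.1 }.

Lemma Minv_matched n S y : Minv n S -> ~~ D y -> matched S y ->
  exists2 b, b \in S & b.2 = y /\ n <= b.1.
Proof.
move=> I Dy; rewrite matchedE => /orP[/isLP[a aS ay]|/isRP[a aS ay]].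
  by have [_ Da _ _] := inv_arc I aS; rewrite -ay Da in Dy.
by exists a => //; have [h _ _ _] := inv_arc I aS; split=> //; apply: val_inj.
Qed.

Lemma MinvP n : Minv n (Mfrom n).
Proof.
elim/down_ind: n => [n nt|x IH].
  rewrite Mfrom_tot //; split=> [a|a b|a b|a z|z nz]; rewrite ?inE //.
  by have := ltn_ord z; rewrite ltnNge (leq_trans nt nz).
rewrite MfromS /Mstep; set S := Mfrom x.+1 in IH *.
have xS a : a \in S -> x < a.1 by move=> /(inv_arc IH)[].
case: (boolP (D x)) => Dx; last first.
  split.
  - by move=> a /(inv_arc IH)[/ltnW].
  - exact: inv_L IH.
  - exact: inv_R IH.
  - exact: inv_up IH.
  - move=> z; rewrite leq_eqVlt => /orP[/eqP/val_inj <-|]; first by rewrite (negPf Dx).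
    by move=> xz Dz; apply: (inv_down IH xz Dz).
set P := fun y : 'I_tot => _; have := filter_ord_head P.
case: [seq _ <- _ | _] => [|y s].
  move=> hP; split.
  - by move=> a /(inv_arc IH)[/ltnW].
  - exact: inv_L IH.
  - exact: inv_R IH.
  - exact: inv_up IH.
  - move=> z; rewrite leq_eqVlt => /orP[/eqP/val_inj <- _|xz Dz]; last by apply: (inv_down IH xz Dz).
    right=> y xy Dy; have := hP y; rewrite /P xy Dy /= negbK => /(Minv_matched IH Dy)[b bS [? ?]].
    by exists b.
move=> [/and3P[xy Dy my] hy].
have yS a : a \in S -> a.2 <> y.
  by move=> aS ay; move/negP: my; apply; rewrite matchedE; apply/orP; right; apply/isRP; exists a; rewrite ?ay.
split.
- move=> a; rewrite !inE => /orP[/eqP ->/=|/(inv_arc IH)[/ltnW]//].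
  by split.
- move=> a b; rewrite !inE => /orP[/eqP->|aS] /orP[/eqP->|bS] //=.
  + by move=> e; have := xS _ bS; rewrite -e ltnn.
  + by move=> e; have := xS _ aS; rewrite e ltnn.
  + exact: inv_L IH _ _ aS bS.
- move=> a b; rewrite !inE => /orP[/eqP->|aS] /orP[/eqP->|bS] //=.
  + by move=> /esym/(yS _ bS).
  + by move=> /(yS _ aS).
  + exact: inv_R IH _ _ aS bS.
- move=> a z; rewrite !inE => /orP[/eqP->/=|aS] az Dz.
    case/andP: az => xz zy; have : ~~ P z by apply: contraL zy => /hy; rewrite -leqNgt.
    rewrite /P xz Dz /= negbK => /(Minv_matched IH Dz)[b bS [? ?]].
    by exists b => //; rewrite !inE bS orbT.
  have [b bS h] := inv_up IH aS az Dz.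
  by exists b => //; rewrite !inE bS orbT.
- move=> z; rewrite leq_eqVlt => /orP[/eqP/val_inj <- _|xz Dz].
    by left; apply/isLP; exists (x, y); rewrite ?inE ?eqxx.
  case: (inv_down IH xz Dz) => [/isLP[a aS az]|h].
    by left; apply/isLP; exists a; rewrite // !inE aS orbT.
  right=> y' zy' Dy'; have [b bS hb] := h y' zy' Dy'.
  by exists b => //; rewrite !inE bS orbT.
Qed.

Let I0 : Minv 0 (Mmatch d w).
Proof. by rewrite -Mfrom0; apply: MinvP. Qed.

Lemma Mmatch_arc a : a \in Mmatch d w -> [/\ D a.1, ~~ D a.2 & a.1 < a.2].
Proof. by move=> /(inv_arc I0)[]. Qed.

Lemma Mmatch_lcm : lcm_spec (Mmatch d w).
Proof.
split.
- by move=> a /Mmatch_arc[].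
- move=> a i /Mmatch_arc[Da Da' aa] i1 i2; move: Da Da'; rewrite !(downE (i := i)) // => h.
  by rewrite (leq_trans h) // ltnW.
- move=> a b x aS bS; have [Da Da' _] := Mmatch_arc aS; have [Db Db' _] := Mmatch_arc bS.
  move=> /orP[] /eqP/val_inj ax /orP[] /eqP/val_inj bx.
  + by apply: inv_L I0 _ _ aS bS _; rewrite ax.
  + by move: Da Db'; rewrite ax bx => ->.
  + by move: Da' Db; rewrite ax bx => /negPf->.
  + by apply: inv_R I0 _ _ aS bS _; rewrite ax.
- move=> a b aS bS /andP[ab ba]; rewrite leqNgt; apply/negP => h.
  have [_ Da' _] := Mmatch_arc aS.
  have [c cS [c2 c1]] : exists2 c, c \in Mmatch d w & c.2 = a.2 /\ b.1 < c.1.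
    by apply: inv_up I0 _ _ bS _ Da'; rewrite ba.
  by move: (ltn_trans ab c1); rewrite (inv_R I0 cS aS c2) ltnn.
- move=> a x aS ax; have [_ Da' _] := Mmatch_arc aS; rewrite matchedE.
  case: (boolP (D x)) => Dx; last first.
    have [b bS [bx _]] := inv_up I0 aS ax Dx.
    by apply/orP; right; apply/isRP; exists b; rewrite ?bx.
  case: (inv_down I0 (leq0n x) Dx) => [->//|h]; case/andP: ax => ax xa.
  have [b bS [b2 b1]] := h _ xa Da'.
  by move: (ltn_trans ax b1); rewrite (inv_R I0 bS aS b2) ltnn.
Qed.

Section Oriented.
Variable b : arcs d.
Hypothesis Hb : lcm_spec b.
Hypothesis bD : forall a, a \in b -> D a.1 /\ ~~ D a.2.

(** When the left end of an arc of b is reached, the ups under the arc are already taken by nested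
    arcs of b and its right end is still free, so the procedure chooses the same partner. *)
Lemma oriented_sub : b \subset Mmatch d w.
Proof.
rewrite -Mfrom0; suff H n a : a \in b -> n <= a.1 -> a \in Mfrom n.
  by apply/fintype.subsetP => a aS; apply: H.
move: n a; elim/down_ind => [n nt a _ na|x IH a ab].
  by have := ltn_ord a.1; rewrite ltnNge (leq_trans nt na).
rewrite MfromS /Mstep; set S := Mfrom x.+1 in IH *.
have I := MinvP x.+1; rewrite -/S in I.
case: (ltngtP x a.1) => // [xa _|/val_inj xa _].
  have := IH a ab xa; case: ifP => // _; case: [seq _ <- _ | _] => // y s aS.
  by rewrite !inE aS orbT.
have [Da Da'] := bD ab; rewrite xa Da.
have aa := lcm_lt Hb ab.
have nest c : c \in b -> a.1 < c.1 < a.2 -> c.2 < a.2.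
  move=> cb ac; have := lcm_cross Hb ab cb ac; rewrite leq_eqVlt => /orP[/eqP/val_inj e|//].
  by move: ac; rewrite (uniq_R Hb cb ab e) ltnn.
have [|z za|s ->] := @filter_ord_eq _ (fun y : 'I_tot => [&& a.1 < y, ~~ D y & ~~ matched S y]) a.2.
(* If the right end were already taken by c, then c.1 would lie under the arc and start an arc of b;
   by induction that arc is c, yet nested arcs end before a.2. *)
- rewrite aa Da' /=; apply/negP => /(Minv_matched I Da')[c cS [c2 c1]].
  have [_ Dc _ cc] := inv_arc I cS; rewrite c2 in cc; rewrite xa in c1.
  have := lcm_under Hb (x := c.1) ab; rewrite c1 cc matchedE => /(_ isT)/orP[/isLP|/isRP] [c' cb e].
    have ac' : a.1 < c'.1 < a.2 by rewrite e c1.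
    have c'S : c' \in S by apply: IH => //; rewrite xa e.
    have e2 := inv_L I c'S cS (val_inj e); have := nest _ cb ac'.
    by rewrite e2 c2 ltnn.
  by have [_] := bD cb; rewrite (val_inj e) Dc.
- apply/and3P => -[az Dz]; rewrite matchedE => /norP[_ /negP]; apply.
  have := lcm_under Hb (x := z) ab; rewrite az za matchedE => /(_ isT)/orP[/isLP|/isRP] [c cb e].
    by have [Dc _] := bD cb; rewrite -e Dc in Dz.
  apply/isRP; exists c => //; apply: IH => //; rewrite xa ltnNge; apply/negP.
  rewrite leq_eqVlt => /orP[/eqP/val_inj e1|ca].
    by move: za; rewrite -e (uniq_L Hb cb ab e1) ltnn.
  have := lcm_cross Hb cb ab; rewrite ca e az leqNgt za => /(_ isT) //.
- by rewrite !inE; case: (a) => a1 a2; rewrite eqxx.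
Qed.
End Oriented.

Hypothesis wd : forall i, w i <= d i.

Lemma card_down i : #|[set x : 'I_tot | inbox i x && D x]| = w i.
Proof.
have -> : [set x : 'I_tot | inbox i x && D x] =
    [set x : 'I_tot | Defs.off d i + (d i - w i) <= x < Defs.off d i + d i].
  apply/setP => x; rewrite !inE; case: (boolP (inbox i x)) => xi /=.
    by rewrite (downE xi); case/andP: xi => _ ->; rewrite andbT.
  apply/esym/negP => /andP[h1 h2]; move/negP: xi; apply; rewrite /Defs.inbox h2 andbT.
  exact: leq_trans (leq_addr _ _) h1.
by rewrite card_itv ?off_tot // subnDl subKn.
Qed.

Lemma card_ups i : #|[set x : 'I_tot | inbox i x && ~~ D x]| = d i - w i.
Proof.
rewrite -[d i](card_box d i) -(card_down i) -[in RHS](cardsID [set x : 'I_tot | D x]).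
have -> : [set x : 'I_tot | inbox i x] :&: [set x : 'I_tot | D x] = [set x : 'I_tot | inbox i x && D x].
  by apply/setP => x; rewrite !inE.
by rewrite addKn; apply: eq_card => x; rewrite !inE andbC.
Qed.

Lemma sub_Mmatch_lefts (b : arcs d) i : lcm_spec b -> b \subset Mmatch d w -> lefts b i <= w i.
Proof.
move=> Hb /fintype.subsetP bM; rewrite leftsE // -(card_down i); apply: subset_leq_card.
apply/fintype.subsetP => x; rewrite !inE => /andP[-> /isLP[a /bM/Mmatch_arc[Da _ _] <-]] //.
Qed.

(** The left endpoints are the last [lefts b i] vertices of the box by [L_up], the right endpoints
    the first [rights b i] ones by [R_down], and exactly the last [w i] vertices are down. *)
Lemma box_oriented (b : arcs d) : lcm_spec b ->
  (forall i, lefts b i <= w i <= d i - rights b i) ->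
  forall a, a \in b -> D a.1 /\ ~~ D a.2.
Proof.
move=> Hb h a ab; split.
  have [i ai] := box_ex (ltn_ord a.1); rewrite (downE ai).
  have /andP[lw _] := h i; move: (ai) => /andP[ai1 ai2].
  suff H : Defs.off d i + d i - a.1 <= lefts b i by move: (wd i) lw H ai2; clear; lia.
  rewrite -(card_itv a.1 (off_tot d i)) leftsE //; apply: subset_leq_card.
  apply/fintype.subsetP => x; rewrite !inE => /andP[ax xi].
  have xb : inbox i x by rewrite /Defs.inbox xi andbT (leq_trans ai1).
  rewrite xb; move: ax; rewrite leq_eqVlt => /orP[/eqP <-|ax].
    by apply/isLP; exists a.
  by apply: (L_up Hb ai xb ax); apply/isLP; exists a.
have [i ai] := box_ex (ltn_ord a.2); rewrite (downE ai) -ltnNge.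
have /andP[_ wr] := h i; move: (ai) => /andP[ai1 ai2].
have rd : rights b i <= d i by rewrite [d i](box_count Hb); lia.
suff H : a.2.+1 - Defs.off d i <= rights b i by move: (wd i) rd wr H ai1; clear; lia.
rewrite -(card_itv (n := tot) (Defs.off d i) (b := a.2.+1)) // rightsE //; apply: subset_leq_card.
apply/fintype.subsetP => x; rewrite !inE ltnS => /andP[xi xa].
have xb : inbox i x by rewrite /Defs.inbox xi (leq_ltn_trans xa).
rewrite xb; move: xa; rewrite leq_eqVlt => /orP[/eqP ->|ax].
  by apply/isRP; exists a.
by apply: (R_down Hb xb ai ax); apply/isRP; exists a.
Qed.

Lemma counts_sub_Mmatch (b : arcs d) : lcm_spec b ->
  (forall i, lefts b i <= w i <= d i - rights b i) -> b \subset Mmatch d w.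
Proof. by move=> Hb h; apply: oriented_sub => //; apply: box_oriented. Qed.

Lemma card_Mmatch : #|Mmatch d w| <= \sum_i (d i - w i).
Proof.
rewrite -(card_in_imset (f := snd)) => [|a b aS bS]; last exact: (inv_R I0).
rewrite -(eq_bigr _ (fun i _ => card_ups i)) -(@card_boxes k d xpredT (fun x : nat => ~~ D x)).
apply: subset_leq_card; apply/fintype.subsetP => x /imsetP[a /Mmatch_arc[_ Da _] ->].
rewrite inE Da andbT; have [i ai] := box_ex (ltn_ord a.2).
by apply/existsP; exists i; rewrite ai.
Qed.

(* Otherwise an unmatched down vertex of box [i] sees only ups matched to downs on its right. *)
Lemma good_lefts : (forall i, \sum_(j < k | i <= j) w j <= \sum_(j < k | i < j) (d j - w j)) ->
  forall i, lefts (Mmatch d w) i = w i.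
Proof.
move=> good i; rewrite leftsE; last exact: Mmatch_lcm.
rewrite -[RHS]card_down; apply: eq_card => z; rewrite !inE.
case: (boolP (inbox i z)) => //= zi; apply/idP/idP => [/isLP[a /Mmatch_arc[Da _ _] <-]//|Dz].
apply: contraT => nL; case: (inv_down I0 (leq0n z) Dz) => [h|h]; first by rewrite h in nL.
have := good i; rewrite -(eq_bigr _ (fun j _ => card_down j)) -(eq_bigr _ (fun j _ => card_ups j)).
rewrite -(@card_boxes k d (fun j => i <= j) D) -(@card_boxes k d (fun j => i < j) (fun x : nat => ~~ D x)).
rewrite leqNgt => /negP[]; set U := finset _; set Dn := finset _.
(* Sending an up to its partner injects the ups after box i into the downs from box i on other than
   z, against the inequality of [good]. *)
pose A := [set a in Mmatch d w | a.2 \in U].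
have -> : #|U| = #|A|.
  rewrite -(card_in_imset (f := snd) (D := A)) => [|a b]; last first.
    by rewrite !inE => /andP[aS _] /andP[bS _]; apply: inv_R I0 _ _ aS bS.
  apply: eq_card => y; apply/idP/imsetP => [yU|[a]]; last by rewrite !inE => /andP[_ h'] ->.
  have := yU; rewrite inE => /andP[/existsP[j /andP[yj ij]] Dy].
  have [b bS [by2 zb]] := h y (inbox_lt zi yj ij) Dy.
  by exists b; rewrite ?by2 // inE bS by2.
rewrite -(card_in_imset (f := fst) (D := A)) => [|a b]; last first.
  by rewrite !inE => /andP[aS _] /andP[bS _]; apply: inv_L I0 _ _ aS bS.
have zDn : z \in Dn by rewrite inE Dz andbT; apply/existsP; exists i; rewrite zi leqnn.
rewrite (cardsD1 z Dn) zDn add1n ltnS; apply: subset_leq_card.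
apply/fintype.subsetP => x /imsetP[a]; rewrite inE => /andP[aM aU] ->.
have [Da Da' _] := Mmatch_arc aM; rewrite !inE Da andbT.
move: aU; rewrite inE => /andP[/existsP[j /andP[aj ij]] _].
have [b bS [b2 zb]] := h _ (inbox_lt zi aj ij) Da'.
rewrite (inv_R I0 bS aM b2) in zb; apply/andP; split.
  by apply: contraTneq zb => ->; rewrite ltnn.
have [t at1] := box_ex (ltn_ord a.1); apply/existsP; exists t; rewrite at1.
exact: inbox_le zi at1 (ltnW zb).
Qed.

End Mmatch.

Section RightsInj.
Variables (k : nat) (d : 'I_k -> nat).

(** Mark all vertices down except the right endpoints. The match lies in [Mmatch] of this marking,
    which has at most as many arcs as there are ups, that is, as the match has; so they are equal,
    and only [rights] enters the marking. *)
Lemma rights_inj (b S : arcs d) : lcm_spec b -> lcm_spec S ->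
  (forall i, rights b i = rights S i) -> b = S.
Proof.
move=> Hb HS h; pose w i := d i - rights b i.
have wd i : w i <= d i by apply: leq_subr.
have sub (c : arcs d) : lcm_spec c -> (forall i, rights b i = rights c i) -> c = Mmatch d w.
  move=> Hc hc; apply/eqP; rewrite eqEcard; apply/andP; split.
    apply: counts_sub_Mmatch => // i; rewrite /w hc leqnn andbT.
    by rewrite {1}(box_count Hc i); lia.
  apply: leq_trans (card_Mmatch wd) _; rewrite -(sum_rights Hc); apply: leq_sum => i _.
  rewrite /w -hc; move: (leq_subr (rights b i) (d i)); lia.
by rewrite (sub b) // (sub S).
Qed.
End RightsInj.

Local Close Scope nat_scope.

End MarkedMatches.

(** * The maps gamma as composites of contractions *)

Section SignedWords.

Section Telescope.
Variables (K : fieldType) (q : K).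
Hypothesis q0 : q != 0.

(** With partial sums X and total T, the summand is (q^(2 X_(s+1) - T) - q^(2 X_s - T))/(q -
    q^-1). *)
Lemma qz_telescope k (x : 'I_k -> int) :
  \sum_(s < k) q ^ (\sum_(t < k | (t < s)%N) x t - \sum_(t < k | (s < t)%N) x t) * qz q (x s)
  = qz q (\sum_(t < k) x t).
Proof.
pose X m : int := \sum_(t < k | (t < m)%N) x t; pose T : int := \sum_(t < k) x t.
pose g m : K := q ^ (X m *+ 2 - T).
have XS (s : 'I_k) : X s.+1 = X s + x s.
  rewrite /X (bigD1 s) //= addrC; congr (_ + _); apply: eq_bigl => t.
  by rewrite ltnS [RHS]ltn_neqAle andbC -(inj_eq val_inj).
have XT (s : 'I_k) : T = X s.+1 + \sum_(t < k | (s < t)%N) x t.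
  rewrite /T (bigID (fun t : 'I_k => t < s.+1)%N) /=; congr (_ + _); apply: eq_bigl => t.
  by rewrite ltnS -ltnNge.
transitivity (\sum_(s < k) (g s.+1 - g s) / (q - q^-1)).
  apply: eq_bigr => s _; rewrite /qz mulrA mulrBr -!expfzDr //; congr ((q ^ _ - q ^ _) / _).
    by have := XT s; rewrite -/(X s) XS => ->; rewrite mulr2n; ring.
  by have := XT s; rewrite -/(X s) XS => ->; rewrite mulr2n; ring.
rewrite -mulr_suml -(big_mkord xpredT (fun s => g s.+1 - g s)) telescope_sumr // /qz.
congr ((q ^ _ - q ^ _) / _); rewrite /X.
  by rewrite (eq_bigl xpredT) => [|t]; rewrite ?ltn_ord // mulr2n addrK.
by rewrite big_pred0 // mul0rn add0r.
Qed.
End Telescope.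

Section Distribute.
Variables (K : fieldType) (T J : finType) (c : T -> J) (G : J -> {ffun T -> bool} -> K).

Definition cmask j (f : {ffun T -> bool}) : {ffun T -> bool} :=
  [ffun x => f x && (c x == j)].
Definition sub_class j (f : {ffun T -> bool}) := [forall x, f x ==> (c x == j)].

(** Distributivity: a word on T is one word on each class of c. *)
Lemma sum_classes :
  \sum_f \prod_j G j (cmask j f) = \prod_j \sum_(f | sub_class j f) G j f.
Proof.
rewrite bigA_distr_big_dep /=.
pose F (f : {ffun T -> bool}) : {ffun J -> {ffun T -> bool}} := [ffun j => cmask j f].
rewrite (reindex_onto F (fun g => [ffun x => g (c x) x])) /=.
  apply: eq_big => [f|f _]; last by apply: eq_bigr => j _; rewrite ffunE.
  apply/esym/andP; split.
    apply/familyP => j; rewrite ffunE; apply/forallP => x; rewrite ffunE.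
    by apply/implyP => /andP[].
  by apply/eqP/ffunP => x; rewrite !ffunE eqxx andbT.
move=> g /familyP h; apply/ffunP => j; rewrite ffunE; apply/ffunP => x; rewrite !ffunE.
case: eqP => [->|/eqP cj]; rewrite ?andbT // andbF; apply/esym/negP => gx.
by have /forallP/(_ x) := h j; rewrite gx (negPf cj).
Qed.
End Distribute.

Section Inversions.
Local Open Scope nat_scope.
Variable n : nat.
Implicit Types (X Y : {set 'I_n}) (f : 'I_n -> bool).

Definition dnS f X := \sum_(x in X) f x.
Definition upS f X := \sum_(x in X) ~~ f x.
Definition invS f X := \sum_(x in X) \sum_(y in X | x < y) (f x * ~~ f y).

Lemma dnSU f X Y : [disjoint X & Y] -> dnS f (X :|: Y) = dnS f X + dnS f Y.
Proof. by move=> h; rewrite /dnS -bigU //; apply: eq_bigl => x; rewrite inE. Qed.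
Lemma upSU f X Y : [disjoint X & Y] -> upS f (X :|: Y) = upS f X + upS f Y.
Proof. by move=> h; rewrite /upS -bigU //; apply: eq_bigl => x; rewrite inE. Qed.

Lemma upS_dnS f X : upS f X = #|X| - dnS f X.
Proof.
rewrite -sum1_card /dnS /upS; have -> : \sum_(i in X) 1 = \sum_(i in X) ~~ f i + \sum_(i in X) f i.
  by rewrite -big_split; apply: eq_bigr => x _; case: (f x).
by rewrite addnK.
Qed.

Lemma eq_dnS f g X : {in X, f =1 g} -> dnS f X = dnS g X.
Proof. by move=> h; apply: eq_bigr => x /h->. Qed.
Lemma eq_upS f g X : {in X, f =1 g} -> upS f X = upS g X.
Proof. by move=> h; apply: eq_bigr => x /h->. Qed.
Lemma eq_invS f g X : {in X, f =1 g} -> invS f X = invS g X.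
Proof. by move=> h; apply: eq_bigr => x xX; apply: eq_bigr => y /andP[yX _]; rewrite !h. Qed.

Lemma invSU f X Y : (forall x y, x \in X -> y \in Y -> x < y) ->
  invS f (X :|: Y) = invS f X + invS f Y + dnS f X * upS f Y.
Proof.
move=> XY; have h : [disjoint X & Y].
  rewrite -setI_eq0; apply/eqP/setP => x; rewrite !inE; apply/negP => /andP[xX xY].
  by have := XY _ _ xX xY; rewrite ltnn.
have bU (P : pred 'I_n) (F : 'I_n -> nat) :
    \sum_(y in X :|: Y | P y) F y = \sum_(y in X | P y) F y + \sum_(y in Y | P y) F y.
  rewrite !big_mkcondr -bigU //=; apply: eq_bigl => x; by rewrite inE.
rewrite /invS (eq_bigl (fun x => (x \in X :|: Y) && true)) => [|x]; last by rewrite andbT.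
rewrite bU; under eq_bigl do rewrite andbT.
under [X in _ + X = _]eq_bigl do rewrite andbT.
under eq_bigr do rewrite bU.
under [X in _ + X = _]eq_bigr do rewrite bU.
rewrite !big_split /= -!addnA; congr addn.
rewrite [X in _ + (X + _)]big1 => [|x xY]; last first.
  by rewrite big1 // => y /andP[yX xy]; have := ltn_trans xy (XY _ _ yX xY); rewrite ltnn.
rewrite add0n addnC; congr addn; rewrite /dnS big_distrl; apply: eq_bigr => x xX /=.
rewrite /upS big_distrr /=; apply: eq_bigl => y.
by rewrite andb_idr // => /(XY _ _ xX).
Qed.
End Inversions.

End SignedWords.

(** * The symmetric vectors in a power of V_1 *)

Section JuxtaposedWords.

Section Iota.
Variables (K : fieldType) (q : K).
Hypothesis q0 : q != 0.
Hypothesis qnr : forall n, (0 < n)%N -> q ^+ n != q ^- n.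
Variable n : nat.
Local Notation one := (fun _ : 'I_n => 1%N).
Implicit Types (f : 'I_n -> bool) (s t : 'I_n).

Definition b2n f : 'I_n -> nat := fun j => f j.

Lemma inr_b2n f : inr one (b2n f).
Proof. by apply/inrP => t; rewrite /b2n; case: (f t). Qed.

Lemma b2nK (v : 'I_n -> nat) : inr one v -> b2n (fun j => v j == 1%N) = v.
Proof. by move=> /inrP h; apply: funext => t; rewrite /b2n; move: (h t); case: (v t) => [|[]]. Qed.

(** The image of v_(n-2u) under iota, by [iota_tbas] below: words with u downs, weighted by q^-1 for
    each down before an up. *)
Definition Jv u : gtens K one :=
  mk one (fun v => let f := fun j => v j == 1%N in
    (dnS f [set: 'I_n]%SET == u)%:R * q ^- invS f [set: 'I_n]%SET).

Lemma cf_Jv f u : cf (b2n f) (Jv u) =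
  (dnS f [set: 'I_n]%SET == u)%:R * q ^- invS f [set: 'I_n]%SET.
Proof.
rewrite cf_mk inr_b2n /=.
have -> : (fun j => b2n f j == 1%N) = f by apply: funext => j; rewrite /b2n; case: (f j).
by [].
Qed.

Lemma gext_b2n (z z' : gtens K one) : (forall f, cf (b2n f) z = cf (b2n f) z') -> z = z'.
Proof. by move=> h; apply: gext => v /b2nK <-; apply: h. Qed.

Definition setf f s : 'I_n -> bool := fun t => f t && (t != s).

Lemma dn_b2n f s : f s -> dn (b2n f) s = b2n (setf f s).
Proof.
move=> fs; apply: funext => t; rewrite /dn /b2n /setf.
by case: eqVneq => [->|_]; rewrite ?fs ?andbF // andbT subn0.
Qed.

Definition lows s := [set t : 'I_n | t < s]%N.
Definition highs s := [set t : 'I_n | s < t]%N.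

Lemma setT_split s : [set: 'I_n]%SET = (lows s :|: ([set s] :|: highs s))%SET.
Proof.
apply/setP => t; rewrite !inE -(inj_eq val_inj) /=; by case: ltngtP.
Qed.

Lemma invS_split f s : invS f [set: 'I_n]%SET =
  (invS f (lows s) + invS f (highs s) + f s * upS f (highs s)
   + dnS f (lows s) * (~~ f s + upS f (highs s)))%N.
Proof.
rewrite (setT_split s) !invSU; last 2 first.
- by move=> x y; rewrite !inE => /eqP->.
- by move=> x y; rewrite !inE => xs /orP[/eqP->//|]; apply: ltn_trans.
have d1 : [disjoint [set s] & highs s].
  rewrite -setI_eq0; apply/eqP/setP => x; rewrite !inE; apply/negP => /andP[/eqP->].
  by rewrite ltnn.
have -> : invS f [set s] = 0%N.
  by rewrite /invS big_set1 big1 // => y; rewrite inE => /andP[/eqP->]; rewrite ltnn.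
rewrite upSU // /upS big_set1 /dnS !big_set1 add0n !addnA; congr (_ + _)%N.
Qed.

Lemma dnS_split f s : dnS f [set: 'I_n]%SET = (dnS f (lows s) + f s + dnS f (highs s))%N.
Proof.
rewrite (setT_split s) !dnSU /dnS ?big_set1 ?addnA //.
- rewrite -setI_eq0; apply/eqP/setP => x; rewrite !inE; apply/negP => /andP[/eqP->].
  by rewrite ltnn.
- rewrite -setI_eq0; apply/eqP/setP => x; rewrite !inE; apply/negP => /andP[xs].
  by case/orP => [/eqP e|h]; [move: xs; rewrite e ltnn|move: (ltn_trans xs h); rewrite ltnn].
Qed.

(** Turning the down at s into an up adds the downs before s to the inversions and removes the ups
    after s. With the K^-1 on the later factors this leaves the summand of [qz_telescope] for x_t =
    - f t. *)
Lemma gF_Jv u : gF q n (Jv u) = qn q u.+1 *: Jv u.+1.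
Proof.
apply: gext_b2n => f; rewrite cfZ cf_gF cf_Jv.
set N := dnS f _; set I := invS f _.
have key s : (s < n)%N -> q ^ (- wF one (b2n f) s n) * cf (b2n f) (gf q s (Jv u)) =
   (N == u.+1)%:R * q ^- I *
   - (q ^ (\sum_(t < n | (t < s)%N) - (f t)%:Z - \sum_(t < n | (s < t)%N) - (f t)%:Z) * qz q (- (f s)%:Z)).
  move=> _; rewrite cf_gf /b2n; case: (boolP (f s)) => fs; last first.
    by rewrite qn0 oppr0 qz0 mul0r !mulr0 oppr0 mulr0.
  rewrite mul1r -/(b2n f) dn_b2n // cf_Jv.
  have fss : setf f s s = false by rewrite /setf eqxx andbF.
  have eq1 (X : {set 'I_n}) : s \notin X -> {in X, setf f s =1 f}.
    by move=> sX t tX; rewrite /setf (_ : t != s) ?andbT //; apply: contraNneq sX => <-.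
  have sl : s \notin lows s by rewrite inE ltnn.
  have sh : s \notin highs s by rewrite inE ltnn.
  have eN : N = (dnS (setf f s) [set: 'I_n]%SET).+1.
    rewrite /N !(dnS_split _ s) fss fs (eq_dnS (eq1 _ sl)) (eq_dnS (eq1 _ sh)).
    by rewrite addn0 addn1 addSn.
  have eI : (I + dnS f (lows s) = invS (setf f s) [set: 'I_n]%SET + upS f (highs s))%N.
    rewrite /I !(invS_split _ s) fss fs.
    rewrite !(eq_invS (eq1 _ sl), eq_invS (eq1 _ sh), eq_upS (eq1 _ sh), eq_dnS (eq1 _ sl)).
    rewrite /= !mul1n !mul0n; lia.
  have PS (P : pred 'I_n) (g : 'I_n -> nat) :
      (\sum_(t | P t) g t)%N%:Z = \sum_(t | P t) (g t)%:Z.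
    exact: (big_morph Posz PoszD (erefl 0%:Z)).
  have eW : wF one (b2n f) s n = (upS f (highs s))%:Z - (dnS f (highs s))%:Z.
    rewrite /wF /upS /dnS !PS -sumrB; apply: eq_big => t; first by rewrite inE ltn_ord andbT.
    by rewrite /hw /b2n => _; case: (f t).
  have -> : \sum_(t < n | (t < s)%N) - (f t)%:Z = - (dnS f (lows s))%:Z.
    by rewrite /dnS PS sumrN; congr (- _); apply: eq_bigl => t; rewrite inE.
  have -> : \sum_(t < n | (s < t)%N) - (f t)%:Z = - (dnS f (highs s))%:Z.
    by rewrite /dnS PS sumrN; congr (- _); apply: eq_bigl => t; rewrite inE.
  rewrite eN eqSS eW qzN mulrN opprK -!(qnE q 1) /Submission.qn expr1 divff ?(qmV_neq0 qnr) // mul1r mulrN1 mulrN opprK.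
  rewrite mulrCA -mulrA; congr (_ * _); rewrite !exprnN -!expfzDr //; congr (q ^ _).
  by move: eI; clear; lia.
have -> : \sum_(s < n | (s < n)%N) q ^ (- wF one (b2n f) s n) * cf (b2n f) (gf q s (Jv u)) =
  - ((N == u.+1)%:R * q ^- I * qz q (\sum_(t < n) - (f t)%:Z)).
  rewrite (eq_bigr _ key) -qz_telescope // mulr_sumr -sumrN.
  by apply: eq_big => s; rewrite ?ltn_ord // => _; rewrite mulrN.
rewrite sumrN qzN mulrN opprK mulrC; have -> : \sum_(t < n) (f t)%:Z = N%:Z.
  rewrite /N /dnS (big_morph Posz PoszD (erefl 0%:Z)); apply: eq_bigl => t; by rewrite inE.
by rewrite -qnE; case: eqP => [->|_]; rewrite ?mul0r ?mulr0.
Qed.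

End Iota.

End JuxtaposedWords.

(** * Coordinates of iota and pi *)

Section SymmetricPowers.

Section Transport.
Local Open Scope nat_scope.
Variables (N : nat) (L : seq 'I_N) (f : 'I_N -> bool).
Hypothesis Ls : sorted (fun x y : 'I_N => x < y) L.

Let tr : transitive (fun x y : 'I_N => x < y).
Proof. by move=> ? ? ?; apply: ltn_trans. Qed.

Let Lu : uniq L.
Proof. by apply: (sorted_uniq tr) Ls => x; rewrite ltnn. Qed.

Lemma big_sorted_nth (F : 'I_N -> nat) (P : pred 'I_N) x0 :
  \sum_(x in [set x in L] | P x) F x = \sum_(j < size L | P (nth x0 L j)) F (nth x0 L j).
Proof.
rewrite (eq_bigl (fun x => (x \in L) && P x)) => [|x]; last by rewrite inE.
rewrite big_mkcondr -big_uniq //= (big_nth x0) big_mkord.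
by rewrite -big_mkcond.
Qed.

(** Iota and pi number the letters of a box from 0, the match uses vertices of the whole line; L is
    increasing, so downs and inversions are the same in both numberings. *)
Lemma dnS_transport n : n = size L ->
  dnS (fun j : 'I_n => nth false (map f L) j) [set: 'I_n] = dnS f [set x in L].
Proof.
move=> ->; rewrite /dnS; case: (posnP (size L)) => [s0|].
  rewrite big1 => [|j]; last by have := ltn_ord j; rewrite [X in _ < X]s0.
  by rewrite big1 // => x; rewrite inE (size0nil s0).
case E : L => [//|x0 L'] _; rewrite -E.
rewrite [RHS](eq_bigl (fun x => (x \in [set x in L]) && true)) => [|x]; last by rewrite andbT.
rewrite (big_sorted_nth _ xpredT x0); apply: eq_big => j; rewrite ?inE // => _.
by rewrite (nth_map x0).
Qed.

Lemma invS_transport n : n = size L ->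
  invS (fun j : 'I_n => nth false (map f L) j) [set: 'I_n] = invS f [set x in L].
Proof.
move=> ->; rewrite /invS; case: (posnP (size L)) => [s0|].
  rewrite big1 => [|j]; last by have := ltn_ord j; rewrite [X in _ < X]s0.
  by rewrite big1 // => x; rewrite inE (size0nil s0).
case E : L => [//|x0 L'] _; rewrite -E.
rewrite [RHS](eq_bigl (fun x => (x \in [set x in L]) && true)) => [|x]; last by rewrite andbT.
rewrite (big_sorted_nth _ xpredT x0); apply: eq_big => j; rewrite ?inE // => _.
rewrite (big_sorted_nth _ (fun y => nth x0 L j < y) x0).
have lt (i1 i2 : 'I_(size L)) : (nth x0 L i1 < nth x0 L i2) = (i1 < i2).
  have H (a b : 'I_(size L)) : a < b -> nth x0 L a < nth x0 L b.
    by move=> ab; apply: (sorted_ltn_nth tr x0 Ls); rewrite ?inE.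
  case: (ltngtP i1 i2) => [/H->//|/H h|/val_inj ->]; last by rewrite ltnn.
  by rewrite ltnNge ltnW.
by apply: eq_big => l; rewrite ?inE ?lt // => _; rewrite !(nth_map x0).
Qed.
End Transport.

Section PiIota.
Variable R : realType.
Local Notation K := (Cq R).
Local Notation q := (@q R).
Let q0 := q_neq0 R.
Let qnr := @q_regular R.

Lemma q_int_inj (x y : int) : q ^ x = q ^ y -> x = y.
Proof.
suff H (n : nat) (z : int) : q ^ (z + n%:Z) = q ^ z -> n = 0%N.
  move=> e1; have [[n en]|[n en]] : (exists n : nat, y = x + n%:Z) \/ (exists n : nat, x = y + n%:Z).
  - by case: (boolP (x <= y)) => h; [left; exists `|y - x|%N|right; exists `|x - y|%N]; lia.
  - by have := H n x; rewrite -en e1 => /(_ erefl) n0; rewrite en n0 addr0.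
  - by have := H n y; rewrite -en e1 => /(_ erefl) n0; rewrite en n0 addr0.
rewrite expfzDr // -[RHS]mulr1 => /(mulfI (expfz_neq0 z q0)) e1.
case: n e1 => // n e1; have := qnr (ltn0Sn n).
by rewrite (e1 : q ^+ n.+1 = 1) invr1 eqxx.
Qed.

Lemma cf_tbas k (e u v : 'I_k -> nat) : inr e v ->
  cf v (tbas R e u : gtens K e) = [forall i, v i == u i]%:R.
Proof.
by move=> vr; rewrite /cf vr ffunE; congr (nat_of_bool _)%:R; apply: eq_forallb => i; rewrite mkiE.
Qed.

Lemma tbas_sum k (e : 'I_k -> nat) (z : tens R e) :
  z = \sum_(a : idx e) z a *: (tbas R e (fun i => a i) : gtens K e).
Proof.
apply/ffunP => a; rewrite sum_ffunE (bigD1 a) //= big1 ?addr0 => [|b ba].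
  rewrite !ffunE (_ : [forall i, _]) ?[RHS]mulr1 //; by apply/forallP.
rewrite !ffunE (_ : [forall i, _] = false) ?[LHS]mulr0 //.
apply: contraNF ba => /forallP h; apply/eqP/ffunP => i; apply/esym/val_inj/eqP/h.
Qed.

Lemma actF_Vn n u : actF (tbas R (fun _ : 'I_1 => n) (fun=> u)) =
  qn q u.+1 *: (tbas R (fun _ : 'I_1 => n) (fun=> u.+1) : gtens K (fun _ : 'I_1 => n)).
Proof.
rewrite /actF actF_firstE; apply: gext => v vr; rewrite cfZ cf_gF big_mkcond big_ord_recl big_ord0 /= addr0.
rewrite /wF big_pred0 ?oppr0 ?expr0z ?mul1r => [|t]; last by rewrite (ord1 t).
rewrite cf_gf; have /inrP/(_ ord0) -> := vr; rewrite mul1r.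
rewrite !cf_tbas ?inr_dn //; have [v0|v0] := posnP (v ord0).
  rewrite v0 qn0 mul0r (_ : [forall i, v i == u.+1] = false) ?mulr0 //.
  by apply/forallP => /(_ ord0); rewrite v0.
have -> : [forall i, v i == u.+1] = (v ord0 == u.+1).
  by apply/forallP/eqP => [/(_ ord0)/eqP//|h i]; rewrite (ord1 i) h.
have -> : [forall i, dn v ord0 i == u] = (v ord0 == u.+1).
  rewrite -(prednK v0) eqSS -dnE.
  by apply/forallP/eqP => [/(_ ord0)/eqP//|h i]; rewrite (ord1 i) h.
by case: eqP => [->|_]; rewrite ?mulr0.
Qed.

Variable n : nat.
Variables (phi : 'Hom(Vn R n, V1pow R n)) (psi : 'Hom(V1pow R n, Vn R n)).
Hypothesis Hphi : is_iota phi.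
Hypothesis Hpsi : is_pi psi.

Lemma tbas_Jv0 : tbas R (fun _ : 'I_n => 1%N) (fun=> 0%N) = Jv q n 0.
Proof.
apply: gext_b2n => f; rewrite cf_Jv cf_tbas ?inr_b2n //.
have -> : [forall i, b2n f i == 0%N] = (dnS f [set: 'I_n]%SET == 0%N).
  rewrite /dnS sum_nat_eq0; apply/forallP/forallP => h i; have := h i; rewrite ?inE //.
case: eqP => [h|_]; last by rewrite mul0r.
rewrite (_ : invS f _ = 0%N) ?expr0 ?invr1 ?mulr1 //.
apply/eqP; rewrite /invS sum_nat_eq0; apply/forallP => x; apply/implyP => _.
move/eqP: h; rewrite /dnS sum_nat_eq0 => /forallP/(_ x); rewrite inE /= eqb0 => /negPf->.
by rewrite sum_nat_eq0; apply/forallP => y; apply/implyP.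
Qed.

Lemma iota_tbas u : (u <= n)%N -> phi (tbas R _ (fun=> u)) = Jv q n u.
Proof.
have [[_ hF _ _] h0] := Hphi.
elim: u => [_|u IH un]; first by rewrite h0 tbas_Jv0.
have := hF (tbas R _ (fun=> u)); rewrite actF_Vn linearZ_LR IH ?(ltnW un) //.
rewrite /actF actF_firstE gF_Jv //.
by move=> /(scalerI (qn_neq0 qnr (ltn0Sn u))).
Qed.

Lemma pi_iota u : (u <= n)%N -> psi (Jv q n u) = tbas R _ (fun=> u).
Proof.
have [[_ hF _ _] h0] := Hpsi.
elim: u => [_|u IH un]; first by rewrite -h0 tbas_Jv0.
have := hF (Jv q n u); rewrite /actF actF_firstE gF_Jv // linearZ_LR IH ?(ltnW un) //.
by rewrite -/(actF _) actF_Vn => /(scalerI (qn_neq0 qnr (ltn0Sn u))).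
Qed.

Lemma pi_weight (f : 'I_n -> bool) (a : 'I_n.+1) :
  psi (tbas R _ (b2n f)) [ffun=> a] != 0 -> dnS f [set: 'I_n]%SET = a.
Proof.
have [[_ _ hK _] _] := Hpsi; have := hK (tbas R _ (b2n f)).
have -> : actK (tbas R (fun _ : 'I_n => 1%N) (b2n f)) = q ^ (\sum_t hw (fun=> 1%N) (b2n f) t) *:
    (tbas R (fun _ : 'I_n => 1%N) (b2n f) : gtens K _).
  rewrite actKE; apply: gext => v vr; rewrite cfZ cf_gKt cf_tbas //.
  case: (boolP [forall i, v i == b2n f i]) => [/forallP h|_]; last by rewrite !mulr0.
  by have -> : v = b2n f by apply: funext => t; apply/eqP.
rewrite linearZ_LR actKE => /(congr1 (fun z : gtens K (fun _ : 'I_1 => n) => cf (fun=> a) z)).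
have ar : inr (fun _ : 'I_1 => n) (fun=> a : nat) by apply/inrP => t; rewrite -ltnS.
rewrite cfZ cf_gKt; set c := cf _ _ => e1.
have -> : psi (tbas R _ (b2n f)) [ffun=> a] = c.
  by rewrite /c /cf ar; congr (fun_of_fin _ _); apply/ffunP => t; rewrite !ffunE inord_val.
move=> c0; move/(mulIf c0)/q_int_inj: e1; rewrite big_ord_recl big_ord0 addr0.
rewrite /hw sumrB sumr_const card_ord.
have -> : \sum_(i < n) (b2n f i)%:Z *+ 2 = (dnS f [set: 'I_n]%SET)%:Z *+ 2.
  rewrite sumrMnl /dnS (big_morph Posz PoszD (erefl 0%:Z)); congr (_ *+ 2).
  by apply: eq_bigl => t; rewrite inE.
by move: (dnS _ _) => N; lia.
Qed.

(** The identity pi o iota = id in coordinates, words of the wrong weight being killed by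
    [pi_weight]. The computation of gamma uses exactly these two facts about pi. *)
Lemma pi_sum (a : 'I_n.+1) :
  \sum_(f : {ffun 'I_n -> bool}) q ^- invS f [set: 'I_n]%SET * psi (tbas R _ (b2n f)) [ffun=> a] = 1.
Proof.
have an : (a <= n)%N by rewrite -ltnS.
have := pi_iota an; rewrite [Jv q n a]tbas_sum linear_sum => /ffunP/(_ [ffun=> a]).
rewrite sum_ffunE [RHS]ffunE (_ : [forall i, _]); last by apply/forallP => i; rewrite ffunE.
move=> e1; apply: etrans e1; rewrite [RHS](reindex (fun v : {ffun 'I_n -> bool} => [ffun j => inord (v j)] : idx (fun _ : 'I_n => 1%N))) /=.
  apply: eq_bigr => f _; rewrite linearZ_LR ffunE.
  have -> : (fun i => ([ffun j => inord (f j)] : idx (fun _ : 'I_n => 1%N)) i : nat) = b2n f.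
    by apply: funext => i; rewrite ffunE inordK // /b2n; case: (f i).
  have -> : Jv q n a [ffun j => inord (f j)] = cf (b2n f) (Jv q n a).
    rewrite /cf inr_b2n; congr (fun_of_fin _ _); by apply/ffunP => i; rewrite !ffunE.
  rewrite cf_Jv.
  have [p0|p0] := eqVneq (psi (tbas R _ (b2n f)) [ffun=> a]) 0; first by rewrite p0 mulr0 [RHS]mulr0.
  by rewrite (pi_weight p0) eqxx mul1r.
exists (fun v : idx (fun _ : 'I_n => 1%N) => [ffun j => v j == 1%N :> nat]) => [f _|v _].
  by apply/ffunP => j; rewrite !ffunE inordK; case: (f j).
apply/ffunP => j; rewrite !ffunE; apply: val_inj; rewrite /= inordK; move: (v j) => [[|[]] h] //=.
Qed.

End PiIota.

End SymmetricPowers.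

(** * Matrix coefficients of gamma *)

Section GammaCoefficients.

Section GammaFormula.
Variable R : realType.
Local Notation K := (Cq R).
Local Notation q := (@q R).
Let q0 := q_neq0 R.
Let qnr := @q_regular R.
Variables (k : nat) (d : 'I_k -> nat).
Local Notation T := 'I_(tot d).
Variables (iota_ : forall n, 'Hom(Vn R n, V1pow R n))
          (pi_ : forall n, 'Hom(V1pow R n, Vn R n)).
Hypothesis Hiota : forall n, is_iota (iota_ n).
Hypothesis Hpi : forall n, is_pi (pi_ n).
Implicit Types (S : arcs d) (i : 'I_k) (f : T -> bool).

Lemma prod_option (I : finType) (F : option I -> K) :
  \prod_j F j = F None * \prod_i F (Some i).
Proof.
rewrite (bigD1 None) //=; congr (_ * _).
rewrite (reindex_omap (@Some I) id) /=; first by apply: eq_bigl => i; rewrite eqxx.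
by case.
Qed.

Definition Bs i : {set T} := [set x : T | inbox d i x]%SET.
Definition Ls S i : {set T} := [set x : T | inbox d i x && isL S x]%SET.
Definition Rs S i : {set T} := [set x : T | inbox d i x && isR S x]%SET.
Definition Us S i : {set T} := [set x : T | inbox d i x && ~~ matched S x]%SET.

Definition Lbox i : seq T := [seq x : T <- enum T | inbox d i x].
Definition Ubox S i : seq T := [seq x : T <- enum T | inbox d i x && ~~ matched S x].

Lemma enumT_sorted (P : pred T) : sorted (fun x y : T => (x < y)%N) [seq x : T <- enum T | P x].
Proof.
apply: sorted_filter => [x y z|]; first exact: ltn_trans.
by rewrite -(@sorted_map _ _ val ltn) val_enum_ord iota_ltn_sorted.
Qed.

Lemma set_filter (P : pred T) : [set x in [seq x : T <- enum T | P x]]%SET = [set x | P x]%SET.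
Proof. by apply/setP => x; rewrite !inE mem_filter mem_enum andbT. Qed.

Lemma size_filter_card (P : pred T) : size [seq x : T <- enum T | P x] = #|[set x | P x]%SET|.
Proof. by rewrite -set_filter cardsE; apply/esym/card_uniqP; rewrite filter_uniq // enum_uniq. Qed.

Lemma val_Lbox i : [seq val x | x <- Lbox i] = iota (Defs.off d i) (d i).
Proof.
apply: (irr_sorted_eq ltn_trans ltnn).
- by rewrite sorted_map; apply: enumT_sorted.
- exact: iota_ltn_sorted.
move=> y; rewrite mem_iota -/(inbox d i y); apply/mapP/idP => [[x]|yi].
  by rewrite mem_filter => /andP[h _] ->.
have yt : (y < tot d)%N by case/andP: yi => _ h; apply: leq_trans h (off_tot d i).
by exists (Ordinal yt) => //; rewrite mem_filter mem_enum andbT.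
Qed.

Lemma lettersE (b : (tot d).-tuple bool) i : letters d b i = [seq tnth b x | x <- Lbox i].
Proof.
rewrite /letters -val_Lbox -map_comp; apply: eq_map => x /=.
by rewrite (tnth_nth false).
Qed.

Lemma ulettersE S (b : (tot d).-tuple bool) i : uletters S b i = [seq tnth b x | x <- Ubox S i].
Proof.
rewrite /uletters -val_Lbox filter_map -map_comp.
have -> : Ubox S i = [seq x : T <- Lbox i | ~~ matched S x].
  by rewrite /Ubox /Lbox -filter_predI; apply: eq_filter => x; rewrite /= andbC.
apply: eq_map => x /=; by rewrite (tnth_nth false).
Qed.

Lemma size_Lbox i : size (Lbox i) = d i.
Proof. by rewrite -(size_map val) val_Lbox size_iota. Qed.

Lemma word_fun n (s : seq bool) :
  (fun j => word n s j : nat) = b2n (fun j : 'I_n => nth false s j).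
Proof. by apply: funext => j; rewrite ffunE inordK // /b2n; case: nth. Qed.

Lemma iota_coef i (u : nat) (b : (tot d).-tuple bool) : (u <= d i)%N ->
  (iota_ (d i) (tbas R _ (fun=> u)) : V1pow R _) (word (d i) (letters d b i)) =
  (dnS (tnth b) (Bs i) == u)%:R * q ^- invS (tnth b) (Bs i).
Proof.
move=> ud; rewrite (iota_tbas (Hiota _) ud) -cf_idx word_fun cf_Jv lettersE.
have e1 : d i = size (Lbox i) by rewrite size_Lbox.
by rewrite (dnS_transport _ (enumT_sorted _) e1) (invS_transport _ (enumT_sorted _) e1) set_filter.
Qed.

Section Fixed.
Variable S : arcs d.
Hypothesis HS : lcm_spec S.
Local Notation m := (fun i => nS S i - rS S i)%N.

Lemma size_Ubox i : m i = size (Ubox S i).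
Proof. by rewrite /= (nrE HS) size_filter_card. Qed.

Definition PIc i (a : 'I_(m i).+1) f : K :=
  pi_ (m i) (tbas R _ (b2n (fun j : 'I_(m i) => nth false [seq f x | x <- Ubox S i] j))) [ffun=> a].

Arguments PIc : clear implicits.

Lemma PIc_weight i (a : 'I_(m i).+1) f : PIc i a f != 0 -> dnS f (Us S i) = a.
Proof.
move=> /(pi_weight (Hpi _)); rewrite (dnS_transport _ (enumT_sorted _) (size_Ubox i)).
by rewrite set_filter.
Qed.

Lemma PIc_eq i (a : 'I_(m i).+1) f g : {in Us S i, f =1 g} -> PIc i a f = PIc i a g.
Proof.
move=> h; rewrite /PIc; have -> // : [seq f x | x <- Ubox S i] = [seq g x | x <- Ubox S i].
by apply/eq_in_map => x; rewrite mem_filter => /andP[h1 _]; apply: h; rewrite inE.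
Qed.

(** The classes for [sum_classes]: all matched vertices together, the unmatched ones box by box. *)
Definition ocls (x : T) : option 'I_k :=
  if matched S x then None else [pick i | inbox d i x].

Lemma oclsN x : (ocls x == None) = matched S x.
Proof.
rewrite /ocls; case: ifP => // _; case: pickP => // h.
by have [i xi] := box_ex (ltn_ord x); rewrite h in xi.
Qed.

Lemma oclsS x i : (ocls x == Some i) = (x \in Us S i).
Proof.
rewrite inE /ocls; case: ifP => // _; rewrite ?andbF ?andbT //.
case: pickP => [j xj|h]; last by rewrite h.
by apply/eqP/idP => [[<-]//|xi]; rewrite (inbox_inj xi xj).
Qed.

Lemma PIc_sum i (a : 'I_(m i).+1) :
  \sum_(f | sub_class ocls (Some i) f) q ^- invS f (Us S i) * PIc i a f = 1.
Proof.
rewrite -(pi_sum (Hpi _) a).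
have Uu : uniq (Ubox S i) by rewrite filter_uniq // enum_uniq.
have UU x : (x \in Ubox S i) = (x \in Us S i) by rewrite mem_filter inE mem_enum andbT.
pose g (f : {ffun T -> bool}) : {ffun 'I_(m i) -> bool} :=
  [ffun j : 'I_(m i) => nth false [seq f x | x <- Ubox S i] j].
pose h (p : {ffun 'I_(m i) -> bool}) : {ffun T -> bool} :=
  [ffun x => (x \in Ubox S i) && nth false [seq p j | j <- enum 'I_(m i)] (index x (Ubox S i))].
rewrite [RHS](reindex_onto g h) /= => [|p _].
  apply: eq_big => [f|f _].
    apply/forallP/eqP => [hf|<- x].
      apply/ffunP => x; rewrite ffunE UU -oclsS.
      case: (boolP (ocls x == Some i)) => [cx|cx] /=; last first.
        by have := hf x; rewrite (negPf cx); case: (f x).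
      have xU : x \in Ubox S i by rewrite UU -oclsS.
      have xm : (index x (Ubox S i) < m i)%N by rewrite size_Ubox index_mem.
      rewrite (nth_map (Ordinal xm)) ?size_enum_ord // ffunE nth_enum_ord //.
      by rewrite (nth_map x) ?index_mem // nth_index.
    by rewrite ffunE UU -oclsS; apply/implyP => /andP[].
  congr (q ^- _ * _).
    rewrite -[Us S i](set_filter (fun x : T => inbox d i x && ~~ matched S x)).
    rewrite -(invS_transport f (enumT_sorted _) (size_Ubox i)).
    by apply: eq_invS => j _; rewrite ffunE.
  rewrite /PIc; have -> // : b2n (g f) = b2n (fun j : 'I_(m i) => nth false [seq f x | x <- Ubox S i] j).
  by apply: funext => j; rewrite /b2n ffunE.
apply/ffunP => j; rewrite ffunE.
have js : (j < size (Ubox S i))%N by rewrite -size_Ubox.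
case E : (Ubox S i) js => [//|x0 L] js; rewrite -E in js *.
rewrite (nth_map x0) // ffunE mem_nth //= index_uniq //.
by rewrite (nth_map j) ?size_enum_ord // nth_ord_enum.
Qed.

(** The inversions of box i that involve a matched vertex. By the order of the vertices in a box
    they see the unmatched letters only through their number [a] of downs. *)
Definition exS i f (a mi : nat) : nat :=
  (invS f (Rs S i) + invS f (Ls S i) + dnS f (Rs S i) * upS f (Ls S i)
   + dnS f (Rs S i) * (mi - a) + upS f (Ls S i) * a)%N.

Lemma box_split i : Bs i = (Rs S i :|: (Us S i :|: Ls S i))%SET.
Proof.
by apply/setP => x; rewrite !inE matchedE; case: (inbox d i x) => //=;
  case: (isL S x); case: (isR S x).
Qed.

Lemma matched_box f i : invS f (Bs i) = (invS f (Us S i) + exS i f (dnS f (Us S i)) #|Us S i|)%N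
  /\ dnS f (Bs i) = (dnS f (Rs S i) + dnS f (Ls S i) + dnS f (Us S i))%N.
Proof.
have UL x y : x \in Us S i -> y \in Ls S i -> (x < y)%N.
  rewrite !inE matchedE negb_or => /andP[xi /andP[nL _]] /andP[yi yL].
  case: (ltngtP x y) => // [yx|xy]; last by rewrite xy yL in nL.
  by rewrite (L_up HS yi xi yx yL) in nL.
have RU x y : x \in Rs S i -> y \in Us S i -> (x < y)%N.
  rewrite !inE matchedE negb_or => /andP[xi xR] /andP[yi /andP[_ nR]].
  case: (ltngtP x y) => // [yx|xy]; last by rewrite -xy xR in nR.
  by rewrite (R_down HS yi xi yx xR) in nR.
have RL x y : x \in Rs S i -> y \in Ls S i -> (x < y)%N.
  rewrite !inE => /andP[xi xR] /andP[yi yL].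
  case: (ltngtP x y) => // [yx|xy]; last by case: (not_LRx HS yL); rewrite -xy.
  by case: (not_LRx HS (L_up HS yi xi yx yL)).
have disj (X Y : {set T}) : (forall x y, x \in X -> y \in Y -> (x < y)%N) -> [disjoint X & Y].
  move=> h; rewrite -setI_eq0; apply/eqP/setP => x; rewrite !inE.
  by apply/negP => /andP[xX xY]; have := h _ _ xX xY; rewrite ltnn.
have RUL x y : x \in Rs S i -> y \in (Us S i :|: Ls S i)%SET -> (x < y)%N.
  by move=> xR; rewrite finset.in_setU => /orP[]; [apply: RU|apply: RL].
rewrite box_split !invSU // !dnSU ?disj // !upSU ?disj // /exS -upS_dnS; split; lia.
Qed.

Definition Hval (u a : 'I_k -> nat) f : K :=
  (\prod_(x in S) eps R (f x.1) (f x.2)) *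
  \prod_i ((dnS f (Rs S i) + dnS f (Ls S i) + a i == u i)%N%:R * q ^- exS i f (a i) (m i)).

Lemma Hval_eq u a f g : (forall x : T, matched S x -> f x = g x) -> Hval u a f = Hval u a g.
Proof.
move=> h; rewrite /Hval; congr (_ * _).
  apply: eq_bigr => x xS; rewrite !h // matchedE; apply/orP; [right|left];
    by [apply/isRP; exists x|apply/isLP; exists x].
have hR i : {in Rs S i, f =1 g} by move=> x; rewrite inE => /andP[_ xR]; apply: h; rewrite matchedE xR orbT.
have hL i : {in Ls S i, f =1 g} by move=> x; rewrite inE => /andP[_ xR]; apply: h; rewrite matchedE xR.
apply: eq_bigr => i _; rewrite /exS !(eq_dnS (hR i), eq_dnS (hL i), eq_invS (hR i), eq_invS (hL i)).
by rewrite !(eq_upS (hL i)).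
Qed.

Definition Gam (a u : 'I_k -> nat) : K := \sum_(f | sub_class ocls None f) Hval u a f.

(** The summand factors over the classes of [ocls]. Each unmatched class gives the normalised sum of
    [PIc_sum], which is 1, so only the letters at matched vertices remain. *)
Lemma gamma_sum (u : 'I_k -> nat) (a : idx m) :
  \sum_(f : {ffun T -> bool}) (\prod_i ((dnS f (Bs i) == u i)%:R * q ^- invS f (Bs i))) *
     (\prod_(x in S) eps R (f x.1) (f x.2)) * (\prod_i PIc i (a i) f) = Gam (fun i => a i) u.
Proof.
pose G (j : option 'I_k) (f : {ffun T -> bool}) : K :=
  match j with None => Hval u (fun i => a i) f
  | Some i => q ^- invS f (Us S i) * PIc i (a i) f end.
transitivity (\prod_j \sum_(f | sub_class ocls j f) G j f); last first.
  by rewrite prod_option [X in _ * X]big1 ?mulr1 //= => i _; apply: PIc_sum.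
rewrite -sum_classes; apply: eq_bigr => f _; rewrite prod_option /G.
rewrite (@Hval_eq _ _ (cmask ocls None f) f) => [|x xm]; last by rewrite ffunE oclsN xm andbT.
have -> : \prod_i (q ^- invS (cmask ocls (Some i) f) (Us S i) * PIc i (a i) (cmask ocls (Some i) f)) =
   \prod_i (q ^- invS f (Us S i) * PIc i (a i) f).
  have h i : {in Us S i, cmask ocls (Some i) f =1 f} by move=> x xU; rewrite ffunE oclsS xU andbT.
  by apply: eq_bigr => i _; rewrite (eq_invS (h i)) (PIc_eq _ (h i)).
rewrite /Hval -[LHS]mulrA [LHS]mulrCA -[RHS]mulrA; congr (_ * _).
rewrite -!big_split /=; apply: eq_bigr => i _.
have [->|p0] := eqVneq (PIc i (a i) f) 0; first by rewrite !mulr0.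
have e1 := PIc_weight p0; have [-> ->] := matched_box f i.
have -> : #|Us S i| = m i by rewrite /= (nrE HS).
rewrite e1 exprD invfM; case: eqP => _; rewrite ?mul0r // !mul1r -!mulrA.
by rewrite [RHS]mulrCA.
Qed.

End Fixed.
End GammaFormula.

End GammaCoefficients.

(** * Effect of one more arc on the coefficients of gamma *)

Section AddingAnArc.

Section AddArc.
Variables (k : nat) (d : 'I_k -> nat).
Local Notation T := 'I_(tot d).
Implicit Types (S : arcs d) (i t : 'I_k).
Local Notation msz S := (fun i => nS S i - rS S i)%N.

Variables (A : arcs d) (x y : T) (i j : 'I_k).
Local Notation A' := ((x, y) |: A)%SET.
Hypothesis HA : lcm_spec A.
Hypothesis HA' : lcm_spec A'.
Hypothesis xi : inbox d i x.
Hypothesis yj : inbox d j y.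
Hypothesis xA : ~~ matched A x.
Hypothesis yA : ~~ matched A y.

Lemma add_ij : (i < j)%N.
Proof.
have xy : (x < y)%N by apply: (lcm_lt HA' (a := (x, y))); rewrite !inE eqxx.
rewrite ltnNge; apply/negP; rewrite leq_eqVlt => /orP[/eqP/val_inj ji|ji].
  apply: (lcm_box HA' (a := (x, y)) (i := i)) => //; first by rewrite !inE eqxx.
  by rewrite /= -ji.
by have := inbox_lt yj xi ji; rewrite ltnNge ltnW.
Qed.

Lemma add_isL v : isL A' v = (v == x :> nat) || isL A v.
Proof.
apply/isLP/orP => [[a]|[/eqP->|/isLP[a aA <-]]].
- rewrite !inE => /orP[/eqP->/= ->|aA <-]; first by left.
  by right; apply/isLP; exists a.
- by exists (x, y); rewrite ?inE ?eqxx.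
- by exists a; rewrite ?inE ?aA ?orbT.
Qed.

Lemma add_isR v : isR A' v = (v == y :> nat) || isR A v.
Proof.
apply/isRP/orP => [[a]|[/eqP->|/isRP[a aA <-]]].
- rewrite !inE => /orP[/eqP->/= ->|aA <-]; first by left.
  by right; apply/isRP; exists a.
- by exists (x, y); rewrite ?inE ?eqxx.
- by exists a; rewrite ?inE ?aA ?orbT.
Qed.

Lemma add_matched v : matched A' v = [|| v == x :> nat, v == y :> nat | matched A v].
Proof. by rewrite !matchedE add_isL add_isR; case: (v == x :> nat); case: (isL A v); rewrite ?orbT. Qed.

Lemma add_Ls t : Ls A' t = if t == i then (x |: Ls A i)%SET else Ls A t.
Proof.
apply/setP => v; rewrite inE add_isL -[v == x :> nat]/(v == x).
have [->|ti] := eqVneq t i; rewrite !inE.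
  by case: eqP => [->|//]; rewrite /= xi.
case: eqP => [->|//]; rewrite /= andbT; case: (boolP (inbox d t x)) => //= xt.
by rewrite (inbox_inj xt xi) eqxx in ti.
Qed.

Lemma add_Rs t : Rs A' t = if t == j then (y |: Rs A j)%SET else Rs A t.
Proof.
apply/setP => v; rewrite inE add_isR -[v == y :> nat]/(v == y).
have [->|ti] := eqVneq t j; rewrite !inE.
  by case: eqP => [->|//]; rewrite /= yj.
case: eqP => [->|//]; rewrite /= andbT; case: (boolP (inbox d t y)) => //= xt.
by rewrite (inbox_inj xt yj) eqxx in ti.
Qed.

Lemma xLs v : v \in Ls A i -> (x < v)%N.
Proof.
rewrite inE => /andP[vi vL]; have := xA; rewrite matchedE => /norP[nL _].
case: (ltngtP x v) => // [vx|xv]; last by rewrite xv vL in nL.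
by rewrite (L_up HA vi xi vx vL) in nL.
Qed.

Lemma yRs v : v \in Rs A j -> (v < y)%N.
Proof.
rewrite inE => /andP[vi vR]; have := yA; rewrite matchedE => /norP[_ nR].
case: (ltngtP v y) => // [vx|xv]; last by rewrite -xv vR in nR.
by rewrite (R_down HA yj vi vx vR) in nR.
Qed.

Let nij : i != j. Proof. by rewrite neq_ltn add_ij. Qed.

Lemma add_sizes : [/\ msz A i = (msz A' i).+1, msz A j = (msz A' j).+1,
  forall t, t != i -> t != j -> msz A t = msz A' t &
  forall t, (i < t < j)%N -> msz A t = 0%N].
Proof.
have el t : lefts A' t = (lefts A t + (t == i))%N.
  rewrite (leftsE HA') (leftsE HA) -/(Ls A' t) -/(Ls A t) add_Ls; case: eqP => [->|_]; last by rewrite addn0.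
  rewrite cardsU1 addnC; congr (_ + nat_of_bool _)%N.
  by apply/negP => /xLs; rewrite ltnn.
have er t : rights A' t = (rights A t + (t == j))%N.
  rewrite (rightsE HA') (rightsE HA) -/(Rs A' t) -/(Rs A t) add_Rs; case: eqP => [->|_]; last by rewrite addn0.
  rewrite cardsU1 addnC; congr (_ + nat_of_bool _)%N.
  by apply/negP => /yRs; rewrite ltnn.
have bc t := box_count HA' t; rewrite /nS /rS; split.
- by have := bc i; rewrite el er eqxx (negPf nij); move: (lefts A i) (rights A i) (mS _ i); lia.
- have := bc j; rewrite el er eqxx [j == i]eq_sym (negPf nij).
  by move: (lefts A j) (rights A j) (mS _ j); lia.
- by move=> t ti tj; rewrite el er (negPf ti) (negPf tj) !addn0.
- move=> t tm; rewrite -/(rS A t) -/(nS A t) (nrE HA); apply/eqP; rewrite cards_eq0; apply/eqP/setP => v.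
  rewrite !inE; apply/negP => /andP[vt vA]; have /andP[ti tj] := tm.
  have xv := inbox_lt xi vt ti; have vy := inbox_lt vt yj tj.
  have := lcm_under HA' (a := (x, y)) (x := v); rewrite !inE eqxx xv vy add_matched => /(_ isT isT).
  by rewrite (negPf vA) orbF; case: ltngtP xv => //; case: ltngtP vy.
Qed.

Lemma add_lefts t : lefts A' t = (lefts A t + (t == i))%N.
Proof.
rewrite (leftsE HA') (leftsE HA) -/(Ls A' t) -/(Ls A t) add_Ls; case: eqP => [->|_]; last by rewrite addn0.
rewrite cardsU1 addnC; congr (_ + nat_of_bool _)%N.
by apply/negP => /xLs; rewrite ltnn.
Qed.

Lemma Ls_adj t : (t != i) -> Ls A' t = Ls A t.
Proof. by rewrite add_Ls => /negPf->. Qed.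
Lemma Rs_adj t : (t != j) -> Rs A' t = Rs A t.
Proof. by rewrite add_Rs => /negPf->. Qed.

Definition upd (p : bool * bool) (f : {ffun T -> bool}) : {ffun T -> bool} :=
  [ffun v => if v == x then p.1 else if v == y then p.2 else f v].

Lemma updx p f : upd p f x = p.1. Proof. by rewrite ffunE eqxx. Qed.
Lemma updy p f : upd p f y = p.2.
Proof.
rewrite ffunE eqxx; case: eqP => // e.
by have := lcm_lt HA' (a := (x, y)); rewrite !inE eqxx e ltnn => /(_ isT).
Qed.
Lemma upd_matched p f (v : T) : matched A v -> upd p f v = f v.
Proof.
move=> vA; rewrite ffunE; case: eqP => [e|_]; first by rewrite e (negPf xA) in vA.
by case: eqP => [e|_ //]; rewrite e (negPf yA) in vA.
Qed.

Lemma in_Ls p f t : {in Ls A t, upd p f =1 f}.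
Proof. by move=> v; rewrite inE => /andP[_ h]; apply: upd_matched; rewrite matchedE h. Qed.
Lemma in_Rs p f t : {in Rs A t, upd p f =1 f}.
Proof. by move=> v; rewrite inE => /andP[_ h]; apply: upd_matched; rewrite matchedE h orbT. Qed.

Let xnL : [disjoint [set x] & Ls A i].
Proof. by rewrite disjoints1; apply/negP => /xLs; rewrite ltnn. Qed.
Let ynR : [disjoint Rs A j & [set y]].
Proof. by rewrite disjoint_sym disjoints1; apply/negP => /yRs; rewrite ltnn. Qed.

Lemma invS1 n (f : 'I_n -> bool) v : invS f [set v] = 0%N.
Proof. by rewrite /invS big_set1 big1 // => w; rewrite inE => /andP[/eqP->]; rewrite ltnn. Qed.

(** Before the arc is added, x is the last unmatched vertex of box i and y the first one of box j,
    so their letters belong to the index. The extra terms are their inversions with the other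
    unmatched letters: an up x has the downs before it, a down y the ups after it. *)
Lemma exS_add p f t (a : nat) : (a <= msz A' t)%N ->
  let g := upd p f in
  let a' := (a + (t == i) * p.1 + (t == j) * p.2)%N in
  (exS A' t g a (msz A' t) + (t == j) * p.2 * 0 =
   exS A t f a' (msz A t) + (t == i) * ~~ p.1 * a + (t == j) * p.2 * (msz A' t - a))%N /\
  (dnS g (Rs A' t) + dnS g (Ls A' t) + a = dnS f (Rs A t) + dnS f (Ls A t) + a')%N.
Proof.
move=> am g a'; have [mi mj mt _] := add_sizes; rewrite muln0 addn0 /exS.
have eqs t' := (eq_invS (@in_Ls p f t'), eq_invS (@in_Rs p f t'), eq_dnS (@in_Ls p f t'),
             eq_dnS (@in_Rs p f t'), eq_upS (@in_Ls p f t')).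
rewrite {}/a' {}/g; have [ti|ti] := eqVneq t i.
  move: am; rewrite {}ti (Rs_adj nij) add_Ls eqxx (negPf nij).
  have -> : invS (upd p f) (x |: Ls A i)%SET = (invS f (Ls A i) + p.1 * upS f (Ls A i))%N.
    rewrite invSU => [|v w]; last by rewrite inE => /eqP->; apply: xLs.
    by rewrite invS1 !eqs add0n /dnS big_set1 updx.
  have -> : dnS (upd p f) (x |: Ls A i)%SET = (p.1 + dnS f (Ls A i))%N.
    by rewrite dnSU // !eqs /dnS big_set1 updx.
  have -> : upS (upd p f) (x |: Ls A i)%SET = (~~ p.1 + upS f (Ls A i))%N.
    by rewrite upSU // !eqs /upS big_set1 updx.
  rewrite !eqs mi; move: (msz A' i) => mm am; case: p {eqs} => p1 p2 /=.
  move: (invS f (Rs A i)) (invS f (Ls A i)) (dnS f (Rs A i)) (dnS f (Ls A i)) (upS f (Ls A i)).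
  move=> I1 I2 r l ul; split; last by clear; case: p1; case: p2; lia.
  case: p1 => /=; rewrite ?mul0n ?mul1n ?addn0 ?add0n ?muln1.
    by rewrite addn1 subSS mulnS; clear; lia.
  by rewrite subSn // mulnDl mulnDr mulnS; clear; lia.
have [tj|tj] := eqVneq t j.
  have nji : j != i by rewrite eq_sym.
  move: am; rewrite {ti}tj (Ls_adj nji) add_Rs eqxx.
  have -> : invS (upd p f) (y |: Rs A j)%SET = (invS f (Rs A j) + dnS f (Rs A j) * ~~ p.2)%N.
    rewrite finset.setUC invSU => [|v w vR]; last by rewrite inE => /eqP->; apply: yRs.
    by rewrite invS1 !eqs addn0 /upS big_set1 updy.
  have -> : dnS (upd p f) (y |: Rs A j)%SET = (p.2 + dnS f (Rs A j))%N.
    by rewrite finset.setUC dnSU // !eqs /dnS big_set1 updy addnC.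
  rewrite !eqs mj; move: (msz A' j) => mm am; case: p {eqs} => p1 p2 /=.
  move: (invS f (Rs A j)) (invS f (Ls A j)) (dnS f (Rs A j)) (dnS f (Ls A j)) (upS f (Ls A j)).
  move=> I1 I2 r l ul; split; last by clear; case: p1; case: p2; lia.
  case: p2 => /=; rewrite ?mul0n ?mul1n ?addn0 ?add0n ?muln0 ?muln1.
    by rewrite addn1 subSS !mulnDl mulnS; clear; lia.
  by rewrite subSn // mulnS; clear; lia.
by rewrite (Ls_adj ti) (Rs_adj tj) !eqs (mt t ti tj) !mul0n !addn0.
Qed.

Definition bump_pair (a : 'I_k -> nat) (p : bool * bool) : 'I_k -> nat :=
  fun t => (a t + (t == i) * p.1 + (t == j) * p.2)%N.

End AddArc.

Section GammaArc.
Variable R : realType.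
Local Notation K := (Cq R).
Local Notation q := (@q R).
Let q0 := q_neq0 R.
Let qnr := @q_regular R.
Variables (k : nat) (d : 'I_k -> nat).
Local Notation T := 'I_(tot d).
Variables (iota_ : forall n, 'Hom(Vn R n, V1pow R n))
          (pi_ : forall n, 'Hom(V1pow R n, Vn R n)).
Hypothesis Hiota : forall n, is_iota (iota_ n).
Hypothesis Hpi : forall n, is_pi (pi_ n).
Implicit Types (S : arcs d) (i t : 'I_k).

Local Notation msz S := (fun i => nS S i - rS S i)%N.

Lemma gammaE S (z : tens R d) (a : idx (msz S)) : lcm_spec S ->
  gamma iota_ pi_ S z a = \sum_(u : idx d) z u * Gam R S (fun i => a i) (fun i => u i).
Proof.
move=> HS; rewrite ffunE; apply: eq_bigr => u _; congr (_ * _).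
rewrite -(gamma_sum Hpi HS).
rewrite [LHS](reindex_onto (fun f : {ffun T -> bool} => [tuple f i | i < tot d])
   (fun b : (tot d).-tuple bool => [ffun x => tnth b x])) => [|b _]; last first.
  by apply: eq_from_tnth => x; rewrite tnth_mktuple ffunE.
apply: eq_big => [f|f _].
  by apply/eqP/ffunP => x; rewrite ffunE tnth_mktuple.
have e1 : tnth [tuple f i | i < tot d] = f by apply: funext => x; rewrite tnth_mktuple.
congr (_ * _ * _).
- apply: eq_bigr => i _; have ud : (u i <= d i)%N by rewrite -ltnS; apply: ltn_ord.
  by have := @iota_coef _ _ _ _ Hiota i (u i) [tuple f x | x < tot d] ud; rewrite e1.
- by apply: eq_bigr => x _; rewrite e1.
- by apply: eq_bigr => i _; rewrite word_fun ulettersE e1.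
Qed.

Section Add.
Variables (A : arcs d) (x y : T) (i j : 'I_k).
Local Notation A' := ((x, y) |: A)%SET.
Hypothesis HA : lcm_spec A.
Hypothesis HA' : lcm_spec A'.
Hypothesis xi : inbox d i x.
Hypothesis yj : inbox d j y.
Hypothesis xA : ~~ matched A x.
Hypothesis yA : ~~ matched A y.

Let nij : i != j. Proof. by rewrite neq_ltn (add_ij HA' xi yj). Qed.
Local Notation upd := (upd x y).
Local Notation bump2 := (bump_pair i j).

Lemma Hval_upd u (a : 'I_k -> nat) p f : inr (msz A') a ->
  Hval R A' u a (upd p f) =
  eps R p.1 p.2 * q ^- (~~ p.1 * a i + p.2 * (msz A' j - a j)) * Hval R A u (bump2 a p) f.
Proof.
move=> /inrP ar; rewrite /Hval big_setU1 /=; last first.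
  apply: contra xA => xyA; rewrite matchedE; apply/orP; left; apply/isLP.
  by exists (x, y).
rewrite updx (updy HA') -!mulrA; congr (_ * _); rewrite [RHS]mulrCA; congr (_ * _).
  apply: eq_bigr => b bA; rewrite !(upd_matched xA yA) // matchedE; apply/orP; [right|left];
    by [apply/isRP; exists b|apply/isLP; exists b].
pose c t := ((t == i) * ~~ p.1 * a t + (t == j) * p.2 * (msz A' t - a t))%N.
have -> : (~~ p.1 * a i + p.2 * (msz A' j - a j))%N = (\sum_t c t)%N.
  rewrite /c big_split /= (bigD1 i) //= eqxx big1 ?addn0 => [|t /negPf ->//].
  by rewrite (bigD1 j) //= eqxx big1 ?addn0 ?mul1n // => t /negPf ->.
have -> : q ^- (\sum_t c t)%N = \prod_t q ^- c t.
  by apply: (big_morph (fun n : nat => q ^- n)) => [m n|]; rewrite ?exprD ?invfM ?expr0 ?invr1.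
rewrite -big_split /=; apply: eq_bigr => t _.
have [e1 e2] := exS_add HA HA' xi yj xA yA p f (ar t); rewrite e2 mulrCA; congr (_ * _).
by move: e1; rewrite muln0 addn0 -addnA => ->; rewrite addnC exprD invfM.
Qed.

(** A word on the matched vertices of the larger match with letters p at x and y is a word on those
    of A, extended by p. *)
Lemma Gam_upd u (a : 'I_k -> nat) p : 
  \sum_(f | sub_class (ocls A') None f && ((f x, f y) == p)) Hval R A' u a f =
  \sum_(f | sub_class (ocls A) None f) Hval R A' u a (upd p f).
Proof.
rewrite (reindex_onto (upd p) (upd (false, false))) /= => [|f /andP[_ /eqP fp]]; last first.
  apply/ffunP => v; rewrite !ffunE; case: eqP => [->|_]; first by rewrite -fp.
  by case: eqP => // ->; rewrite -fp.
apply: eq_bigl => f; rewrite updx (updy HA') -surjective_pairing eqxx andbT.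
apply/andP/forallP => [[/forallP h1 /eqP h2] v|h].
  apply/implyP => fv; rewrite oclsN.
  have vx : v != x by apply: contraTneq fv => ->; rewrite -h2 updx.
  have vy : v != y by apply: contraTneq fv => ->; rewrite -h2 (updy HA').
  have := h1 v; rewrite oclsN ffunE (negPf vx) (negPf vy) fv add_matched.
  by rewrite -[_ == x :> nat]/(v == x) -[_ == y :> nat]/(v == y) (negPf vx) (negPf vy).
have fm (v : T) : ~~ matched A v -> f v = false.
  by move=> vA; have := h v; rewrite oclsN (negPf vA); case: (f v).
split.
  apply/forallP => v; apply/implyP; rewrite oclsN ffunE add_matched.
  rewrite -[_ == x :> nat]/(v == x) -[_ == y :> nat]/(v == y).
  case: (v == x); case: (v == y) => //= fv; apply: contraTT fv => /fm ->//.
apply/eqP/ffunP => v; rewrite !ffunE; case: eqP => [->|_]; first by rewrite fm.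
by case: eqP => [->|//]; rewrite fm.
Qed.

(** Split the sum by the letters at x and y. [eps] leaves down-up, with weight 1, and up-down, with
    weight - [carc]. *)
Lemma Gam_step u (a : 'I_k -> nat) : inr (msz A') a ->
  Gam R A' a u = Gam R A (up a i) u - carc q (msz A') i j a * Gam R A (up a j) u.
Proof.
move=> ar; rewrite {1}/Gam (partition_big (fun f : {ffun T -> bool} => (f x, f y)) xpredT) //=.
rewrite (eq_bigr _ (fun p _ => Gam_upd u a p)).
have E p : \sum_(f | sub_class (ocls A) None f) Hval R A' u a (upd p f) =
   eps R p.1 p.2 * q ^- (~~ p.1 * a i + p.2 * (msz A' j - a j)) * Gam R A (bump2 a p) u.
  by rewrite /Gam mulr_sumr; apply: eq_bigr => f _; apply: Hval_upd.
rewrite (eq_bigr _ (fun p _ => E p)).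
rewrite -(pair_bigA _ (fun b1 b2 => eps R b1 b2 * q ^- (~~ b1 * a i + b2 * (msz A' j - a j)) *
   Gam R A (bump2 a (b1, b2)) u)) /= big_bool !big_bool /= !mul0r !add0r addr0.
have -> : bump2 a (true, false) = up a i.
  by apply: funext => t; rewrite /bump_pair /up muln1 muln0 addn0.
have -> : bump2 a (false, true) = up a j.
  by apply: funext => t; rewrite /bump_pair /up muln1 muln0 addn0.
have /inrP/(_ j) aj := ar.
have -> : carc q (msz A') i j a = q ^- (a i + (msz A' j - a j)).+1.
  by rewrite /carc exprnN; congr (q ^ (- _)); move: aj; clear; lia.
rewrite mul0n expr0 invr1 !mul1r !mulNr; congr (_ - _ * _).
by rewrite !mul1n exprS invfM.
Qed.

End Add.
End GammaArc.

End AddingAnArc.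

(** * Gamma commutes with the generators and with Psi *)

Section GammaIntertwiner.

Section GammaProps.
Variable R : realType.
Local Notation K := (Cq R).
Local Notation q := (@q R).
Let q0 := q_neq0 R.
Let qnr := @q_regular R.
Variables (k : nat) (d : 'I_k -> nat).
Local Notation T := 'I_(tot d).
Variables (iota_ : forall n, 'Hom(Vn R n, V1pow R n))
          (pi_ : forall n, 'Hom(V1pow R n, Vn R n)).
Hypothesis Hiota : forall n, is_iota (iota_ n).
Hypothesis Hpi : forall n, is_pi (pi_ n).
Implicit Types (S : arcs d) (i t : 'I_k).
Local Notation msz S := (fun i => nS S i - rS S i)%N.
Local Notation gam S z := (gamma iota_ pi_ S z : gtens K (msz S)).

Lemma cf_gamma S (z : tens R d) a : lcm_spec S -> inr (msz S) a ->
  cf a (gam S z) = \sum_(u : idx d) z u * Gam R S a (fun i => u i).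
Proof.
move=> HS ar; rewrite /cf ar (gammaE Hiota Hpi _ _ HS); apply: eq_bigr => u _.
by rewrite (idx_mki ar).
Qed.

Lemma gamma_arc (A : arcs d) (x y : T) (i j : 'I_k) (z : tens R d) :
  lcm_spec A -> lcm_spec ((x, y) |: A)%SET -> inbox d i x -> inbox d j y ->
  ~~ matched A x -> ~~ matched A y ->
  gam ((x, y) |: A)%SET z = El q (msz ((x, y) |: A)%SET) i j (gam A z).
Proof.
move=> HA HA' xi yj xA yA.
have ij := add_ij HA' xi yj; have [mi mj mt mid] := add_sizes HA HA' xi yj xA yA.
apply: gext => a ar; have /inrP h := ar.
have nij : i != j by rewrite neq_ltn ij.
have inu s : (s == i) || (s == j) -> inr (msz A) (up a s).
  move=> hs; apply/inrP => t; have [ts|ts] := eqVneq t s.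
    by rewrite ts upE; case/orP: hs => /eqP ->; rewrite ?mi ?mj ltnS h.
  rewrite upN //; have [->|ti] := eqVneq t i; first by rewrite mi ltnW // ltnS h.
  have [->|tj] := eqVneq t j; first by rewrite mj ltnW // ltnS h.
  by rewrite (mt t ti tj) h.
rewrite (cf_El q (e := msz A) mt) // !cf_gamma ?inu ?eqxx ?orbT //.
rewrite mulr_sumr -sumrB; apply: eq_bigr => u _.
by rewrite (Gam_step R HA HA' xi yj xA yA) // mulrBr [in RHS]mulrCA.
Qed.

Lemma matched0 v : matched (finset.set0 : arcs d) v = false.
Proof. by apply/existsP => -[a]; rewrite inE. Qed.

Lemma lefts0 i : lefts (finset.set0 : arcs d) i = 0%N.
Proof. by apply/eqP; rewrite cards_eq0; apply/eqP/setP => a; rewrite !inE. Qed.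
Lemma rights0 i : rights (finset.set0 : arcs d) i = 0%N.
Proof. by apply/eqP; rewrite cards_eq0; apply/eqP/setP => a; rewrite !inE. Qed.

Lemma msz0 : msz (finset.set0 : arcs d) = d.
Proof. by apply: funext => i; rewrite /nS /rS rights0 lefts0 !subn0. Qed.

Lemma lcm0 : lcm_spec (finset.set0 : arcs d).
Proof. by split => a; rewrite inE. Qed.

Lemma Gam0 (a u : 'I_k -> nat) : Gam R (finset.set0 : arcs d) a u = [forall i, a i == u i]%:R.
Proof.
have nL v : isL (finset.set0 : arcs d) v = false by apply/existsP => -[b]; rewrite inE.
have nR v : isR (finset.set0 : arcs d) v = false by apply/existsP => -[b]; rewrite inE.
have eL i : Ls (finset.set0 : arcs d) i = finset.set0 by apply/setP => v; rewrite !inE nL andbF.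
have eR i : Rs (finset.set0 : arcs d) i = finset.set0 by apply/setP => v; rewrite !inE nR andbF.
rewrite /Gam (big_pred1 [ffun=> false]) => [|f]; last first.
  apply/forallP/eqP => [h|-> v]; last by rewrite ffunE.
  apply/ffunP => v; rewrite ffunE; have := h v.
  by rewrite (oclsN (finset.set0 : arcs d)) matched0; case: (f v).
rewrite /Hval big_set0 mul1r.
have D0 (f : T -> bool) : dnS f finset.set0 = 0%N by rewrite /dnS big_set0.
have U0 (f : T -> bool) : upS f finset.set0 = 0%N by rewrite /upS big_set0.
have I0 (f : T -> bool) : invS f finset.set0 = 0%N by rewrite /invS big_set0.
case: forallP => [h|h].
  by rewrite big1 // => i _; rewrite /exS eL eR !(D0, U0, I0) !mul0n (eqP (h i)) eqxx expr0 invr1 mulr1.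
have [i hi] : exists i, a i != u i.
  by apply/existsP; rewrite -negb_forall; apply/forallP.
by rewrite (bigD1 i) //= eL eR !D0 add0n (negPf hi) !mul0r.
Qed.

Lemma cf_gamma0 (z : tens R d) a :
  cf a (gam (finset.set0 : arcs d) z) = cf a (z : gtens K d).
Proof.
case: (boolP (inr d a)) => ar; last by rewrite !cf_out ?msz0.
rewrite cf_gamma ?msz0 //; last exact: lcm0.
rewrite (bigD1 (mki d a)) //= big1 ?addr0 => [|u ua]; last first.
  rewrite Gam0 (_ : [forall i, _] = false) ?mulr0 //; apply: contraNF ua => /forallP h.
  by apply/eqP/ffunP => i; apply: val_inj; rewrite /= mkiE // (eqP (h i)).
rewrite Gam0 (_ : [forall i, _] = true) ?mulr1 /cf ?ar //.
by apply/forallP => i; rewrite mkiE.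
Qed.

(** Arcs are added by increasing right end: those under a given arc end before it, so no stage
    leaves an unmatched vertex under an arc. *)
Definition Apre S n : arcs d := [set a in S | (a.2 < n)%N]%SET.

Lemma Apre_lcm S n : lcm_spec S -> lcm_spec (Apre S n).
Proof.
move=> HS; have sub a : a \in Apre S n -> a \in S by rewrite inE => /andP[].
split.
- by move=> a /sub; apply: lcm_lt.
- by move=> a i /sub; apply: lcm_box.
- by move=> a b x /sub aS /sub bS; apply: (lcm_uniq HS).
- by move=> a b /sub aS /sub bS; apply: (lcm_cross HS).
- move=> a x aA ax; have aS := sub _ aA; move: aA; rewrite inE => /andP[_ an].
  have := lcm_under HS aS ax; rewrite !matchedE => /orP[/isLP[b bS bx]|/isRP[b bS bx]].
    apply/orP; left; apply/isLP; exists b => //; rewrite inE bS /=.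
    by apply: leq_ltn_trans an; apply: (lcm_cross HS aS bS); rewrite bx.
  apply/orP; right; apply/isRP; exists b => //; rewrite inE bS /= bx.
  by apply: ltn_trans an; case/andP: ax.
Qed.

Lemma gamma_ind (P : forall S : arcs d, Prop) :
  P finset.set0 ->
  (forall (A : arcs d) (x y : T) (i j : 'I_k), lcm_spec A -> lcm_spec ((x, y) |: A)%SET ->
     inbox d i x -> inbox d j y -> ~~ matched A x -> ~~ matched A y -> P A -> P ((x, y) |: A)%SET) ->
  forall S, lcm_spec S -> P S.
Proof.
move=> P0 PS S HS; have -> : S = Apre S (tot d) by apply/setP => a; rewrite inE ltn_ord andbT.
elim: (tot d) => [|n IH].
  by have -> : Apre S 0 = finset.set0 by apply/setP => a; rewrite !inE ltn0 andbF.
case: (boolP (isR S n)) => [/isRP[[x y] aS /= yn]|nR]; last first.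
  have -> // : Apre S n.+1 = Apre S n.
  apply/setP => a; rewrite !inE; case: (boolP (a \in S)) => //= aS.
  rewrite ltnS leq_eqVlt; case: eqP => // an; case/negP: nR.
  by apply/isRP; exists a.
have E : Apre S n.+1 = ((x, y) |: Apre S n)%SET.
  apply/setP => a; rewrite !inE ltnS leq_eqVlt; have [->|/eqP ne] := eqVneq a (x, y).
    by rewrite aS /= yn eqxx.
  case: (boolP (a \in S)) => //= bS; case: eqP => // an; case: ne.
  by apply: (uniq_R HS bS aS); apply: val_inj; rewrite /= an.
have nm v : touches v (x, y) -> ~~ matched (Apre S n) v.
  move=> tv; apply/existsP => -[b /andP[bA bv]]; move: (bA); rewrite inE => /andP[bS bn].
  have vt : (v < tot d)%N by case/orP: tv => /eqP <-.
  have e1 := lcm_uniq HS (x := Ordinal vt) aS bS tv bv.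
  by move: bn; rewrite -e1 /= yn ltnn.
have [i xi] := box_ex (ltn_ord x); have [j yj] := box_ex (ltn_ord y).
rewrite E; apply: (PS _ x y i j) => //.
- exact: Apre_lcm.
- by rewrite -E; apply: Apre_lcm.
- by apply: nm; rewrite /touches eqxx.
- by apply: nm; rewrite /touches eqxx orbT.
Qed.

(** The sizes of the empty match equal d only propositionally, so operators on the two tensor spaces
    are compared through coordinates. *)
Lemma cf_ext_op (e e' : 'I_k -> nat) (op : forall e, gtens K e -> gtens K e)
    (z : gtens K e) (z' : gtens K e') : e = e' -> (forall u, cf u z = cf u z') ->
  forall u, cf u (op e z) = cf u (op e' z').
Proof. by move=> h; move: z z'; rewrite {}h => z z' h u; congr (cf u (op _ _)); apply: gext. Qed.

Section Operator.
Variable op : forall e : 'I_k -> nat, gtens K e -> gtens K e.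
Hypothesis opEl : forall (e e' : 'I_k -> nat) (i j : 'I_k), (i < j)%N ->
  e i = (e' i).+1 -> e j = (e' j).+1 -> (forall t, t != i -> t != j -> e t = e' t) ->
  (forall t : 'I_k, (i < t < j)%N -> e t = 0%N) -> forall z : gtens K e,
  El q e' i j (op z) = op (El q e' i j z).

Lemma gamma_op S (z : tens R d) : lcm_spec S -> gam S (op (z : gtens K d)) = op (gam S z).
Proof.
move=> HS; move: S HS z; apply: gamma_ind => [z|A x y i j HA HA' xi yj xA yA IH z].
  apply: gext => u _; rewrite cf_gamma0; apply/esym.
  by apply: (@cf_ext_op (msz finset.set0) d op); [exact: msz0|exact: cf_gamma0].
rewrite !(gamma_arc _ HA HA' xi yj xA yA) IH; have [mi mj mt mid] := add_sizes HA HA' xi yj xA yA.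
by apply: opEl => //; apply: (add_ij HA' xi yj).
Qed.
End Operator.

Lemma gamma_gEt S (z : tens R d) : lcm_spec S -> gam S (gEt q z) = gEt q (gam S z).
Proof. by move=> HS; apply: (@gamma_op (fun e z => gEt q z)) => // *; apply: El_gEt. Qed.

Lemma gamma_gF S (z : tens R d) : lcm_spec S -> gam S (gF q k z) = gF q k (gam S z).
Proof. by move=> HS; apply: (@gamma_op (fun e z => gF q k z)) => // *; apply: El_gF. Qed.

Lemma gamma_gKt S (z : tens R d) : lcm_spec S -> gam S (gKt q z) = gKt q (gam S z).
Proof. by move=> HS; apply: (@gamma_op (fun e z => gKt q z)) => // *; apply: El_gKt. Qed.

Lemma gamma_gKit S (z : tens R d) : lcm_spec S -> gam S (gKit q z) = gKit q (gam S z).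
Proof. by move=> HS; apply: (@gamma_op (fun e z => gKit q z)) => // *; apply: El_gKit. Qed.

Lemma gamma_gPsi S (z : tens R d) : lcm_spec S ->
  gam S (gPsi q (barM R) k z) = gPsi q (barM R) k (gam S z).
Proof.
move=> HS; apply: (@gamma_op (fun e z => gPsi q (barM R) k z)) => // *; apply: El_gPsi => //.
exact: bar_q.
Qed.

Lemma gamma_uq_hom S : lcm_spec S -> uq_hom (gamma iota_ pi_ S).
Proof.
by move=> HS; split=> z; rewrite ?(actE_E, actKE, actKiE) /actF ?actF_firstE;
  [exact: gamma_gEt|exact: gamma_gF|exact: gamma_gKt|exact: gamma_gKit].
Qed.

Lemma gamma_Psi S (z : tens R d) : lcm_spec S -> gamma iota_ pi_ S (Psi z) = Psi (gamma iota_ pi_ S z).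
Proof. by move=> HS; rewrite !PsiE; apply: gamma_gPsi. Qed.

Lemma qinvZ_carc (e' : 'I_k -> nat) (i j : 'I_k) a : (a j <= e' j)%N -> in_qinvZ (carc q e' i j a).
Proof.
move=> h; have -> : carc q e' i j a = q ^- (a i + (e' j - a j)).+1.
  by rewrite /carc exprnN; congr (q ^ (- _)); move: h; clear; lia.
exact: qinvZ_exp.
Qed.

(** As [carc] lies in q^-1 Z[q^-1], one contraction is z(up a i) modulo q^-1; each arc lowers the
    leading index by one in the box of its left end. *)
Lemma gamma_lead S (w : 'I_k -> nat) (z : tens R d) : lcm_spec S ->
  (forall u, inr d u -> in_qinvZ (cf u (z : gtens K d) - [forall t, u t == w t]%:R)) ->
  forall a, inr (msz S) a -> in_qinvZ (cf a (gam S z) - [forall t, a t + lefts S t == w t]%N%:R).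
Proof.
move=> HS hz; move: S HS; apply: gamma_ind => [a ar|A x y i j HA HA' xi yj xA yA IH a ar].
  rewrite cf_gamma0; have -> : [forall t, a t + lefts (finset.set0 : arcs d) t == w t]%N = [forall t, a t == w t].
    by apply: eq_forallb => t; rewrite lefts0 addn0.
  by apply: hz; rewrite -msz0.
have [mi mj mt mid] := add_sizes HA HA' xi yj xA yA; have /inrP h := ar.
have nij : i != j by rewrite neq_ltn (add_ij HA' xi yj).
have inu s : (s == i) || (s == j) -> inr (msz A) (up a s).
  move=> hs; apply/inrP => t; have [ts|ts] := eqVneq t s.
    by rewrite ts upE; case/orP: hs => /eqP ->; rewrite ?mi ?mj ltnS h.
  rewrite upN //; have [->|ti] := eqVneq t i; first by rewrite mi ltnW // ltnS h.
  have [->|tj] := eqVneq t j; first by rewrite mj ltnW // ltnS h.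
  by rewrite (mt t ti tj) h.
rewrite (gamma_arc _ HA HA' xi yj xA yA) (cf_El q (e := msz A) mt) // addrAC.
have -> : [forall t, a t + lefts ((x, y) |: A)%SET t == w t]%N = [forall t, up a i t + lefts A t == w t]%N.
  apply: eq_forallb => t; rewrite (add_lefts HA HA' xi xA) /up.
  by rewrite addnA addnAC.
apply: qinvZB; first by apply: IH; rewrite inu ?eqxx.
apply: qinvZM; first exact: qinvZ_carc.
have /qinvZP[p ep] := IH _ (inu j (introT orP (or_intror (eqxx j)))).
exists ('X * p + ([forall t, up a j t + lefts A t == w t]%N)%:R).
by rewrite rmorphD /= -ep [evZ R _%:R](rmorph_nat (evZ R)) subrK.
Qed.

End GammaProps.

End GammaIntertwiner.

(** * Gaussian binomials *)

Section GaussianBinomials.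

Section Gauss.
Variable A : comNzRingType.
Variable Q : A.

(** Gaussian binomials, by the recursion that sorts subspaces according to whether they lie in a
    given hyperplane. *)
Fixpoint gb (n j : nat) {struct n} : A :=
  match n, j with
  | _, 0 => 1
  | 0, _.+1 => 0
  | n'.+1, j'.+1 => gb n' j + Q ^+ (n' - j') * gb n' j'
  end.

Lemma gbn0 n : gb n 0 = 1. Proof. by case: n. Qed.
Lemma gbSS n j : gb n.+1 j.+1 = gb n j.+1 + Q ^+ (n - j) * gb n j. Proof. by []. Qed.
Lemma gb_small n j : (n < j)%N -> gb n j = 0.
Proof.
elim: n j => [|n IH] [|j] //; rewrite ltnS => h.
by rewrite gbSS !IH ?mulr0 ?addr0 // ltnW.
Qed.

(* Block sizes and numbers of ones, last block first. *)
Fixpoint cc (es js : seq nat) : A :=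
  match es, js with
  | [::], [::] => 1
  | e :: es', j :: js' => gb e j * Q ^+ (j * (sumn es' - sumn js')) * cc es' js'
  | _, _ => 0
  end.

Lemma cc_small es js : (sumn es < sumn js)%N -> cc es js = 0.
Proof.
elim: es js => [|e es IH] [|j js] //= h.
have [eh|eh] := ltnP e j; first by rewrite gb_small // !mul0r.
by rewrite IH ?mulr0 //; move: h eh; lia.
Qed.

Fixpoint words n : seq (seq bool) :=
  if n is n'.+1 then [seq rcons w false | w <- words n'] ++ [seq rcons w true | w <- words n']
  else [:: [::]].

(** The number of pairs with a 0 before a 1, which is half the exponent of q in [cnum]. *)
Fixpoint wexp (w : seq bool) : nat :=
  if w is x :: w' then (wexp w' + ~~ x * count id w')%N else 0%N.

Lemma wexp_cat w1 w2 : wexp (w1 ++ w2) = (wexp w1 + wexp w2 + count negb w1 * count id w2)%N.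
Proof.
elim: w1 => [|x w IH] /=; first by rewrite mul0n addn0.
by rewrite IH count_cat /= mulnDr mulnDl; lia.
Qed.

Lemma mem_words n w : (w \in words n) = (size w == n).
Proof.
elim: n w => [|n IH] w /=; first by rewrite inE; case: w.
rewrite mem_cat; case: (lastP w) => [|v x].
  by apply/negP => /orP[]/mapP[[|? ?]].
rewrite size_rcons eqSS -IH; apply/orP/idP => [[]/mapP[u uw /rcons_inj[-> _]]//|vw].
by case: x; [right|left]; apply/mapP; exists v.
Qed.

Lemma uniq_words n : uniq (words n).
Proof.
elim: n => //= n IH; rewrite cat_uniq !map_inj_uniq ?IH ?andbT //=; try by move=> ? ? /rcons_inj[].
by apply/hasPn => ? /mapP[w _ ->]; apply/mapP => -[v _ /rcons_inj[]].
Qed.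

Lemma sum_words_tuple n (P : pred (seq bool)) (G : seq bool -> A) :
  \sum_(b : n.-tuple bool | P b) G b = \sum_(w <- words n | P w) G w.
Proof.
rewrite -(big_map val P G); apply: perm_big; apply: uniq_perm.
- by rewrite map_inj_uniq ?index_enum_uniq //; apply: val_inj.
- exact: uniq_words.
move=> w; rewrite mem_words; apply/mapP/eqP => [[b _ ->]|/eqP wn]; first exact: size_tuple.
by exists (Tuple wn); rewrite // mem_index_enum.
Qed.

Lemma words_cat m n (G : seq bool -> A) :
  \sum_(w <- words (m + n)) G w = \sum_(w1 <- words m) \sum_(w2 <- words n) G (w1 ++ w2).
Proof.
elim: n G => [|n IH] G.
  by rewrite addn0; apply: eq_bigr => w _; rewrite big_seq1 cats0.
rewrite addnS /= big_cat /= !big_map !IH -big_split; apply: eq_bigr => w _ /=.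
by rewrite big_cat /= !big_map; congr (_ + _); apply: eq_bigr => v _; rewrite rcons_cat.
Qed.

Lemma sum_words_gb n j :
  \sum_(w <- words n | count id w == j) Q ^+ wexp w = gb n j.
Proof.
have cr w x : count id (rcons w x) = (count id w + x)%N by rewrite -cats1 count_cat /= addn0.
have wr w x : wexp (rcons w x) = (wexp w + x * count negb w)%N.
  by rewrite -cats1 wexp_cat /= muln0 !addn0 mulnC.
elim: n j => [|n IH] j.
  by rewrite /= big_cons big_nil /=; case: j => [|j]; rewrite ?addr0.
rewrite /= big_cat /= !big_map.
under eq_bigl do rewrite cr addn0.
under eq_bigr do rewrite wr mul0n addn0.
under [X in _ + X]eq_bigl do rewrite cr addn1.
under [X in _ + X]eq_bigr do rewrite wr mul1n exprD.
case: j => [|j].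
  rewrite [X in _ + X]big_pred0 ?addr0 => [|w]; last by [].
  by rewrite (IH 0%N) gbn0; case: n {IH}.
rewrite IH -[gb n j](IH j) mulr_sumr; congr (_ + _).
rewrite big_seq_cond [RHS]big_seq_cond; apply: eq_big => [w|w]; first by rewrite eqSS.
rewrite mem_words eqSS => /andP[/eqP <- /eqP <-]; rewrite mulrC; congr (_ ^+ _ * _).
by rewrite -(count_predC id w) addKn.
Qed.

(** The common value for four blocks of the Schubert cell count [cc] and the word sum [ccl], which
    list the blocks in opposite orders. *)
Definition cc4 e1 e2 e3 e4 a1 a2 a3 a4 : A :=
  gb e1 a1 * gb e2 a2 * gb e3 a3 * gb e4 a4 *
  Q ^+ ((e1 - a1) * (a2 + a3 + a4) + (e2 - a2) * (a3 + a4) + (e3 - a3) * a4).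

Lemma cc4E e1 e2 e3 e4 a1 a2 a3 a4 :
  cc [:: e4; e3; e2; e1] [:: a4; a3; a2; a1] = cc4 e1 e2 e3 e4 a1 a2 a3 a4.
Proof.
rewrite /cc4 /= !addn0 !subn0 muln0 expr0 !mulr1.
(* Where a subtraction would be truncated, a Gaussian binomial is 0 on both sides. *)
have [h|h1] := ltnP e1 a1; first by rewrite (gb_small h) !(mul0r, mulr0).
have [h|h2] := ltnP e2 a2; first by rewrite (gb_small h) !(mul0r, mulr0).
have [h|h3] := ltnP e3 a3; first by rewrite (gb_small h) !(mul0r, mulr0).
have -> : ((e1 - a1) * (a2 + a3 + a4) + (e2 - a2) * (a3 + a4) + (e3 - a3) * a4 =
  a4 * (e3 + (e2 + e1) - (a3 + (a2 + a1))) + a3 * (e2 + e1 - (a2 + a1)) + a2 * (e1 - a1))%N.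
  have -> : (e3 + (e2 + e1) - (a3 + (a2 + a1)) = (e3 - a3) + (e2 - a2) + (e1 - a1))%N by lia.
  have -> : (e2 + e1 - (a2 + a1) = (e2 - a2) + (e1 - a1))%N by lia.
  by rewrite !mulnDr; lia.
by rewrite !exprD; ring.
Qed.

Fixpoint ccl (es js : seq nat) : A :=
  match es, js with
  | [::], [::] => 1
  | e :: es', j :: js' => gb e j * Q ^+ ((e - j) * sumn js') * ccl es' js'
  | _, _ => 0
  end.

Lemma sum_words_ccl es js :
  \sum_(w <- words (sumn es) | [seq count id s | s <- reshape es w] == js) Q ^+ wexp w = ccl es js.
Proof.
elim: es js => [|e es IH] js.
  by rewrite /= big_cons big_nil; case: js => [|j js]; rewrite ?addr0.
case: js => [|j js]; first by rewrite big_pred0.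
rewrite big_mkcond [sumn _]/= words_cat [ccl _ _]/= -IH -sum_words_gb -mulrA mulr_suml [RHS]big_mkcond.
rewrite big_seq [RHS]big_seq; apply: eq_bigr => w1; rewrite mem_words => /eqP s1.
have H w2 : ([seq count id s | s <- reshape (e :: es) (w1 ++ w2)] == j :: js) =
    (count id w1 == j) && ([seq count id s | s <- reshape es w2] == js).
  by rewrite /= take_size_cat // drop_size_cat // eqseq_cons.
under eq_bigr do rewrite H.
case: eqP => c1 /=; last by rewrite big1.
rewrite mulrA mulr_sumr [RHS]big_mkcond big_seq [RHS]big_seq; apply: eq_bigr => w2 h2.
case: eqP => // c2.
rewrite wexp_cat !exprD mulrAC; congr (_ * _ * _); congr (_ ^+ (_ * _)).
  by rewrite -s1 -c1 -(count_predC id w1) addKn.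
have s2 : (size w2 <= sumn es)%N by move: h2; rewrite mem_words => /eqP ->.
by rewrite -c2 -[in LHS](reshapeKr s2) count_flatten.
Qed.

Lemma ccl4E e1 e2 e3 e4 a1 a2 a3 a4 :
  ccl [:: e1; e2; e3; e4] [:: a1; a2; a3; a4] = cc4 e1 e2 e3 e4 a1 a2 a3 a4.
Proof.
rewrite /cc4 /= !addn0 muln0 expr0 !mulr1 !addnA !exprD; ring.
Qed.
End Gauss.

Lemma rmorph_gb (A B : comNzRingType) (f : {rmorphism A -> B}) Q n j : f (gb Q n j) = gb (f Q) n j.
Proof.
elim: n j => [|n IH] [|j] /=; rewrite ?rmorph1 ?rmorph0 //.
by rewrite rmorphD rmorphM rmorphXn /= !IH.
Qed.

Lemma rmorph_cc4 (A B : comNzRingType) (f : {rmorphism A -> B}) Q e1 e2 e3 e4 a1 a2 a3 a4 :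
  f (cc4 Q e1 e2 e3 e4 a1 a2 a3 a4) = cc4 (f Q) e1 e2 e3 e4 a1 a2 a3 a4.
Proof. by rewrite /cc4 !rmorphM rmorphXn /= !rmorph_gb. Qed.

Section Cnum.
Variable R : realType.

Lemma tuple_exp (s : seq bool) :
  (\sum_(i < size s) \sum_(j < size s | j < i) (nth false s i * (1 - nth false s j)))%N = wexp s.
Proof.
elim: s => [|x s IH] /=; first by rewrite big_ord0.
rewrite big_ord_recl [X in (X + _)%N]big_pred0 // add0n.
under eq_bigr => i _.
  rewrite big_mkcond big_ord_recl /= -(@big_mkcond _ _ _ _ _ (fun j : 'I_(size s) => j < i)%N).
  over.
rewrite big_split /= addnC IH; congr (_ + _)%N.
have -> : count id s = (\sum_(i < size s) nth false s i)%N.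
  by rewrite -sumn_count sumnE big_map (big_nth false) big_mkord.
rewrite big_distrr /=; apply: eq_bigr => i _.
by rewrite mulnC; case: x.
Qed.

Lemma cnum4 e1 e2 e3 e4 a1 a2 a3 a4 :
  cnum R [:: e1; e2; e3; e4] [:: a1; a2; a3; a4] = cc4 (q ^+ 2 : Cq R) e1 e2 e3 e4 a1 a2 a3 a4.
Proof.
rewrite -ccl4E -sum_words_ccl -sum_words_tuple /cnum; apply: eq_bigr => b _.
rewrite -exprM; congr (_ ^+ (_ * _)); rewrite -tuple_exp size_tuple.
by apply: eq_bigr => i _; apply: eq_bigr => j _; rewrite !(tnth_nth false).
Qed.
End Cnum.

End GaussianBinomials.

(** * Point counts over finite fields *)

Section SchubertCells.

Section Subspaces.
Variables (F : finFieldType) (n : nat).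
Local Notation vT := 'rV[F]_n.
Implicit Types (U V W E H D : {vspace vT}) (x y : vT).

Lemma card_vs U : #|[set v | v \in U]%SET| = (#|F| ^ \dim U)%N.
Proof.
pose f (c : {ffun 'I_(\dim U) -> F}) : vT := \sum_i c i *: (vbasis U)`_i.
have fb := basis_free (vbasisP U).
have fi : injective f.
  move=> c c' e; apply/ffunP => i; have := congr1 (coord (vbasis U) i) e.
  by rewrite !(coord_sum_free _ _ fb).
rewrite -[in RHS](card_ord (\dim U)) -card_ffun -cardsT -(card_imset _ fi).
apply: eq_card => v; rewrite inE; apply/idP/imsetP => [vU|[c _ ->]].
  exists [ffun i => coord (vbasis U) i v] => //.
  rewrite [LHS](coord_vbasis vU); apply: eq_bigr => i _; by rewrite ffunE.
apply: memv_suml => i _; apply: memvZ; apply: vbasis_mem; apply: mem_nth.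
by rewrite size_tuple.
Qed.

Lemma dim_addl V x : x \notin V -> \dim (V + <[x]>) = (\dim V).+1.
Proof.
move=> xV; have x0 : x != 0 by apply: contraNneq xV => ->; apply: mem0v.
rewrite dimv_disjoint_sum ?dim_vline ?x0 ?addn1 //.
apply/eqP; rewrite -subv0; apply/subvP => v; rewrite memv_cap memv0 => /andP[vV].
case/vlineP => c e; rewrite e; have [->|c0] := eqVneq c 0; first by rewrite scale0r.
by case/negP: xV; rewrite -[x]scale1r -(mulVf c0) -scalerA -e memvZ.
Qed.

Lemma notin_ex U H : ~~ (U <= H)%VS -> exists2 x, x \in U & x \notin H.
Proof. by move=> /subvPn. Qed.

Section Hyper.
Variables (H E V : {vspace vT}).
Hypothesis HE : (H <= E)%VS.
Hypothesis dE : \dim E = (\dim H).+1.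
Hypothesis VH : (V <= H)%VS.

Definition hset := [set U : {vspace vT} | [&& (V <= U)%VS, (U <= E)%VS,
  \dim U == (\dim V).+1 & (U :&: H)%VS == V]]%SET.

(** Fix x in E outside H. The spaces counted are V + <x + h> with h in H, and such a space
    determines h up to V. *)
Lemma hyper_count : (#|hset| * #|F| ^ \dim V = #|F| ^ \dim H)%N.
Proof.
have [x xE xH] : exists2 x, x \in E & x \notin H.
  by apply: notin_ex; apply/negP => /dimvS; rewrite dE ltnn.
have EHx : E = (H + <[x]>)%VS.
  apply/esym/eqP; rewrite eqEdim dim_addl // dE leqnn andbT subv_add HE.
  by rewrite -memvE.
pose phi h := (V + <[x + h]>)%VS.
have xh h : h \in H -> x + h \notin H.
  by move=> hH; apply: contra xH => xhH; rewrite -[x](addrK h) rpredB.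
have phi_in h : h \in H -> phi h \in hset.
  move=> hH; have nH := xh _ hH.
  have nV : x + h \notin V by apply: contra nH; apply: (subvP VH).
  rewrite inE addvSl dim_addl // eqxx /=; apply/andP; split.
    rewrite subv_add (subv_trans VH HE) -memvE rpredD //; exact: (subvP HE).
  rewrite eq_sym eqEdim subv_cap addvSl VH /= -ltnS -(dim_addl nV) ltn_neqAle dimvS ?capvSl // andbT.
  apply: contra nH => /eqP e.
  have : (phi h <= phi h :&: H)%VS by rewrite -(dimv_leqif_sup (capvSl _ _)) /phi e.
  rewrite subv_cap => /andP[_ /subvP]; apply.
  exact: (subvP (addvSr _ _) _ (memv_line _)).
have fibre U : U \in hset -> #|[set h | (h \in H) && (phi h == U)]%SET| = (#|F| ^ \dim V)%N.
  rewrite inE => /and4P[VU UE /eqP dU /eqP UH].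
  have [h0 h0H xU] : exists2 h0, h0 \in H & x + h0 \in U.
    have [y yU yH] : exists2 y, y \in U & y \notin H.
      apply: notin_ex; apply/negP => h; have := dU.
      by rewrite -UH (capv_idPl h); apply: n_Sn.
    have : y \in (H + <[x]>)%VS by rewrite -EHx (subvP UE).
    case/memv_addP => h hH [v /vlineP[c ->] ey]; have c0 : c != 0.
      by apply: contraNneq yH => c0; rewrite ey c0 scale0r addr0.
    exists (c^-1 *: h); first exact: memvZ.
    have -> : x + c^-1 *: h = c^-1 *: y by rewrite ey scalerDr scalerA mulVf // scale1r addrC.
    exact: memvZ.
  rewrite -card_vs -(card_imset (mem [set v | v \in V]%SET) (addrI h0)); apply: eq_card => h.
  apply/idP/imsetP => [|[v]]; rewrite !inE.
    case/andP => hH /eqP ph; exists (h - h0); last by rewrite addrC subrK.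
    rewrite !inE -UH memv_cap (rpredB hH h0H) andbT.
    have -> : h - h0 = (x + h) - (x + h0) by rewrite opprD addrACA subrr add0r.
    apply: rpredB => //; rewrite -ph; exact: (subvP (addvSr _ _) _ (memv_line _)).
  move=> vV ->; have hH : h0 + v \in H by rewrite rpredD // (subvP VH).
  rewrite hH; have := phi_in _ hH; rewrite inE => /and4P[_ _ /eqP dp _].
  rewrite eqEdim dU dp leqnn andbT /phi subv_add VU -memvE addrA rpredD //.
  exact: (subvP VU).
rewrite -(card_vs H) -[RHS]sum1_card (partition_big phi (mem hset)) /=; last first.
  by move=> h; rewrite inE; apply: phi_in.
rewrite -sum_nat_const; apply: eq_bigr => U UH; rewrite -(fibre U UH) -[LHS]sum1_card.
by apply: eq_bigl => h; rewrite !inE.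
Qed.
End Hyper.

Lemma hyper_ex H E : (H <= E)%VS -> (\dim H < \dim E)%N ->
  exists H', [/\ (H <= H')%VS, (H' <= E)%VS & \dim E = (\dim H').+1].
Proof.
have [m] := ubnP (\dim E - \dim H)%N; elim: m H => // m IH H hm HE dHE.
have [e|ne] := eqVneq (\dim E) (\dim H).+1; first by exists H; rewrite subvv.
have [x xE xH] : exists2 x, x \in E & x \notin H.
  by apply: notin_ex; apply/negP => /dimvS; rewrite leqNgt dHE.
have [|||H' [h1 h2 h3]] := IH (H + <[x]>)%VS.
- by rewrite dim_addl //; move: hm dHE; lia.
- by rewrite subv_add HE -memvE.
- by rewrite dim_addl // ltn_neqAle eq_sym ne.
by exists H'; split=> //; apply: subv_trans h1; apply: addvSl.
Qed.

Section Schubert.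
Variable A : comNzRingType.
Variable D : {vspace vT}.
Local Notation Q := (#|F|%:R : A).

(** A flag above D is listed from its largest member down, and [js] records the jumps of dim (U :&:
    E) along it; [Xset] is then a Schubert cell of the quotient by D. *)
Definition vtop (Es : seq {vspace vT}) := head D Es.
Fixpoint chain (Es : seq {vspace vT}) :=
  if Es is E :: Es' then (vtop Es' <= E)%VS && chain Es' else true.
Fixpoint gsizes (Es : seq {vspace vT}) : seq nat :=
  if Es is E :: Es' then (\dim E - \dim (vtop Es'))%N :: gsizes Es' else [::].
Fixpoint profile (Es : seq {vspace vT}) (js : seq nat) U : bool :=
  match Es, js with
  | E :: Es', j :: js' => (\dim (U :&: E) == \dim D + (j + sumn js'))%N && profile Es' js' U
  | [::], [::] => true
  | _, _ => false
  end.

Definition Xset Es js := [set U : {vspace vT} | [&& (D <= U)%VS, (U <= vtop Es)%VS & profile Es js U]]%SET.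

Lemma chain_D Es : chain Es -> (D <= vtop Es)%VS.
Proof. by elim: Es => [|E Es IH] /=; [rewrite subvv|case/andP => h /IH h'; apply: subv_trans h]. Qed.

Lemma dim_top Es : chain Es -> \dim (vtop Es) = (\dim D + sumn (gsizes Es))%N.
Proof.
elim: Es => [|E Es IH] /=; first by rewrite addn0.
by move=> /andP[h /IH e]; rewrite addnCA -e subnK // dimvS.
Qed.

Lemma profile_top Es js U : (D <= U)%VS -> chain Es -> profile Es js U ->
  \dim (U :&: vtop Es) = (\dim D + sumn js)%N.
Proof.
case: Es js => [|E Es] [|j js] //= DU _; last by move=> /andP[/eqP <- _].
by rewrite addn0 => _; rewrite (capv_idPr DU).
Qed.

Lemma eq_profile Es js U V H : chain Es -> (vtop Es <= H)%VS -> (U :&: H = V)%VS ->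
  profile Es js U = profile Es js V.
Proof.
elim: Es js => [|E Es IH] [|j js] //= /andP[h ch] EH UV.
rewrite (IH js) // -?UV; last exact: subv_trans EH.
by rewrite -capvA (capv_idPr EH).
Qed.

(** Induction on the flag and on the codimension of the second member in E. Take a hyperplane H of E
    containing that member: the U inside H form the cell with H for E, the others lie over the cell
    with one jump fewer, with fibres given by [hyper_count]. This is the recursion of [gb]. *)
Lemma card_Xset Es js : chain Es -> (#|Xset Es js|)%:R = cc Q (gsizes Es) js.
Proof.
elim: Es js => [|E Es IH] js /=.
  move=> _; case: js => [|j js]; last by rewrite /Xset (_ : [set _ | _] = finset.set0) ?cards0 //;
    apply/setP => U; rewrite !inE !andbF.
  suff -> : Xset [::] [::] = [set D]%SET by rewrite cards1.
  by apply/setP => U; rewrite !inE /= andbT eqEsubv andbC.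
case/andP => tE ch; case: js => [|j js].
  by rewrite /Xset (_ : [set _ | _] = finset.set0) ?cards0 //; apply/setP => U; rewrite !inE !andbF.
have dt := dim_top ch.
have : \dim E = (\dim (vtop Es) + (\dim E - \dim (vtop Es)))%N by rewrite subnKC // dimvS.
move: (\dim E - _)%N => e; elim: e E j tE => [|e IHe] E j tE dE.
  have -> : E = vtop Es by apply/eqP; rewrite eq_sym eqEdim tE dE addn0 leqnn.
  case: j => [|j] /=; last first.
    rewrite !mul0r /Xset (_ : [set _ | _] = finset.set0) ?cards0 //; apply/setP => U; rewrite !inE /=.
    apply/negP => /and4P[DU UE /eqP d1 /(profile_top DU ch)]; rewrite d1; clear; lia.
  rewrite mul0n expr0 !mul1r -IH //; congr (_%:R); apply: eq_card => U; rewrite !inE /= add0n.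
  apply/and4P/and3P => [[] //|[DU UE pU]]; split=> //.
  by rewrite (profile_top DU ch pU).
have [H [tH HE dEH]] : exists H', [/\ (vtop Es <= H')%VS, (H' <= E)%VS & \dim E = (\dim H').+1].
  by apply: hyper_ex => //; rewrite dE addnS ltnS leq_addr.
have dH : \dim H = (\dim (vtop Es) + e)%N by apply/eqP; rewrite -eqSS -dEH dE addnS.
have chH : chain (H :: Es) by rewrite /= tH.
set X := Xset (E :: Es) (j :: js).
have XU U : U \in X -> [/\ (D <= U)%VS, (U <= E)%VS, \dim U = (\dim D + (j + sumn js))%N & profile Es js U].
  by rewrite inE /= => /and4P[DU UE /eqP dU pU]; rewrite -dU (capv_idPl UE).
have part1 : [set U in X | (U <= H)%VS]%SET = Xset (H :: Es) (j :: js).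
  apply/setP => U; rewrite !inE /=; apply/andP/and4P => [[/and4P[DU UE /eqP d1 pU] UH]|[DU UH /eqP d1 pU]].
    by split=> //; rewrite (capv_idPl UH) -d1 (capv_idPl UE).
  have UE := subv_trans UH HE; split=> //; apply/and4P; split=> //.
  by rewrite (capv_idPl UE) -d1 (capv_idPl UH).
have capH U : (U <= E)%VS -> ~~ (U <= H)%VS -> \dim U = (\dim (U :&: H)).+1.
  move=> UE UH; have d1 : \dim (U + H) = (\dim H).+1.
    apply/eqP; rewrite eqn_leq -{1}dEH dimvS ?subv_add ?UE ?HE //= ltn_neqAle dimvS ?addvSr // andbT.
    apply: contra UH => /eqP h; have /eqP -> : H == (U + H)%VS by rewrite eqEdim addvSr h leqnn.
    exact: addvSl.
  by have := dimv_sum_cap U H; rewrite d1 addSn -addnS addnC => /addIn.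
rewrite -(cardsID [set U : {vspace vT} | (U <= H)%VS]%SET X).
have -> : X :&: [set U : {vspace vT} | (U <= H)%VS]%SET = [set U in X | (U <= H)%VS]%SET.
  by apply/setP => U; rewrite !inE.
rewrite part1 natrD (IHe H j tH dH).
have X2 U : U \in X :\: [set U : {vspace vT} | (U <= H)%VS]%SET ->
    exists2 j', j = j'.+1 & (U :&: H)%VS \in Xset (H :: Es) (j' :: js).
  rewrite finset.in_setD inE => /andP[UH /XU[DU UE dU pU]].
  have dV := capH U UE UH.
  have pV : profile Es js (U :&: H)%VS by rewrite -(eq_profile _ ch tH erefl).
  have DV : (D <= U :&: H)%VS by rewrite subv_cap DU (subv_trans (chain_D ch)).
  have lV : (\dim D + sumn js <= \dim (U :&: H))%N.
    by rewrite -(profile_top DV ch pV) dimvS // capvSl.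
  case: j dU {XU part1 X} => [|j'] dU; first by move: lV; rewrite -ltnS -dV dU add0n ltnn.
  exists j' => //; rewrite inE /= DV capvSr pV -capvA capvv andbT /=.
  by rewrite -eqSS -dV dU addSn addnS.
case: j @X XU part1 X2 => [|j] X XU part1 X2.
  rewrite [X :\: _](_ : _ = finset.set0) ?cards0 ?addr0 /= ?gbn0 ?mul0n //.
  by apply/setP => U; rewrite [RHS]inE; apply/negP => /X2[].
have -> : #|X :\: [set U : {vspace vT} | (U <= H)%VS]%SET|%:R =
    #|Xset (H :: Es) (j :: js)|%:R * Q ^+ (sumn (gsizes Es) + e - sumn js - j).
  rewrite -natrX -natrM; congr (_%:R).
  rewrite -sum1_card (partition_big (fun U => U :&: H)%VS (mem (Xset (H :: Es) (j :: js)))) /=; last first.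
    by move=> U /X2[j' [->]].
  rewrite -sum_nat_const; apply: eq_bigr => V; rewrite inE /= => /and4P[DV VH /eqP d1 pV].
  rewrite (capv_idPl VH) in d1.
  have <- : #|hset H E V| = (#|F| ^ (sumn (gsizes Es) + e - sumn js - j))%N.
    apply/eqP; rewrite -(@eqn_pmul2r (#|F| ^ \dim V)) ?expn_gt0 ?(ltnW (card_finNzRing_gt1 F)) //.
    rewrite hyper_count // -expnD; apply/eqP; congr (_ ^ _)%N.
    have := dimvS VH; rewrite dH dt d1; clear; lia.
  rewrite -[RHS]sum1_card; apply: eq_bigl => U; rewrite !inE /=.
  apply/andP/and4P => [[/andP[UH /and4P[DU UE /eqP dU pU]] /eqP UV]|[VU UE /eqP dU /eqP UV]].
    have := capH U UE UH; rewrite UV => e1; split=> //; rewrite ?e1 -?UV ?capvSl //.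
  have UH : ~~ (U <= H)%VS.
    by apply/negP => h; move: dU; rewrite -UV (capv_idPl h); apply: n_Sn.
  split; last by rewrite UV.
  rewrite UH (subv_trans DV VU) UE (capv_idPl UE) dU d1 addSn addnS eqxx /=.
  by rewrite (eq_profile js ch tH UV).
rewrite (IHe H j tH dH) /= mulrDl mulrDl; congr (_ + _).
have [h|h] := ltnP e j; first by rewrite gb_small // !(mulr0, mul0r).
have [h'|h'] := ltnP (sumn (gsizes Es)) (sumn js); first by rewrite cc_small // !(mulr0, mul0r).
have -> : (sumn (gsizes Es) + e - sumn js - j = (e - j) + (sumn (gsizes Es) - sumn js))%N by move: h h'; clear; lia.
rewrite mulSn !exprD; move: (Q ^+ (e - j)) (Q ^+ (sumn _ - _)) (Q ^+ (j * _)) (gb _ _ _) (cc _ _ _).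
move=> a b c g h2; rewrite -!mulrA; rewrite (mulrCA a g); congr (_ * _).
by rewrite (mulrC _ (a * b)) -!mulrA mulrCA (mulrCA c); congr (_ * _); rewrite (mulrC h2) mulrCA.
Qed.
End Schubert.
End Subspaces.

End SchubertCells.

(** * Flags over a point of M(d) *)

Section FlagCount.

Section Chains.
Variables (T : finType) (A : comNzRingType).

Definition walks m (R : 'I_m -> T -> T -> bool) x0 :=
  [set g : {ffun 'I_m.+1 -> T} | (g ord0 == x0) &&
    [forall i : 'I_m, R i (g (widen_ord (leqnSn m) i)) (g (lift ord0 i))]]%SET.

Lemma walks_inv m (R : 'I_m -> T -> T -> bool) (I : nat -> T -> Prop) x0 g :
  (forall (i : 'I_m) x y, I i x -> R i x y -> I i.+1 y) -> I 0%N x0 ->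
  g \in walks R x0 -> forall j : 'I_m.+1, I j (g j).
Proof.
move=> st I0; rewrite inE => /andP[/eqP g0 /forallP gs] [j jm].
elim: j jm => [|j IH] jm; first by rewrite (_ : Ordinal jm = ord0) ?g0 //; apply: val_inj.
have jm' : (j < m)%N by [].
have := st (Ordinal jm') _ _ _ (gs (Ordinal jm')).
rewrite (_ : lift ord0 (Ordinal jm') = Ordinal jm); last exact: val_inj.
apply; rewrite (_ : widen_ord _ _ = Ordinal (ltnW jm)); last exact: val_inj.
exact: (IH (ltnW jm)).
Qed.

(** While the invariant I holds, the number of continuations depends on the step alone, so the
    counts multiply. *)
Lemma card_walks m (R : 'I_m -> T -> T -> bool) (I : nat -> T -> Prop) (s : 'I_m -> A) x0 :
  (forall (i : 'I_m) x y, I i x -> R i x y -> I i.+1 y) ->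
  (forall (i : 'I_m) x, I i x -> #|[set y | R i x y]%SET|%:R = s i) ->
  I 0%N x0 -> #|walks R x0|%:R = \prod_(i < m) s i.
Proof.
elim: m R I s x0 => [|m IH] R I s x0 st sc I0.
  rewrite big_ord0 (_ : walks R x0 = [set [ffun=> x0]]%SET) ?cards1 //.
  apply/setP => g; rewrite !inE; apply/andP/eqP => [[/eqP g0 _]|->].
    by apply/ffunP => j; rewrite ffunE -g0; congr (g _); apply: val_inj; case: j => [[]].
  by rewrite ffunE; split=> //; apply/forallP => -[].
pose R' i := R (lift ord0 i).
pose sh (g : {ffun 'I_m.+2 -> T}) : {ffun 'I_m.+1 -> T} := [ffun i => g (lift ord0 i)].
have shW g : g \in walks R x0 -> R ord0 x0 (sh g ord0) /\ sh g \in walks R' (sh g ord0).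
  rewrite !inE => /andP[/eqP g0 /forallP gs]; split.
    by rewrite ffunE -g0; have := gs ord0; rewrite (_ : widen_ord _ _ = ord0) //; apply: val_inj.
  rewrite eqxx; apply/forallP => i; rewrite !ffunE; have := gs (lift ord0 i); rewrite /R'.
  by rewrite (_ : widen_ord _ (lift _ _) = lift ord0 (widen_ord (leqnSn m) i)) //; apply: val_inj.
have IH' y : R ord0 x0 y -> #|walks R' y|%:R = \prod_(i < m) s (lift ord0 i).
  move=> xy; apply: (IH R' (fun i => I i.+1)) => //.
  - by move=> i x z Ix; apply: st.
  - by move=> i x Ix; apply: sc.
  exact: st xy.
rewrite big_ord_recl -(sc ord0 x0) //.
rewrite -sum1_card (partition_big (fun g => sh g ord0) (mem [set y | R ord0 x0 y]%SET)) /=; last first.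
  by move=> g /shW[]; rewrite inE.
rewrite -[in RHS]sum1_card !natr_sum big_distrl /=; apply: eq_bigr => y; rewrite inE => xy.
rewrite mul1r -(IH' _ xy) -[in RHS]sum1_card; congr (_%:R).
pose un (g : {ffun 'I_m.+1 -> T}) : {ffun 'I_m.+2 -> T} :=
  [ffun j => if unlift ord0 j is Some i then g i else x0].
have unK g : sh (un g) = g by apply/ffunP => i; rewrite !ffunE liftK.
have shK (g : {ffun 'I_m.+2 -> T}) : g ord0 = x0 -> un (sh g) = g.
  by move=> g0; apply/ffunP => j; rewrite !ffunE; case: unliftP => [i|] ->; rewrite ?ffunE.
rewrite (reindex_onto un sh) /=; last by move=> g /andP[]; rewrite inE => /andP[/eqP g0 _] _; apply: shK.
apply: eq_bigl => g; rewrite unK eqxx andbT; apply/andP/idP => [[/shW[_]]|gW].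
  by rewrite unK => h /eqP e; rewrite e in h.
have g0 : g ord0 = y by move: gW; rewrite inE => /andP[/eqP].
split; last exact/eqP; rewrite inE !ffunE unlift_none eqxx; apply/forallP => i.
have [j|] := unliftP ord0 i => ->; last first.
  rewrite (_ : widen_ord _ _ = ord0); last exact: val_inj.
  by rewrite !ffunE unlift_none liftK g0.
rewrite (_ : widen_ord _ (lift _ _) = lift ord0 (widen_ord (leqnSn m) j)); last exact: val_inj.
rewrite !ffunE !liftK; move: gW; rewrite inE => /andP[_ /forallP]; exact.
Qed.
End Chains.

(** The first three hypotheses are Grassmann formulas for U' :&: (X + U) with X = im t, W, ker t;
    they translate the jumps of a flag step into the [profile] of a Schubert cell. *)
Lemma step_arith (u' u lu ru wu wv nv ru' nu nu' k1 dd nn ww rr : nat) :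
  (k1 + ru = u + ru')%N -> (wv + wu = u + nv)%N -> (nu' + nu = u + lu)%N ->
  (nn <= dd)%N -> (ww <= nn)%N -> (rr <= ww)%N ->
  [&& u' == u + dd, nv == wu + ww, ru' == ru + rr & lu == nu + nn]%N =
  [&& u' == u + (dd - nn + (nn - ww + (ww - rr + rr))),
      nu' == u + (nn - ww + (ww - rr + rr)), wv == u + (ww - rr + rr) & k1 == u + rr]%N.
Proof.
move=> h1 h2 h3 h4 h5 h6; apply/and4P/and4P => -[/eqP a /eqP b /eqP c /eqP e];
by split; apply/eqP; lia.
Qed.

Section Flags.
Variables (A : comNzRingType) (k : nat) (d : 'I_k -> nat) (F : finFieldType).
Local Notation vT := 'rV[F]_(tot d).
Variables (W : {vspace vT}) (t : 'End(vT)).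
Hypotheses (tW : (limg t <= W)%VS) (Wt : (W <= lker t)%VS).
Variables (w r n : 'I_k -> nat).
Hypotheses (rw : forall i, (r i <= w i)%N) (wn : forall i, (w i <= n i)%N) (nd : forall i, (n i <= d i)%N).
Hypothesis Wd : \dim W = (\sum_i w i)%N.
Hypothesis td : \dim (limg t) = (\sum_i r i)%N.
Hypothesis rn : (\sum_i r i + \sum_i n i = \sum_i d i)%N.
Implicit Types U V X : {vspace vT}.

Definition psum (v : 'I_k -> nat) (i : nat) := (\sum_(j < k | (j < i)%N) v j)%N.
Definition tsum (v : 'I_k -> nat) (i : nat) := (\sum_(j < k | (i <= j)%N) v j)%N.

Lemma psumS v (i : 'I_k) : psum v i.+1 = (psum v i + v i)%N.
Proof.
rewrite /psum (bigD1 i) //= addnC; congr (_ + _)%N; apply: eq_bigl => j.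
by rewrite ltnS [RHS]ltn_neqAle andbC.
Qed.

Lemma psum_tsum v i : (psum v i + tsum v i = \sum_j v j)%N.
Proof.
rewrite /psum /tsum (bigID (fun j : 'I_k => (j < i)%N) predT) /=; congr (_ + _)%N.
by apply: eq_bigl => j; rewrite -leqNgt.
Qed.

Lemma tsumB u v i : (forall j, u j <= v j)%N -> tsum (fun j => v j - u j)%N i = (tsum v i - tsum u i)%N.
Proof.
move=> uv; have -> : tsum v i = (tsum (fun j => v j - u j)%N i + tsum u i)%N.
  by rewrite /tsum -big_split; apply: eq_bigr => j _; rewrite /= subnK.
by rewrite addnK.
Qed.

Definition stepR (i : 'I_k) U U' :=
  [&& (U <= U')%VS, (\dim U' - \dim U)%N == d i, (t @: U' <= U)%VS,
    (\dim (W :&: U') - \dim (W :&: U))%N == w i,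
    (\dim (limg t :&: U') - \dim (limg t :&: U))%N == r i &
    (\dim (lker t :&: U') - \dim (lker t :&: U))%N == n i].

Definition stepI (i : nat) U :=
  [/\ \dim U = psum d i, (t @: U <= U)%VS, \dim (W :&: U) = psum w i,
    \dim (limg t :&: U) = psum r i & \dim (lker t :&: U) = psum n i].

Lemma subn_eqD a b c : (a <= b)%N -> ((b - a)%N == c) = (b == (a + c)%N).
Proof. by move=> h; rewrite -(eqn_add2l a) subnKC. Qed.

Lemma stepRE i U U' : (U <= U')%VS -> stepR i U U' =
  [&& \dim U' == (\dim U + d i)%N, (t @: U' <= U)%VS,
    \dim (W :&: U') == (\dim (W :&: U) + w i)%N,
    \dim (limg t :&: U') == (\dim (limg t :&: U) + r i)%N &
    \dim (lker t :&: U') == (\dim (lker t :&: U) + n i)%N].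
Proof. by move=> h; rewrite /stepR h !subn_eqD ?dimvS ?capvS. Qed.

Lemma stepI_next (i : 'I_k) U U' : stepI i U -> stepR i U U' -> stepI i.+1 U'.
Proof.
case=> h1 h2 h3 h4 h5 s; have UU : (U <= U')%VS by case/and3P: s.
move: s; rewrite stepRE // => /and5P[/eqP e1 e2 /eqP e3 /eqP e4 /eqP e5].
by split; rewrite ?psumS ?e1 ?e3 ?e4 ?e5 ?h1 ?h3 ?h4 ?h5 // (subv_trans e2).
Qed.

Lemma stepI0 : stepI 0 0%VS.
Proof. by split; rewrite ?limg0 ?capv0 ?dimv0 ?sub0v //; rewrite /psum big_pred0. Qed.

Lemma memv_preim_sub U V : (U <= t @^-1: V)%VS = (t @: U <= V)%VS.
Proof.
apply/subvP/subvP => [h v /memv_imgP[u uU ->]|h u uU].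
  by have := h _ uU; rewrite -memv_preim.
by rewrite -memv_preim h // memv_img.
Qed.

Lemma dim_preim V : \dim (t @^-1: V) = (\dim (lker t) + \dim (limg t :&: V))%N.
Proof.
have kV : (lker t <= t @^-1: V)%VS by apply/subvP => v; rewrite memv_ker -memv_preim => /eqP ->; apply: mem0v.
rewrite -(limg_ker_dim t (t @^-1: V)) (capv_idPr kV); congr (_ + \dim _)%N.
apply/eqP; rewrite eqEsubv subv_cap limgS ?subvf // -memv_preim_sub subvv /=.
apply/subvP => v; rewrite memv_cap => /andP[/memv_imgP[u _ ->]].
by rewrite memv_preim; apply: memv_img.
Qed.

Lemma dim_cap_sum U U' X : (U <= U')%VS ->
  (\dim (U' :&: (X + U)) + \dim (X :&: U) = \dim U + \dim (X :&: U'))%N.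
Proof.
move=> UU; have -> : (U' :&: (X + U) = (X :&: U') + U)%VS.
  apply/eqP; rewrite eqEsubv subv_cap !subv_add capvSr UU addvSr (subv_trans (capvSl _ _) (addvSl _ _)).
  rewrite !andbT; apply/subvP => v; rewrite memv_cap => /andP[vU /memv_addP[x xX [u uU e]]].
  rewrite e memv_add // memv_cap xX (_ : x = v - u) ?rpredB //; first exact: (subvP UU).
  by rewrite e addrK.
by have := dimv_sum_cap (X :&: U') U; rewrite -capvA (capv_idPr UU) => ->; rewrite addnC.
Qed.

(** The next member U' lies between U and the preimage of U under t, and the required jumps fix its
    dimensions against U + im t, U + W and U + ker t: a Schubert cell with four blocks. *)
Lemma card_step (i : 'I_k) U : stepI i U -> #|[set U' | stepR i U U']%SET|%:R =
  cc4 (#|F|%:R : A) (tsum r i) (tsum (fun j => w j - r j) i)%N (tsum (fun j => n j - w j) i)%N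
    (tsum d i - tsum r i - tsum n i) (r i) (w i - r i) (n i - w i) (d i - n i).
Proof.
case=> h1 h2 h3 h4 h5.
pose Es := [:: (t @^-1: U); lker t + U; W + U; limg t + U]%VS.
have ch : chain U Es.
  rewrite /= addvSr !andbT subv_add (memv_preim_sub U) h2 andbT; apply/and3P; split.
  - by apply/subvP => v; rewrite memv_ker -memv_preim => /eqP ->; apply: mem0v.
  - by apply: addvS.
  - by apply: addvS.
have dK : (\dim (lker t) + \sum_j r j = \sum_j d j)%N.
  rewrite -td; have := limg_ker_dim t fullv; rewrite capfv => ->.
  by rewrite dimvf /dim /= mul1n /tot sum_ring_nat.
have dk : \dim (lker t) = (\sum_j n j)%N by apply/eqP; rewrite -(eqn_add2r (\sum_j r j)%N) dK -rn addnC.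
have e1 : (\dim (limg t + U) = \dim U + tsum r i)%N.
  by apply/eqP; rewrite -(eqn_add2r (\dim (limg t :&: U))) dimv_sum_cap h4 td -(psum_tsum r i) -addnA addnC (addnC (tsum _ _)).
have e2 : (\dim (W + U) = \dim U + tsum w i)%N.
  by apply/eqP; rewrite -(eqn_add2r (\dim (W :&: U))) dimv_sum_cap h3 Wd -(psum_tsum w i) -addnA addnC (addnC (tsum _ _)).
have e3 : (\dim (lker t + U) = \dim U + tsum n i)%N.
  by apply/eqP; rewrite -(eqn_add2r (\dim (lker t :&: U))) dimv_sum_cap h5 dk -(psum_tsum n i) -addnA addnC (addnC (tsum _ _)).
have gs : gsizes U Es = [:: (tsum d i - tsum r i - tsum n i)%N; tsum (fun j => n j - w j)%N i;
    tsum (fun j => w j - r j)%N i; tsum r i].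
  rewrite /= e1 e2 e3 !subnDl addKn !tsumB //; congr (_ :: _).
  rewrite dim_preim h4 h1 dk; have := psum_tsum d i; have := psum_tsum r i; have := psum_tsum n i.
  by move: rn; clear; lia.
rewrite -cc4E -gs -(card_Xset A _ ch); congr (_%:R); apply: eq_card => U'; rewrite !inE.
have [UU|nUU] := boolP (U <= U')%VS; last by rewrite /stepR (negPf nUU).
rewrite stepRE //= memv_preim_sub !addn0.
have [tU|ntU] := boolP (t @: U' <= U)%VS; last by rewrite andbF.
have c4 : (U' :&: t @^-1: U)%VS = U' by apply/capv_idPl; rewrite memv_preim_sub.
rewrite c4 /= andbT.
have c1 := dim_cap_sum (limg t) UU; have c2 := dim_cap_sum W UU; have c3 := dim_cap_sum (lker t) UU.
exact: step_arith c1 c2 c3 (nd i) (wn i) (rw i).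
Qed.

Lemma tot_dim_flag fl : fl \in walks stepR 0%VS -> fl ord_max = fullv.
Proof.
move=> fw; have [h _ _ _ _] := walks_inv stepI_next stepI0 fw ord_max.
apply/eqP; rewrite eqEdim subvf /= h dimvf /dim /= mul1n /tot sum_ring_nat.
by rewrite -(psum_tsum d k) [tsum d k]big_pred0 ?addn0 // => j; rewrite leqNgt ltn_ord.
Qed.

Lemma card_flags :
  #|walks stepR 0%VS|%:R = \prod_(i < k)
    cc4 (#|F|%:R : A) (tsum r i) (tsum (fun j => w j - r j) i)%N (tsum (fun j => n j - w j) i)%N
      (tsum d i - tsum r i - tsum n i) (r i) (w i - r i) (n i - w i) (d i - n i).
Proof. exact: (card_walks stepI_next card_step stepI0). Qed.
End Flags.

Section Fibre.
Variables (A : comNzRingType) (k : nat) (d : 'I_k -> nat) (F : finFieldType).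
Variables (w r n : 'I_k -> nat) (x : Mvar d F).
Hypotheses (rw : forall i, (r i <= w i)%N) (wn : forall i, (w i <= n i)%N) (nd : forall i, (n i <= d i)%N).
Hypothesis Wd : Wdim x = (\sum_i w i)%N.
Hypothesis td : trank x = (\sum_i r i)%N.
Hypothesis rn : (\sum_i r i + \sum_i n i = \sum_i d i)%N.

Lemma card_fibre :
  #|[set y : Tvar d F | (Tproj y == x) && Aset w r n y]%SET|%:R = \prod_(i < k)
    cc4 (#|F|%:R : A) (tsum r i) (tsum (fun j => w j - r j) i)%N (tsum (fun j => n j - w j) i)%N
      (tsum d i - tsum r i - tsum n i) (r i) (w i - r i) (n i - w i) (d i - n i).
Proof.
move: Wd td; case: x => -[W t] xM Wd' td'; have [/= tW Wt] := andP xM.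
rewrite -(@card_flags A k d F W t tW Wt w r n) //; congr (_%:R).
have fi : {in [set y : Tvar d F | (Tproj y == exist _ (W, t) xM) && Aset w r n y]%SET &,
    injective (fun y : Tvar d F => flag y)}.
  move=> [[f p] hf] [[f' p'] hf']; rewrite !inE /flag /= => /andP[/eqP[e] _] /andP[/eqP[e'] _] ff.
  by apply: val_inj; rewrite /= e e' ff.
rewrite -(card_in_imset fi); apply: eq_card => fl; apply/imsetP/idP => [[y]|fw].
  rewrite inE => /andP[/eqP pe /forallP ya ->]; rewrite /flag.
  case: y pe ya => -[f p] hf [e] ya; move: ya; rewrite /Wof /tof /flag /= e /= => ya.
  have /and4P[_ f0 _ /forallP ff] := hf; rewrite inE f0 /=; apply/forallP => i.
  have /and3P[a1 a2 a3] := ya i; have /and3P[b1 b2 b3] := ff i.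
  by rewrite e in b3; apply/and5P; split=> //; apply/andP.
have fT : Tcond (fl, (W, t)).
  rewrite /Tcond /= xM (tot_dim_flag fw) eqxx /=; move: fw; rewrite inE => /andP[-> /forallP fs] /=.
  by apply/forallP => i; have /and5P[b1 b2 b3 _ _] := fs i; apply/and3P.
exists (exist _ (fl, (W, t)) fT) => //; rewrite inE; apply/andP; split; first exact/eqP/val_inj.
apply/forallP => i; move: fw; rewrite inE => /andP[_ /forallP/(_ i)/and5P[_ _ _ a1 /andP[a2 a3]]].
exact/and3P.
Qed.
End Fibre.

End FlagCount.

(** * Counting polynomials *)

Section PointCounts.

Section Standard.
Variables (F : finFieldType) (D : nat).
Local Notation vT := 'rV[F]_D.

Lemma free_std (s : seq 'I_D) : uniq s -> free [seq (delta_mx 0 i : vT) | i <- s].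
Proof.
elim: s => [|i s IH] /=; first by rewrite nil_free.
case/andP => si us; rewrite free_cons IH // andbT; apply/negP => /(@coord_span _ _ _ (in_tuple _) _) e.
have := congr1 (fun v : vT => v 0 i) e; rewrite mxE !eqxx summxE big1 => [/eqP|j _].
  by rewrite oner_eq0.
have js : (j < size s)%N by case: j => j /= jm; move: (jm); rewrite size_map.
rewrite mxE (nth_map i) // mxE eqxx /= (_ : (i == _) = false) ?mulr0 //.
by apply/negbTE; apply: contraNneq si => ->; apply: mem_nth.
Qed.

Definition stds (m : nat) : {vspace vT} :=
  <<[seq (delta_mx 0%R i : vT) | i <- [seq i : 'I_D <- enum 'I_D | (i < m)%N]]>>%VS.

Lemma mem_stds m (i : 'I_D) : (i < m)%N -> (delta_mx 0 i : vT) \in stds m.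
Proof. by move=> h; apply: memv_span; apply: map_f; rewrite mem_filter h mem_enum. Qed.

Lemma dim_stds m : (m <= D)%N -> \dim (stds m) = m.
Proof.
move=> mD; have /eqP -> := free_std (filter_uniq (fun i : 'I_D => (i < m)%N) (enum_uniq 'I_D)).
rewrite size_map -(size_map val) (_ : [seq val x | x <- [seq i <- _ | _]] = iota 0 m) ?size_iota //.
rewrite -(filter_map _ (fun i => i < m)%N) val_enum_ord -[D in iota 0 D](subnKC mD) iotaD filter_cat.
rewrite (_ : [seq i <- iota 0 m | _] = iota 0 m); last first.
  by apply/all_filterP/allP => i; rewrite mem_iota.
rewrite (_ : [seq i <- iota _ (D - m) | _] = [::]) ?cats0 //; apply/eqP; rewrite -[_ == _]negbK -has_filter.
by apply/hasPn => i; rewrite mem_iota -leqNgt add0n => /andP[].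
Qed.

Lemma stds_sub m (V : {vspace vT}) :
  (forall i : 'I_D, (i < m)%N -> delta_mx 0 i \in V) -> (stds m <= V)%VS.
Proof.
move=> h; apply/span_subvP => v vs.
case: (@mapP _ (matrix F 1 D : eqType) _ _ _ vs) => i; rewrite mem_filter => /andP[im _ ->].
exact: h.
Qed.

Lemma stdsS m n : (m <= n)%N -> (stds m <= stds n)%VS.
Proof. by move=> mn; apply: stds_sub => i im; apply: mem_stds; apply: leq_trans mn. Qed.

(** Sends the last r standard vectors, in order, to the first r ones and kills the others. *)
Definition stdt (r : nat) : 'End(vT) :=
  linfun (mulmxr (\matrix_(i < D, j < D) (i == j + (D - r) :> nat)%N%:R : 'M[F]_D)).

Lemma stdt_delta r (i : 'I_D) : stdt r (delta_mx 0 i) = \row_j (i == j + (D - r) :> nat)%N%:R.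
Proof.
rewrite lfunE /=; apply/rowP => j; rewrite !mxE (bigD1 i) //= big1 => [|l li].
  by rewrite !mxE !eqxx mul1r addr0.
by rewrite !mxE (negPf li) andbF mul0r.
Qed.

Lemma limg_stdt r : (r <= D)%N -> limg (stdt r) = stds r.
Proof.
move=> rD; apply/eqP; rewrite eqEsubv; apply/andP; split.
  apply/subvP => v /memv_imgP[u _ ->]; rewrite (row_sum_delta u) linear_sum; apply: memv_suml => i _.
  rewrite linearZ /= memvZ // stdt_delta; have [h|h] := leqP (D - r) i; last first.
    rewrite (_ : \row_j _ = 0) ?mem0v //; apply/rowP => j; rewrite !mxE; case: eqP => // e.
    by move: h; rewrite e; lia.
  have ij : (i - (D - r) < D)%N by move: (ltn_ord i); lia.
  rewrite (_ : \row_j _ = delta_mx 0 (Ordinal ij)); first by apply: mem_stds => /=; move: (ltn_ord i) rD; lia.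
  apply/rowP => j; rewrite !mxE eqxx /= -val_eqE /=; congr (_%:R); congr nat_of_bool.
  by apply/eqP/eqP; lia.
apply: stds_sub => i ir.
have ij : (i + (D - r) < D)%N by move: ir rD; lia.
rewrite (_ : delta_mx 0 i = stdt r (delta_mx 0 (Ordinal ij))); first exact/memv_img/memvf.
by rewrite stdt_delta; apply/rowP => j; rewrite !mxE eqxx /= eqn_add2r eq_sym.
Qed.

Lemma stds_ker r m : (m + r <= D)%N -> (stds m <= lker (stdt r))%VS.
Proof.
move=> h; apply: stds_sub => i im.
rewrite memv_ker stdt_delta; apply/eqP/rowP => j; rewrite !mxE; case: eqP => // e.
by move: im h; rewrite e; lia.
Qed.
End Standard.

Section Chi.
Variables (R : realType).

(** The standard pair has the same dimensions over any field, the only constraint being w + r at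
    most d. So the counts defining [chi_q] are never vacuous. *)
Lemma stratum_ex k (d : 'I_k -> nat) (F : finFieldType) (x : Mvar d F) (F' : finFieldType) :
  exists x' : Mvar d F', Wdim x' = Wdim x /\ trank x' = trank x.
Proof.
have /andP[h1 h2] : Mcond (val x) by case: x.
have r_w : (trank x <= Wdim x)%N by apply: dimvS.
have w_k : (Wdim x + trank x <= tot d)%N.
  have := limg_ker_dim (val x).2 fullv; rewrite capfv dimvf /dim /= mul1n => <-.
  by rewrite leq_add2r; apply: dimvS.
pose y := (stds F' (tot d) (Wdim x), stdt F' (tot d) (trank x)).
have Wd : (Wdim x <= tot d)%N by apply: leq_trans w_k; apply: leq_addr.
have rd : (trank x <= tot d)%N by apply: leq_trans w_k; apply: leq_addl.
have yM : Mcond y by rewrite /Mcond /= limg_stdt // stdsS // stds_ker.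
exists (exist _ y yM); split; first by rewrite /Wdim /= dim_stds.
by rewrite /trank /= limg_stdt // dim_stds.
Qed.

Lemma prime_seq n : exists s : seq nat, [/\ uniq s, all prime s & size s = n].
Proof.
elim: n => [|n [s [us ps sn]]]; first by exists [::].
have [p ps' pp] := prime_above (\max_(i <- s) i).
exists (p :: s); rewrite /= us ps pp sn andbT; split=> //.
by apply/negP => h; move: ps'; rewrite (big_rem p h) /= ltnNge leq_maxl.
Qed.

Lemma poly_primes0 (P : {poly R[i]}) : (forall p, prime p -> P.[p%:R] = 0) -> P = 0.
Proof.
move=> h; have [s [us ps sn]] := prime_seq (size P); apply/eqP/negPn/negP => P0.
have := @max_poly_roots _ P [seq p%:R | p <- s] P0; rewrite size_map sn ltnn => H; suff: false by []; apply: H.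
  by apply/allP => _ /mapP[p sp ->]; apply/rootP/h/(allP ps).
by rewrite map_inj_uniq // => a b /eqP; rewrite eqr_nat => /eqP.
Qed.

(** Two admissible polynomials agree at every prime, because some count exists over each prime
    field; hence the choice made in [chi_q] is forced. *)
Lemma chi_qE (N : finFieldType -> nat -> Prop) (P : {poly R[i]}) :
  (forall (F : finFieldType) n, N F n -> n%:R = P.[#|F|%:R]) ->
  (forall F : finFieldType, exists n, N F n) ->
  chi_q R N = FracField.tofrac (P \Po 'X^2).
Proof.
move=> NP Nex; rewrite /chi_q (xget_subset1 0 (x := P)) //= => P1 P2 h1 h2.
apply/eqP; rewrite -subr_eq0; apply/eqP/poly_primes0 => p pp.
have [n Nn] := Nex 'F_p; have e1 := h1 _ _ Nn; have e2 := h2 _ _ Nn.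
by rewrite card_Fp // in e1 e2; rewrite hornerD hornerN -e1 -e2 subrr.
Qed.
End Chi.

End PointCounts.

(** * The push-forward in coordinates *)

Section PushForwardFormula.

Section Alpha.
Variables (k : nat) (d : 'I_k -> nat) (F : finFieldType).

Lemma psum_alpha (y : Tvar d F) X (j : 'I_k.+1) :
  psum (alpha X (flag y)) j = \dim (X :&: flag y j).
Proof.
case: y => -[fl x] hy; have /and4P[_ /eqP f0 _ /forallP fs] := hy; rewrite /flag /=.
case: j => j jk; elim: j jk => [|j IH] jk /=.
  rewrite (_ : Ordinal jk = ord0) ?f0 ?capv0 ?dimv0; last exact: val_inj.
  by rewrite /psum big_pred0.
have jk' : (j < k)%N by [].
have /= -> := psumS (alpha X fl) (Ordinal jk').
have /= -> := IH (ltnW jk); rewrite /alpha /fhi /flo.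
rewrite (_ : lift ord0 (Ordinal jk') = Ordinal jk); last exact: val_inj.
rewrite (_ : widen_ord _ (Ordinal jk') = Ordinal (ltnW jk)); last exact: val_inj.
rewrite subnKC // dimvS // capvS //; have /and3P[h _ _] := fs (Ordinal jk').
move: h; rewrite /fhi /flo (_ : lift ord0 (Ordinal jk') = Ordinal jk); last exact: val_inj.
by rewrite (_ : widen_ord _ (Ordinal jk') = Ordinal (ltnW jk)); last exact: val_inj.
Qed.

Lemma sum_alpha (y : Tvar d F) X : (\sum_i alpha X (flag y) i)%N = \dim X.
Proof.
have := psum_alpha y X ord_max; have /and4P[_ _ /eqP -> _] : Tcond (val y) by case: y.
rewrite capvf => <-; rewrite -(psum_tsum _ k) [tsum _ k]big_pred0 ?addn0 // => j.
by rewrite leqNgt ltn_ord.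
Qed.

Lemma Aset_type w r n (y : Tvar d F) : Aset w r n y ->
  Wdim (Tproj y) = (\sum_i w i)%N /\ trank (Tproj y) = (\sum_i r i)%N.
Proof.
move=> /forallP ya; rewrite /Wdim /trank -!(sum_alpha y) /=.
by split; apply: eq_bigr => i _; have /and3P[/eqP h1 /eqP h2 _] := ya i.
Qed.
End Alpha.

Section PushForward.
Variables (R : realType) (k : nat) (d : 'I_k -> nat).
Variables (iota_ : forall n, 'Hom(Vn R n, V1pow R n)) (pi_ : forall n, 'Hom(V1pow R n, Vn R n)).
Variable b : arcs d.
Hypothesis lb : lcm_spec b.
Variable z : tens R d.
Local Notation K := (Cq R).
Local Notation e := (fun i : 'I_k => nS b i - rS b i)%N.

Definition fcoef (a : idx e) : K :=
  gamma iota_ pi_ b z a * kfac R (fun i => a i + rS b i)%N (rS b) (nS b).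

(** Generic in the ring: the same product is the point count over F, the counting polynomial in ['X]
    and its value at q^2. *)
Definition fcount (A : comNzRingType) (Q : A) (a : idx e) : A := \prod_(i < k)
  cc4 Q (tsum (rS b) i) (tsum (fun j => a j + rS b j - rS b j) i)%N
    (tsum (fun j => nS b j - (a j + rS b j)) i)%N (tsum d i - tsum (rS b) i - tsum (nS b) i)
    (rS b i) (a i + rS b i - rS b i) (nS b i - (a i + rS b i)) (d i - nS b i).

Definition ftype F (x : Mvar d F) (a : idx e) : bool :=
  (Wdim x == (\sum_i (a i + rS b i))%N) && (trank x == (\sum_i rS b i)%N).

(** On [Yset b] a summand S survives only if n^S = n^b. This fixes the number of right endpoints per
    box, hence S = b by [rights_inj]. *)
Lemma Tc_Yset F (y : Tvar d F) :
  (Yset b y)%:R * Tc_iso iota_ pi_ z y = \sum_a fcoef a * (Aset (fun i => a i + rS b i)%N (rS b) (nS b) y)%:R.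
Proof.
have [Yy|nY] := boolP (Yset b y); last first.
  rewrite mul0r big1 // => a _; rewrite (_ : Aset _ _ _ y = false) ?mulr0 //.
  apply: contraNF nY => /forallP ya; apply/forallP => i; by have /and3P[] := ya i.
rewrite mul1r /Tc_iso (bigD1 b) /=; last exact/lcmP.
rewrite [X in _ + X]big1 ?addr0 => [|S /andP[/lcmP lS Sb]].
  by rewrite /eta_inv; apply: eq_bigr => a _; rewrite /fwrn /fcoef -mulrA.
rewrite /eta_inv big1 // => a _; rewrite /fwrn (_ : Aset _ _ _ y = false) ?mulr0 //.
apply: contraNF Sb => /forallP ya; apply/eqP/esym/rights_inj => // i.
have /and3P[_ _ /eqP e1] := ya i; have /forallP/(_ i)/eqP e2 := Yy.
move: e1; rewrite e2 /nS; have := box_count lb i; have := box_count lS i; clear; lia.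
Qed.

Lemma Aset_uniq F (y : Tvar d F) (a a' : idx e) :
  Aset (fun i => a i + rS b i)%N (rS b) (nS b) y -> Aset (fun i => a' i + rS b i)%N (rS b) (nS b) y -> a = a'.
Proof.
move=> /forallP h /forallP h'; apply/ffunP => i; apply: val_inj => /=; apply/eqP.
by have /and3P[/eqP h1 _ _] := h i; have /and3P[/eqP h2 _ _] := h' i; rewrite -(eqn_add2r (rS b i)) -h1 -h2.
Qed.

(** The sets [Aset] are disjoint and the function is constant on each. The value 0 is excluded
    because it also occurs outside all of them. *)
Lemma card_value F (x : Mvar d F) (c : K) : c != 0 ->
  #|[set y : Tvar d F | (Tproj y == x) && ((Yset b y)%:R * Tc_iso iota_ pi_ z y == c)]%SET| =
  (\sum_(a | fcoef a == c) #|[set y : Tvar d F | (Tproj y == x) && Aset (fun i => a i + rS b i) (rS b) (nS b) y]%SET|)%N.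
Proof.
move=> c0; have val_a (y : Tvar d F) (a : idx e) : Aset (fun i => a i + rS b i)%N (rS b) (nS b) y ->
    (Yset b y)%:R * Tc_iso iota_ pi_ z y = fcoef a :> K.
  move=> ya; rewrite Tc_Yset (bigD1 a) //= ya mulr1 big1 ?addr0 // => a' na.
  by rewrite (_ : Aset _ _ _ y = false) ?mulr0 //; apply: contraNF na => /(Aset_uniq ya) ->.
pose f (y : Tvar d F) := [pick a : idx e | Aset (fun i => a i + rS b i)%N (rS b) (nS b) y].
have fP (y : Tvar d F) (a : idx e) : Aset (fun i => a i + rS b i)%N (rS b) (nS b) y -> f y = Some a.
  by move=> ya; rewrite /f; case: pickP => [a' /(Aset_uniq ya) ->|/(_ a)]; rewrite ?ya.
have fA (y : Tvar d F) (a : idx e) : f y = Some a -> Aset (fun i => a i + rS b i)%N (rS b) (nS b) y.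
  by rewrite /f; case: pickP => // a' h [<-].
have f0 (y : Tvar d F) : f y = None -> (Yset b y)%:R * Tc_iso iota_ pi_ z y = 0 :> K.
  move=> fy; rewrite Tc_Yset big1 // => a _; rewrite (_ : Aset _ _ _ y = false) ?mulr0 //.
  by apply/negP => /fP; rewrite fy.
pose fo y : idx e := if f y is Some a then a else [ffun=> ord0].
rewrite -sum1_card (partition_big fo (fun a : idx e => fcoef a == c)) /fo /=; last first.
  move=> y; rewrite inE => /andP[_ /eqP yc]; case fy : (f y) => [a|] /=.
    by rewrite -(val_a _ _ (fA _ _ fy)) yc.
  by move: yc c0; rewrite f0 // => <-; rewrite eqxx.
apply: eq_bigr => a /eqP ac; rewrite -sum1_card; apply: eq_bigl => y; rewrite !inE.
apply/andP/andP => [[/andP[-> /eqP yc]]|[-> ya]].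
  case fy : (f y) => [a'|] /= /eqP aa; first by rewrite -aa; split=> //; apply: fA.
  by move: c0; rewrite -yc f0 ?eqxx.
by rewrite (fP _ _ ya) (val_a _ _ ya) ac !eqxx.
Qed.

Lemma card_fibre_type (A : comNzRingType) F (x : Mvar d F) (a : idx e) :
  #|[set y : Tvar d F | (Tproj y == x) && Aset (fun i => a i + rS b i)%N (rS b) (nS b) y]%SET|%:R =
  (ftype x a)%:R * fcount (#|F|%:R : A) a.
Proof.
have bc := box_count lb.
have rn i : (rS b i <= nS b i)%N by rewrite /rS /nS; have := bc i; lia.
case: (boolP (ftype x a)) => [/andP[/eqP h1 /eqP h2]|h].
  rewrite mul1r; apply: card_fibre => //.
  - by move=> i; apply: leq_addl.
  - by move=> i; have := ltn_ord (a i); have := rn i; rewrite ltnS; lia.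
  - by move=> i; apply: leq_subr.
  rewrite -big_split /=; have : (\sum_i lefts b i = \sum_i rights b i)%N by rewrite sum_lefts // sum_rights.
  rewrite big_split /= /rS => ->; rewrite -big_split /=; apply: eq_bigr => i _.
  by rewrite /nS subnKC // (bc i) addnAC leq_addl.
rewrite mul0r (_ : [set _ | _]%SET = finset.set0) ?cards0 //; apply/setP => y; rewrite [RHS]inE.
apply/negP; rewrite inE => /andP[/eqP e1 /Aset_type[h1 h2]]; case/negP: h.
by rewrite /ftype -e1 h1 h2 !eqxx.
Qed.

Lemma rmorph_fcount (A B : comNzRingType) (f : {rmorphism A -> B}) Q a : f (fcount Q a) = fcount (f Q) a.
Proof. by rewrite /fcount rmorph_prod; apply: eq_bigr => i _; rewrite rmorph_cc4. Qed.

Lemma TYE F (x : Mvar d F) :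
  TY (fun F => @Yset k d F b) (Tc_iso iota_ pi_ z) x =
  \sum_(a : idx e) fcoef a * ((ftype x a)%:R * fcount (q ^+ 2 : K) a).
Proof.
rewrite /TY /pushforward.
pose G a : K := (ftype x a)%:R * fcount (q ^+ 2 : K) a.
have H (c : K) : c * chi_q R (fun F' n => exists x' : Mvar d F', [/\ Wdim x' = Wdim x, trank x' = trank x &
    n = #|[set y : Tvar d F' | (Tproj y == x') && ((Yset b y)%:R * Tc_iso iota_ pi_ z y == c)]%SET|]) =
    \sum_(a | fcoef a == c) fcoef a * G a.
  have [->|c0] := eqVneq c 0.
    by rewrite mul0r big1 // => a /eqP ->; rewrite mul0r.
  pose P : {poly R[i]} := \sum_(a | fcoef a == c) (ftype x a)%:R * fcount 'X a.
  rewrite (@chi_qE _ _ P).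
  - rewrite /P !rmorph_sum big_distrr /=; apply: eq_bigr => a /eqP ->; congr (_ * _).
    rewrite !rmorphM !rmorph_nat /G; congr (_ * _).
    by rewrite !rmorph_fcount /= comp_polyX rmorphXn.
  - move=> F' n [x' [h1 h2 ->]]; rewrite card_value // natr_sum /P horner_sum; apply: eq_bigr => a _.
    rewrite card_fibre_type -[RHS]/(horner_eval _ _) rmorphM rmorph_nat rmorph_fcount /= /horner_eval hornerX.
    by rewrite /ftype h1 h2.
  move=> F'; have [x' [h1 h2]] := stratum_ex x F'.
  by eexists; exists x'; split.
under eq_fsbigr do rewrite H.
(* Only the finitely many values [fcoef a] contribute to the sum over all c; duplicates are removed
   as several a may share a value. *)
rewrite (@fsbigE _ _ _ _ _ (undup [seq fcoef a | a : idx e])) ?undup_uniq //; last first.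
  move=> c _; rewrite mem_undup => nc; rewrite big_pred0 // => a.
  by apply: contraNF nc => /eqP <-; apply: map_f; rewrite mem_enum.
under eq_bigl do rewrite in_setT.
rewrite (exchange_big_dep predT) //=; apply: eq_bigr => a _.
rewrite -big_filter (_ : [seq c <- _ | _] = [:: fcoef a]) ?big_seq1 //.
rewrite (eq_filter (a2 := pred1 (fcoef a))) => [|c]; last by rewrite /= eq_sym.
by rewrite filter_pred1_uniq ?undup_uniq // mem_undup; apply: map_f; rewrite mem_enum.
Qed.
End PushForward.

End PushForwardFormula.

(** * The push-forward as an intertwiner *)

Section MultinomialIntertwiner.

Section Level.
Variables (K : fieldType) (q : K).
Hypothesis q0 : q != 0.
Hypothesis qnr : forall n, (0 < n)%N -> q ^+ n != q ^- n.
Variable (k : nat).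
Implicit Types (u v e : 'I_k -> nat) (s t : 'I_k).

Definition sz u : nat := (\sum_t u t)%N.

Lemma sz_up u s : sz (up u s) = (sz u).+1.
Proof.
rewrite /sz /up big_split /= -addn1; congr (_ + _)%N.
by rewrite (bigD1 s) //= eqxx big1 // => t /negPf ->.
Qed.

Lemma sz_dn u s : (0 < u s)%N -> (sz (dn u s)).+1 = sz u.
Proof. by move=> us; rewrite -[in RHS](dnK us) sz_up. Qed.

Lemma sz_sub e u : inr e u -> sz (fun t => e t - u t)%N = (sz e - sz u)%N.
Proof.
move=> /inrP h; rewrite (_ : sz e = (sz (fun t => e t - u t) + sz u)%N) ?addnK //.
by rewrite /sz -big_split; apply: eq_bigr => t _; rewrite /= subnK.
Qed.

Lemma sz_le e u : inr e u -> (sz u <= sz e)%N.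
Proof. by move=> /inrP h; apply: leq_sum. Qed.

Lemma sum_up e s (f : ('I_k -> nat) -> K) :
  \sum_(a : idx e | (0 < a s)%N) f (fun t => a t) = \sum_(a : idx e | (a s < e s)%N) f (up (fun t => a t) s).
Proof.
have inr_u (a : idx e) : (a s < e s)%N -> inr e (up (fun t => a t) s).
  move=> h; apply/inrP => t; have [->|ts] := eqVneq t s; first by rewrite upE.
  by rewrite upN // -ltnS.
have out (a : idx e) : (e s <= a s)%N -> mki e (up (fun t => a t) s) s = 0%N :> nat.
  by move=> h; rewrite ffunE /inord val_insubd upE ltnS ltnNge h.
rewrite (reindex_onto (fun a : idx e => mki e (up (fun t => a t) s)) (fun a : idx e => mki e (dn (fun t => a t) s))) /=.
  apply: eq_big => [a|a /andP[h1 _]]; have [h|h] := ltnP (a s) (e s).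
  - rewrite (mkiE s (inr_u _ h)) upE; apply/eqP/ffunP => t; apply: val_inj.
    by rewrite idx_mki ?inr_u // upK mki_idx.
  - by rewrite out.
  - by rewrite idx_mki ?inr_u.
  by rewrite out in h1.
move=> a h; rewrite idx_mki ?dnK ?mki_idx //; apply: inr_dn; apply: inr_idx.
Qed.

Definition gt u s : nat := (\sum_(j < k | (s < j)%N) u j)%N.
Definition lt u s : nat := (\sum_(j < k | (j < s)%N) u j)%N.

(** For v = m - u these are the coefficients of a U_q-map to the largest summand. Keeping u and v
    independent gives a separate recursion for raising each of them. *)
Definition shuf u v : K := q ^+ (\sum_i v i * gt u i)%N * qf q (sz u) * qf q (sz v) /
  \prod_i (qf q (u i) * qf q (v i)).

Lemma prod_qf_up u s : \prod_i qf q (up u s i) = qn q (u s).+1 * \prod_i qf q (u i).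
Proof.
rewrite (bigD1 s) //= [in RHS](bigD1 s) //= upE qfS mulrAC mulrC; congr (_ * (_ * _)).
by apply: eq_bigr => i ne; rewrite upN.
Qed.

Lemma gt_up u s i : gt (up u s) i = (gt u i + (i < s)%N)%N.
Proof.
rewrite /gt /up big_split /=; congr (_ + _)%N; case: ltnP => h.
  by rewrite (bigD1 s) //= eqxx big1 // => t /andP[_ /negPf ->].
by rewrite big1 // => t ht; rewrite (_ : t == s = false) //; apply: contraTF ht => /eqP ->; rewrite -leqNgt.
Qed.

Lemma prod_qf_neq0 u : \prod_i qf q (u i) != 0.
Proof. by apply/prodf_neq0 => i _; apply: qf_neq0. Qed.

Lemma shuf_upl u v s : shuf (up u s) v * qn q (u s).+1 =
  q ^+ (lt v s) * qn q (sz u).+1 * shuf u v.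
Proof.
have n1 : qn q (u s).+1 != 0 by apply: qn_neq0.
rewrite /shuf sz_up qfS !big_split /= prod_qf_up.
have -> : (\sum_i v i * gt (up u s) i = lt v s + \sum_i v i * gt u i)%N.
  rewrite /lt [in RHS]big_mkcond -big_split; apply: eq_bigr => i _ /=; rewrite gt_up mulnDr addnC.
  by case: ltnP; rewrite ?muln1 ?muln0.
have := prod_qf_neq0 u; have := prod_qf_neq0 v; move: n1; rewrite exprD.
move: (q ^+ _) (q ^+ _) (qf q _) (qf q _) (qn q _) (\prod_i _) (\prod_i _) (qn q _) => a b c d' e f g h.
by move=> n1 n2 n3; field; rewrite n1 n2 n3.
Qed.

Lemma shuf_upr u v s : shuf u (up v s) * qn q (v s).+1 =
  q ^+ (gt u s) * qn q (sz v).+1 * shuf u v.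
Proof.
have n1 : qn q (v s).+1 != 0 by apply: qn_neq0.
rewrite /shuf sz_up qfS !big_split /= prod_qf_up.
have -> : (\sum_i up v s i * gt u i = gt u s + \sum_i v i * gt u i)%N.
  rewrite (bigD1 s) //= [in RHS](bigD1 s) //= upE mulSn -addnA; congr (_ + (_ + _))%N.
  by apply: eq_bigr => i ne; rewrite upN.
have := prod_qf_neq0 u; have := prod_qf_neq0 v; move: n1; rewrite exprD.
move: (q ^+ _) (q ^+ _) (qf q _) (qf q _) (qn q _) (\prod_i _) (\prod_i _) (qn q _) => a b c d' e f g h.
by move=> n1 n2 n3; field; rewrite n1 n2 n3.
Qed.

Variable m : 'I_k -> nat.
Notation M := (sz m).

Section Functional.
Variable L : ('I_k -> nat) -> K.
(** Commutation of [Phi] with F, read off on the basis vector of index u; the last factor accounts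
    for F being 0 on the lowest weight vector. [LE] is the same for E. *)
Hypothesis LF : forall u, inr m u ->
  \sum_(s | (u s < m s)%N) q ^ (- \sum_(t < k | (s < t)%N) hw m u t) * qn q (u s).+1 * L (up u s) = qn q (sz u).+1 * L u * (sz u < M)%N%:R.
Hypothesis LE : forall u, inr m u ->
  \sum_(s | (0 < u s)%N) q ^ (\sum_(t < k | (t < s)%N) hw m u t) * qn q (m s - u s).+1 * L (dn u s) = qn q (M - sz u).+1 * L u * (0 < sz u)%N%:R.

Definition Phi (z : gtens K m) : gtens K (fun _ : 'I_1 => M) :=
  mk _ (fun w => \sum_(a : idx m | sz (fun t => a t) == w ord0) z a * L (fun t => a t)).

Lemma cf_Phi w z : cf w (Phi z) = \sum_(a : idx m | sz (fun t => a t) == w ord0) z a * L (fun t => a t).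
Proof.
rewrite cf_mk; case: ifP => // /negbT nw; rewrite big_pred0 // => a; apply: contraNF nw => /eqP e.
by apply/inrP => t; rewrite (ord1 t) -e; apply/sz_le/inr_idx.
Qed.

Lemma Phi_gKt z : Phi (gKt q z) = gKt q (Phi z).
Proof.
apply: gext => w wr; rewrite cf_gKt !cf_Phi mulr_sumr; apply: eq_bigr => a /eqP aw.
rewrite -cf_idx cf_gKt cf_idx mulrA big_ord1; congr (q ^ _ * _ * _).
rewrite /hw big_split /= sumrN sumrMnl -aw /sz; congr (_ - _ *+ 2); by rewrite (big_morph Posz PoszD (erefl _)).
Qed.

Lemma Phi_gKit z : Phi (gKit q z) = gKit q (Phi z).
Proof.
apply: gext => w wr; rewrite cf_gKit !cf_Phi mulr_sumr; apply: eq_bigr => a /eqP aw.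
rewrite -cf_idx cf_gKit cf_idx mulrA big_ord1; congr (q ^ (- _) * _ * _).
rewrite /hw big_split /= sumrN sumrMnl -aw /sz; congr (_ - _ *+ 2); by rewrite (big_morph Posz PoszD (erefl _)).
Qed.

Lemma Phi_gF z : Phi (gF q k z) = gF q 1 (Phi z).
Proof.
apply: gext => w wr; rewrite cf_gF big_ord1_cond /= cf_gf cf_Phi.
rewrite (_ : wF _ w ord0 1 = 0) ?oppr0 ?expr0z ?mul1r; last by rewrite /wF big_pred0 // => t; rewrite (ord1 t).
have -> : (w ord0 <= M)%N = true by have /inrP := wr; apply.
rewrite mul1r.
transitivity (\sum_s \sum_(a : idx m | (0 < a s)%N)
    (sz (fun t => a t) == w ord0)%:R * (q ^ (- wF m (fun t => a t) s k) * (qn q (a s) * cf (dn (fun t => a t) s) z) * L (fun t => a t))).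
  rewrite [RHS](exchange_big_dep predT) //= [LHS]big_mkcond /=; apply: eq_bigr => a _.
  case: eqP => _; last by rewrite big1 // => s _; rewrite mul0r.
  rewrite -cf_idx cf_gF; under [X in X * _]eq_bigl => s do rewrite ltn_ord.
  rewrite mulr_suml [RHS]big_mkcond; apply: eq_bigr => s _ /=; rewrite cf_gf (_ : (a s <= m s)%N = true) ?mul1r; last by rewrite -ltnS ltn_ord.
  by case: posnP => // ->; rewrite qn0 mul0r mulr0 mul0r.
transitivity (\sum_(a : idx m) (((sz (fun t => a t)).+1 == w ord0)%:R * z a) *
   \sum_(s | (a s < m s)%N) q ^ (- \sum_(t < k | (s < t)%N) hw m (fun t => a t) t) * qn q (a s).+1 * L (up (fun t => a t) s)).
  under eq_bigr => s _.
    rewrite (sum_up m s (fun u => (sz u == w ord0)%:R * (q ^ (- wF m u s k) * (qn q (u s) * cf (dn u s) z) * L u))).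
    over.
  rewrite (exchange_big_dep predT) //=; apply: eq_bigr => a _.
  rewrite mulr_sumr; apply: eq_bigr => s h; rewrite sz_up upK upE cf_idx.
  have -> : wF m (up (fun t => a t) s) s k = \sum_(t < k | (s < t)%N) hw m (fun t => a t) t.
    rewrite /wF (eq_bigl (fun t : 'I_k => (s < t)%N)) => [|t /=]; last by rewrite (ltn_ord t) andbT.
    by rewrite sum_hw_up /= ltnn; apply: subr0.
  ring.
rewrite (eq_bigr (fun a : idx m => ((sz (fun t => a t)).+1 == w ord0)%:R * (qn q (w ord0) * (z a * L (fun t => a t))))); last first.
  move=> a _; rewrite LF ?inr_idx //; case: eqP => [e|_]; last by rewrite !mul0r.
  rewrite e (_ : (w ord0 <= M)%N = true) ?mulr1; last by have /inrP/(_ ord0) := wr.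
  by rewrite !mul1r mulrCA.
rewrite cf_Phi; case: (posnP (w ord0)) => w0.
  by rewrite w0 qn0 mul0r big1 // => a _; rewrite mul0r.
rewrite mulr_sumr [RHS]big_mkcond; apply: eq_bigr => a _; rewrite dnE -[w ord0 in LHS](prednK w0) eqSS.
by case: eqP => _; rewrite ?mul1r ?mul0r ?prednK.
Qed.

Lemma Phi_gEt z : Phi (gEt q z) = gEt q (Phi z).
Proof.
apply: gext => w wr; rewrite cf_gEt big_ord1 cf_gE cf_Phi.
rewrite (_ : wE _ w ord0 = 0) ?expr0z ?mul1r; last by rewrite /wE big_pred0 // => t; rewrite (ord1 t).
transitivity (\sum_s \sum_(a : idx m | (a s < m s)%N)
    (sz (fun t => a t) == w ord0)%:R * (q ^ (wE m (fun t => a t) s) * (qn q (m s - a s) * cf (up (fun t => a t) s) z) * L (dn (up (fun t => a t) s) s))).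
  rewrite [RHS](exchange_big_dep predT) //= [LHS]big_mkcond /=; apply: eq_bigr => a _.
  case: eqP => _; last by rewrite big1 // => s _; rewrite mul0r.
  rewrite -cf_idx cf_gEt mulr_suml [RHS]big_mkcond; apply: eq_bigr => s _ /=; rewrite cf_gE upK mul1r.
  by case: ltnP => // h; rewrite (eqP h) qn0 mul0r mulr0 mul0r.
transitivity (\sum_(a : idx m) ((sz (fun t => a t) == (w ord0).+1)%:R * z a) *
   \sum_(s | (0 < a s)%N) q ^ (\sum_(t < k | (t < s)%N) hw m (fun t => a t) t) * qn q (m s - a s).+1 * L (dn (fun t => a t) s)).
  under [RHS]eq_bigr => a _ do rewrite mulr_sumr.
  rewrite [RHS](exchange_big_dep predT) //=; apply: eq_bigr => s _.
  rewrite [RHS](eq_bigr (fun a : idx m => (fun u => ((sz u == (w ord0).+1)%:R * cf u z) *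
    (q ^ (\sum_(t < k | (t < s)%N) hw m u t) * qn q (m s - u s).+1 * L (dn u s))) (fun t => a t))); last first.
    by move=> a _; rewrite cf_idx.
  rewrite [RHS](sum_up m s (fun u => ((sz u == (w ord0).+1)%:R * cf u z) *
    (q ^ (\sum_(t < k | (t < s)%N) hw m u t) * qn q (m s - u s).+1 * L (dn u s)))).
  apply: eq_bigr => a h; rewrite sz_up eqSS upE -subSn // subSS.
  have -> : \sum_(t < k | (t < s)%N) hw m (up (fun t0 => a t0) s) t = wE m (fun t => a t) s.
    by rewrite /wE sum_hw_up /= ltnn; apply: subr0.
  by rewrite upK; ring.
rewrite (eq_bigr (fun a : idx m => (sz (fun t => a t) == (w ord0).+1)%:R * (qn q (M - w ord0) * (z a * L (fun t => a t))))); last first.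
  move=> a _; rewrite LE ?inr_idx //; case: eqP => [e|_]; last by rewrite !mul0r.
  have h : (w ord0 < M)%N by rewrite -e; apply/sz_le/inr_idx.
  by rewrite e mulr1 -subSn // subSS !mul1r mulrCA.
rewrite cf_Phi mulr_sumr [RHS]big_mkcond; apply: eq_bigr => a _; rewrite upE.
by case: eqP => _; rewrite ?mul1r ?mul0r.
Qed.
End Functional.

Definition Lc u := shuf u (fun t => m t - u t)%N.

Lemma posz_sum (P : pred 'I_k) u : \sum_(t | P t) (u t)%:Z = (\sum_(t | P t) u t)%N :> int.
Proof. by rewrite (big_morph Posz PoszD (erefl _)). Qed.

Lemma hw_diff (P : pred 'I_k) u : inr m u -> \sum_(t | P t) hw m u t =
  (\sum_(t | P t) (m t - u t))%N%:Z - (\sum_(t | P t) u t)%N%:Z.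
Proof.
move=> /inrP h; rewrite -!posz_sum -sumrB; apply: eq_bigr => t _.
by rewrite /hw -subzn // mulr2n; ring.
Qed.

(** By [shuf_upl] and [shuf_upr] each summand is a constant times the summand of [qz_telescope] for
    x = m - u. *)
Lemma Lc_F u : inr m u ->
  \sum_(s | (u s < m s)%N) q ^ (- \sum_(t < k | (s < t)%N) hw m u t) * qn q (u s).+1 * Lc (up u s) =
  qn q (sz u).+1 * Lc u * (sz u < M)%N%:R.
Proof.
move=> ur; have ule := inrP _ _ ur; pose v t := (m t - u t)%N.
have H s : (u s < m s)%N -> q ^ (- \sum_(t < k | (s < t)%N) hw m u t) * qn q (u s).+1 * Lc (up u s) =
    q ^ (\sum_(t < k | (t < s)%N) (v t)%:Z - \sum_(t < k | (s < t)%N) (v t)%:Z) * qz q (v s) *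
    (qn q (sz u).+1 * Lc u / qn q (sz v)).
  move=> us; rewrite /Lc; pose v' := dn v s.
  have vs : (0 < v s)%N by rewrite subn_gt0.
  have -> : (fun t => m t - up u s t)%N = v' by apply: funext => t; rewrite /v' /dn /up /v subnDA.
  rewrite (hw_diff (fun t : 'I_k => (s < t)%N) ur) !posz_sum -[(\sum_(t < k | (s < t)%N) (m t - u t))%N]/(gt v s).
  rewrite -[(\sum_(t < k | (s < t)%N) u t)%N]/(gt u s).
  rewrite -[(\sum_(t < k | (t < s)%N) v t)%N]/(lt v s) -mulrA (mulrC (qn _ _)) shuf_upl.
  have -> : lt v s = lt v' s by apply: eq_bigr => t ts; rewrite /v' dnN // -val_eqE ltn_eqF.
  have -> : sz v = (sz v').+1 by rewrite sz_dn.
  have := shuf_upr u v' s; rewrite dnK // /v' dnE prednK // -/v' -qnE => e.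
  have n1 : qn q (sz v').+1 != 0 by apply: qn_neq0.
  transitivity (q ^ ((lt v' s)%:Z - (gt v s)%:Z) * (qn q (sz u).+1 / qn q (sz v').+1 * (shuf u v * qn q (v s)))); last first.
    by move: (q ^ _) => X; ring.
  rewrite e; move: (lt v' s) (gt v s) (gt u s) n1; clear -q0 => a b c n1.
  rewrite opprB !expfzDr // -!exprnP; move: (q ^ - b%:Z) (q ^+ a) (q ^+ c) => x1 x2 x3.
  by field.
rewrite (eq_bigr _ H) big_mkcond /= (eq_bigr (fun s =>
    q ^ (\sum_(t < k | (t < s)%N) (v t)%:Z - \sum_(t < k | (s < t)%N) (v t)%:Z) * qz q (v s) *
    (qn q (sz u).+1 * Lc u / qn q (sz v)))); last first.
  move=> s _; case: ltnP => // h; have -> : v s = 0%N by apply/eqP; rewrite subn_eq0.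
  by rewrite qz0 mulr0 mul0r.
rewrite -mulr_suml qz_telescope // posz_sum -qnE -[(\sum_(t < k) v t)%N]/(sz v).
have -> : (sz u < M)%N = (0 < sz v)%N by rewrite sz_sub // subn_gt0.
case: posnP => [->|h]; first by rewrite qn0 mul0r mulr0.
by rewrite mulr1 mulrC divfK // qn_neq0.
Qed.

(** As for [Lc_F], now with x = - u, which accounts for the signs. *)
Lemma Lc_E u : inr m u ->
  \sum_(s | (0 < u s)%N) q ^ (\sum_(t < k | (t < s)%N) hw m u t) * qn q (m s - u s).+1 * Lc (dn u s) =
  qn q (M - sz u).+1 * Lc u * (0 < sz u)%N%:R.
Proof.
move=> ur; have ule := inrP _ _ ur; pose v t := (m t - u t)%N.
have H s : (0 < u s)%N -> q ^ (\sum_(t < k | (t < s)%N) hw m u t) * qn q (m s - u s).+1 * Lc (dn u s) =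
    q ^ (\sum_(t < k | (t < s)%N) (- (u t)%:Z) - \sum_(t < k | (s < t)%N) (- (u t)%:Z)) * qz q (- (u s)%:Z) *
    - (qn q (sz v).+1 * Lc u / qn q (sz u)).
  move=> us; rewrite /Lc; pose u' := dn u s.
  have -> : (fun t => m t - dn u s t)%N = up v s.
    apply: funext => t; rewrite /dn /up /v; have := ule t; case: eqP => [->|_]; lia.
  rewrite (hw_diff (fun t : 'I_k => (t < s)%N) ur) !sumrN !posz_sum.
  rewrite -[(\sum_(t < k | (t < s)%N) (m t - u t))%N]/(lt v s) -[(\sum_(t < k | (t < s)%N) u t)%N]/(lt u s).
  rewrite -[(\sum_(t < k | (s < t)%N) u t)%N]/(gt u s) -mulrA (mulrC (qn _ _)) shuf_upr -/u'.
  have -> : gt u' s = gt u s by apply: eq_bigr => t ts; rewrite /u' dnN // -val_eqE gtn_eqF.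
  have -> : sz u = (sz u').+1 by rewrite sz_dn.
  have := shuf_upl u' v s; rewrite dnK // /u' dnE prednK // -/u' => e.
  have n1 : qn q (sz u').+1 != 0 by apply: qn_neq0.
  rewrite qzN -qnE -/v.
  transitivity (q ^ ((gt u s)%:Z - (lt u s)%:Z) * (qn q (sz v).+1 / qn q (sz u').+1 * (shuf u v * qn q (u s)))); last first.
    by rewrite opprK addrC; move: (q ^ _) => X; ring.
  rewrite e; move: (lt v s) (lt u s) (gt u s) n1; clear -q0 => a b c n1.
  rewrite !expfzDr // -!exprnP; move: (q ^ - b%:Z) (q ^+ a) (q ^+ c) => x1 x2 x3.
  by field.
rewrite (eq_bigr _ H) big_mkcond /= (eq_bigr (fun s =>
    q ^ (\sum_(t < k | (t < s)%N) (- (u t)%:Z) - \sum_(t < k | (s < t)%N) (- (u t)%:Z)) * qz q (- (u s)%:Z) *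
    - (qn q (sz v).+1 * Lc u / qn q (sz u)))); last first.
  by move=> s _; case: posnP => // ->; rewrite oppr0 qz0 mulr0 mul0r.
rewrite -mulr_suml (qz_telescope q0 (fun t => - (u t)%:Z)) sumrN posz_sum qzN -qnE mulrNN -[(\sum_(t < k) u t)%N]/(sz u).
have <- : sz v = (M - sz u)%N by rewrite sz_sub.
case: posnP => [->|h]; first by rewrite qn0 mul0r mulr0.
by rewrite mulr1 mulrC divfK // qn_neq0.
Qed.
End Level.

End MultinomialIntertwiner.

(** * Products of Gaussian binomials as multinomials *)

Section ProductFormula.

Section Closed.
Variables (K : fieldType) (q : K).
Hypothesis q0 : q != 0.
Hypothesis qnr : forall n, (0 < n)%N -> q ^+ n != q ^- n.
Local Notation gb := (gb (q ^+ 2)).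

Lemma gb_qf n j : gb (n + j) j = q ^+ (j * n) * (qf q (n + j) / (qf q j * qf q n)).
Proof.
have [N] := ubnP (n + j); elim: N n j => // N IH n j.
have nz x : qf q x != 0 by apply: qf_neq0.
case: j => [|j].
  by rewrite addn0 gbn0 mul0n expr0 mul1r {2}/qf big_nil mul1r divff.
case: n => [|n] lt.
  rewrite add0n muln0 expr0 mul1r {3}/qf big_nil mulr1 divff //.
  elim: j {lt} => [|j IHj]; first by rewrite gbSS subnn expr0 mul1r gbn0 gb_small // add0r.
  by rewrite gbSS gb_small // add0r subnn expr0 mul1r.
rewrite addSn addnS gbSS -[gb _ j.+1]/(gb (n + j).+1 j.+1) -addnS IH; last by move: lt; lia.
rewrite addnS -addSn IH; last by move: lt; lia.
rewrite addSn subSn ?leq_addl // addnK !qfS.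
have n1 : qn q n.+1 != 0 by apply: qn_neq0.
have n2 : qn q j.+1 != 0 by apply: qn_neq0.
have -> : qn q (n + j).+2 = q ^- j.+1 * qn q n.+1 + q ^+ n.+1 * qn q j.+1.
  rewrite !qnE (_ : (n + j).+2%:Z = j.+1%:Z + n.+1%:Z); last by rewrite -PoszD; congr Posz; lia.
  by rewrite (qzD q0) -!exprnP addrC exprnN.
rewrite -!exprM (_ : j.+1 * n.+1 = j.+1 * n + j.+1)%N; last by rewrite mulnS addnC.
rewrite (_ : j * n.+1 = j * n + j)%N; last by rewrite mulnS addnC.
rewrite (_ : j.+1 * n = j * n + n)%N; last by rewrite mulSn addnC.
rewrite (_ : 2 * n.+1 = n.+1 + n.+1)%N; last by lia.
rewrite !exprD !exprS; have := nz (n + j)%N; have := nz n; have := nz j; have := expf_neq0 n q0; have := expf_neq0 j q0.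
move: n1 n2; move: (qn q n.+1) (qn q j.+1) (qf q (n + j)) (qf q n) (qf q j) (q ^+ n) (q ^+ j) (q ^+ (j * n)) q0; clear.
move=> a b c x y f g h qq n1 n2 n3 n4 n5 n6 n7.
by field; rewrite n1 n2 n5 n6 qq n3.
Qed.

Lemma gb_neq0 n j : (j <= n)%N -> gb n j != 0.
Proof.
move=> jn; rewrite -(subnK jn) gb_qf mulf_neq0 ?expf_neq0 //.
by rewrite mulf_neq0 ?invr_eq0 ?mulf_neq0 ?qf_neq0.
Qed.

Variable k : nat.
Implicit Types (u v e r p : 'I_k -> nat) (i : 'I_k).

Lemma tsum_gt u i : tsum u i = (gt u i + u i)%N.
Proof.
rewrite /tsum (bigD1 i) //= addnC; congr (_ + _)%N; apply: eq_bigl => j.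
by rewrite ltn_neqAle andbC -val_eqE eq_sym.
Qed.

(** [gt u i] is the tail sum starting at i + 1, so the two products differ only at the ends; g 0 = 1
    takes care of the empty tail. *)
Lemma prod_tail u (g : nat -> K) : g 0%N = 1 ->
  \prod_(i < k) g (tsum u i) = g (sz u) * \prod_i g (gt u i).
Proof.
move=> g0; have tk : tsum u k = 0%N by rewrite /tsum big_pred0 // => j; rewrite leqNgt ltn_ord.
transitivity (\prod_(j < k.+1) g (tsum u j)); first by rewrite big_ord_recr /= tk g0 mulr1.
by rewrite big_ord_recl.
Qed.

Lemma prod_gb u : \prod_(i < k) gb (tsum u i) (u i) =
  q ^+ (\sum_i u i * gt u i)%N * (qf q (sz u) / \prod_(i < k) qf q (u i)).
Proof.
rewrite (eq_bigr (fun i => q ^+ (u i * gt u i) * (qf q (tsum u i) / (qf q (u i) * qf q (gt u i))))); last first.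
  by move=> i _; rewrite tsum_gt gb_qf.
rewrite big_split prodrXr; congr (_ * _); rewrite big_split /= prodfV big_split /= prod_tail.
  have := prod_qf_neq0 qnr (gt u); have := prod_qf_neq0 qnr u.
  by move: (\prod_i _) (\prod_i _) (qf q _) => a b c n1 n2; field; rewrite n1.
by rewrite /qf big_nil.
Qed.

(** What is left of the exponents of q in [prod_cc4] once those of [shuf] are removed; it sees u and
    v only through e = u + v. *)
Definition Cexp e r p : nat :=
  (\sum_i (r i * (gt e i + gt r i) + e i * gt e i + 2 * (gt r i * (e i + p i)) + 2 * (gt e i * p i)))%N.

Definition Cc e r p (X : 'I_k -> nat) : K :=
  q ^+ Cexp e r p * \prod_(i < k) gb (tsum r i) (r i) * \prod_(i < k) gb (X i) (p i).

Lemma Cc_neq0 e r p X : (forall i, p i <= X i)%N -> Cc e r p X != 0.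
Proof.
move=> pX; rewrite /Cc !mulf_neq0 ?expf_neq0 //; apply/prodf_neq0 => i _; apply: gb_neq0 => //.
by rewrite tsum_gt leq_addl.
Qed.

Lemma prod_cc4 e r p X u v : (forall i, e i = u i + v i)%N ->
  q ^+ (\sum_i (r i * (gt e i + gt r i) + u i * gt v i))%N *
  \prod_(i < k) cc4 (q ^+ 2) (tsum r i) (tsum u i) (tsum v i) (X i) (r i) (u i) (v i) (p i) =
  Cc e r p X * shuf q u v.
Proof.
move=> euv; have ge i : gt e i = (gt u i + gt v i)%N by rewrite /gt -big_split; apply: eq_bigr => j _; rewrite euv.
(* The factor k supplies the cross terms u_i * gt v i that complete e_i * gt e i; the count
   contributes v_i * gt u i twice, and one copy is left for [shuf]. *)
have E : ((\sum_i (r i * (gt e i + gt r i) + u i * gt v i)) + (\sum_i u i * gt u i) + (\sum_i v i * gt v i) +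
    2 * \sum_(i < k) ((tsum r i - r i) * (u i + v i + p i) + (tsum u i - u i) * (v i + p i) + (tsum v i - v i) * p i) =
    Cexp e r p + \sum_i v i * gt u i)%N.
  rewrite big_distrr /= /Cexp -!big_split; apply: eq_bigr => i _ /=; rewrite !tsum_gt !addnK ge euv.
  by rewrite !(mulnDr, mulnDl); lia.
have H (xA g1 xU fu pu xV fv pv g4 xS : K) :
    xA * (g1 * (xU * (fu / pu)) * (xV * (fv / pv)) * g4 * xS) = (xA * xU * xV * xS) * (g1 * g4 * (fu * fv / (pu * pv))).
  by rewrite invfM; ring.
have H' (xC g1 g4 xS fu fv P : K) : xC * g1 * g4 * (xS * fu * fv / P) = (xC * xS) * (g1 * g4 * (fu * fv / P)).
  by ring.
move: E; set S0 := (\sum_i (r i * _ + _))%N => E.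
rewrite /cc4 !big_split /= (prod_gb u) (prod_gb v) prodrXr -exprM H -!exprD E /Cc /shuf big_split /= H'.
by rewrite exprD.
Qed.
End Closed.

End ProductFormula.

(** * The push-forward as gamma followed by the multinomial map *)

Section PushForwardIntertwiner.

Section Last.
Variables (R : realType) (k : nat) (d : 'I_k -> nat).
Variables (iota_ : forall n, 'Hom(Vn R n, V1pow R n)) (pi_ : forall n, 'Hom(V1pow R n, Vn R n)).
Hypotheses (Hiota : forall n, is_iota (iota_ n)) (Hpi : forall n, is_pi (pi_ n)).
Local Notation K := (Cq R).
Local Notation q := (@q R).
Local Notation qnr := (q_regular R).
Local Notation q0 := (q_neq0 R).

Lemma gamma_linear b : linear (gamma iota_ pi_ b : tens R d -> _).
Proof.
move=> c x y; apply/ffunP => a; rewrite !ffunE /= scaler_sumr -big_split /=; apply: eq_bigr => u _.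
by rewrite !ffunE mulrDl -mulrA.
Qed.

Variable b : arcs d.
Local Notation e := (fun i : 'I_k => nS b i - rS b i)%N.
Local Notation rho := (fun i : 'I_k => d i - nS b i)%N.
Local Notation Xb := (fun i : 'I_k => tsum d i - tsum (rS b) i - tsum (nS b) i)%N.

Definition Cb : K := Cc q e (rS b) rho Xb.

Definition ThatF mu (z : tens R d) : Vn R mu :=
  [ffun w : idx (fun _ : 'I_1 => mu) =>
    \sum_(a : idx e | sz (fun t => a t) == w ord0) gamma iota_ pi_ b z a * (Cb * Lc q e (fun t => a t))].

Lemma ThatF_linear mu : linear (@ThatF mu).
Proof.
move=> c x y; apply/ffunP => w; rewrite !ffunE /= scaler_sumr -big_split /=; apply: eq_bigr => a _.
by rewrite gamma_linear !ffunE mulrDl -mulrA.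
Qed.
HB.instance Definition _ mu := GRing.isLinear.Build K (tens R d) (Vn R mu) _ (@ThatF mu) (@ThatF_linear mu).

Hypothesis lb : lcm_spec b.

Lemma sz_lefts : sz (rS b) = #|b|.
Proof. exact: sum_lefts. Qed.

Lemma left_right_sizes i : (rS b i + e i <= d i)%N /\ (rS b i + e i = nS b i)%N.
Proof. by have := box_count lb i; rewrite /rS /nS; lia. Qed.

Lemma sz_e : (sz e + 2 * #|b| = tot d)%N.
Proof.
transitivity (\sum_i d i)%N; last by rewrite /tot sum_ring_nat.
rewrite mul2n -addnn -{1}(sum_lefts lb) -(sum_rights lb) /sz -!big_split /=.
by apply: eq_bigr => i _; have := box_count lb i; rewrite /rS /nS; lia.
Qed.

Lemma ThatF_uq_hom mu : (mu + 2 * #|b| = tot d)%N -> uq_hom (@ThatF mu).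
Proof.
move=> h; have /addIn -> := etrans h (esym sz_e).
have TE z : @ThatF (sz e) z = Cb *: Phi (Lc q e) (gamma iota_ pi_ b z : gtens K e).
  apply/ffunP => w; rewrite !ffunE -[RHS]/(Cb * _) mulr_sumr; apply: eq_bigr => a _.
  by rewrite mulrCA.
have [g1 g2 g3 g4] := gamma_uq_hom Hiota Hpi lb.
split=> z; rewrite !TE ?g1 ?g2 ?g3 ?g4.
- rewrite !actE_E (Phi_gEt (Lc_E q0 qnr (m := e))); exact: (esym (@linearZ_LR _ _ _ _ (gEt q (e:=fun _ : 'I_1 => sz e)) Cb _)).
- rewrite /actF !actF_firstE (Phi_gF (Lc_F q0 qnr (m := e))); exact: (esym (@linearZ_LR _ _ _ _ (gF q (e:=fun _ : 'I_1 => sz e) 1) Cb _)).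
- rewrite !actKE Phi_gKt; exact: (esym (@linearZ_LR _ _ _ _ (gKt q (e:=fun _ : 'I_1 => sz e)) Cb _)).
- rewrite !actKiE Phi_gKit; apply: gext => u _; rewrite cfZ !cf_gKit cfZ mulrCA //.
Qed.

(** An arc starting in box i or later ends in a box after i. This keeps the last Gaussian binomials
    in [Cb] non-zero. *)
Lemma tail_lefts (i : 'I_k) : (tsum (rS b) i <= gt (rights b) i)%N.
Proof.
have H (f : 'I_(tot d) * 'I_(tot d) -> nat) (P : pred 'I_k) :
    (\sum_(j | P j) #|[set a in b | inbox d j (f a)]%SET| = \sum_(a in b) \sum_(j | P j) inbox d j (f a))%N.
  rewrite exchange_big /=; apply: eq_bigr => j _; rewrite -sum1_card big_mkcond [RHS]big_mkcond.
  by apply: eq_bigr => a _; rewrite inE; case: (a \in b); case: inbox.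
rewrite /tsum /gt /rS (H fst) (H snd); apply: leq_sum => a ab.
case: (boolP [exists j : 'I_k, (i <= j)%N && inbox d j a.1]) => [/existsP[j /andP[ij aj]]|nj]; last first.
  rewrite big1 // => j ij; case: (boolP (inbox d j a.1)) => // aj.
  by case/existsP: nj; exists j; rewrite ij.
rewrite (bigD1 j) //= aj big1 ?addn0; last first.
  move=> t /andP[_ tj]; case: (boolP (inbox d t a.1)) => // h.
  by rewrite (inbox_inj h aj) eqxx in tj.
have [j' aj'] := box_ex (ltn_ord a.2).
rewrite (bigD1 j') /= ?aj' //; apply: leq_ltn_trans ij _.
rewrite ltn_neqAle (inbox_le aj aj' (ltnW (lcm_lt lb ab))) andbT.
by apply/eqP => /val_inj jj; apply: (lcm_box lb ab aj); rewrite jj.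
Qed.

Lemma rho_rights i : (d i - nS b i)%N = rights b i.
Proof. by have := box_count lb i; rewrite /nS; lia. Qed.

Lemma XbE (i : 'I_k) : Xb i = (tsum rho i - tsum (rS b) i)%N.
Proof.
have -> : tsum d i = (tsum rho i + tsum (nS b) i)%N.
  by rewrite /tsum -big_split; apply: eq_bigr => j _; rewrite /= subnK // leq_subr.
by rewrite -subnDA [(tsum (rS b) i + _)%N]addnC subnDA addnK.
Qed.

Lemma Cb_neq0 : Cb != 0.
Proof.
apply: (Cc_neq0 q0 qnr) => i; rewrite XbE tsum_gt.
have -> : gt rho i = gt (rights b) i by apply: eq_bigr => j _; apply: rho_rights.
by have := tail_lefts i; lia.
Qed.

(** With w = u + r and n = r + u + v the negative terms of the exponent cancel, leaving natural
    numbers. *)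
Lemma kfacE (u v : 'I_k -> nat) : (forall i, e i = u i + v i)%N ->
  kfac R (fun i => u i + rS b i)%N (rS b) (nS b) =
  q ^+ (\sum_i (rS b i * (gt e i + gt (rS b) i) + u i * gt v i))%N.
Proof.
move=> euv; rewrite /kfac exprnP (big_morph Posz PoszD (erefl _)); congr (q ^ _); apply: eq_bigr => i _.
have -> : gt e i = (gt u i + gt v i)%N by rewrite /gt -big_split; apply: eq_bigr => j _; rewrite euv.
have H j : (rS b i * (u j + rS b j))%N%:Z + ((u i + rS b i) * nS b j)%N%:Z - ((u i + rS b i) * (u j + rS b j))%N%:Z =
    (rS b i * (u j + v j + rS b j) + u i * v j)%N%:Z.
  have [_ <-] := left_right_sizes j; rewrite euv -PoszD subzn; first by congr Posz; rewrite !(mulnDl, mulnDr); lia.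
  by rewrite !(mulnDl, mulnDr); lia.
rewrite (eq_bigr _ (fun j _ => H j)) -(big_morph Posz PoszD (erefl _)) /gt -!big_split /= !big_distrr /= -big_split /=.
by congr Posz; apply: eq_bigr => j _.
Qed.

Lemma fcoef_fcount z (a : idx e) : fcoef iota_ pi_ z a * fcount (q ^+ 2 : K) a =
  gamma iota_ pi_ b z a * (Cb * Lc q e (fun t => a t)).
Proof.
have le i : (a i <= e i)%N by rewrite -ltnS.
have ev i : e i = (a i + (e i - a i))%N by rewrite subnKC.
rewrite /fcoef -mulrA (kfacE ev) /Lc -(prod_cc4 q0 qnr _ _ _ ev); congr (_ * (_ * _)).
apply: eq_bigr => i _; have nle j := (left_right_sizes j).2.
congr cc4; rewrite ?addnK //; last by rewrite addnC subnDA.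
  by apply: eq_bigr => j _; rewrite addnK.
by apply: eq_bigr => j _; rewrite addnC subnDA.
Qed.

Lemma T_That mu (z : tens R d) F (x : Mvar d F) : (mu + 2 * #|b| = tot d)%N ->
  TY (fun F => @Yset k d F b) (Tc_iso iota_ pi_ z) x = M_iso #|b| (ThatF mu z) x.
Proof.
move=> h; have /addIn -> := etrans h (esym sz_e); rewrite TYE // /M_iso.
have sa (a : idx e) : (sz (fun t => a t) < (sz e).+1)%N by rewrite ltnS; apply/sz_le/inr_idx.
rewrite (partition_big (fun a : idx e => Ordinal (sa a)) predT) //=; apply: eq_bigr => u _.
rewrite !ffunE mulr_suml; apply: eq_big => [a|a /eqP au].
  by rewrite -val_eqE /=.
rewrite mulrA mulrAC fcoef_fcount; congr (_ * _); rewrite /indM /ftype /Mstratum.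
have h1 : (\sum_i rS b i)%N = #|b| := sz_lefts.
by rewrite -au big_split /= h1.
Qed.
End Last.

End PushForwardIntertwiner.

(** * Spanning *)

Section SlTwoTheory.

Section SlTwo.
Variables (K : fieldType) (q : K).
Hypothesis q0 : q != 0.
Hypothesis qnr : forall n, (0 < n)%N -> q ^+ n != q ^- n.
Variables (k : nat) (e : 'I_k -> nat).
Implicit Types (u : 'I_k -> nat) (s t : 'I_k) (z : gtens K e).
Local Notation gEt := (gEt q (e := e)).
Local Notation gF := (gF q (e := e)).
Local Notation W u := (\sum_t hw e u t).

(** Terms with E and F on different factors cancel; the diagonal ones are quantum integers of the
    single weights and telescope to that of the total weight. *)
Lemma EF_comm u z : inr e u ->
  cf u (gEt (gF k z)) - cf u (gF k (gEt z)) = qz q (W u) * cf u z.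
Proof.
move=> ur; rewrite cf_gEt cf_gF.
have -> : \sum_s q ^ (wE e u s) * cf u (gE q s (gF k z)) =
    \sum_s \sum_t q ^ (wE e u s - wF e u t k + (t < s)%N%:Z *+ 2) * cf u (gE q s (gf q t z)).
  apply: eq_bigr => s _; rewrite cf_gE cf_gF mulr_sumr mulr_sumr.
  apply: eq_big => [t|t _]; first exact: ltn_ord.
  have -> : wF e (up u s) t k = wF e u t k - (t < s)%N%:Z *+ 2.
    by rewrite /wF sum_hw_up ltn_ord andbT.
  rewrite cf_gE (_ : wE e u s - wF e u t k + (t < s)%N%:Z *+ 2 = wE e u s + - (wF e u t k - (t < s)%N%:Z *+ 2)).
    by rewrite (expfzDr (wE e u s)) //; ring.
  by move: (wE _ _ _) (wF _ _ _ _) (_ *+ 2) => A B C; ring.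
have -> : \sum_(s < k | (s < k)%N) q ^ (- wF e u s k) * cf u (gf q s (gEt z)) =
    \sum_s \sum_t q ^ (wE e u s - wF e u t k + (t < s)%N%:Z *+ 2) * cf u (gf q t (gE q s z)).
  rewrite exchange_big /=; apply: eq_big => [t|t _]; first exact: ltn_ord.
  rewrite cf_gf cf_gEt; under [RHS]eq_bigr do rewrite cf_gf.
  case: (posnP (u t)) => ut.
    by rewrite ut qn0 mul0r !mulr0 big1 // => s _; rewrite mul0r !mulr0.
  rewrite !mulr_sumr; apply: eq_bigr => s _.
  have -> : wE e (dn u t) s = wE e u s + (t < s)%N%:Z *+ 2 by rewrite /wE sum_hw_dn.
  rewrite (_ : wE e u s - wF e u t k + (t < s)%N%:Z *+ 2 = - wF e u t k + (wE e u s + (t < s)%N%:Z *+ 2)).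
    by rewrite (expfzDr (- wF e u t k)) //; ring.
  by move: (wE _ _ _) (wF _ _ _ _) (_ *+ 2) => A B C; ring.
rewrite -(qz_telescope q0 (hw e u)) mulr_suml -sumrB; apply: eq_bigr => s _.
rewrite -sumrB (bigD1 s) //= big1 ?addr0 => [|t ts]; last by rewrite gE_gf // subrr.
have := congr1 (cf u) (gE_gf_comm q0 qnr s z); rewrite cfB cfZ cfB cf_gk cf_gki -mulrBr => ->.
rewrite ltnn addr0 -mulrA; congr (q ^ _ * _).
  by rewrite /wE /wF; congr (_ - _); apply: eq_bigl => t; rewrite ltn_ord andbT.
by rewrite /qz -mulrBl mulrA (mulrC _^-1).
Qed.

Definition wt (c : int) z := forall u, inr e u -> W u != c -> cf u z = 0.

Lemma wt_EF c z : wt c z -> gEt (gF k z) = gF k (gEt z) + qz q c *: z.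
Proof.
move=> wz; apply: gext => u ur; rewrite cfD cfZ.
have /eqP := EF_comm z ur; rewrite subr_eq => /eqP ->; rewrite addrC; congr (_ + _).
by have [->|n] := eqVneq (W u) c; rewrite // wz // !mulr0.
Qed.

Lemma wt_E c z : wt c z -> wt (c + 2) (gEt z).
Proof.
move=> wz u ur n; rewrite cf_gEt big1 // => s _; rewrite cf_gE.
case: (boolP (inr e (up u s))) => h; last by rewrite cf_out ?mulr0.
rewrite wz ?mulr0 //; apply: contra n => /eqP <-.
by rewrite (sum_hw_up e xpredT) /= -addrA addNr addr0.
Qed.

Lemma qz_step (c n : nat) :
  qn q n.+2 * qn q (c + n).+1 = qn q n.+1 * qn q (c + n) + qn q (c + n.+1 + n.+1).
Proof.
have nz := qmV_neq0 qnr; have nz1 := qq1_neq0 q0 qnr.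
rewrite /qn !exprD !exprS !exprD; set A := q ^+ c; set B := q ^+ n.
have hA : A != 0 by rewrite expf_neq0.
have hB : B != 0 by rewrite expf_neq0.
by field; rewrite hA hB nz1 q0.
Qed.

Lemma wt_iter (c n : nat) z : wt c%:Z z -> wt (c + n + n)%N%:Z (iter n gEt z).
Proof.
elim: n => [|n IH] wz; first by rewrite !addn0.
have := wt_E (IH wz); rewrite (_ : (c + n + n)%N%:Z + 2 = (c + n.+1 + n.+1)%N%:Z) //; lia.
Qed.

Lemma F_iterE (c n : nat) z : wt c%:Z z -> gF k z = 0 ->
  gF k (iter n.+1 gEt z) = - (qn q n.+1 * qn q (c + n)) *: iter n gEt z.
Proof.
move=> wz Fz; elim: n => [|n IH].
  have := wt_EF wz; rewrite Fz linear0 => /esym/eqP; rewrite addr_eq0 => /eqP /= ->.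
  have q1 : qn q 1 = 1 by rewrite /qn expr1 divff // (qmV_neq0 qnr).
  by rewrite addn0 scaleNr -qnE q1 mul1r.
have E := wt_EF (@wt_iter c n.+1 z wz); rewrite IH linearZ_LR in E.
have E2 : gF k (iter n.+2 gEt z) = - (qn q n.+1 * qn q (c + n)) *: iter n.+1 gEt z -
    qz q (c + n.+1 + n.+1)%N *: iter n.+1 gEt z.
  by apply/eqP; rewrite eq_sym subr_eq; apply/eqP; exact: E.
have -> : qn q (c + n.+1)%N = qn q (c + n).+1 by rewrite addnS.
by rewrite E2 -scalerBl qz_step -qnE opprD.
Qed.

(** Powers of E eventually kill z because weights are bounded, and by [F_iterE] applying F to
    E^(n+1) z = 0 gives E^n z = 0, the coefficient [n+1][c+n] being non-zero. *)
Lemma F_inj (c : nat) z : (0 < c)%N -> wt c%:Z z -> gF k z = 0 -> z = 0.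
Proof.
move=> c0 wz Fz; suff H n : iter n gEt z = 0 -> z = 0.
  apply: (H (sz e).+1); apply: gext => u ur; rewrite cf0 (wt_iter wz) //.
  rewrite (hw_diff xpredT ur); have := sz_sub ur; rewrite -/(sz u) -/(sz (fun t => e t - u t)%N) => ->.
  by apply/eqP; lia.
elim: n => [|n IH] //= h; apply: IH; have := @F_iterE c n z wz Fz; rewrite /= h linear0 => /esym/eqP.
rewrite scaler_eq0 oppr_eq0 mulf_eq0 !(negPf (qn_neq0 qnr _)) ?addn_gt0 ?c0 //= => /eqP //.
Qed.
End SlTwo.

End SlTwoTheory.

(** * The ballot condition and the number of indices violating it *)

Section Peaks.

Section Excess.
Import Order.TTheory.
Variables (k : nat) (d : 'I_k -> nat).
Implicit Types (u : 'I_k -> nat) (i j : 'I_k).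

Lemma ex_top (T : eqType) (R : rel T) (x : T) s : total R -> transitive R ->
  exists2 i : T, i \in x :: s & forall j : T, j \in x :: s -> R j i.
Proof.
move=> tot tr; have rx y : R y y by case/orP: (tot y y).
elim: s x => [|y s IH] x; first by exists x; rewrite ?inE // => j; rewrite inE => /eqP ->.
have [i iy ih] := IH y; case/orP: (tot x i) => xi.
  by exists i; [rewrite inE iy orbT|move=> j; rewrite inE => /orP[/eqP ->|/ih]].
exists x; first by rewrite inE eqxx.
by move=> j; rewrite inE => /orP[/eqP ->|/ih ji] //; apply: tr xi.
Qed.

(** For the marking u: the downs from box i on minus the ups after box i. If it is never positive,
    every down gets matched, by [good_bound] and [good_lefts]. *)
Definition excess u i : int := (u i)%:Z - \sum_(t < k | (i < t)%N) hw d u t.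
Definition good u := [forall i, excess u i <= 0].
(** The last box of maximal excess. Lowering u there is injective by [peak_inj], so the bad indices
    of level r are at most as many as the indices of level r - 1. *)
Definition peak u i := [&& [forall j : 'I_k, excess u j <= excess u i],
  [forall j : 'I_k, (i < j)%N ==> (excess u j < excess u i)] & (0 < u i)%N].

Lemma excess_dn u i j : (0 < u i)%N ->
  excess (dn u i) j = excess u j - (j == i)%N%:Z - (j < i)%N%:Z *+ 2.
Proof.
move=> ui; rewrite /excess (sum_hw_dn d (fun t : 'I_k => (j < t)%N)) //= opprD addrA; congr (_ - _).
rewrite addrAC; congr (_ - _); rewrite /dn -subzn //.
by case: eqP => // ->.
Qed.

Lemma peak_ex u : inr d u -> ~~ good u -> exists i, peak u i.
Proof.
move=> ur; rewrite negb_forall => /existsP[i0]; rewrite -ltNge => p0.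
pose R (j i : 'I_k) := (excess u j < excess u i) || ((excess u j == excess u i) && (j <= i)%N).
have [||i _ h] := @ex_top _ R i0 (enum 'I_k).
- move=> a b; rewrite /R; case: (ltgtP (excess u a) (excess u b)) => //= _; exact: leq_total.
- move=> b a c; rewrite /R => /orP[h1|/andP[/eqP -> h1]] /orP[h2|/andP[/eqP <- h2]].
  + by rewrite (lt_trans h1 h2).
  + by rewrite h1.
  + by rewrite h2.
  + by rewrite eqxx (leq_trans h1 h2) orbT.
have hh j : R j i by apply: h; rewrite inE mem_enum orbT.
have lei j : excess u j <= excess u i by case/orP: (hh j) => [/ltW //|/andP[/eqP ->]].
have lti j : (i < j)%N -> excess u j < excess u i.
  by move=> ij; case/orP: (hh j) => // /andP[_]; rewrite leqNgt ij.
exists i; apply/and3P; split; [exact/forallP| |].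
  by apply/forallP => j; apply/implyP; apply: lti.
(* If u i = 0, the next box has at least the same excess, since u is at most d there, against the
   choice of i; in the last box the excess would be 0. *)
rewrite lt0n; apply/eqP => ui; have pi : 0 < excess u i by apply: lt_le_trans p0 (lei i0).
have [ik|ik] := ltnP i.+1 k; last first.
  move: pi; rewrite /excess ui big_pred0 ?subr0 // => t; apply/negbTE; rewrite -leqNgt.
  by have := ltn_ord t; move: ik; lia.
have := lti (Ordinal ik) (ltnSn i); apply/negP; rewrite -leNgt /excess ui.
rewrite [X in _ - X <= _](bigD1 (Ordinal ik)) //= (eq_bigl (fun t : 'I_k => (Ordinal ik < t)%N)).
  by have := inrP _ _ ur (Ordinal ik); rewrite /hw; move: (\sum_(_ | _) _); lia.
by move=> t /=; rewrite -val_eqE /=; lia.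
Qed.

(** Lowering at i lowers the excess by 1 at i and by 2 to its left. For i < i', with v the common
    lowered index, one peak gives excess v i' <= excess v i and the other excess v i + 1 <= excess v
    i'. *)
Lemma peak_inj u u' i i' : peak u i -> peak u' i' -> dn u i = dn u' i' -> u = u'.
Proof.
wlog le : u u' i i' / (i <= i')%N.
  by move=> H p p' e; case/orP: (leq_total i i') => h; [apply: (H u u' i i')|apply/esym/(H u' u i' i)].
move=> /and3P[/forallP m1 /forallP m2 ui] /and3P[/forallP m1' _ ui'] e.
suff ii : i = i' by rewrite -(dnK ui) e ii dnK.
apply: val_inj; apply/eqP; rewrite eqn_leq le leqNgt; apply/negP => lt /=.
have h1 := excess_dn i ui; have h2 := excess_dn i' ui.
have h3 := excess_dn i ui'; have h4 := excess_dn i' ui'.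
have ne : (i == i') = false by rewrite -val_eqE ltn_eqF.
rewrite e in h1 h2; move: h1 h2 h3 h4 (implyP (m2 i') lt) (m1' i).
rewrite ne (eq_sym i') ne !eqxx !ltnn lt (ltnNge i' i) le /=; lia.
Qed.

Lemma card_bad r : (#|[set a : idx d | (sz (fun t => a t) == r) && ~~ good (fun t => a t)]%SET| <=
  #|[set a : idx d | (sz (fun t => a t)).+1 == r]%SET|)%N.
Proof.
pose f (a : idx d) : idx d := if [pick i | peak (fun t => a t) i] is Some i then mki d (dn (fun t => a t) i) else a.
have fP (a : idx d) : ~~ good (fun t => a t) -> exists2 i, peak (fun t => a t) i & (fun t => f a t : nat) = dn (fun t => a t) i.
  move=> na; rewrite /f; case: pickP => [i p|/= h].
    by exists i => //; rewrite idx_mki //; apply/inr_dn/inr_idx.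
  by case: (peak_ex (inr_idx a) na) => i; rewrite h.
rewrite -(@card_in_imset _ _ f).
  apply/subset_leq_card/fintype.subsetP => _ /imsetP[a + ->]; rewrite !inE => /andP[/eqP <- /fP[i p ->]].
  by rewrite sz_dn //; case/and3P: p.
move=> a a'; rewrite !inE => /andP[_ /fP[i p e]] /andP[_ /fP[i' p' e']] ff.
have := peak_inj p p'; rewrite -e -e' ff => /(_ erefl) h.
by apply/ffunP => t; apply: val_inj; apply: (congr1 (fun g => g t) h).
Qed.

Lemma good_bound u : inr d u -> good u ->
  forall i, (\sum_(j < k | i <= j) u j <= \sum_(j < k | i < j) (d j - u j))%N.
Proof.
move=> ur /forallP g i; have := g i; rewrite /excess (hw_diff (fun t : 'I_k => (i < t)%N) ur).
rewrite -[(\sum_(j < k | (i <= j)%N) u j)%N]/(tsum u i) tsum_gt /gt /=.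
move: (\sum_(_ | _) (d _ - u _))%N (\sum_(_ | _) u _)%N (u i) => A B C; clear; lia.
Qed.
End Excess.

End Peaks.

(** * Intertwiners to V_mu through their highest weight coefficient *)

Section TopCoefficient.

Section Spanning.
Variables (R : realType) (k : nat) (d : 'I_k -> nat).
Variables (iota_ : forall n, 'Hom(Vn R n, V1pow R n)) (pi_ : forall n, 'Hom(V1pow R n, Vn R n)).
Hypotheses (Hiota : forall n, is_iota (iota_ n)) (Hpi : forall n, is_pi (pi_ n)).
Local Notation K := (Cq R).
Local Notation q := (@q R).
Local Notation qnr := (q_regular R).
Local Notation q0 := (q_neq0 R).
Local Notation nul := (fun=> 0%N).

Definition That (b : arcs d) (mu : nat) : 'Hom(tens R d, Vn R mu) := linfun (ThatF iota_ pi_ b mu).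

Lemma ThatE b mu z : That b mu z = ThatF iota_ pi_ b mu z.
Proof. by rewrite lfunE. Qed.

Lemma That_uq_hom b mu : lcm_spec b -> (mu + 2 * #|b| = tot d)%N -> uq_hom (That b mu).
Proof. by move=> lb e; have [h1 h2 h3 h4] := ThatF_uq_hom Hiota Hpi lb e; split=> z; rewrite !ThatE. Qed.

Section Hom.
Variable mu : nat.
Implicit Types (psi f g : 'Hom(tens R d, Vn R mu)).

Lemma uq_hom_lin (c : K) f g : uq_hom f -> uq_hom g -> uq_hom (c *: f + g).
Proof.
move=> [f1 f2 f3 f4] [g1 g2 g3 g4]; split=> z; rewrite !add_lfunE !scale_lfunE.
- rewrite f1 g1 !actE_E; exact/esym/gEt_linear.
- rewrite f2 g2 /actF !actF_firstE; exact/esym/gF_linear.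
- rewrite f3 g3 !actKE; exact/esym/gKt_linear.
- rewrite f4 g4 !actKiE; apply: gext => u _.
  by rewrite cfD cfZ !cf_gKit cfD cfZ mulrDr mulrCA.
Qed.

Lemma uq_hom0 : uq_hom (0 : 'Hom(tens R d, Vn R mu)).
Proof.
split=> z; rewrite !zero_lfunE.
- by rewrite actE_E; apply/esym; apply: gext => u _; rewrite cf_gEt big1 ?cf0 // => s _; rewrite cf_gE cf0 !mulr0.
- rewrite /actF actF_firstE; apply/esym; apply: gext => u _; rewrite cf_gF big1 ?cf0 // => s _.
  by rewrite cf_gf cf0 !mulr0.
- by rewrite actKE; apply/esym; apply: gext => u _; rewrite cf_gKt cf0 mulr0.
- by rewrite actKiE; apply/esym; apply: gext => u _; rewrite cf_gKit cf0 mulr0.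
Qed.

Lemma uq_hom_sum (I : Type) (r : seq I) (c : I -> K) (f : I -> 'Hom(tens R d, Vn R mu)) :
  (forall i, uq_hom (f i)) -> uq_hom (\sum_(i <- r) c i *: f i).
Proof.
move=> h; elim: r => [|i r IH]; first by rewrite big_nil; apply: uq_hom0.
by rewrite big_cons; apply: uq_hom_lin.
Qed.

(* The coefficient of the highest weight vector. *)
Definition top psi (z : tens R d) : K := cf nul (psi z : gtens K (fun _ : 'I_1 => mu)).

Lemma top_lin psi z : top psi z = \sum_(a : idx d) z a * top psi (tbas R d (fun t => a t)).
Proof.
rewrite {1}/top [in LHS](tbas_sum z) linear_sum cf_sum; apply: eq_bigr => a _.
by rewrite linearZ cfZ.
Qed.

(** Up to a non-zero quantum integer, the coefficient of v_(mu-2n-2) in psi z is that of v_(mu-2n)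
    in psi (E z). *)
Lemma top_eq0 psi : uq_hom psi -> (forall z, top psi z = 0) -> psi = 0.
Proof.
move=> [pE _ _ _] h; apply/lfunP => z; rewrite zero_lfunE; apply: gext => w wr; rewrite cf0.
have -> : w = fun=> w ord0 by apply: funext => t; rewrite (ord1 t).
have := inrP _ _ wr ord0; elim: (w ord0) z => [|n IH] z nm; first exact: h.
have := IH (actE z) (ltnW nm); rewrite pE actE_E cf_gEt big_ord1 cf_gE => /eqP.
have -> : up (fun=> n) ord0 = (fun _ : 'I_1 => n.+1) by apply: funext => t; rewrite (ord1 t) upE.
rewrite mulf_eq0 (negPf (expfz_neq0 _ q0)) orFb mulf_eq0 => /orP[h0|/eqP //].
by have := @qn_neq0 _ q qnr (mu - n); rewrite subn_gt0 nm => /(_ isT); rewrite h0.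
Qed.

Lemma top_gF psi z : uq_hom psi -> top psi (gF q k (z : gtens K d)) = 0.
Proof.
move=> [_ pF _ _]; rewrite /top -actF_firstE -[actF_first k z]/(actF z) pF /actF actF_firstE.
by rewrite cf_gF big1 // => s _; rewrite cf_gf qn0 mul0r !mulr0.
Qed.

Lemma top_weight psi (u : idx d) : uq_hom psi -> top psi (tbas R d (fun t => u t)) != 0 ->
  (mu + 2 * sz (fun t => u t) = tot d)%N.
Proof.
move=> [_ _ pK _] n0; pose t0 : gtens K d := tbas R d (fun t => u t).
have e1 : gKt q t0 = q ^ (\sum_t hw d (fun t => u t) t) *: t0.
  apply: gext => v vr; rewrite cf_gKt cfZ /t0 cf_tbas //; case: forallP => h; last by rewrite !mulr0.
  by rewrite (_ : v = fun t => u t) //; apply: funext => t; apply/eqP.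
have := congr1 (cf nul) (pK t0); rewrite !actKE e1 linearZ cf_gKt big_ord1 cfZ => /(mulIf n0)/q_int_inj.
have ur := inr_idx u; rewrite (hw_diff xpredT ur) -[(\sum_t u t)%N]/(sz (fun t => u t)).
rewrite -[(\sum_t (d t - u t))%N]/(sz (fun t => d t - u t)%N) sz_sub //.
have := sz_le ur; have -> : tot d = sz d by exact: sum_ring_nat.
by rewrite /hw; move: (sz d) (sz _) => A B; clear; lia.
Qed.
End Hom.

Lemma cf_tbas_idx (a a' : idx d) : cf (fun t => a t) (tbas R d (fun t => a' t) : gtens K d) = (a == a')%:R.
Proof.
rewrite cf_tbas ?inr_idx //; congr (nat_of_bool _)%:R; apply/forallP/eqP => [h|-> //].
by apply/ffunP => t; apply: val_inj; exact/eqP/h.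
Qed.

End Spanning.

End TopCoefficient.

(** * The push-forwards span the intertwiners *)

Section SpanningSet.

Lemma sum_delta (A : nzRingType) (I : finType) (P : pred I) (f : I -> A) y : P y ->
  \sum_(i | P i) f i * (i == y)%:R = f y.
Proof.
by move=> Py; rewrite (bigD1 y) //= eqxx mulr1 big1 ?addr0 // => i /andP[_ /negPf ->]; rewrite mulr0.
Qed.

Section Span.
Variables (R : realType) (k : nat) (d : 'I_k -> nat).
Variables (iota_ : forall n, 'Hom(Vn R n, V1pow R n)) (pi_ : forall n, 'Hom(V1pow R n, Vn R n)).
Hypotheses (Hiota : forall n, is_iota (iota_ n)) (Hpi : forall n, is_pi (pi_ n)).
Local Notation K := (Cq R).
Local Notation q := (@q R).
Local Notation qnr := (q_regular R).
Local Notation q0 := (q_neq0 R).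
Local Notation nul := (fun=> 0%N).

Lemma That_top (b : arcs d) mu z : lcm_spec b -> top (That iota_ pi_ b mu) z =
  Cb R b * Lc q (fun i => nS b i - rS b i)%N nul *
  cf nul (gamma iota_ pi_ b z : gtens K (fun i => nS b i - rS b i)%N).
Proof.
move=> lb; set e := (fun i : 'I_k => nS b i - rS b i)%N.
have nr (k' : nat) (m : 'I_k' -> nat) : inr m nul by apply/inrP.
rewrite /top ThatE /cf !nr ffunE mkiE // (big_pred1 (mki e nul)) => [|a].
  by rewrite idx_mki // mulrC.
apply/eqP/eqP => [h|->]; last by rewrite idx_mki // /sz big1.
apply/ffunP => t; apply: val_inj; rewrite /= mkiE //; apply/eqP; rewrite -leqn0 -h.
by rewrite /sz (bigD1 t) //= leq_addr.
Qed.

Definition topc (b : arcs d) : K := Cb R b * Lc q (fun i => nS b i - rS b i)%N nul.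

Lemma topc_neq0 b : lcm_spec b -> topc b != 0.
Proof.
move=> lb; rewrite /topc /Lc /shuf; apply: mulf_neq0; first exact: Cb_neq0.
apply: mulf_neq0; last by rewrite invr_eq0; apply/prodf_neq0 => i _; apply: mulf_neq0; apply: (qf_neq0 qnr).
exact: mulf_neq0 (mulf_neq0 (expf_neq0 _ q0) (qf_neq0 qnr _)) (qf_neq0 qnr _).
Qed.

Lemma gF_tbas_level (a y : idx d) : sz (fun t => a t) != (sz (fun t => y t)).+1 ->
  cf (fun t => a t) (gF q k (tbas R d (fun t => y t) : gtens K d)) = 0.
Proof.
move=> n; rewrite cf_gF big1 // => s _; rewrite cf_gf; case: (posnP (a s)) => [->|as0].
  by rewrite qn0 mul0r !mulr0.
rewrite cf_tbas ?(inr_dn _ (inr_idx a)) //; case: forallP => h; last by rewrite !mulr0.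
case/eqP: n; rewrite -(@sz_dn _ (fun t => a t) s as0); congr (_.+1); apply: eq_bigr => t _; exact/eqP.
Qed.

(** The determinant is a polynomial in q^-1 whose constant term is det 1 = 1. *)
Lemma qinvZ_unitmx n (A : 'M[K]_n) : (forall i j, in_qinvZ (A i j - (i == j)%:R)) -> A \in unitmx.
Proof.
move=> h; have H (ij : 'I_n * 'I_n) : exists p, A ij.1 ij.2 - (ij.1 == ij.2)%:R = evZ R ('X * p).
  by have /qinvZP := h ij.1 ij.2.
have [p pE] := boolp.choice H.
pose G : 'M[{poly int}]_n := \matrix_(i, j) ((i == j)%:R + 'X * p (i, j)).
have AG : A = map_mx (evZ R) G.
  apply/matrixP => i j; rewrite !mxE rmorphD rmorph_nat /= -(pE (i, j)) /=.
  by rewrite addrC subrK.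
rewrite unitmxE AG det_map_mx unitfE evZ_eq0; apply/eqP => G0.
have := det_map_mx (horner_eval (0 : int)) G; rewrite G0 rmorph0.
rewrite (_ : map_mx _ G = 1%:M) ?det1 => [/eqP|]; first by rewrite oner_eq0.
by apply/matrixP => i j; rewrite !mxE /= /horner_eval hornerD hornerM hornerX mul0r addr0; case: (i == j); rewrite ?hornerC ?horner0.
Qed.

Section Level.
Variables (mu r : nat).
Hypothesis mur : (mu + 2 * r = tot d)%N.
Local Notation Lv := [set a : idx d | sz (fun t => a t) == r]%SET.
Local Notation Lv' := [set a : idx d | (sz (fun t => a t)).+1 == r]%SET.
Local Notation Gd := [set a : idx d | (sz (fun t => a t) == r) && good d (fun t => a t)]%SET.
Local Notation tb a := (tbas R d (fun t => (a : idx d) t)).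

Definition Fmat : 'M[K]_(#|Lv'|, #|Lv|) :=
  \matrix_(y, x) cf (fun t => (enum_val x : idx d) t) (gF q k (tb (enum_val y) : gtens K d)).

(** Level r - 1 has weight mu + 2 > 0, so [F_inj] applies. *)
Lemma Fmat_free : row_free Fmat.
Proof.
apply: inj_row_free => v v0; pose z : gtens K d := \sum_y v 0 y *: (tb (enum_val y) : gtens K d).
have sy (y : 'I_#|Lv'|) : (sz (fun t => (enum_val y : idx d) t)).+1 = r.
  by have := enum_valP y; rewrite inE => /eqP.
have z0 : z = 0.
  apply: (@F_inj K q q0 qnr k d mu.+2) => //.
    move=> u ur nW; rewrite cf_sum big1 // => y _; rewrite cfZ cf_tbas //; case: forallP => h; last by rewrite mulr0.
    case/eqP: nW; have -> : u = (fun t => (enum_val y : idx d) t) by apply: funext => t; apply/eqP.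
    have yr := inr_idx (enum_val y : idx d); rewrite (hw_diff xpredT yr).
    rewrite -[(\sum_t (d t - _))%N]/(sz (fun t => d t - (enum_val y : idx d) t)%N) sz_sub //.
    rewrite -[(\sum_t _)%N]/(sz (fun t => (enum_val y : idx d) t)).
    have := sz_le yr; have := sy y; have : sz d = tot d by exact/esym/sum_ring_nat.
    by move: mur; move: (sz d) (sz _) => A B; clear; lia.
  have gz : gF q k z = \sum_y v 0 y *: gF q k (tb (enum_val y) : gtens K d).
    by rewrite /z linear_sum; apply: eq_bigr => y _; rewrite linearZ_LR.
  apply: gext => u ur; rewrite cf0 gz cf_sum.
  have [a ->] : exists a : idx d, u = (fun t => a t) by exists (mki d u); rewrite idx_mki.
  have [sa|na] := eqVneq (sz (fun t => a t)) r; last first.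
    by rewrite big1 // => y _; rewrite cfZ gF_tbas_level ?mulr0 // sy.
  have aL : a \in Lv by rewrite inE sa.
  have := congr1 (fun M : 'rV[K]__ => M 0 (enum_rank_in aL a)) v0; rewrite !mxE => e.
  rewrite -[RHS]e; apply: eq_bigr => y _; by rewrite cfZ mxE enum_rankK_in.
apply/rowP => y; rewrite mxE.
rewrite -(@sum_delta K _ predT (fun y' => v 0 y') y isT).
transitivity (cf (fun t => (enum_val y : idx d) t) z); last by rewrite z0; apply: cf0.
rewrite /z cf_sum; apply: eq_bigr => y' _; rewrite cfZ; congr (_ * _).
by rewrite cf_tbas_idx (inj_eq enum_val_inj) eq_sym.
Qed.

Definition toprow (psi : 'Hom(tens R d, Vn R mu)) : 'rV[K]_#|Lv| := \row_x top psi (tb (enum_val x)).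

Lemma toprow_Fmat (psi : 'Hom(tens R d, Vn R mu)) : uq_hom psi -> toprow psi *m Fmat^T = 0.
Proof.
move=> up; apply/rowP => y; rewrite !mxE -[RHS](top_gF (tb (enum_val y)) up) top_lin.
rewrite (bigID (mem Lv)) /= [X in _ = _ + X]big1 ?addr0; last first.
  move=> a; rewrite inE => na; rewrite -(cf_idx (gF q k _) a) gF_tbas_level ?mul0r //.
  by have := enum_valP y; rewrite inE => /eqP ->.
rewrite [RHS]big_enum_val; apply: eq_bigr => x _; rewrite !mxE mulrC; congr (_ * _).
by rewrite cf_idx.
Qed.

Lemma good_lefts_idx (a : idx d) : a \in Gd -> forall i, lefts (Mmatch d (fun t => a t)) i = a i.
Proof.
rewrite inE => /andP[_ g] i; apply: good_lefts => [j|]; first exact: (inrP _ _ (inr_idx a)).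
exact: (good_bound (inr_idx a) g).
Qed.

(** Normalised so that the top coefficient becomes the coordinate of gamma at index 0, whose leading
    term is known. *)
Definition basic (i : 'I_#|Gd|) : 'Hom(tens R d, Vn R mu) :=
  let b := Mmatch d (fun t => (enum_val i : idx d) t) in (topc b)^-1 *: That iota_ pi_ b mu.

Lemma Mmatch_idx_lcm (a : idx d) : lcm_spec (Mmatch d (fun t => a t)).
Proof. by apply: Mmatch_lcm => i; apply: (inrP _ _ (inr_idx a)). Qed.

Lemma card_good_match (i : 'I_#|Gd|) : (mu + 2 * #|Mmatch d (fun t => (enum_val i : idx d) t)| = tot d)%N.
Proof.
have h := enum_valP i; apply: (etrans _ mur); congr (_ + 2 * _)%N; rewrite -sum_lefts; last exact: Mmatch_idx_lcm.
rewrite (eq_bigr _ (fun t _ => good_lefts_idx h t)); by move: h; rewrite inE => /andP[/eqP].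
Qed.

Lemma basic_uq_hom i : uq_hom (basic i).
Proof.
rewrite -[basic i]addr0; apply: uq_hom_lin; last exact: uq_hom0.
by apply: (That_uq_hom Hiota Hpi); [exact: Mmatch_idx_lcm|exact: card_good_match].
Qed.

Lemma basic_top i j : in_qinvZ (top (basic i) (tb (enum_val j : idx d)) - (i == j)%:R).
Proof.
set b := Mmatch d (fun t => (enum_val i : idx d) t); have lb : lcm_spec b by exact: Mmatch_idx_lcm.
have -> : top (basic i) (tb (enum_val j : idx d)) =
    cf nul (gamma iota_ pi_ b (tb (enum_val j)) : gtens K (fun i => nS b i - rS b i)%N).
  rewrite /top scale_lfunE cfZ -/b -[cf nul (That iota_ pi_ b mu _)]/(top (That iota_ pi_ b mu) _) That_top //.
  by rewrite -/(topc b) mulKf // topc_neq0.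
have := @gamma_lead R k d iota_ pi_ Hiota Hpi b (fun t => (enum_val j : idx d) t) (tb (enum_val j)) lb.
have h (u : 'I_k -> nat) : inr d u -> in_qinvZ (cf u (tb (enum_val j : idx d) : gtens K d) -
    [forall t, u t == (enum_val j : idx d) t]%:R).
  by move=> ur; rewrite cf_tbas // subrr; apply: qinvZ0.
move/(_ h nul); rewrite (_ : [forall t, _] = (i == j)); first by apply; apply/inrP.
have lE := good_lefts_idx (enum_valP i); apply/forallP/eqP => [hh|<- t]; last by rewrite add0n lE.
apply: enum_val_inj; apply/ffunP => t; apply: val_inj; rewrite /= -lE; exact/eqP/hh.
Qed.

(** Top rows of intertwiners are killed by [Fmat^T], which has rank |Lv'|, so they span at most |Lv|
    - |Lv'| dimensions. By [card_bad] this is at most |Gd|, the rank already reached by the [basic]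
    rows. *)
Lemma Hom_span (psi : 'Hom(tens R d, Vn R mu)) : uq_hom psi -> exists c, psi = \sum_i c i *: basic i.
Proof.
move=> up; pose A : 'M[K]_(#|Gd|, #|Lv|) := \matrix_(i, x) top (basic i) (tb (enum_val x)).
have rowA i : row i A = toprow (basic i) by apply/rowP => x; rewrite !mxE.
have rA : (#|Gd| <= \rank A)%N.
  (* P selects the columns of the good indices; the resulting square block is the identity modulo
     q^-1. *)
  pose P : 'M[K]_(#|Lv|, #|Gd|) := \matrix_(x, j) (enum_val x == enum_val j :> idx d)%:R.
  have PE i j : (A *m P) i j = top (basic i) (tb (enum_val j : idx d)).
    have jL : enum_val j \in Lv by have := enum_valP j; rewrite !inE => /andP[].
    rewrite -(@sum_delta K _ (mem Lv) (fun a : idx d => top (basic i) (tb a)) _ jL) mxE.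
    rewrite [RHS]big_enum_val; apply: eq_bigr => x _; by rewrite !mxE.
  have U : A *m P \in unitmx by apply: qinvZ_unitmx => i j; rewrite PE; apply: basic_top.
  by have := mxrankM_maxl A P; rewrite (mxrank_unit U).
have AF : A *m Fmat^T = 0.
  by apply/row_matrixP => i; rewrite row_mul rowA toprow_Fmat ?row0 //; apply: basic_uq_hom.
have rk : (\rank (A + toprow psi)%MS <= \rank A)%N.
  have h0 : col_mx A (toprow psi) *m Fmat^T = 0 by rewrite mul_col_mx AF toprow_Fmat // col_mx0.
  have h1 := mulmx0_rank_max h0; rewrite mxrank_tr (eqP Fmat_free) -(addsmxE A (toprow psi)) in h1.
  have ar (x n L G B : nat) : (x + n <= L)%N -> (B <= n)%N -> (G + B = L)%N -> (x <= G)%N by clear; lia.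
  apply: leq_trans rA; apply: (ar _ _ _ _ _ h1 (card_bad d r)).
  rewrite -[RHS](cardsID [set a : idx d | good d (fun t => a t)]%SET Lv); congr (_ + _)%N.
    by apply: eq_card => a; rewrite !inE.
  by apply: eq_card => a; rewrite !inE andbC.
have /submxP[c cE] : (toprow psi <= A)%MS.
  apply: submx_trans (addsmxSr A (toprow psi)) _.
  by rewrite -(geq_leqif (mxrank_leqif_sup (addsmxSl A (toprow psi)))).
exists (fun i => c 0 i); apply/eqP; rewrite -subr_eq0; apply/eqP.
have us : uq_hom (\sum_i c 0 i *: basic i) by apply: uq_hom_sum; apply: basic_uq_hom.
have uc : uq_hom (psi - \sum_i c 0 i *: basic i).
  by rewrite addrC -scaleN1r; apply: uq_hom_lin.
apply: (top_eq0 uc) => z; rewrite top_lin big1 // => a _.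
have [->|n0] := eqVneq (top (psi - \sum_i c 0 i *: basic i) (tb a)) 0; first by rewrite mulr0.
have sa : sz (fun t => a t) = r by have := top_weight uc n0; move: mur; clear; lia.
have aL : a \in Lv by rewrite inE sa.
case/eqP: n0; have := congr1 (fun M : 'rV[K]__ => M 0 (enum_rank_in aL a)) cE.
rewrite !mxE enum_rankK_in // => e; rewrite /top add_lfunE opp_lfunE cfB -/(top psi (tb a)) e.
rewrite sum_lfunE cf_sum; apply/eqP; rewrite subr_eq0; apply/eqP; apply: eq_bigr => i _.
by rewrite mxE enum_rankK_in // scale_lfunE cfZ.
Qed.
End Level.

Lemma uq_hom_span mu (psi : 'Hom(tens R d, Vn R mu)) : uq_hom psi <->
  psi \in <<[seq That iota_ pi_ b mu | b : arcs d <- lcmatches d & (mu + 2 * #|b| == tot d)%N]>>%VS.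
Proof.
set s := [seq _ | _ <- _ & _]; split=> [up|].
  case: (boolP [exists a : idx d, (mu + 2 * sz (fun t => a t) == tot d)%N]) => [/existsP[a /eqP e]|ne].
    have [c ->] := Hom_span e up; apply: memv_suml => i _; do 2 apply: memvZ; apply: memv_span.
    apply: (map_f (fun b : arcs d => That iota_ pi_ b mu)); rewrite mem_filter (card_good_match e) eqxx /=.
    by rewrite mem_filter mem_enum andbT; apply/lcmP; apply: Mmatch_idx_lcm.
  (* Here mu is not a weight of the tensor product, so [top] vanishes on every basis vector. *)
  have -> : psi = 0; last exact: mem0v.
  apply: (top_eq0 up) => z; rewrite top_lin big1 // => a _.
  have [->|n0] := eqVneq (top psi (tbas R d (fun t => a t))) 0; first by rewrite mulr0.
  by case/existsP: ne; exists a; rewrite (top_weight up n0).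
move/(@coord_span _ _ _ (in_tuple s)) => ->; apply: uq_hom_sum => i.
have : s`_i \in s by apply: mem_nth.
case/mapP => b; rewrite mem_filter => /andP[/eqP e]; rewrite mem_filter => /andP[/lcmP lb _] ->.
exact: (That_uq_hom Hiota Hpi).
Qed.
End Span.

End SpanningSet.

(** * Images of canonical basis elements *)

Section CanonicalBasis.

Section Canonical.
Variables (R : realType) (k : nat) (d : 'I_k -> nat).
Variables (iota_ : forall n, 'Hom(Vn R n, V1pow R n)) (pi_ : forall n, 'Hom(V1pow R n, Vn R n)).
Hypotheses (Hiota : forall n, is_iota (iota_ n)) (Hpi : forall n, is_pi (pi_ n)).
Local Notation K := (Cq R).
Local Notation q := (@q R).
Variables (b : arcs d) (w : 'I_k -> nat) (z : tens R d).
Hypotheses (lb : lcm_spec b) (wd : forall i, (w i <= d i)%N) (cz : is_canonical w z).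
Local Notation e := (fun i : 'I_k => nS b i - rS b i)%N.
Local Notation gam := (gamma iota_ pi_ b z : gtens K e).

Lemma gam_lead a : inr e a -> in_qinvZ (cf a gam - [forall t, a t + lefts b t == w t]%N%:R).
Proof.
apply: (gamma_lead Hiota Hpi lb) => u ur; rewrite /cf ur; have := cz.2 (mki d u).
by rewrite /tbas ffunE; under eq_forallb do rewrite (mkiE _ ur).
Qed.

Lemma fixed_qinvZ_eq0 (m : 'I_k -> nat) (y : tens R m) : gPsi q (barM R) k (y : gtens K m) = y ->
  (forall u, inr m u -> in_qinvZ (cf u (y : gtens K m))) -> y = 0.
Proof.
move=> fy hy; exact: (gPsi_fixed_eq0 (q_neq0 R) (I := @in_qinvZ R) (@qinvZ_bar_eq0 R) fy hy).
Qed.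

Lemma gam_fixed : gPsi q (barM R) k gam = gam.
Proof. by rewrite -PsiE -(gamma_Psi Hiota Hpi _ lb) cz.1. Qed.

(** The component of gam in a weight space is again fixed by Psi; away from the weight of the
    leading index all its coordinates lie in q^-1 Z[q^-1], so it is 0. *)
Lemma gam_sz a : inr e a -> (sz a + #|b| != \sum_i w i)%N -> cf a gam = 0.
Proof.
move=> ar nw; have H : pr (sz a) gam = 0.
  apply: fixed_qinvZ_eq0; first by rewrite -pr_gPsi gam_fixed.
  move=> u ur; rewrite cf_pr -[lev u]/(sz u); case: eqP => [su|_]; last exact: qinvZ0.
  have := gam_lead ur; rewrite (_ : [forall t, _] = false) ?subr0 //.
  apply: contraNF nw => /forallP h; rewrite -su -(sum_lefts lb) /sz -big_split /=.
  by apply/eqP; apply: eq_bigr => t _; apply/eqP.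
by have := congr1 (cf a) H; rewrite cf_pr cf0 -[lev a]/(sz a) eqxx.
Qed.

(** A leading index a with a + l = w would satisfy the inequalities of [counts_sub_Mmatch] and place
    b below [Mmatch d w]. So there is none, and a fixed vector without leading term is 0. *)
Lemma gam_eq0 : ~~ (b \subset Mmatch d w) -> gam = 0.
Proof.
move=> nb; apply: fixed_qinvZ_eq0; first exact: gam_fixed.
move=> u ur; have := gam_lead ur; rewrite (_ : [forall t, _] = false) ?subr0 //.
apply: contraNF nb => /forallP h; apply: (counts_sub_Mmatch wd lb) => i.
have := eqP (h i); have := inrP _ _ ur i; have := box_count lb i; rewrite /nS /rS; clear; lia.
Qed.

(** Both vectors are fixed by Psi with the same leading index, hence equal. The sum against an
    arbitrary G expresses this across index functions m and e that are equal but not convertible. *)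
Lemma kappa_sum : b \subset Mmatch d w -> forall (m : 'I_k -> nat), m = e -> forall (kappa : tens R m),
  is_canonical (fun i => w i - lefts b i)%N kappa -> forall G : ('I_k -> nat) -> K,
  \sum_(a : idx m) kappa a * G (fun t => a t) = \sum_(a : idx e) gamma iota_ pi_ b z a * G (fun t => a t).
Proof.
move=> bM m -> kappa [fk hk] G; have lw i : (lefts b i <= w i)%N by apply: sub_Mmatch_lefts.
suff H : kappa - gamma iota_ pi_ b z = 0 by rewrite (subr0_eq H).
apply: fixed_qinvZ_eq0; first by rewrite gPsiB gam_fixed -PsiE fk.
move=> u ur; rewrite cfB.
have h1 : in_qinvZ (cf u (kappa : gtens K e) - [forall t, u t + lefts b t == w t]%N%:R).
  rewrite /cf ur; have := hk (mki e u); rewrite /tbas ffunE.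
  rewrite (_ : [forall i, mki e u i == (w i - lefts b i)%N :> nat] = [forall t, u t + lefts b t == w t]%N) //.
  apply: eq_forallb => t; rewrite (mkiE _ ur); have := lw t; clear; lia.
have := qinvZB h1 (gam_lead ur); rewrite opprB addrA subrK //.
Qed.

Lemma T_zero F (x : Mvar d F) : ~~ (b \subset Mmatch d w) ->
  TY (fun F => @Yset k d F b) (Tc_iso iota_ pi_ z) x = 0.
Proof.
move=> nb; rewrite TYE // big1 // => a _; rewrite /fcoef.
have -> : gamma iota_ pi_ b z = 0 :> tens R e by exact: gam_eq0.
by rewrite ffunE !mul0r.
Qed.

Lemma fcount_cnum (u : idx e) : fcount (q ^+ 2 : K) u = \prod_(i < k | (i.+1 < k)%N)
  cnum R [:: tailsum (lefts b) i; tailsum (fun j => u j) i; tailsum (fun j => mS b j - u j)%N i;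
            (tailsum d i - tailsum (mS b) i - 2 * tailsum (lefts b) i)%N]
         [:: lefts b i; u i : nat; (mS b i - u i)%N; (d i - mS b i - lefts b i)%N].
Proof.
have mE i := nrE lb i; have bc := box_count lb.
have nE j : nS b j = (mS b j + lefts b j)%N by have := bc j; rewrite /nS; clear; lia.
have ule j : (u j <= mS b j)%N by rewrite -mE -ltnS.
have tE v i : tailsum v i = tsum v i by rewrite /tailsum sum_ring_nat.
have E1 i : tsum (fun j => u j + rS b j - rS b j)%N i = tsum (fun j => u j) i.
  by apply: eq_bigr => j _; rewrite addnK.
have E2 i : tsum (fun j => nS b j - (u j + rS b j))%N i = tsum (fun j => mS b j - u j)%N i.
  by apply: eq_bigr => j _; have := nE j; rewrite /rS; clear; lia.
have E3 i : (tsum d i - tsum (rS b) i - tsum (nS b) i = tsum d i - tsum (mS b) i - 2 * tsum (lefts b) i)%N.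
  have -> : tsum (nS b) i = (tsum (mS b) i + tsum (lefts b) i)%N.
    by rewrite /tsum -big_split; apply: eq_bigr => j _; apply: nE.
  by rewrite /rS; clear; lia.
rewrite /fcount [RHS]big_mkcond; apply: eq_bigr => i _; rewrite E1 E2 E3 addnK.
rewrite (_ : nS b i - (u i + rS b i) = mS b i - u i)%N; last by have := nE i; rewrite /rS; clear; lia.
rewrite (_ : d i - nS b i = d i - mS b i - lefts b i)%N; last by rewrite nE subnDA.
case: ltnP => ik; first by rewrite cnum4 !tE.
(* In the last box all tails reduce to single entries and no arc starts, so every Gaussian binomial
   is of the form gb n n = 1; hence the product over i < k - 1 only. *)
have last_gt v : gt v i = 0%N.
  by rewrite /gt big_pred0 // => j; have := ltn_ord j; move: ik; clear; lia.
have l0 : lefts b i = 0%N.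
  have := tail_lefts lb i; rewrite last_gt tsum_gt last_gt /rS; clear; lia.
rewrite /cc4 !tsum_gt !last_gt /rS; move: (nat_of_ord (u i)) => x; rewrite l0 !add0n muln0 !subn0 !subnn !mul0n ?addn0 expr0 mulr1.
have gbnn (Q : K) n : gb Q n n = 1.
  by elim: n => // n IH; rewrite gbSS gb_small // add0r subnn expr0 mul1r.
by rewrite !gbnn !mulr1.
Qed.

Lemma T_omega F (x : Mvar d F) : b \subset Mmatch d w -> forall kappa : tens R (mS b),
  is_canonical (fun i => w i - lefts b i)%N kappa ->
  TY (fun F => @Yset k d F b) (Tc_iso iota_ pi_ z) x =
    omega kappa * indM R (\sum_i lefts b i)%N (\sum_i w i)%N x.
Proof.
move=> bM kappa ck; have mE : mS b = e by apply: funext => i; rewrite (nrE lb).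
pose G (u : 'I_k -> nat) : K := kfac R (fun i => u i + lefts b i)%N (lefts b) (fun i => lefts b i + mS b i)%N *
  \prod_(i < k | (i.+1 < k)%N)
  cnum R [:: tailsum (lefts b) i; tailsum u i; tailsum (fun j => mS b j - u j)%N i;
            (tailsum d i - tailsum (mS b) i - 2 * tailsum (lefts b) i)%N]
         [:: lefts b i; u i; (mS b i - u i)%N; (d i - mS b i - lefts b i)%N].
have -> : omega kappa = \sum_(a : idx (mS b)) kappa a * G (fun t => a t).
  by apply: eq_bigr => a _; rewrite -mulrA.
rewrite (kappa_sum bM mE ck) TYE // mulr_suml; apply: eq_bigr => a _.
have nE : (fun i => lefts b i + mS b i)%N = nS b.
  by apply: funext => i; have := box_count lb i; rewrite /nS; clear; lia.
(* Indices of the wrong weight have coefficient 0 by [gam_sz]; for the others the stratum is the one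
   with dim W = |w|, independent of a. *)
have [sa|nsa] := eqVneq (sz (fun t => a t) + #|b|)%N (\sum_i w i)%N; last first.
  have := gam_sz (inr_idx a) nsa; rewrite cf_idx /fcoef => ->; by rewrite !mul0r.
rewrite /fcoef /G nE -fcount_cnum -!mulrA; congr (_ * (_ * _)); rewrite mulrC; congr (_ * _).
have h1 : (\sum_i lefts b i)%N = #|b| := sum_lefts lb.
by rewrite /indM /ftype /Mstratum big_split /= /rS h1 -[(\sum_i a i)%N]/(sz (fun t => a t)) sa.
Qed.
End Canonical.

End CanonicalBasis.

Theorem theorem3p6p1 (R : realType) (k : nat) (d : 'I_k -> nat)
    (iota_ : forall n, 'Hom(Vn R n, V1pow R n))
    (pi_ : forall n, 'Hom(V1pow R n, Vn R n)) :
  (1 <= k)%N ->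
  (forall n, is_iota (iota_ n)) ->
  (forall n, is_pi (pi_ n)) ->
  let T (b : arcs d) (z : tens R d) : funM R d :=
    TY (fun F => @Yset k d F b) (Tc_iso iota_ pi_ z) in
  (exists That : forall (b : arcs d) (mu : nat), 'Hom(tens R d, Vn R mu),
     (forall (b : arcs d) (mu : nat), lcmatch b -> (mu + 2 * #|b| = tot d)%N ->
        forall (z : tens R d) (F : finFieldType) (x : Mvar d F),
          T b z F x = M_iso #|b| (That b mu z) x) /\
     (forall (mu : nat) (psi : 'Hom(tens R d, Vn R mu)),
        uq_hom psi <->
        psi \in <<[seq That b mu | b : arcs d <- lcmatches d
                                 & (mu + 2 * #|b| == tot d)%N]>>%VS)) /\
  (forall (b : arcs d) (w : 'I_k -> nat) (z : tens R d),
     lcmatch b -> (forall i, (w i <= d i)%N) -> is_canonical w z ->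
     (b \subset Mmatch d w ->
        forall kappa : tens R (mS b),
          is_canonical (fun i => w i - lefts b i)%N kappa ->
          forall (F : finFieldType) (x : Mvar d F),
            T b z F x = omega kappa *
              indM R (\sum_i lefts b i)%N (\sum_i w i)%N x) /\
     (~~ (b \subset Mmatch d w) ->
        forall (F : finFieldType) (x : Mvar d F), T b z F x = 0)).
Proof.
move=> _ Hiota Hpi T; split.
  exists (That iota_ pi_); split=> [b mu /lcmP lb e z F x|mu psi]; last exact: uq_hom_span.
  by rewrite ThatE; apply: T_That.
move=> b w z /lcmP lb wd cz; split=> [bM kappa ck F x|nb F x].
  exact: (T_omega Hiota Hpi lb wd cz x bM ck).
exact: (T_zero Hiota Hpi lb wd cz x nb).
Qed.
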